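(* Let $X$ be a compact Hausdorff metric space of dimension at most one and let $A,B$ be unital interval algebras. Set $\mathcal{A}:=C(X)\otimes A$ and $\mathcal{B}:=C(X)\otimes B$, viewed as trivial continuous fields over $X$. For any scaled $\mathrm{Cu}$-morphism $\alpha\colon\mathrm{Cu}(C(X)\otimes A)\to\mathrm{Cu}(C(X)\otimes B)$ (i.e. $\alpha([1_{\mathcal{A}}])\leq[1_{\mathcal{B}}]$) descending to the fibers, with induced $\mathrm{Cu}$-morphisms $\alpha_x\colon \mathrm{Cu}(A)\to\mathrm{Cu}(B)$, $x\in X$, there exists a continuous field morphism $\phi\colon\mathcal{A}\to\mathcal{B}$ such that $\mathrm{Cu}(\phi)=\alpha$. A fortiori, $\mathrm{Cu}(\phi_x)=\alpha_x$ for any $x\in X$.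
   Context: The trivial continuous field $C(X)\otimes A=C(X,A)$ has all fibers $A_x=A$ and evaluation maps $\pi_x\colon C(X)\otimes A\to A$, $a\mapsto a(x)$. A continuous field morphism $\phi\colon C(X)\otimes A\to C(X)\otimes B$ is a *-homomorphism inducing *-homomorphisms $\phi_x\colon A\to B$ with $\pi_x^{\mathcal{B}}\circ\phi=\phi_x\circ\pi_x^{\mathcal{A}}$ for all $x\in X$. An interval algebra is a $C^*$-algebra of the form $C([0,1])\otimes F$ with $F$ finite-dimensional. $\mathrm{Cu}(\cdot)$ denotes the Cuntz semigroup; a $\mathrm{Cu}$-morphism is an additive, zero-preserving, order-preserving map that preserves suprema of increasing sequences and the compact containment relation $\ll$. A $\mathrm{Cu}$-morphism $\alpha\colon\mathrm{Cu}(\mathcal{A})\to\mathrm{Cu}(\mathcal{B})$ descends to the fibers if it induces $\mathrm{Cu}$-morphisms $\alpha_x\colon\mathrm{Cu}(A_x)\to\mathrm{Cu}(B_x)$ with $\mathrm{Cu}(\pi_x^{\mathcal{B}})\circ\alpha=\alpha_x\circ\mathrm{Cu}(\pi_x^{\mathcal{A}})$ for all $x\in X$. *)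

(* Defs.v *)
From HB Require Import structures.
From mathcomp Require Import all_boot all_order all_algebra complex.
From mathcomp Require Import all_classical all_reals topology normedtype.

Set Implicit Arguments.
Unset Strict Implicit.
Unset Printing Implicit Defensive.

Import Order.TTheory GRing.Theory Num.Theory numFieldNormedType.Exports.

Local Open Scope classical_set_scope.
Local Open Scope ring_scope.
Local Open Scope complex_scope.

(* C*-algebras over the complex numbers R[i], possibly without unit and possibly
   zero.  The norm takes its values in R[i], where 0 <= z means that z is real
   and nonnegative. *)
HB.mixin Record isCStarAlgebra (R : realType) V & CompleteNormedModule R[i] V := {
  cmul : V -> V -> V ;
  cadj : V -> V ;
  cmulA : associative cmul ;
  cmulDl : left_distributive cmul +%R ;
  cmulDr : right_distributive cmul +%R ;
  cmulZl : forall (k : R[i]) a b, cmul (k *: a) b = k *: cmul a b ;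
  cmulZr : forall (k : R[i]) a b, cmul a (k *: b) = k *: cmul a b ;
  cadjK : involutive cadj ;
  cadjD : {morph cadj : a b / a + b} ;
  cadjZ : forall (k : R[i]) a, cadj (k *: a) = k^* *: cadj a ;
  cadjM : forall a b, cadj (cmul a b) = cmul (cadj b) (cadj a) ;
  cnormM : forall a b, `|cmul a b| <= `|a| * `|b| ;
  cnorm_adj : forall a, `|cmul (cadj a) a| = `|a| ^+ 2
}.

#[short(type="cstarType")]
HB.structure Definition CStarAlgebra (R : realType) :=
  {V of CompleteNormedModule R[i] V & isCStarAlgebra R V}.

HB.mixin Record isUnitalCStar (R : realType) V & CStarAlgebra R V := {
  cone : V ;
  cmul1l : left_id cone (@cmul R V) ;
  cmul1r : right_id cone (@cmul R V)
}.

#[short(type="ucstarType")]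
HB.structure Definition UnitalCStarAlgebra (R : realType) :=
  {V of CStarAlgebra R V & isUnitalCStar R V}.

Section CStarTheory.
Context {R : realType} {A : cstarType R}.
Implicit Types a b : A.

Lemma cmulNl a b : cmul (- a) b = - cmul a b.
Proof. by rewrite -scaleN1r cmulZl scaleN1r. Qed.

Lemma cmulNr a b : cmul a (- b) = - cmul a b.
Proof. by rewrite -scaleN1r cmulZr scaleN1r. Qed.

Lemma cmulBl a b (c : A) : cmul (a - b) c = cmul a c - cmul b c.
Proof. by rewrite cmulDl cmulNl. Qed.

Lemma cmulBr a b (c : A) : cmul c (a - b) = cmul c a - cmul c b.
Proof. by rewrite cmulDr cmulNr. Qed.

Lemma cadjB a b : cadj (a - b) = cadj a - cadj b.
Proof.
have cadjN (c : A) : cadj (- c) = - cadj c.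
  by rewrite -scaleN1r cadjZ rmorphN rmorph1 scaleN1r.
by rewrite cadjD cadjN.
Qed.

Lemma norm_cadj a : `|cadj a| = `|a|.
Proof.
have H b : `|b| <= `|cadj b|.
  have [->|b0] := eqVneq b 0; first by rewrite normr0.
  by rewrite -(ler_pM2r (x := `|b|)) ?normr_gt0// -expr2 -cnorm_adj cnormM.
by apply/eqP; rewrite eq_le H andbT -[leRHS](congr1 _ (cadjK a)) H.
Qed.

Lemma cmul_cvg (T : Type) (F : set_system T) {FF : Filter F} (f g : T -> A) a b :
  f @ F --> a -> g @ F --> b -> (fun x => cmul (f x) (g x)) @ F --> cmul a b.
Proof.
move=> /cvgrPdist_lt fa /cvgrPdist_lt gb; apply/cvgrPdist_lt => e e0.
pose S : R[i] := `|a| + 1 + `|b|; pose d := e / (e + S).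
have S0 : 0 < S by rewrite ltr_wpDr// ltr_wpDl.

have eS0 : 0 < e + S by exact: addr_gt0.
have d1 : d <= 1 by rewrite /d ler_pdivrMr// mul1r lerDl ltW.
have de : d * S < e.
  by rewrite /d mulrAC ltr_pdivrMr// ltr_pM2l// ltrDr.
have d0 : 0 < d by exact: divr_gt0.
near=> x.
have fx : `|a - f x| < d by near: x; exact: fa.
have gx : `|b - g x| < d by near: x; exact: gb.
rewrite (_ : _ - _ = cmul (a - f x) b + cmul (f x) (b - g x)); last first.
  by rewrite cmulBl cmulBr addrA subrK.
apply: le_lt_trans de; rewrite (le_trans (ler_normD _ _))// addrC mulrDr.
apply: lerD; rewrite (le_trans (cnormM _ _))//.
  rewrite mulrC; apply: ler_pM => //; first exact: ltW.
  rewrite -[f x](subKr a) (le_trans (ler_normB _ _))// lerD// ltW//.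
  exact: lt_le_trans d1.
by rewrite ler_wpM2r// ltW.
Unshelve. all: by end_near. Qed.

Lemma cadj_cvg (T : Type) (F : set_system T) {FF : Filter F} (f : T -> A) a :
  f @ F --> a -> (fun x => cadj (f x)) @ F --> cadj a.
Proof.
move=> /cvgrPdist_lt fa; apply/cvgrPdist_lt => e e0; near=> x.
rewrite -cadjB norm_cadj; near: x; exact: fa.
Unshelve. all: by end_near. Qed.

End CStarTheory.

(* C(X) (x) A, identified with C(X, A) under the supremum norm.  The proof of
   compactness is a parameter so that the C*-structure can depend on it. *)
Definition Cfun (R : realType) (X : topologicalType) (cX : compact [set: X])
  (A : cstarType R) : Type := continuousType X A.

HB.instance Definition _ (R : realType) (X : topologicalType)
    (cX : compact [set: X]) (A : cstarType R) :=
  Choice.copy (Cfun cX A) (continuousType X A).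

Section CfunAlgebra.
Context {R : realType} {X : topologicalType} {cX : compact [set: X]}.
Context {A : cstarType R}.
Local Notation C := (Cfun cX A).
Implicit Types f g h : C.

Definition cev (x : X) (f : C) : A := (f : continuousType X A) x.

Lemma CfunP f g : (forall x, cev x f = cev x g) -> f = g.
Proof. by move=> fg; apply/continuousEP => x; exact: fg. Qed.

Lemma cev_continuous f : continuous (fun x => cev x f).
Proof. exact: cts_fun. Qed.

Definition Cmk (f : X -> A) (cf : continuous f) : C :=
  (mkcts cf : continuousType X A).

Lemma add_subproof f g : continuous (fun x => cev x f + cev x g).
Proof. by move=> x; apply: cvgD; exact: cev_continuous. Qed.

Lemma opp_subproof f : continuous (fun x => - cev x f).
Proof. by move=> x; apply: cvgN; exact: cev_continuous. Qed.

Lemma scale_subproof (k : R[i]) f : continuous (fun x => k *: cev x f).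
Proof. by move=> x; apply: cvgZr; exact: cev_continuous. Qed.

Lemma mul_subproof f g : continuous (fun x => cmul (cev x f) (cev x g)).
Proof. by move=> x; apply: cmul_cvg; exact: cev_continuous. Qed.

Lemma adj_subproof f : continuous (fun x => cadj (cev x f)).
Proof. by move=> x; apply: cadj_cvg; exact: cev_continuous. Qed.

Lemma cst_subproof (a : A) : continuous (fun _ : X => a).
Proof. by move=> x; exact: cvg_cst. Qed.

Let Cadd f g := Cmk (@add_subproof f g).
Let Copp f := Cmk (@opp_subproof f).
Let Czero := Cmk (cst_subproof (a := 0)).

Let CaddA : associative Cadd.
Proof. by move=> f g h; apply: CfunP => x; exact: addrA. Qed.
Let CaddC : commutative Cadd.
Proof. by move=> f g; apply: CfunP => x; exact: addrC. Qed.
Let Cadd0 : left_id Czero Cadd.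
Proof. by move=> f; apply: CfunP => x; exact: add0r. Qed.
Let CaddN : left_inverse Czero Copp Cadd.
Proof. by move=> f; apply: CfunP => x; exact: addNr. Qed.

HB.instance Definition _ := GRing.isZmodule.Build C CaddA CaddC Cadd0 CaddN.

Let Cscale (k : R[i]) f := Cmk (@scale_subproof k f).

Let CscaleA a b f : Cscale a (Cscale b f) = Cscale (a * b) f.
Proof. by apply: CfunP => x; exact: scalerA. Qed.
Let Cscale1 : left_id 1 Cscale.
Proof. by move=> f; apply: CfunP => x; exact: scale1r. Qed.
Let CscaleDr : right_distributive Cscale +%R.
Proof. by move=> k f g; apply: CfunP => x; exact: scalerDr. Qed.
Let CscaleDl f : {morph Cscale^~ f : a b / a + b}.
Proof. by move=> a b; apply: CfunP => x; exact: scalerDl. Qed.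

HB.instance Definition _ := GRing.Zmodule_isLmodule.Build R[i] C
  CscaleA Cscale1 CscaleDr CscaleDl.

Let Cnorm f : R[i] := (sup (range (fun x => complex.Re `|cev x f|)))%:C.

Let Re_norm (a : A) : `|a| = (complex.Re `|a|)%:C.
Proof. by rewrite RRe_real// ger0_real. Qed.

Let has_ubound_norm f : has_ubound (range (fun x => complex.Re `|cev x f|)).
Proof.
have cf : continuous (fun x : X => complex.Re `|cev x f| : R).
  move=> x; apply/cvgrPdist_lt => e e0; near=> y.
  rewrite -ltcR; apply: (@le_lt_trans _ _ `|cev x f - cev y f|).
    rewrite (le_trans _ (ler_dist_dist _ _))//.
    have -> : `| `|cev x f| - `|cev y f| | =
              `|complex.Re `|cev x f| - complex.Re `|cev y f| |%:C.
      rewrite [in LHS](Re_norm (cev x f)) [in LHS](Re_norm (cev y f)) -rmorphB.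
      by rewrite normc_def /= expr0n addr0 sqrtr_sqr.
    by [].
  near: y; move/cvgrPdist_lt: (cev_continuous (f := f) (x := x)); apply.
  by rewrite ltcR.
have := continuous_compact (continuous_subspaceT cf) cX.
move/compact_bounded => [M [_ /(_ (M + 1))]].
rewrite ltrDl ltr01 => /(_ isT) HM.
by exists (M + 1) => r rX; rewrite (le_trans (ler_norm _))//; exact: HM.
Unshelve. all: by end_near. Qed.

Let le_Cnorm x f : `|cev x f| <= Cnorm f.
Proof. by rewrite Re_norm lecR; apply: ub_le_sup => //; exists x. Qed.

Let Cnorm_le (M : R[i]) f :
  0 <= M -> (forall x, `|cev x f| <= M) -> Cnorm f <= M.
Proof.
move=> M0 fM; have ME : M = (complex.Re M)%:C by rewrite RRe_real// ger0_real.
rewrite ME lecR; have [->|S0] := eqVneq (range (fun x => complex.Re `|cev x f|)) set0.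
  by rewrite sup0 -ler0c -ME.
apply: ge_sup; first exact/set0P.
by move=> _ [x _ <-]; rewrite -lecR -ME -Re_norm.
Qed.

Let Cnorm_ge0 f : 0 <= Cnorm f.
Proof.
rewrite ler0c; have [->|/set0P[_ [x _ _]]] :=
  eqVneq (range (fun x => complex.Re `|cev x f|)) set0; first by rewrite sup0.
by rewrite -ler0c (le_trans _ (le_Cnorm x f)).
Qed.

Let CnormD f g : Cnorm (f + g) <= Cnorm f + Cnorm g.
Proof.
apply: Cnorm_le => [|x]; first exact: addr_ge0.
by rewrite (le_trans (ler_normD _ _))// lerD.
Qed.

Let CnormZ (k : R[i]) f : Cnorm (k *: f) = `|k| * Cnorm f.
Proof.
have le l g : Cnorm (l *: g) <= `|l| * Cnorm g.
  apply: Cnorm_le => [|x]; first exact: mulr_ge0.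
  by rewrite (_ : cev x (l *: g) = l *: cev x g)// normrZ ler_wpM2l.
apply/eqP; rewrite eq_le le /=; have [->|k0] := eqVneq k 0.
  by rewrite normr0 mul0r.
rewrite -ler_pdivlMl ?normr_gt0// -normfV.
by rewrite -[X in Cnorm X](_ : k^-1 *: (k *: f) = f)// scalerA mulVf// scale1r.
Qed.

Let Cnorm0_eq0 f : Cnorm f = 0 -> f = 0.
Proof.
move=> f0; apply: CfunP => x; apply/eqP.
by rewrite -normr_le0 (le_trans (le_Cnorm x f))// f0.
Qed.

HB.instance Definition _ :=
  @Lmodule_isNormed.Build R[i] C Cnorm CnormD CnormZ Cnorm0_eq0.

Lemma norm_cev_le x f : `|cev x f| <= `|f|.
Proof. exact: le_Cnorm. Qed.

Lemma Cfun_norm_le (M : R[i]) f :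
  0 <= M -> (forall x, `|cev x f| <= M) -> `|f| <= M.
Proof. exact: Cnorm_le. Qed.

Lemma cevD x f g : cev x (f + g) = cev x f + cev x g. Proof. by []. Qed.
Lemma cevB x f g : cev x (f - g) = cev x f - cev x g. Proof. by []. Qed.
Lemma cevZ x (k : R[i]) f : cev x (k *: f) = k *: cev x f. Proof. by []. Qed.

Let Ccauchy_cvg (F : set_system C) : ProperFilter F -> cauchy F -> cvg F.
Proof.
move=> FF /cauchy_ballP cF.
have cl x : cvg (cev x @ F).
  apply: cauchy_cvg; apply/cauchy_ballP => e e0.
  have [[P Q] /= [FP FQ] PQ] := cF e e0.
  exists (cev x @` P, cev x @` Q) => /=.
    by split; [apply: filterS FP|apply: filterS FQ] => f fP; exists f.
  move=> [_ _] /= [[f Pf <-] [g Qg <-]]; have := PQ (f, g) (conj Pf Qg).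
  rewrite -!ball_normE /= -cevB => /(le_lt_trans (norm_cev_le _ _)); exact.
pose l x : A := lim (cev x @ F).
have unif (e : R[i]) : 0 < e ->
    exists2 P, F P & forall f x, P f -> `|cev x f - l x| < e + e.
  move=> e0; have [[P Q] /= [FP FQ] PQ] := cF e e0; exists P => // f x Pf.
  have /cvgrPdist_lt/(_ _ e0) Fl := cl x.
  have [g [Qg gl]] := filter_ex (filterI FQ Fl).
  rewrite -(subrK (cev x g) (cev x f)) -addrA (le_lt_trans (ler_normD _ _))//.
  apply: ltrD; last by rewrite distrC.
  have := PQ (f, g) (conj Pf Qg).
  by rewrite -ball_normE /= => /(le_lt_trans (norm_cev_le x _)).
have cl' : continuous l.
  move=> x; apply/cvgrPdist_lt => e e0.
  have [d d0 ->] : exists2 d : R[i], 0 < d & e = (d + d) + d + (d + d).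
    exists (e / 5%:R); first exact: divr_gt0.
    by rewrite -mulr2n -mulrSr -mulrnDr -[RHS]/(e / 5%:R *+ 5) -mulr_natr mulfVK// pnatr_eq0.
  have [P /filter_ex[f Pf] Pl] := unif _ d0; near=> y.
  have -> : l x - l y = (l x - cev x f) + (cev x f - cev y f) + (cev y f - l y).
    by rewrite subrKA subrKA.
  rewrite (le_lt_trans (ler_normD _ _))// ltrD//; last exact: Pl.
  rewrite (le_lt_trans (ler_normD _ _))// ltrD//; first by rewrite distrC Pl.
  near: y; move/cvgrPdist_lt: (cev_continuous (f := f) (x := x)); exact.
apply/cvg_ex; exists (Cmk cl'); apply/cvgrPdist_le => e e0.
have e20 : 0 < e / 2%:R by exact: divr_gt0.
have [P FP Pl] := unif _ e20; apply: filterS FP => f Pf.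
apply: Cfun_norm_le => [|x]; first exact: ltW.
by rewrite cevB distrC [e]splitr ltW// Pl.
Unshelve. all: by end_near. Qed.

HB.instance Definition _ := Uniform_isComplete.Build C Ccauchy_cvg.

Let Cmul f g := Cmk (@mul_subproof f g).
Let Cadj f := Cmk (@adj_subproof f).

Let CmulA : associative Cmul.
Proof. by move=> f g h; apply: CfunP => x; exact: cmulA. Qed.
Let CmulDl : left_distributive Cmul +%R.
Proof. by move=> f g h; apply: CfunP => x; exact: cmulDl. Qed.
Let CmulDr : right_distributive Cmul +%R.
Proof. by move=> f g h; apply: CfunP => x; exact: cmulDr. Qed.
Let CmulZl (k : R[i]) f g : Cmul (k *: f) g = k *: Cmul f g.
Proof. by apply: CfunP => x; exact: cmulZl. Qed.
Let CmulZr (k : R[i]) f g : Cmul f (k *: g) = k *: Cmul f g.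
Proof. by apply: CfunP => x; exact: cmulZr. Qed.
Let CadjK : involutive Cadj.
Proof. by move=> f; apply: CfunP => x; exact: cadjK. Qed.
Let CadjD : {morph Cadj : f g / f + g}.
Proof. by move=> f g; apply: CfunP => x; exact: cadjD. Qed.
Let CadjZ (k : R[i]) f : Cadj (k *: f) = k^* *: Cadj f.
Proof. by apply: CfunP => x; exact: cadjZ. Qed.
Let CadjM f g : Cadj (Cmul f g) = Cmul (Cadj g) (Cadj f).
Proof. by apply: CfunP => x; exact: cadjM. Qed.
Let CnormM f g : `|Cmul f g| <= `|f| * `|g|.
Proof.
apply: Cfun_norm_le => [|x]; first exact: mulr_ge0.
by rewrite (le_trans (cnormM _ _))// ler_pM// norm_cev_le.
Qed.
Let Cnorm_adj f : `|Cmul (Cadj f) f| = `|f| ^+ 2.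
Proof.
apply/eqP; rewrite eq_le; apply/andP; split.
  apply: Cfun_norm_le => [|x]; first exact: exprn_ge0.
  by rewrite [leLHS]cnorm_adj lerXn2r ?nnegrE// norm_cev_le.
rewrite -[leRHS]sqrtCK lerXn2r ?nnegrE ?sqrtC_ge0//.
apply: Cfun_norm_le => [|x]; first by rewrite sqrtC_ge0.
rewrite -(ler_pXn2r (n := 2)) ?nnegrE ?sqrtC_ge0// sqrtCK -cnorm_adj.
exact: (norm_cev_le x (Cmul (Cadj f) f)).
Qed.

HB.instance Definition _ := @isCStarAlgebra.Build R C Cmul Cadj CmulA CmulDl
  CmulDr CmulZl CmulZr CadjK CadjD CadjZ CadjM CnormM Cnorm_adj.

End CfunAlgebra.

Section CfunUnital.
Context {R : realType} {X : topologicalType} (cX : compact [set: X]).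
Context (A : ucstarType R).

Let Cone : Cfun cX A := Cmk (cst_subproof (a := cone)).
Let Cmul1l : left_id Cone cmul.
Proof. by move=> f; apply: CfunP => x; exact: cmul1l. Qed.
Let Cmul1r : right_id Cone cmul.
Proof. by move=> f; apply: CfunP => x; exact: cmul1r. Qed.

HB.instance Definition _ :=
  @isUnitalCStar.Build R (Cfun cX A) Cone Cmul1l Cmul1r.

End CfunUnital.

Lemma unit_interval_compact (R : realType) :
  compact [set: `[0, 1 : R]%classic].
Proof.
move=> F FF _.
have FF' := fmap_proper_filter (set_val : `[0, 1 : R]%classic -> R) FF.
have FI : (set_val @ F) `[0, 1 : R]%classic.
  apply: (@filterS _ F _ setT); last exact: filterT.
  by move=> [x xI] _; exact: set_mem.
have [p [pI clp]] := @segment_compact R 0 1 _ FF' FI.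
exists (exist _ p (mem_set pI)); split=> // P U FP.
rewrite nbhsE => -[_ [[W oW <-] Wp] WU].
have [||y [[q Pq <-] Wq]] := clp (set_val @` P) W.
- by apply: (@filterS _ F _ P) FP => q Pq; exists q.
- exact: open_nbhs_nbhs.
- by exists q; split=> //; exact: WU.
Qed.

Section StarMorphisms.
Context {R : realType}.

Definition star_hom (A B : cstarType R) (f : A -> B) : Prop :=
  [/\ linear f, {morph f : a b / cmul a b} & {morph f : a / cadj a}].

Definition finite_dimensional (F : cstarType R) : Prop :=
  exists n (v : 'I_n -> F), forall a, exists c : 'I_n -> R[i],
    a = \sum_i c i *: v i.

(* A is *-isomorphic to C([0,1]) (x) F; finite-dimensional C*-algebras are
   exactly the finite direct sums of matrix algebras. *)
Definition interval_algebra (A : cstarType R) : Prop :=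
  exists2 F : cstarType R, finite_dimensional F &
  exists2 f : A -> Cfun (@unit_interval_compact R) F, star_hom f & bijective f.

(* [phi] is a morphism of trivial continuous fields with fibre maps [phi_]. *)
Definition field_morphism (X : topologicalType) (cX : compact [set: X])
    (A B : cstarType R) (phi : Cfun cX A -> Cfun cX B) (phi_ : X -> A -> B) :=
  star_hom phi /\
  forall x, star_hom (phi_ x) /\ cev x \o phi = phi_ x \o cev x.

End StarMorphisms.

(* Every finite open cover has a finite open refinement in which each point
   lies in at most d + 1 members (indexed members, counted with repetition). *)
Definition covering_dim_le (X : topologicalType) (d : nat) : Prop :=
  forall (m : nat) (U : 'I_m -> set X),
    (forall i, open (U i)) -> \bigcup_i U i = [set: X] ->
  exists (n : nat) (V : 'I_n -> set X),
    [/\ forall j, open (V j), \bigcup_j V j = [set: X],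
        forall j, exists i, V j `<=` U i &
        forall (x : X) (J : {set 'I_n}),
          (forall j, j \in J -> V j x) -> (#|J| <= d.+1)%N].

(* A model of A (x) K, K the compact operators on l^2(N): the C*-completion of
   the increasing union of the M_n(A), where [mxu i j a] is a (x) e_ij.  The
   relations say that the [mxu i j] assemble into a *-homomorphism from the
   finitely supported matrices over A; it is injective because each [mxu i j]
   is, hence isometric on each M_n(A), and its range is dense.  So a model is
   unique up to a unique *-isomorphism respecting [mxu]. *)
Record stabilization (R : realType) (A : cstarType R) := Stabilization {
  stab_alg :> cstarType R ;
  mxu : nat -> nat -> A -> stab_alg ;
  mxu_linear : forall i j, linear (mxu i j) ;
  mxu_mul : forall i j k l a b,
    cmul (mxu i j a) (mxu k l b) = if j == k then mxu i l (cmul a b) else 0 ;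
  mxu_adj : forall i j a, cadj (mxu i j a) = mxu j i (cadj a) ;
  mxu_inj : forall i j, injective (mxu i j) ;
  mxu_dense : closure [set s | exists n (a : nat -> nat -> A),
    s = \sum_(i < n) \sum_(j < n) mxu i j (a i j)] = setT
}.
Arguments mxu {R A} s : rename.

Section CuntzComparison.
Context {R : realType} {S : cstarType R}.
Implicit Types a b : S.

Definition cpositive a : Prop := exists c, a = cmul (cadj c) c.

Definition cuntz_le a b : Prop :=
  exists r : nat -> S, (fun n => cmul (cmul (r n) b) (cadj (r n))) @ \oo --> a.

Definition cuntz_class a : set S :=
  [set b | [/\ cpositive b, cuntz_le a b & cuntz_le b a]].

End CuntzComparison.

(* Cu(A) = (A (x) K)_+ modulo Cuntz equivalence; an element is an equivalence
   class, as a set of positive elements. *)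
Record Cu (R : realType) (A : cstarType R) (K : stabilization A) := MkCu {
  Cu_set :> set K ;
  Cu_setP : exists2 a : K, cpositive a & Cu_set = cuntz_class a
}.

Section CuntzSemigroup.
Context {R : realType} {A : cstarType R} {K : stabilization A}.
Implicit Types x y z : Cu K.

Definition Cu_of (a : K) (a0 : cpositive a) : Cu K :=
  MkCu (ex_intro2 _ _ a a0 erefl).

Lemma cpositive0 : cpositive (0 : K).
Proof. by exists 0; rewrite -(scale0r (0 : K)) cmulZr !scale0r. Qed.

Definition Cu_zero : Cu K := Cu_of cpositive0.

Definition Cu_le x y : Prop :=
  exists (a b : K), [/\ Cu_set x a, Cu_set y b & cuntz_le a b].

(* The graph of the addition [a] + [b] = [a (+) b]: orthogonal representatives
   always exist since A (x) K is stable, and then a (+) b ~ a + b. *)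
Definition Cu_add x y z : Prop :=
  exists (a b : K),
    [/\ Cu_set x a, Cu_set y b, cmul a b = 0 & Cu_set z (a + b)].

Definition Cu_increasing (u : nat -> Cu K) : Prop :=
  forall n, Cu_le (u n) (u n.+1).

Definition Cu_sup (u : nat -> Cu K) x : Prop :=
  (forall n, Cu_le (u n) x) /\
  forall y, (forall n, Cu_le (u n) y) -> Cu_le x y.

Definition Cu_ll x y : Prop :=
  forall u z, Cu_increasing u -> Cu_sup u z -> Cu_le y z ->
  exists n, Cu_le x (u n).

End CuntzSemigroup.

Lemma cpositive_mxu1 (R : realType) (A : ucstarType R) (K : stabilization A) :
  cpositive (mxu K 0 0 (cone : A)).
Proof.
have cadj1 : cadj (cone : A) = cone.
  by rewrite -[LHS]cmul1r -[RHS]cadjK -[in RHS](cmul1r (cadj cone)) cadjM cadjK.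
by exists (mxu K 0 0 cone); rewrite mxu_adj mxu_mul eqxx cmul1r cadj1.
Qed.

Definition Cu_one (R : realType) (A : ucstarType R) (K : stabilization A) :
  Cu K := Cu_of (cpositive_mxu1 K).

Section CuMorphisms.
Context {R : realType} {A B : cstarType R}.
Context {KA : stabilization A} {KB : stabilization B}.

Definition Cu_morphism (f : Cu KA -> Cu KB) : Prop :=
  [/\ f Cu_zero = Cu_zero,
      forall x y z, Cu_add x y z -> Cu_add (f x) (f y) (f z),
      forall x y, Cu_le x y -> Cu_le (f x) (f y),
      forall u x, Cu_increasing u -> Cu_sup u x -> Cu_sup (f \o u) (f x) &
      forall x y, Cu_ll x y -> Cu_ll (f x) (f y)].

(* [Phi] is phi (x) id_K. *)
Definition amplification (phi : A -> B) (Phi : KA -> KB) : Prop :=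
  star_hom Phi /\ forall i j a, Phi (mxu KA i j a) = mxu KB i j (phi a).

(* [f] is Cu(phi), that is f [a] = [(phi (x) id_K) a].  A *-homomorphism has
   exactly one amplification, so this determines [f]. *)
Definition is_Cu_of (phi : A -> B) (f : Cu KA -> Cu KB) : Prop :=
  exists2 Phi : KA -> KB, amplification phi Phi &
    forall (x : Cu KA) a, Cu_set x a -> Cu_set (f x) (Phi a).

End CuMorphisms.

Definition descends_to_fibers (R : realType) (X : topologicalType)
    (cX : compact [set: X]) (A B : cstarType R)
    (KA : stabilization A) (KB : stabilization B)
    (KXA : stabilization (Cfun cX A)) (KXB : stabilization (Cfun cX B))
    (alpha : Cu KXA -> Cu KXB) (alpha_ : X -> Cu KA -> Cu KB) : Prop :=
  forall x, Cu_morphism (alpha_ x) /\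
    exists (piA : Cu KXA -> Cu KA) (piB : Cu KXB -> Cu KB),
      [/\ is_Cu_of (cev x) piA, is_Cu_of (cev x) piB &
          piB \o alpha = alpha_ x \o piA].

(* Main.v *)
(** Over the one-dimensional [X], positive matrices over [X * [0, 1]] can be
    diagonalised approximately with continuous eigenvalues: nearly maximal unit
    vectors form a continuous field, because local paths of them, over a cover of
    multiplicity two, can be glued along the unit interval.  Hence, in the
    stabilization of [C(X) (x) A], Cuntz comparison is comparison of the pointwise
    ranks, and a Cu-morphism [alpha] is determined by the ranks [nu y O] of
    the image of the class of a function with cozero set [O], at the points [y] of
    the spectrum of [C(X) (x) B].

    As [alpha] is additive and continuous and descends to the fibres, [nu y] is an
    integer valuation on the open sets, carried by the fibre over the image of
    [y] in [X].  In one dimension such a valuation counts points: [nu y] is a sum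
    of point masses whose order statistics are continuous in [y].  Putting the
    values of a function at these points on a diagonal defines [phi], and
    [alpha [1] <= [1]] says that there is enough room for it. *)

Require Import Defs.
From mathcomp Require Import all_boot all_order all_algebra complex.
From mathcomp Require Import all_classical all_reals topology normedtype.
From HB Require Import structures.
From mathcomp Require Import sequences realfun.
From mathcomp Require Import lra ring zify.

Set Implicit Arguments.
Unset Strict Implicit.
Unset Printing Implicit Defensive.

Import Order.TTheory GRing.Theory Num.Theory numFieldNormedType.Exports.

Local Open Scope classical_set_scope.
Local Open Scope ring_scope.
Local Open Scope complex_scope.

(** * Contractivity of *-homomorphisms *)

Section RealNorm.
Context {R : realType} {A : cstarType R}.
Implicit Types a b : A.

(** Exact eigenvectors are discontinuous where eigenvalues cross, so only nearly maximal ones are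
    sought: vectors at which a continuous family of positive forms is small. Convexity lets such
    vectors be averaged as long as the average does not vanish, and all the topology goes into
    preventing that. Over an overlap of two cover members it takes one phase, which exists because
    the interval is contractible; multiplicity two means that no triple overlap imposes a
    compatibility of phases. Dimension one is used nowhere else. Matrix units of the
    finite-dimensional algebra turn a stabilization of $C(X,A)$ into one of $C(Z)$ with the same
    underlying algebra, where $Z$ is $X\times[0,1]$ times the finite set of matrix blocks. Functions
    of a positive element are replaced by functions of the entries of a diagonal approximant. The
    class of a clopen set is compact, hence so is its image; this makes the number of points in each
    block locally constant, without which their order statistics could jump. The fibrewise identity
    comes from applying $\alpha$ to constant functions. *)

Definition nrm a : R := complex.Re `|a|.

Lemma nrmE a : `|a| = (nrm a)%:C.
Proof. by rewrite /nrm RRe_real// ger0_real. Qed.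

Lemma nrm_ge0 a : 0 <= nrm a.
Proof. by rewrite -lecR -nrmE normr_ge0. Qed.

Lemma nrm0 : nrm (0 : A) = 0.
Proof. by rewrite /nrm normr0. Qed.

Lemma nrm_eq0 a : nrm a = 0 -> a = 0.
Proof. by move=> a0; apply/normr0_eq0; rewrite nrmE a0. Qed.

Lemma nrmD a b : nrm (a + b) <= nrm a + nrm b.
Proof. by rewrite -lecR rmorphD/= -!nrmE ler_normD. Qed.

Lemma nrmN a : nrm (- a) = nrm a.
Proof. by rewrite /nrm normrN. Qed.

Lemma nrmB a b : nrm (a - b) <= nrm a + nrm b.
Proof. by rewrite -(nrmN b) nrmD. Qed.

Lemma nrm_distC a b : nrm (a - b) = nrm (b - a).
Proof. by rewrite -nrmN opprB. Qed.

Lemma nrm_dist a b c : nrm (a - c) <= nrm (a - b) + nrm (b - c).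
Proof. by rewrite -[a - c](subrKA b) nrmD. Qed.

Lemma nrmZ (k : R[i]) a : nrm (k *: a) = complex.Re `|k| * nrm a.
Proof.
by apply: complexI; rewrite -nrmE normrZ rmorphM/= -nrmE; congr (_ * _).
Qed.

Lemma nrmM a b : nrm (cmul a b) <= nrm a * nrm b.
Proof. by rewrite -lecR rmorphM/= -!nrmE cnormM. Qed.

Lemma nrm_cadj a : nrm (cadj a) = nrm a.
Proof. by rewrite /nrm norm_cadj. Qed.

Lemma nrm_cstar a : nrm (cmul (cadj a) a) = nrm a ^+ 2.
Proof. by apply: complexI; rewrite -nrmE cnorm_adj rmorphXn/= -nrmE. Qed.

Lemma nrm_sum (I : Type) (r : seq I) (P : pred I) (f : I -> A) :
  nrm (\sum_(i <- r | P i) f i) <= \sum_(i <- r | P i) nrm (f i).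
Proof.
elim/big_ind2 : _ => //; first by rewrite nrm0.
by move=> a x b y ax by_; rewrite (le_trans (nrmD _ _))// lerD.
Qed.

Lemma cmul0l a : cmul 0 a = 0.
Proof. by rewrite -[0 in LHS](scale0r (0 : A)) cmulZl scale0r. Qed.

Lemma cmul0r a : cmul a 0 = 0.
Proof. by rewrite -[0 in LHS](scale0r (0 : A)) cmulZr scale0r. Qed.

Lemma cmul_suml (I : Type) (r : seq I) (P : pred I) (f : I -> A) b :
  cmul (\sum_(i <- r | P i) f i) b = \sum_(i <- r | P i) cmul (f i) b.
Proof. by apply: (big_morph (cmul^~ b)) => [x y|]; [exact: cmulDl|exact: cmul0l]. Qed.

Lemma cmul_sumr (I : Type) (r : seq I) (P : pred I) (f : I -> A) b :
  cmul b (\sum_(i <- r | P i) f i) = \sum_(i <- r | P i) cmul b (f i).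
Proof. by apply: (big_morph (cmul b)) => [x y|]; [exact: cmulDr|exact: cmul0r]. Qed.

Lemma cadj0 : cadj (0 : A) = 0.
Proof. by rewrite -[0 in LHS](scale0r (0 : A)) cadjZ rmorph0 scale0r. Qed.

Lemma cadjN a : cadj (- a) = - cadj a.
Proof. by rewrite -[- a]sub0r cadjB cadj0 sub0r. Qed.

Lemma cadj_sum (I : Type) (r : seq I) (P : pred I) (f : I -> A) :
  cadj (\sum_(i <- r | P i) f i) = \sum_(i <- r | P i) cadj (f i).
Proof. by apply: (big_morph (@cadj R A)) => [x y|]; [exact: cadjD|exact: cadj0]. Qed.

(** Convergence with real bounds: the norm is valued in [R[i]], and this keeps the estimates in the
    ordered field [R]. *)
Definition ccvg (u : nat -> A) (l : A) : Prop :=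
  forall e : R, 0 < e -> exists N, forall n, (N <= n)%N -> nrm (u n - l) < e.

Lemma ccvg_cst a : ccvg (fun=> a) a.
Proof. by move=> e e0; exists 0%N => n _; rewrite subrr nrm0. Qed.

Lemma ccvgD u v a b : ccvg u a -> ccvg v b -> ccvg (fun n => u n + v n) (a + b).
Proof.
move=> ua vb e e0; have e2 : 0 < e / 2 by lra.
have [N HN] := ua _ e2; have [M HM] := vb _ e2.
exists (maxn N M) => n; rewrite geq_max => /andP[/HN h1 /HM h2].
by rewrite opprD addrACA (le_lt_trans (nrmD _ _))//; lra.
Qed.

Lemma ccvgZ (k : R[i]) u a : ccvg u a -> ccvg (fun n => k *: u n) (k *: a).
Proof.
move=> ua e e0; set c := complex.Re `|k|.
have c0 : 0 <= c by rewrite /c -ler0c RRe_real ?ger0_real.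
have e2 : 0 < e / (c + 1) by rewrite divr_gt0// ltr_wpDl.
have [N HN] := ua _ e2; exists N => n /HN; rewrite -scalerBr nrmZ -/c.
by rewrite ltr_pdivlMr ?ltr_wpDl//; have := nrm_ge0 (u n - a); nra.
Qed.

Lemma ccvgN u a : ccvg u a -> ccvg (fun n => - u n) (- a).
Proof.
by move=> ua e /ua[N HN]; exists N => n /HN; rewrite -opprD nrmN.
Qed.

Lemma ccvgB u v a b : ccvg u a -> ccvg v b -> ccvg (fun n => u n - v n) (a - b).
Proof. by move=> ua vb; apply: ccvgD => //; exact: ccvgN. Qed.

Lemma ccvgM u v a b : ccvg u a -> ccvg v b ->
  ccvg (fun n => cmul (u n) (v n)) (cmul a b).
Proof.
move=> ua vb e e0.
set S := nrm a + 1 + nrm b; set d := e / (e + S).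
have S0 : 0 < S by rewrite /S; have := nrm_ge0 a; have := nrm_ge0 b; lra.
have eS0 : 0 < e + S by lra.
have d1 : d <= 1 by rewrite /d ler_pdivrMr//; lra.
have de : d * S < e by rewrite /d mulrAC ltr_pdivrMr//; nra.
have d0 : 0 < d by exact: divr_gt0.
have [N HN] := ua _ d0; have [M HM] := vb _ d0.
exists (maxn N M) => n; rewrite geq_max => /andP[/HN h1 /HM h2].
have -> : cmul (u n) (v n) - cmul a b =
   cmul (u n - a) b + cmul (u n) (v n - b).
  by rewrite cmulBl cmulBr [RHS]addrC subrKA.
have un : nrm (u n) <= nrm a + 1.
  have := nrmD (u n - a) a; rewrite subrK; lra.
have m1 := nrmM (u n - a) b; have m2 := nrmM (u n) (v n - b).
have := nrmD (cmul (u n - a) b) (cmul (u n) (v n - b)).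
have := nrm_ge0 (u n - a); have := nrm_ge0 b; have := nrm_ge0 (u n).
have := nrm_ge0 (v n - b); rewrite /S in de; nra.
Qed.

Lemma ccvg_adj u a : ccvg u a -> ccvg (fun n => cadj (u n)) (cadj a).
Proof.
by move=> ua e /ua[N HN]; exists N => n /HN; rewrite -cadjB nrm_cadj.
Qed.

Lemma nrm_small a : (forall e : R, 0 < e -> nrm a < e) -> a = 0.
Proof.
move=> h; apply: nrm_eq0; apply/eqP; rewrite eq_le nrm_ge0 andbT leNgt.
by apply/negP => /h; rewrite ltxx.
Qed.

Lemma ccvg_unique u a b : ccvg u a -> ccvg u b -> a = b.
Proof.
move=> ua ub; apply/eqP; rewrite -subr_eq0; apply/eqP/nrm_small => e e0.
have e2 : 0 < e / 2 by lra.
have [N HN] := ua _ e2; have [M HM] := ub _ e2.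
have := HN _ (leq_maxl N M); have := HM _ (leq_maxr N M).
by have := nrm_dist a (u (maxn N M)) b; rewrite (nrm_distC a (u _)); lra.
Qed.

Lemma eq_ccvg u v a : (forall n, u n = v n) -> ccvg u a -> ccvg v a.
Proof. by move=> uv ua e /ua[N HN]; exists N => n /HN; rewrite uv. Qed.

Definition ccauchy (u : nat -> A) : Prop :=
  forall e : R, 0 < e -> exists N, forall n, (N <= n)%N -> nrm (u n - u N) < e.

Lemma ccauchy_cvg u : ccauchy u -> exists l, ccvg u l.
Proof.
move=> cu; have : cvgn u.
  apply/cauchy_cvgP/cauchy_ballP => e e0; near_simpl.
  have ee : e = (complex.Re e)%:C by rewrite RRe_real// gtr0_real.
  have e2 : 0 < complex.Re e / 2 by rewrite divr_gt0// -ltcR -ee.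
  have [N HN] := cu _ e2; exists ([set n | N <= n]%N, [set n | N <= n]%N) => /=.
    by split; exists N.
  move=> [n m] /= [/HN h1 /HN h2]; rewrite -ball_normE/= nrmE ee ltcR.
  have := nrm_dist (u n) (u N) (u m); rewrite (nrm_distC (u N)); lra.
move=> /cvg_ex[l /cvgrPdist_lt ul]; exists l => e e0.
have ec : 0 < e%:C by rewrite ltcR.
have [N _ HN] := ul _ ec; exists N => n Nn.
by have := HN n Nn; rewrite /= nrmE ltcR nrm_distC.
Qed.

Lemma geometric_ccvg u (c M : R) : 0 <= c < 1 ->
  (forall n, nrm (u n.+1 - u n) <= M * c ^+ n) -> exists l, ccvg u l.
Proof.
move=> /andP[c0 c1] uc; apply: ccauchy_cvg => e e0.
have M0 : 0 <= M by have := uc 0%N; rewrite expr0 mulr1; apply/le_trans/nrm_ge0.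
have c1' : 0 < 1 - c by lra.
have key N k : nrm (u (N + k)%N - u N) <= M * c ^+ N * (1 - c ^+ k) / (1 - c).
  elim: k => [|k IH]; first by rewrite addn0 subrr nrm0 expr0 subrr mulr0 mul0r.
  have := nrm_dist (u (N + k.+1)%N) (u (N + k)%N) (u N).
  rewrite addnS => /le_trans; apply.
  apply: (le_trans (lerD (uc _) IH)).
  rewrite -(ler_pM2r c1') mulrDl -(mulrA _ (1 - c)^-1) mulVf ?lt0r_neq0// mulr1.
  rewrite -(mulrA _ (1 - c)^-1) mulVf ?lt0r_neq0// mulr1 exprD exprS.
  by rewrite le_eqVlt; apply/orP; left; apply/eqP; ring.
have /cvgrPdist_lt cc : (fun n => c ^+ n : R) @ \oo --> (0 : R).
  by apply: cvg_expr; rewrite ger0_norm.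
have e1 : 0 < e * (1 - c) / (M + 1) by rewrite !divr_gt0 ?mulr_gt0//; lra.
have [N _ HN] := cc _ e1; exists N => n /subnKC <-.
apply: (le_lt_trans (key _ _)).
have := HN N (leqnn N); rewrite /= sub0r normrN ger0_norm ?exprn_ge0//.
rewrite !ltr_pdivlMr// ?ltr_pdivrMr//; last by lra.
have := exprn_ge0 N c0; have := exprn_ge0 (n - N) c0.
set x := c ^+ N; set y := c ^+ (n - N) => y0 x0 h.
have : M * x * (1 - y) <= M * x by have := mulr_ge0 M0 x0; nra.
nra.
Qed.

End RealNorm.

Section Contractive.
Context {R : realType} {A B : cstarType R}.

(** A *-homomorphism on a closed *-subalgebra [P] of a larger algebra. The case needed is the upper
    left corner of a stabilization, on which a map defined entry by entry is multiplicative. *)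
Record partial_star_hom (P : A -> Prop) (f : A -> B) : Prop := PartialStarHom {
  psh_lin : forall (k : R[i]) a b, P a -> P b ->
    P (k *: a + b) /\ f (k *: a + b) = k *: f a + f b ;
  psh_mul : forall a b, P a -> P b ->
    P (cmul a b) /\ f (cmul a b) = cmul (f a) (f b) ;
  psh_adj : forall a, P a -> P (cadj a) /\ f (cadj a) = cadj (f a) ;
  psh_0 : P 0 ;
  psh_lim : forall u l, (forall n, P (u n)) -> ccvg u l -> P l }.

Variables (P : A -> Prop) (f : A -> B).
Hypothesis Pf : partial_star_hom P f.

Let f0 : f 0 = 0.
Proof.
have [_] := psh_lin Pf (- 1) (psh_0 Pf) (psh_0 Pf).
by rewrite scaler0 addr0 scaleN1r addNr.
Qed.

Let PZ (k : R[i]) a : P a -> P (k *: a) /\ f (k *: a) = k *: f a.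
Proof.
by move=> Pa; have := psh_lin Pf k Pa (psh_0 Pf); rewrite f0 !addr0.
Qed.

Let PD a b : P a -> P b -> P (a + b) /\ f (a + b) = f a + f b.
Proof. by move=> Pa Pb; have := psh_lin Pf 1 Pa Pb; rewrite !scale1r. Qed.

Let ks (g : A) := fix ks n : A :=
  if n is m.+1 then 2^-1 *: (g + cmul (ks m) (ks m)) else 0.

Let half (D : cstarType R) (x : D) : nrm (2^-1 *: x) = nrm x / 2.
Proof.
rewrite nrmZ ger0_norm ?invr_ge0// mulrC; congr (_ * _); apply: complexI.
by rewrite RRe_real ?fmorphV ?rmorph_nat ?ger0_real ?invr_ge0.
Qed.

(* The fixed point [k] of [k |-> (h ^ 2 + k ^ 2) / 2] is [1 - sqrt (1 - h ^ 2)]. *)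
Let sqrt_exists h : P h -> cadj h = h -> nrm h < 1 ->
  exists k, [/\ P k, cadj k = k, cmul h k = cmul k h &
    k + k - cmul k k = cmul h h].
Proof.
move=> Ph hs h1; pose g := cmul h h; pose c := nrm h.
have c0 : 0 <= c by exact: nrm_ge0.
have Pg : P g by exact: (psh_mul Pf Ph Ph).1.
have ng : nrm g <= c * c by exact: nrmM.
have Pk n : P (ks g n).
  elim: n => [|n IH] /=; first exact: (psh_0 Pf).
  by apply: (PZ _ _).1; apply: (PD _ _).1 => //; apply: (psh_mul Pf _ _).1.
have ka n : cadj (ks g n) = ks g n.
  elim: n => [|n IH] /=; first exact: cadj0.
  rewrite cadjZ cadjD !cadjM hs IH; congr (_ *: _).
  by rewrite fmorphV rmorph_nat.
have kc n : cmul h (ks g n) = cmul (ks g n) h.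
  elim: n => [|n IH] /=; first by rewrite cmul0l cmul0r.
  rewrite cmulZl cmulZr cmulDr cmulDl; congr (_ *: (_ + _)).
    by rewrite /g cmulA.
  by rewrite cmulA IH -cmulA IH cmulA.
have kn n : nrm (ks g n) <= c.
  elim: n => [|n IH] /=; first by rewrite nrm0.
  rewrite half ler_pdivrMr//; apply: (le_trans (nrmD _ _)).
  have := nrmM (ks g n) (ks g n); have := nrm_ge0 (ks g n); nra.
have kd n : nrm (ks g n.+1 - ks g n) <= c * c ^+ n.
  elim: n => [|n IH].
    rewrite /= subr0 cmul0l addr0 half expr0 mulr1 ler_pdivrMr//; nra.
  rewrite [ks g n.+2]/= [in X in nrm (_ - X)]/=.
  rewrite -scalerBr half opprD addrACA subrr add0r.
  set x := ks g n.+1 in IH *; set y := ks g n in IH *.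
  have -> : cmul x x - cmul y y = cmul x (x - y) + cmul (x - y) y.
    by rewrite cmulBl cmulBr subrKA.
  rewrite ler_pdivrMr// exprSr mulrA.
  have h2 := nrmD (cmul x (x - y)) (cmul (x - y) y); apply: le_trans h2 _.
  have m1 := nrmM x (x - y); have m2 := nrmM (x - y) y.
  have x1 : nrm x <= c by exact: kn.
  have y1 : nrm y <= c by exact: kn.
  have := nrm_ge0 (x - y); have := nrm_ge0 x; have := nrm_ge0 y.
  move: IH; set z := c * c ^+ n => IH y0 x0 d0.
  have e1 : nrm x * nrm (x - y) <= c * z by apply: ler_pM.
  have e2 : nrm (x - y) * nrm y <= c * z by rewrite mulrC; apply: ler_pM.
  lra.
have [k kk] := geometric_ccvg (c := c) (M := c) (introT andP (conj c0 h1)) kd.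
exists k; split.
- exact: (psh_lim Pf Pk kk).
- exact: (ccvg_unique (eq_ccvg ka (ccvg_adj kk)) kk).
- apply: (ccvg_unique (ccvgM (ccvg_cst h) kk)).
  by apply: eq_ccvg (ccvgM kk (ccvg_cst h)) => n; rewrite kc.
- have k1 : ccvg (fun n => ks g n.+1) (2^-1 *: (g + cmul k k)).
    by apply: ccvgZ; apply: ccvgD; [exact: ccvg_cst|exact: ccvgM].
  have k2 : ccvg (fun n => ks g n.+1) k.
    by move=> e /kk[N HN]; exists N => n Nn; apply: HN; rewrite leqW.
  have ke : k = 2^-1 *: (g + cmul k k) by exact: ccvg_unique k2 k1.
  rewrite -mulr2n -scaler_nat [in X in X - _]ke scalerA mulfV ?pnatr_eq0//.
  by rewrite scale1r addrK.
Qed.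

(** With [k] as above $(1-k)^2=1-h^2$, so $\pm i f(h)+(1-f(k))$ acts isometrically by left
    multiplication, even when there is no unit. The difference of the two actions on $x=f(h)$ is
    $2ix^2$, whence $2\|x\|^2\le 2\|x\|$. *)
Let contractive_sa h : P h -> cadj h = h -> nrm h < 1 -> nrm (f h) <= 1.
Proof.
move=> Ph hs h1; have [k [Pk ka kc ke]] := sqrt_exists Ph hs h1.
pose x := f h; pose y := f k.
have xa : cadj x = x by rewrite -(psh_adj Pf Ph).2 hs.
have ya : cadj y = y by rewrite -(psh_adj Pf Pk).2 ka.
have xy : cmul x y = cmul y x.
  by rewrite -(psh_mul Pf Ph Pk).2 kc (psh_mul Pf Pk Ph).2.
have yx : y + y - cmul y y = cmul x x.
  have [Pkk fkk] := psh_mul Pf Pk Pk; have [PN fN] := PZ (-1) Pkk.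
  have [PDk fD] := PD Pk Pk.
  rewrite -(psh_mul Pf Ph Ph).2 -ke -[- cmul k k]scaleN1r (PD PDk PN).2 fD fN fkk.
  by rewrite scaleN1r.
have iso (z : R[i]) b : z * z^* = 1 -> z + z^* = 0 ->
    nrm (z *: cmul x b + (b - cmul y b)) = nrm b.
  move=> z1 z2; have [u uE] : {u | u = b - cmul y b} by eexists.
  have [w wE] : {w | w = cmul x b} by eexists.
  rewrite -uE -wE.
  apply/eqP; rewrite -(eqrXn2 (n := 2)) ?nrm_ge0// -!nrm_cstar; apply/eqP.
  congr nrm; rewrite cadjD cadjZ cmulDl !cmulDr !cmulZl !cmulZr scalerA.
  rewrite [z^* * z]mulrC z1 scale1r -addrA.
  have uw : cmul (cadj w) u = cmul (cadj u) w.
    rewrite wE uE cadjB !cadjM xa ya cmulBl cmulBr; congr (_ - _).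
      by rewrite cmulA.
    by rewrite !cmulA -[in LHS](cmulA (cadj b)) xy cmulA.
  rewrite uw [X in _ + X]addrA -scalerDl [z^* + z]addrC z2 scale0r add0r.
  rewrite wE uE cadjB !cadjM xa ya cmulBl !cmulBr.
  have -> : cmul (cmul (cadj b) x) (cmul x b) = cmul (cmul (cadj b) (cmul x x)) b.
    by rewrite !cmulA.
  rewrite -yx !cmulA cmulBr cmulDr cmulBl cmulDl !cmulA.
  set t := cmul (cmul (cadj b) y) b; set s := cmul _ b.
  by rewrite -[t + t - s]addrA -[X in _ + X]addrA -opprD addrC subrK.
have i1 : 'i * ('i : R[i])^* = 1.
  by rewrite conjCi mulrN -expr2 sqrCi opprK.
have i2 : 'i + ('i : R[i])^* = 0 by rewrite conjCi subrr.
have := iso 'i x i1 i2; have := iso (- 'i) x.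
rewrite rmorphN mulrNN i1 -opprD i2 oppr0 => /(_ erefl erefl) n1 n2.
have : nrm ((2 * 'i) *: cmul x x) <= 2 * nrm x.
  have -> : (2 * 'i) *: cmul x x = ('i *: cmul x x + (x - cmul y x))
     - ((- 'i) *: cmul x x + (x - cmul y x)).
    by rewrite opprD addrACA subrr addr0 scaleNr opprK mulr_natl mulr2n scalerDl.
  by apply: (le_trans (nrmB _ _)); rewrite n1 n2; lra.
rewrite nrmZ normrM normCi mulr1 normr_nat.
have -> : nrm (cmul x x) = nrm x ^+ 2 by rewrite -nrm_cstar xa.
rewrite -/x => h2; rewrite leNgt; apply/negP => x1.
have re2 : complex.Re (2 : R[i]) = 2.
  by apply: complexI; rewrite RRe_real ?realn// rmorph_nat.
by move: h2; rewrite re2 leNgt => /negP; apply; nra.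
Qed.

(** The case of self-adjoint elements is applied to $a^*a/s^2$, where $s$ lies strictly between
    $\|a\|$ and the supposedly larger $\|f(a)\|$. *)
Lemma partial_star_hom_le a : P a -> nrm (f a) <= nrm a.
Proof.
move=> Pa; rewrite leNgt; apply/negP => h.
pose s := (nrm a + nrm (f a)) / 2.
have a0 := nrm_ge0 a; have s0 : 0 < s by rewrite /s; lra.
have as_ : nrm a < s by rewrite /s; lra.
have [Pa' fa'] := psh_adj Pf Pa; have [Pb fb] := psh_mul Pf Pa' Pa.
have [Pc fc] := PZ (s ^- 2)%:C Pb.
have kn : complex.Re `|(s ^- 2)%:C| = s ^- 2.
  apply: complexI; rewrite RRe_real ?ger0_real// ger0_norm//.
  by rewrite ler0c invr_ge0 exprn_ge0// ltW.
have s2 : 0 < s ^+ 2 by rewrite exprn_gt0.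
have := contractive_sa Pc.
have cr : Num.conj ((s ^- 2)%:C : R[i]) = (s ^- 2)%:C by exact: conjc_real.
rewrite cadjZ cadjM cadjK cr fc fb fa' !nrmZ !nrm_cstar kn.
rewrite ![_^-1 * _]mulrC ltr_pdivrMr// ler_pdivrMr// !mul1r => /(_ erefl).
have -> : nrm a ^+ 2 < s ^+ 2 by rewrite ltr_pXn2r ?nnegrE ?(ltW s0).
move=> /(_ isT); rewrite ler_pXn2r ?nnegrE ?nrm_ge0 ?(ltW s0)//.
by rewrite {1}/s; lra.
Qed.

End Contractive.

Section StarHom.
Context {R : realType}.

Lemma star_homD (A B : cstarType R) (f : A -> B) : star_hom f -> {morph f : x y / x + y}.
Proof. by case=> fl _ _ x y; have := fl 1 x y; rewrite !scale1r. Qed.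

Lemma star_hom0 (A B : cstarType R) (f : A -> B) : star_hom f -> f 0 = 0.
Proof.
by move=> /star_homD fD; apply: (addrI (f 0)); rewrite -fD !addr0.
Qed.

Lemma star_homZ (A B : cstarType R) (f : A -> B) : star_hom f ->
  forall (k : R[i]) x, f (k *: x) = k *: f x.
Proof.
by move=> sf k x; have [fl _ _] := sf; have := fl k x 0; rewrite (star_hom0 sf) !addr0.
Qed.

Lemma star_homN (A B : cstarType R) (f : A -> B) : star_hom f -> {morph f : x / - x}.
Proof. by move=> sf x; rewrite -scaleN1r (star_homZ sf) scaleN1r. Qed.

Lemma star_homB (A B : cstarType R) (f : A -> B) : star_hom f -> {morph f : x y / x - y}.
Proof. by move=> sf x y; rewrite star_homD// star_homN. Qed.

Lemma star_hom_sum (A B : cstarType R) (f : A -> B) : star_hom f ->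
  forall (I : Type) (r : seq I) (P : pred I) (F : I -> A),
  f (\sum_(i <- r | P i) F i) = \sum_(i <- r | P i) f (F i).
Proof.
move=> sf I r P F; apply: (big_morph f); [exact: star_homD|exact: star_hom0].
Qed.

Lemma star_hom_le (A B : cstarType R) (f : A -> B) : star_hom f ->
  forall a, nrm (f a) <= nrm a.
Proof.
move=> sf a; have [fl fM fa] := sf.
apply: (@partial_star_hom_le _ _ _ (fun=> True)) => //; split=> //.
by move=> k x y _ _; split=> //; exact: fl.
Qed.

Lemma star_hom_inv (A B : cstarType R) (f : A -> B) (g : B -> A) :
  star_hom f -> cancel f g -> cancel g f -> star_hom g.
Proof.
move=> sf fK gK; have [fl fM fa] := sf; split.
- by move=> k x y; rewrite -{1}(gK x) -{1}(gK y) -fl fK.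
- by move=> x y; rewrite -{1}(gK x) -{1}(gK y) -fM fK.
- by move=> x; rewrite -{1}(gK x) -fa fK.
Qed.

End StarHom.

(** * Matrix units *)

Section FiniteDimensional.
Context {R : realType} {F : cstarType R}.
Implicit Types a b p q h x y : F.
Variables (n : nat) (v : 'I_n -> F).
Hypothesis vspan : forall a, exists c : 'I_n -> R[i], a = \sum_i c i *: v i.

Definition is_proj p := cadj p = p /\ cmul p p = p.

Lemma dependent (m : nat) (u : 'I_m -> F) : (n < m)%N ->
  exists2 c : 'I_m -> R[i], exists i, c i != 0 & \sum_i c i *: u i = 0.
Proof.
move=> nm; have [C uC] := choice (fun i => vspan (u i)).
pose M : 'M[R[i]]_(m, n) := \matrix_(i, j) C i j.
have /rowV0Pn[w wk w0] : kermx M != 0.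
  by rewrite kermx_eq0 /row_free neq_ltn (leq_ltn_trans (rank_leq_col M)).
have wM : w *m M = 0 by apply/sub_kermxP.
exists (fun i => w 0 i).
  have [i wi] : exists i, w 0 i != 0.
    apply/existsP; apply: contraNT w0 => /existsPn wi.
    by apply/eqP/rowP => i; rewrite mxE; apply/eqP; move: (wi i); rewrite negbK.
  by exists i.
under eq_bigr do rewrite uC scaler_sumr.
rewrite exchange_big/= big1// => j _.
under eq_bigr do rewrite scalerA.
rewrite -scaler_suml; have /rowP/(_ j) := wM; rewrite !mxE.
by under eq_bigr do rewrite mxE; move=> ->; rewrite scale0r.
Qed.

Lemma projB p q : is_proj p -> is_proj q -> cmul p q = q -> cmul q p = q ->
  is_proj (p - q).
Proof.
move=> [pa pp] [qa qq] pq qp; split; first by rewrite cadjB pa qa.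
by rewrite cmulBl !cmulBr pp pq qp qq subrr subr0.
Qed.

(** $h^k$ in the corner with unit [p], so that $h^0$ is [p]; [hev] below evaluates polynomials
    there. *)
Definition hpow p h k := iter k (cmul h) p.

Lemma hpow_comm p h y (z : R[i]) : cmul p y = y -> cmul h y = z *: y ->
  forall k, cmul (hpow p h k) y = z ^+ k *: y.
Proof.
move=> py hy; elim=> [|k IH] /=; first by rewrite py expr0 scale1r.
by rewrite -cmulA IH cmulZr hy scalerA -exprSr.
Qed.

Definition hev p h (P : {poly R[i]}) := \sum_(i < size P) P`_i *: hpow p h i.

Lemma hevE p h (P : {poly R[i]}) m : (size P <= m)%N ->
  hev p h P = \sum_(i < m) P`_i *: hpow p h i.
Proof.
move=> Pm; rewrite /hev (big_ord_widen _ (fun i => P`_i *: hpow p h i) Pm).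
rewrite big_mkcond; apply: eq_bigr => i _.
by case: ltnP => // Pi; rewrite nth_default// scale0r.
Qed.

Lemma hev_XsubC p h (z : R[i]) (Q : {poly R[i]}) : hev p h (Q * ('X - z%:P)) = cmul h (hev p h Q) - z *: hev p h Q.
Proof.
have s1 : (size (Q * ('X - z%:P))%R <= (size Q).+1)%N.
  by rewrite (leq_trans (size_polyMleq _ _))// size_XsubC addn2.
rewrite (hevE _ _ s1) (@hevE p h Q (size Q).+1)// scaler_sumr.
rewrite [X in cmul h X](_ : _ = hev p h Q); last exact/esym/hevE.
rewrite cmul_sumr.
under eq_bigr => i _ do rewrite mulrBr coefB coefMX coefMC scalerBl.
rewrite sumrB; congr (_ - _).
  rewrite big_ord_recl /= scale0r add0r; apply: eq_bigr => i _ /=.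
  by rewrite cmulZr.
by apply: eq_bigr => i _; rewrite scalerA mulrC.
Qed.

(** The powers of [h] are dependent, so a non-zero polynomial kills [h]. Roots are divided out until
    a quotient [Q'] no longer does; then $y=Q'(h)$ satisfies $(h-z)y=0$. That [y] is a polynomial in
    [h] serves to turn it into a projection. *)
Lemma eigen p h : is_proj p -> p != 0 -> cmul p h = h ->
  exists (z : R[i]) y, [/\ y != 0, cmul h y = z *: y &
     exists P, y = hev p h P].
Proof.
move=> [pa pp] p0 ph.
have [c [i ci] cs] := @dependent n.+1 (fun i => hpow p h i) (ltnSn n).
pose P0 : {poly R[i]} := \poly_(i < n.+1) c (inord i).
have P0n : P0 != 0.
  apply/eqP => /polyP/(_ i); rewrite coef_poly ltn_ord inord_val coef0.
  by move/eqP; apply/negP.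
have hP0 : hev p h P0 = 0.
  rewrite (hevE _ _ (size_poly _ _)) -[RHS]cs; apply: eq_bigr => j _.
  by rewrite coef_poly ltn_ord inord_val.
elim: {P0 c i ci cs} (size P0) {-2}P0 (leqnn (size P0)) P0n hP0 => [|k IH] Q.
  by rewrite size_poly_leq0 => /eqP ->; rewrite eqxx.
move=> Qk Q0 hQ; have [/eqP|s1] := eqVneq (size Q) 1%N.
  move=> /size_poly1P[c c0 Qc]; move: hQ; rewrite Qc /hev size_polyC c0.
  rewrite big_ord1 coefC/= => /eqP; rewrite scaler_eq0 (negPf c0) (negPf p0)//.
have [z /factor_theorem[Q' QE]] := closed_rootP Q s1.
have Q'0 : Q' != 0 by apply: contraNneq Q0 => Q'0; rewrite QE Q'0 mul0r.
have sQ' : (size Q' <= k)%N.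
  by move: Qk; rewrite QE size_Mmonic ?monicXsubC// size_XsubC addn2.
have [/eqP|hQ'] := eqVneq (hev p h Q') 0; first by move=> /eqP; exact: IH.
exists z, (hev p h Q'); split=> //; last by exists Q'.
by apply/eqP; rewrite -subr_eq0 -hev_XsubC -QE hQ.
Qed.


Lemma hpow_corner p h : is_proj p -> cadj h = h -> cmul p h = h ->
  forall k, [/\ cmul p (hpow p h k) = hpow p h k, cmul (hpow p h k) h = cmul h (hpow p h k)
             & cadj (hpow p h k) = hpow p h k].
Proof.
move=> [pa pp] ha ph; have hp : cmul h p = h by rewrite -[RHS]ha -[in RHS]ph cadjM ha pa.
elim=> [|k [IH1 IH2 IH3]] /=; first by rewrite ph hp.
split; first by rewrite cmulA ph.
  by rewrite -cmulA IH2.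
by rewrite cadjM IH3 ha IH2.
Qed.

(** Since [y] is a polynomial in the self-adjoint [h] and $hy=zy$, the element $y^*y$ is a multiple
    of [y], and it is idempotent up to the scalar [r]. The resulting [q] satisfies $hq=zq$, so $q=p$
    would make [h] a multiple of [p]. *)
Lemma split_proj p h : is_proj p -> p != 0 -> cadj h = h -> cmul p h = h ->
  (forall z : R[i], h != z *: p) ->
  exists q, [/\ is_proj q, q != 0, q != p, cmul p q = q & cmul q p = q].
Proof.
move=> pP p0 ha ph hz; have [z [y [y0 hy [P yP]]]] := eigen pP p0 ph.
have [pa pp] := pP.
have py : cmul p y = y.
  rewrite yP /hev cmul_sumr; apply: eq_bigr => i _.
  by rewrite cmulZr; have [->] := hpow_corner pP ha ph i.
pose k := \sum_(i < size P) (P`_i)^*%R * z ^+ i.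
have yy : cmul (cadj y) y = k *: y.
  rewrite {1}yP /hev cadj_sum cmul_suml /k scaler_suml.
  apply: eq_bigr => i _; rewrite cadjZ cmulZl.
  by have [_ _ ->] := hpow_corner pP ha ph i; rewrite (hpow_comm py hy) scalerA.
pose e := cmul (cadj y) y.
have e0 : e != 0.
  apply: contraNneq y0 => e0; apply/eqP/nrm_eq0/eqP.
  by rewrite -sqrf_eq0 -nrm_cstar -/e e0 nrm0.
have k0 : k != 0 by apply: contraNneq e0 => k0; rewrite /e yy k0 scale0r.
have ea : cadj e = e by rewrite /e cadjM cadjK.
pose r := k * k^*%R.
have r0 : r != 0 by rewrite /r mulf_neq0// conjC_eq0.
have ee : cmul e e = r *: e.
  rewrite -{1}ea {1 2}/e {1 2}yy cadjZ cmulZl cmulZr scalerA -/e /r.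
  by rewrite [k * _]mulrC.
have pe : cmul p e = e by rewrite /e yy cmulZr py.
pose q := r^-1 *: e; exists q.
have rr : (r^-1)^*%R = r^-1 by rewrite fmorphV /r rmorphM/= conjCK mulrC.
have qP : is_proj q.
  split; first by rewrite /q cadjZ ea rr.
  by rewrite /q cmulZl cmulZr ee !scalerA divfK.
have pq : cmul p q = q by rewrite /q cmulZr pe.
have hq : cmul h q = z *: q.
  by rewrite /q cmulZr /e yy cmulZr hy !scalerA; congr (_ *: _); ring.
have q0 : q != 0 by rewrite /q scaler_eq0 invr_eq0 (negPf r0).
split=> //.
  apply: contraNneq (hz z) => qp; rewrite -[X in z *: X]qp -hq qp.
  by rewrite -[eqbLHS]ha -[in eqbLHS]ph cadjM ha pa.
by rewrite -[RHS]qP.1 -[in RHS]pq cadjM pa qP.1.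
Qed.

Definition orthofam m (q : 'I_m -> F) :=
  [/\ forall i, is_proj (q i), forall i, q i != 0 &
      forall i j, i != j -> cmul (q i) (q j) = 0].

Lemma orthofam_bound m (q : 'I_m -> F) : orthofam q -> (m <= n)%N.
Proof.
move=> [qP q0 qq]; rewrite leqNgt; apply/negP => /(dependent q)[c [i ci] cs].
have := congr1 (cmul (q i)) cs; rewrite cmul0r cmul_sumr (bigD1 i)//= big1 ?addr0.
  rewrite cmulZr (qP i).2 => /eqP; rewrite scaler_eq0 (negPf ci) (negPf (q0 i))//.
by move=> j ji; rewrite cmulZr qq ?scaler0// eq_sym.
Qed.

Lemma orthofam_extend m (q : 'I_m -> F) x : orthofam q -> is_proj x -> x != 0 ->
  (forall i, cmul x (q i) = 0) -> exists q' : 'I_m.+1 -> F, orthofam q'.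
Proof.
move=> [qP q0 qq] xP x0 xq.
have qx i : cmul (q i) x = 0.
  by rewrite -(qP i).1 -xP.1 -cadjM xq cadj0.
exists (fun i => if unlift ord_max i is Some j then q j else x); split.
- by move=> i; case: unliftP.
- by move=> i; case: unliftP.
- move=> i j; case: unliftP => [i' ->|->]; case: unliftP => [j' ->|->] //.
    by rewrite (inj_eq lift_inj) => /qq.
  by rewrite eqxx.
Qed.

Variable one : F.
Hypotheses (one_l : forall a, cmul one a = a) (one_r : forall a, cmul a one = a).

Definition minimal p := forall a, exists z : R[i], cmul (cmul p a) p = z *: p.

(** Orthogonal families are linearly independent, so one of maximal length exists. It could be
    lengthened by [one] minus its sum if that were non-zero, and by splitting a member if some
    self-adjoint element of its corner were not scalar. *)
Lemma maximal_fam : exists m (q : 'I_m -> F), [/\ orthofam q,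
  \sum_i q i = one & forall i, minimal (q i)].
Proof.
pose Q m := `[< exists q : 'I_m -> F, orthofam q >].
have Q0 : exists m, Q m.
  by exists 0%N; apply/asboolP; exists (fun i => 0); split; case.
have Qn m : Q m -> (m <= n)%N by move=> /asboolP[q /orthofam_bound].
case: (ex_maxnP Q0 Qn) => m /asboolP[q qo] qmax.
have nomore (q' : 'I_m.+1 -> F) : ~ orthofam q'.
  move=> q'o; have /qmax : Q m.+1 by apply/asboolP; exists q'.
  by rewrite ltnn.
have [qP q0 qq] := qo.
exists m, q; split=> //.
  have onea : cadj one = one by rewrite -[LHS]one_r -[RHS]cadjK -[in RHS](one_r (cadj one)) cadjM cadjK.
  have qs i : cmul (\sum_j q j) (q i) = q i.
    rewrite cmul_suml (bigD1 i)//= big1 ?addr0; first exact: (qP i).2.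
    by move=> j; exact: qq.
  apply/eqP; rewrite eq_sym -subr_eq0; apply/negPn/negP => x0.
  have sP : is_proj (\sum_j q j).
    split; first by rewrite cadj_sum; apply: eq_bigr => j _; exact: (qP j).1.
    by rewrite [in X in cmul _ X](eq_bigr q)// cmul_sumr; apply: eq_bigr => j _.
  have [||] := orthofam_extend qo _ x0.
  - apply: projB => //; split=> //.
  - by move=> i; rewrite cmulBl one_l qs subrr.
  - by move=> q' /nomore.
move=> i.
have sa h : cadj h = h -> cmul (q i) h = h -> exists z : R[i], h = z *: q i.
  move=> ha qh; apply: contrapT => hz.
  have [|x [xP x0 xq qx xq']] := split_proj (qP i) (q0 i) ha qh.
    by move=> z; apply/eqP => hq; apply: hz; exists z.
  pose q1 j := if j == i then q i - x else q j.
  have xj j : j != i -> cmul x (q j) = 0.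
    by move=> ji; rewrite -xq' -cmulA qq ?cmul0r// eq_sym.
  have jx j : j != i -> cmul (q j) x = 0.
    by move=> ji; rewrite -(qP j).1 -xP.1 -cadjM xj// cadj0.
  have q1o : orthofam q1.
    split=> [j|j|j k]; rewrite /q1.
    - by case: eqP => // _; apply: projB.
    - by case: ifP => // _; rewrite subr_eq0 eq_sym.
    - move=> jk; have [ji|ji] := boolP (j == i); have [ki|ki] := boolP (k == i).
      + by move: jk; rewrite (eqP ji) (eqP ki) eqxx.
      + by rewrite cmulBl qq ?xj ?subr0// eq_sym.
      + by rewrite cmulBr qq// jx// subr0.
      + exact: qq.
  have [|q' /nomore//] := orthofam_extend q1o xP x0.
  move=> j; rewrite /q1; case: eqP => [_|/eqP]; last exact: xj.
  by rewrite cmulBr xq' xP.2 subrr.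
move=> a; pose b := cmul (cmul (q i) a) (q i).
have qb : cmul (q i) b = b by rewrite /b !cmulA (qP i).2.
have qb' : cmul (q i) (cadj b) = cadj b.
  by rewrite /b !cadjM (qP i).1 !cmulA (qP i).2.
have [z1 h1] : exists z : R[i], b + cadj b = z *: q i.
  by apply: sa; [rewrite cadjD cadjK addrC|rewrite cmulDr qb qb'].
have ci : ('i : R[i])^*%R = - 'i by exact: conjCi.
have [z2 h2] : exists z : R[i], 'i *: (b - cadj b) = z *: q i.
  apply: sa; last by rewrite cmulZr cmulBr qb qb'.
  by rewrite cadjZ cadjB cadjK ci scaleNr -scalerN opprB.
exists (2^-1 * (z1 - 'i * z2)); rewrite -/b -scalerA scalerBl -scalerA -h1 -h2.
rewrite scalerA -expr2 sqrCi scaleN1r opprK addrACA subrr addr0 -mulr2n.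
by rewrite -[b *+ 2]scaler_nat scalerA mulVf ?pnatr_eq0// scale1r.
Qed.

End FiniteDimensional.

(** All matrix blocks of [F] share one index set: [cl a] is the block of row [a], and [e a b] is
    meaningful only when [a] and [b] belong to the same block. *)
Record matrix_units (R : realType) (F : cstarType R) (r m : nat)
    (cl : 'I_r -> 'I_m) (e : 'I_r -> 'I_r -> F) : Prop := MatrixUnits {
  mu_mul : forall a b c d, cl a = cl b -> cl c = cl d ->
    cmul (e a b) (e c d) = if b == c then e a d else 0 ;
  mu_adj : forall a b, cl a = cl b -> cadj (e a b) = e b a ;
  mu_neq0 : forall a, e a a != 0 ;
  mu_span : forall f, exists c : 'I_r -> 'I_r -> R[i],
    f = \sum_a \sum_(b | cl a == cl b) c a b *: e a b ;
  mu_surj : forall j, exists a, cl a = j }.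

Section MatrixUnits.
Context {R : realType} {F : cstarType R}.
Implicit Types p q x y w : F.

(** The hypotheses give $(w+ip)^*(w+ip)=0$, so $w=-ip$ is both self-adjoint and skew. This takes the
    place of the positivity of $x^*x$: it excludes a negative sign in [partial_isometry]. *)
Lemma skew_sa_eq0 w p : cadj w = w -> cadj p = p -> cmul w p = w ->
  cmul w w = - p -> p = 0.
Proof.
move=> wa pa wp ww; have pw : cmul p w = w by rewrite -[RHS]wa -[in RHS]wp cadjM wa pa.
have pp : cmul p p = p.
  by apply: oppr_inj; rewrite -cmulNl -ww -cmulA wp.
have ci : ('i : R[i])^*%R = - 'i by exact: conjCi.
have h : w + 'i *: p = 0.
  apply: nrm_eq0; apply/eqP; rewrite -sqrf_eq0 -nrm_cstar; apply/eqP.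
  rewrite (_ : cmul _ _ = 0) ?nrm0// cadjD cadjZ wa pa ci cmulDl !cmulDr.
  rewrite !cmulZl !cmulZr wp pw pp ww scalerA mulNr -expr2 sqrCi opprK scale1r.
  by rewrite scaleNr [- ('i *: w) + p]addrC addrACA addNr subrr addr0.
have w1 : w = - ('i *: p) by apply/eqP; rewrite -addr_eq0 h.
have : cadj w = 'i *: p by rewrite w1 cadjN cadjZ ci pa scaleNr opprK.
rewrite wa {1}w1 => /eqP; rewrite eq_sym -addr_eq0 -scalerDl scaler_eq0 -mulr2n.
by rewrite mulrn_eq0/= (negPf (neq0Ci _)) => /eqP.
Qed.

(** Minimality makes $x^*x$ and $xx^*$ multiples of [q] and [p], with one and the same real scalar.
    Rescaling [x] brings that scalar to 1 or -1. *)
Lemma partial_isometry p q x : is_proj p -> is_proj q -> p != 0 -> q != 0 ->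
  cmul p q = 0 ->
  minimal p -> minimal q -> cmul (cmul p x) q = x -> x != 0 ->
  exists y, [/\ cmul (cmul p y) q = y, cmul (cadj y) y = q & cmul y (cadj y) = p].
Proof.
move=> [pa pp] [qa qq] p0 q0 pq pm qm px x0.
have xq : cmul x q = x by rewrite -[in LHS]px -cmulA qq px.
have px' : cmul p x = x by rewrite -[in LHS]px !cmulA pp px.
have qx : cmul q (cadj x) = cadj x by rewrite -{1}qa -cadjM xq.
have xp : cmul (cadj x) p = cadj x by rewrite -{1}pa -cadjM px'.
have [c cE] := qm (cmul (cadj x) x).
have [d dE] := pm (cmul x (cadj x)).
have xx : cmul (cadj x) x = c *: q.
  by rewrite -cE cmulA qx -cmulA xq.
have xx' : cmul x (cadj x) = d *: p.
  by rewrite -dE cmulA px' -cmulA xp.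
have nx0 : cmul (cadj x) x != 0.
  apply: contraNneq x0 => h; apply/eqP/nrm_eq0/eqP.
  by rewrite -sqrf_eq0 -nrm_cstar h nrm0.
have c0 : c != 0 by apply: contraNneq nx0 => c0; rewrite xx c0 scale0r.
have dc : d = c.
  have : cmul (cmul x (cadj x)) x = d *: x by rewrite xx' cmulZl px'.
  rewrite -cmulA xx cmulZr xq => /eqP; rewrite eq_sym -subr_eq0 -scalerBl.
  by rewrite scaler_eq0 subr_eq0 (negPf x0) orbF => /eqP.
have cc : c^*%R = c.
  have : cadj (cmul (cadj x) x) = c *: q by rewrite cadjM cadjK xx.
  rewrite xx cadjZ qa => /eqP; rewrite -subr_eq0 -scalerBl.
  by rewrite scaler_eq0 subr_eq0 (negPf q0) orbF => /eqP.
have creal : c \is Num.real by rewrite CrealE cc.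
have [s [s0 sc]] : exists s : R[i], s^*%R = s /\ (s * s = c^-1 \/ s * s = - c^-1).
  case/orP: (creal) => cs.
    exists (sqrtC c^-1); rewrite -expr2 sqrtCK; split; last by left.
    by apply/CrealP; rewrite ger0_real// sqrtC_ge0 invr_ge0.
  exists (sqrtC (- c^-1)); rewrite -expr2 sqrtCK; split; last by right.
  by apply/CrealP; rewrite ger0_real// sqrtC_ge0 -invrN invr_ge0 oppr_ge0.
pose y := s *: x.
have py : cmul (cmul p y) q = y by rewrite /y cmulZr cmulZl px.
have yy1 : cmul (cadj y) y = (s * s * c) *: q.
  by rewrite /y cadjZ cmulZl cmulZr xx s0 !scalerA.
have yy2 : cmul y (cadj y) = (s * s * c) *: p.
  by rewrite /y cadjZ cmulZl cmulZr xx' dc s0 !scalerA.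
case: sc => sc; rewrite sc ?mulNr mulVf// ?scaleN1r ?scale1r in yy1 yy2.
  by exists y.
(* Here $y^*y=-q$ and $yy^*=-p$, and then [y + cadj y] is self-adjoint with square [- (p + q)]. *)
exfalso; have qp : cmul q p = 0 by rewrite -qa -pa -cadjM pq cadj0.
have yq : cmul y q = y by rewrite -[in LHS]py -cmulA qq py.
have pyy : cmul p y = y by rewrite -[in LHS]py !cmulA pp py.
have yp : cmul y p = 0 by rewrite -yq -cmulA qp cmul0r.
have qy : cmul q y = 0 by rewrite -pyy cmulA qp cmul0l.
have yay : cmul y y = 0 by rewrite -[X in cmul X _]yq -cmulA qy cmul0r.
have pq0 : p + q = 0.
  apply: (@skew_sa_eq0 (y + cadj y)).
  - by rewrite cadjD cadjK addrC.
  - by rewrite cadjD pa qa.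
  - rewrite cmulDl !cmulDr yp yq add0r -{1}pa -{1}qa -!cadjM pyy qy cadj0 addr0//.
  - rewrite cmulDl !cmulDr yay yy1 yy2 -cadjM yay cadj0 add0r addr0.
    by rewrite opprD.
have : cmul p (p + q) = p by rewrite cmulDr pp pq addr0.
by rewrite pq0 cmul0r => /esym/eqP; rewrite (negPf p0).
Qed.

(** Minimal projections are equivalent when a non-zero element links them. Each class gets a root,
    [x a] is a partial isometry from the root of [a] onto [p a], and the units are $x_ax_b^*$. *)
Lemma matrix_units_exist (one : F) : finite_dimensional F ->
  (forall a, cmul one a = a) -> (forall a, cmul a one = a) ->
  exists r m (cl : 'I_r -> 'I_m) (e : 'I_r -> 'I_r -> F), matrix_units cl e.
Proof.
move=> [n [v vspan]] one_l one_r.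
have [r [p [[pP p0 pp] psum pmin]]] := maximal_fam vspan one_l one_r.
pose rl a b := `[< exists2 x, x != 0 & cmul (cmul (p a) x) (p b) = x >].
have rxx a : rl a a by apply/asboolP; exists (p a) => //; rewrite !(pP a).2.
have corner a b x : cmul (cmul (p a) x) (p b) = x ->
    cmul (p a) x = x /\ cmul x (p b) = x.
  by move=> h; split; rewrite -[in LHS]h ?cmulA ?(pP a).2// -cmulA (pP b).2.
have iso a b : rl a b -> exists y, [/\ cmul (cmul (p a) y) (p b) = y,
    cmul (cadj y) y = p b & cmul y (cadj y) = p a].
  move=> /asboolP[x x0 xE]; have [ab|ab] := eqVneq a b.
    by subst b; exists (p a); rewrite (pP a).1 !(pP a).2.
  exact: (partial_isometry (pP a) (pP b) _ _ (pp _ _ ab) (pmin a) (pmin b) xE x0).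
have nz a b y : cmul (cadj y) y = p b -> cmul (cmul (p a) y) (p b) = y -> rl a b.
  move=> yy yE; apply/asboolP; exists y => //.
  by apply: contraNneq (p0 b) => y0; rewrite -yy y0 cmul0r.
have rsym a b : rl a b -> rl b a.
  move=> /iso[y [yE y1 y2]]; apply: (nz _ _ (cadj y)); first by rewrite cadjK.
  by rewrite -{1}(pP b).1 -cadjM -{1}(pP a).1 -cadjM cmulA yE.
have rtrans a b c : rl a b -> rl b c -> rl a c.
  move=> /iso[y [yE y1 y2]] /iso[x [xE x1 x2]].
  have [py yp] := corner _ _ _ yE; have [px xp] := corner _ _ _ xE.
  apply: (nz _ _ (cmul y x)); last by rewrite !cmulA py -cmulA xp.
  by rewrite cadjM -cmulA (cmulA _ y) y1 px x1.
(* The choice depends only on the predicate [rl a], so equivalent indices receive the same root. *)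
pose root a := odflt a [pick b | rl a b].
have rroot a : rl a (root a).
  by rewrite /root; case: pickP => [b //|/(_ a)]; rewrite rxx.
have rootE a b : (root a == root b) = rl a b.
  apply/eqP/idP => [ab|ab].
    by apply: (rtrans _ _ _ (rroot a)); rewrite ab; exact/rsym/rroot.
  rewrite /root; have -> : [pick c | rl a c] = [pick c | rl b c].
    apply: eq_pick => c; apply/idP/idP; first exact/rtrans/rsym.
    exact: rtrans.
  by case: pickP => [//|/(_ b)]; rewrite rxx.
pose T := [set root a | a : 'I_r]%SET.
have Ta a : root a \in T by apply: imset_f.
pose cl a : 'I_#|T| := enum_rank_in (Ta a) (root a).
have clE a b : (cl a == cl b) = rl a b.
  rewrite -rootE; apply/eqP/eqP => [h|h].
    have := congr1 enum_val h; rewrite /cl !enum_rankK_in//.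
  by apply: enum_val_inj; rewrite /cl !enum_rankK_in.
have [x xP] := choice (fun a => iso _ _ (rroot a)).
pose e a b := cmul (x a) (cadj (x b)).
have xx a b : root a = root b -> cmul (cadj (x a)) (x b) = if a == b then p (root a) else 0.
  move=> rab; have [<-|ab] := eqVneq a b; first by have [] := xP a.
  have [/corner[px _] _ _] := xP b.
  have [/corner[pa _] _ _] := xP a.
  by rewrite -px -pa cadjM (pP a).1 -cmulA (cmulA (p a)) pp// cmul0l cmul0r.
exists r, #|T|, cl, e; split.
- move=> a b c d /eqP; rewrite clE -rootE => /eqP ab /eqP; rewrite clE -rootE => /eqP cd.
  rewrite /e -cmulA (cmulA _ (x c)); have [bc|bc] := eqVneq b c.
    subst c; rewrite xx// eqxx; have [/corner[_ xp] _ _] := xP a.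
    by rewrite -ab cmulA xp.
  have [/corner[px _] _ _] := xP c; have [/corner[pb _] _ _] := xP b.
  suff -> : cmul (cadj (x b)) (x c) = 0 by rewrite cmul0l cmul0r.
  by rewrite -px -pb cadjM (pP b).1 -cmulA (cmulA (p b)) pp// cmul0l cmul0r.
- by move=> a b _; rewrite /e cadjM cadjK.
- by move=> a; rewrite /e; have [_ _ ->] := xP a.
- move=> f.
  have coef a b : exists c : R[i], cl a == cl b -> cmul (cmul (p a) f) (p b) = c *: e a b.
    have [ab|ab] := boolP (cl a == cl b); last by exists 0.
    have [/corner[pa xa] a1 a2] := xP a; have [/corner[pb xb] b1 b2] := xP b.
    have rab : root a = root b by apply/eqP; rewrite rootE -clE.
    have [c cE] := pmin a (cmul f (cmul (x b) (cadj (x a)))).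
    exists c => _; rewrite /e.
    have : cmul (cmul (cmul (cmul (p a) (cmul f (cmul (x b) (cadj (x a))))) (p a)) (x a)) (cadj (x b))
       = c *: cmul (x a) (cadj (x b)) by rewrite cE cmulZl pa cmulZl.
    rewrite -(cmulA _ (p a)) pa -!cmulA (cmulA (cadj (x a))) a1 rab.
    by rewrite (cmulA (x b)) xb b2 => <-; rewrite !cmulA.
  have [c cE] := choice (fun ab : 'I_r * 'I_r => coef ab.1 ab.2).
  exists (fun a b => c (a, b)); rewrite -[LHS]one_l -[LHS]one_r -psum cmul_suml cmul_suml.
  apply: eq_bigr => a _; rewrite cmul_sumr [RHS]big_mkcond; apply: eq_bigr => b _.
  case: ifPn => [/(cE (a, b))//|]; rewrite clE => /asboolPn h; apply/eqP.
  apply/negPn/negP => h0; apply: h; exists (cmul (cmul (p a) f) (p b)) => //.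
  by rewrite !cmulA (pP a).2 -cmulA (pP b).2.
- move=> j; have /imsetP[a _ ja] := enum_valP j; exists a.
  by apply: enum_val_inj; rewrite /cl enum_rankK_in.
Qed.

End MatrixUnits.

(** * Coordinates and stabilizations *)

Definition cpx (R : realType) : numClosedFieldType := R[i].

(** The complex numbers as a module over themselves, under a separate name that carries their
    C*-structure; [Cfun cZ (Cplx R)] is then $C(Z)$. *)
Definition Cplx (R : realType) : Type := (cpx R)^o.

HB.instance Definition _ (R : realType) := NormedModule.copy (Cplx R) ((cpx R)^o).

Section CplxTheory.
Context {R : realType}.
Local Notation C := (Cplx R).

Lemma Re_norm_le (z : R[i]) : `|complex.Re z| <= complex.Re `|z|.
Proof.
by rewrite -lecR (le_trans (normc_ge_Re z))// RRe_real// ger0_real.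
Qed.

Lemma Im_norm_le (z : R[i]) : `|complex.Im z| <= complex.Re `|z|.
Proof.
have -> : complex.Im z = complex.Re (z * (- 'i)%C).
  by rewrite mulrN raddfN/= ReiNIm opprK.
by rewrite (le_trans (Re_norm_le _))// normrM normrN normCi mulr1.
Qed.

Lemma norm_Re_Im (z : R[i]) :
  complex.Re `|z| <= `|complex.Re z| + `|complex.Im z|.
Proof.
rewrite -lecR RRe_real ?ger0_real// [in leLHS](complexE z).
rewrite (le_trans (ler_normD _ _))// rmorphD/= lerD//.
  by rewrite normc_def/= expr0n addr0 sqrtr_sqr.
by rewrite normrM normCi mul1r normc_def/= expr0n addr0 sqrtr_sqr.
Qed.

Let Cplx_complete (F : set_system C) : ProperFilter F -> cauchy F -> cvg F.
Proof.
move=> FF /cauchy_ballP cF.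
have c1 (h : R[i] -> R) : (forall z, `|h z| <= complex.Re `|z|) ->
    (forall z w, h (z - w) = h z - h w) -> cvg ((h : C -> R) @ F).
  move=> hle hB; apply: cauchy_cvg; apply/cauchy_ballP => e e0.
  have ec : (0 : R[i]) < e%:C by rewrite ltcR.
  have [[P Q] /= [FP FQ] PQ] := cF _ ec.
  exists (h @` P, h @` Q) => /=.
    by split; [apply: filterS FP|apply: filterS FQ] => f fP; exists f.
  move=> [_ _] /= [[z Pz <-] [w Qw <-]]; have := PQ (z, w) (conj Pz Qw).
  rewrite -!ball_normE /= -hB => zw; rewrite (le_lt_trans (hle _))//.
  by rewrite -ltcR RRe_real// ger0_real.
have /cvg_ex[a Fa] := c1 (@complex.Re R) Re_norm_le (fun z w => raddfB _ z w).
have /cvg_ex[b Fb] := c1 (@complex.Im R) Im_norm_le (fun z w => raddfB _ z w).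
apply/cvg_ex; exists (a +i* b)%C; apply/cvgrPdist_lt => e e0.
have ee : e = (complex.Re e)%:C by rewrite RRe_real// gtr0_real.
have e2 : 0 < complex.Re e / 2 by rewrite divr_gt0// -ltcR -ee.
move/cvgrPdist_lt : Fa => /(_ _ e2) Fa; move/cvgrPdist_lt : Fb => /(_ _ e2) Fb.
near=> z.
have h1 : `|a - complex.Re z| < complex.Re e / 2 by near: z.
have h2 : `|b - complex.Im z| < complex.Re e / 2 by near: z.
set w : R[i] := (a +i* b)%C - z.
have -> : `|(a +i* b)%C - z| = (complex.Re `|w|)%:C :> R[i].
  by rewrite RRe_real// ger0_real.
rewrite ee ltcR (le_lt_trans (norm_Re_Im _))// /w !raddfB/=; lra.
Unshelve. all: by end_near. Qed.

HB.instance Definition _ := Uniform_isComplete.Build C Cplx_complete.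

Let cm (a b : C) : C := (a : R[i]) * b.
Let ca (a : C) : C := (a : R[i])^*%R.

Let cmA : associative cm. Proof. by move=> a b c; exact: mulrA. Qed.
Let cmDl : left_distributive cm +%R. Proof. by move=> a b c; exact: mulrDl. Qed.
Let cmDr : right_distributive cm +%R. Proof. by move=> a b c; exact: mulrDr. Qed.
Let cmZl (k : R[i]) a b : cm (k *: a) b = k *: cm a b.
Proof. by rewrite /cm [RHS]mulrA. Qed.
Let cmZr (k : R[i]) a b : cm a (k *: b) = k *: cm a b.
Proof. by rewrite /cm [LHS]mulrCA. Qed.
Let caK : involutive ca. Proof. by move=> a; exact: conjCK. Qed.
Let caD : {morph ca : a b / a + b}. Proof. by move=> a b; exact: rmorphD. Qed.
Let caZ (k : R[i]) a : ca (k *: a) = k^*%R *: ca a.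
Proof. exact: rmorphM. Qed.
Let caM a b : ca (cm a b) = cm (ca b) (ca a).
Proof. by rewrite /ca /cm rmorphM mulrC. Qed.
Let cnM (a b : C) : `|cm a b| <= `|a| * `|b|.
Proof. by rewrite /cm [leLHS](normrM (a : R[i])). Qed.
Let cnadj (a : C) : `|cm (ca a) a| = `|a| ^+ 2.
Proof. by rewrite /cm /ca [LHS](normrM (_ : R[i])) [X in X * _]norm_conjC expr2. Qed.

HB.instance Definition _ := @isCStarAlgebra.Build R C cm ca cmA cmDl cmDr cmZl
  cmZr caK caD caZ caM cnM cnadj.

Lemma cmulC_E (a b : C) : cmul a b = (a : R[i]) * b :> R[i]. Proof. by []. Qed.
Lemma cadjC_E (a : C) : cadj a = (a : R[i])^*%R :> R[i]. Proof. by []. Qed.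
Lemma nrmC_E (a : C) : nrm a = complex.Re `|a : R[i]|. Proof. by []. Qed.

HB.instance Definition _ := @isUnitalCStar.Build R C (1 : R[i])
  (fun a => mul1r (a : R[i])) (fun a => mulr1 (a : R[i])).

End CplxTheory.

Section Continuity.
Context {R : realType}.

Lemma cstar_continuousP (T : topologicalType) (A : cstarType R) (f : T -> A) :
  continuous f <-> forall x (e : R), 0 < e -> \forall y \near x, nrm (f x - f y) < e.
Proof.
split=> cf x.
  move=> e e0; have /cvgrPdist_lt h := cf x.
  have ec : (0 : R[i]) < e%:C by rewrite ltcR.
  by apply: filterS (h _ ec) => y; rewrite nrmE ltcR.
apply/cvgrPdist_lt => e e0.
have ee : e = (complex.Re e)%:C by rewrite RRe_real// gtr0_real.
have e1 : 0 < complex.Re e by rewrite -ltcR -ee.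
by apply: filterS (cf x _ e1) => y; rewrite nrmE ee ltcR.
Qed.

Lemma real_continuousP (T : topologicalType) (f : T -> R) :
  continuous f <-> forall x (e : R), 0 < e -> \forall y \near x, `|f x - f y| < e.
Proof.
split=> cf x; first by move=> e e0; have /cvgrPdist_lt h := cf x; exact: h.
by apply/cvgrPdist_lt => e /(cf x).
Qed.

Lemma rtoc_continuous (T : topologicalType) (f : T -> R) : continuous f ->
  continuous (fun x => (f x)%:C : Cplx R).
Proof.
move=> /real_continuousP cf; apply/cstar_continuousP => x e e0.
apply: filterS (cf x e e0) => y; apply: le_lt_trans.
rewrite nrmC_E (_ : (_ - _ : Cplx R) = (f x - f y)%:C :> R[i]); last by rewrite rmorphB.
by rewrite normc_def/= expr0n addr0 sqrtr_sqr.
Qed.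

Lemma Re_continuous (T : topologicalType) (f : T -> Cplx R) : continuous f ->
  continuous (fun x => complex.Re (f x : R[i])).
Proof.
move=> /cstar_continuousP cf; apply/real_continuousP => x e e0.
apply: filterS (cf x e e0) => y; apply: le_lt_trans.
by rewrite -raddfB Re_norm_le.
Qed.

Lemma nrm_continuous (T : topologicalType) (A : cstarType R) (f : T -> A) :
  continuous f -> continuous (fun x => nrm (f x)).
Proof.
move=> /cstar_continuousP cf; apply/real_continuousP => x e e0.
apply: filterS (cf x e e0) => y; apply: le_lt_trans.
have := nrmD (f x - f y) (f y); have := nrmD (f y - f x) (f x).
rewrite !subrK (nrm_distC (f y)) => h1 h2.
by rewrite ler_norml; apply/andP; split; lra.
Qed.

Section OneCfun.
Context {X : topologicalType} {cX : compact [set: X]} {A : cstarType R}.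
Local Notation CF := (Cfun cX A).

(* The zero function when [f] is not continuous. *)
Definition mkf (f : X -> A) : CF :=
  if pselect (continuous f) is left cf then Cmk cf else 0.

Lemma mkfE f x : continuous f -> cev x (mkf f) = f x.
Proof. by rewrite /mkf; case: pselect. Qed.

Lemma cev0 x : cev x (0 : CF) = 0. Proof. by []. Qed.
Lemma cevM x (f g : CF) : cev x (cmul f g) = cmul (cev x f) (cev x g). Proof. by []. Qed.
Lemma cev_adj x (f : CF) : cev x (cadj f) = cadj (cev x f). Proof. by []. Qed.

Lemma cev_sum x (I : Type) (r : seq I) (P : pred I) (f : I -> CF) :
  cev x (\sum_(i <- r | P i) f i) = \sum_(i <- r | P i) cev x (f i).
Proof. by apply: (big_morph (cev x)). Qed.

Lemma star_hom_cev x : star_hom (cev x : CF -> A).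
Proof. by split=> [k f g|f g|f]. Qed.

Lemma nrm_cev x (f : CF) : nrm (cev x f) <= nrm f.
Proof. by apply: star_hom_le; exact: star_hom_cev. Qed.

Lemma nrm_Cfun_le (c : R) (f : CF) : 0 <= c -> (forall x, nrm (cev x f) <= c) ->
  nrm f <= c.
Proof.
move=> c0 fc; rewrite -lecR -nrmE; apply: Cfun_norm_le; first by rewrite ler0c.
by move=> x; rewrite nrmE lecR.
Qed.

End OneCfun.
End Continuity.

Lemma cev1 (R : realType) (X : topologicalType) (cX : compact [set: X])
  (A : ucstarType R) x : cev x (cone : Cfun cX A) = cone.
Proof. by []. Qed.

Global Opaque mkf cev.

Lemma compact_setTX (U V : topologicalType) : compact [set: U] -> compact [set: V] ->
  compact [set: U * V].
Proof. by move=> cU cV; rewrite -setXTT; exact: compact_setX. Qed.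

Section Curry.
Context {R : realType} {X W : topologicalType} (cX : compact [set: X]) (cW : compact [set: W]).
Context {A F : cstarType R} (fA : A -> Cfun cW F) (gA : Cfun cW F -> A).
Hypotheses (sA : star_hom fA) (fK : cancel fA gA) (gK : cancel gA fA).

Let cXW := compact_setTX cX cW.

Definition curry_f (a : Cfun cX A) : Cfun cXW F :=
  mkf (fun p => cev p.2 (fA (cev p.1 a))).

Lemma curry_fE a x t : cev (x, t) (curry_f a) = cev t (fA (cev x a)).
Proof.
rewrite /curry_f mkfE//=; apply/cstar_continuousP => -[{}x {}t] e e0 /=.
have e2 : 0 < e / 2 by lra.
have /cstar_continuousP/(_ x _ e2) h1 := @cev_continuous _ _ cX A a.
have /cstar_continuousP/(_ t _ e2) h2 := @cev_continuous _ _ cW F (fA (cev x a)).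
exists ([set y | nrm (cev x a - cev y a) < e / 2],
  [set s | nrm (cev t (fA (cev x a)) - cev s (fA (cev x a))) < e / 2]) => //.
move=> [y s] /= [h3 h4].
apply: (le_lt_trans (nrm_dist _ (cev s (fA (cev x a))) _)).
suff : nrm (cev s (fA (cev x a)) - cev s (fA (cev y a))) < e / 2 by lra.
rewrite -cevB (le_lt_trans (nrm_cev _ _))// -star_homB//.
by rewrite (le_lt_trans (star_hom_le sA _)).
Qed.

Lemma slice_continuous (g : Cfun cXW F) x : continuous (fun t => cev (x, t) g).
Proof.
move=> t; apply: (cvg_comp (fun t => (x, t))); last exact: cev_continuous.
by apply: cvg_pair; [exact: cvg_cst|exact: cvg_id].
Qed.

Definition curry_g (g : Cfun cXW F) : Cfun cX A :=
  mkf (fun x => gA (mkf (fun t => cev (x, t) g))).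

Lemma curry_gE g x : cev x (curry_g g) = gA (mkf (fun t => cev (x, t) g)).
Proof.
rewrite /curry_g mkfE// => {x}; apply/cstar_continuousP => x e e0.
have sG := star_hom_inv sA fK gK.
have e2 : 0 < e / 2 by lra.
(* The supremum norm asks for closeness uniformly in [t]; this is where [W] must be compact. *)
have : \forall y \near x, setT `<=` (fun t => nrm (cev (x, t) g - cev (y, t) g) < e / 2).
  have /compact_near_coveringP := cW; apply => t _.
  have e4 : 0 < e / 4 by lra.
  have /cstar_continuousP/(_ (x, t) _ e4) := @cev_continuous _ _ cXW F g.
  move=> [[U V] /= [Ux Vt] UV]; exists (V, U) => //= -[s y] /= [Vs Uy].
  have h1 := UV (y, s) (conj Uy Vs).
  have h2 := UV (x, s) (conj (nbhs_singleton Ux) Vs).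
  have := nrm_dist (cev (x, s) g) (cev (x, t) g) (cev (y, s) g).
  by rewrite [nrm (cev (x, s) g - cev (x, t) g)]nrm_distC; move: h1 h2 => /=; lra.
apply: filterS => y hy; rewrite -star_homB// (le_lt_trans (star_hom_le sG _))//.
rewrite (@le_lt_trans _ _ (e / 2))//; last by lra.
apply: nrm_Cfun_le; first exact: ltW.
move=> t; rewrite cevB !mkfE; try exact: slice_continuous.
by apply/ltW; exact: hy.
Qed.

Lemma curry_star : star_hom curry_f.
Proof.
have [fl fM fa] := sA.
by split=> [k a b|a b|a]; apply: CfunP => -[x t];
  rewrite ?(cevD, cevZ, cevM, cev_adj) !curry_fE ?(cevD, cevZ, cevM, cev_adj) ?(fl, fM, fa).
Qed.

Lemma curry_fK : cancel curry_f curry_g.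
Proof.
move=> a; apply: CfunP => x; rewrite curry_gE -[RHS]fK; congr gA.
apply: CfunP => t; rewrite mkfE; last exact: slice_continuous.
by rewrite curry_fE.
Qed.

Lemma curry_gK : cancel curry_g curry_f.
Proof.
move=> g; apply: CfunP => -[x t]; rewrite curry_fE curry_gE gK mkfE//.
exact: slice_continuous.
Qed.

End Curry.

Section Coordinates.
Context {R : realType} {Y : topologicalType} (cY : compact [set: Y]).
Context {D F : cstarType R} (f : D -> Cfun cY F) (g : Cfun cY F -> D).
Hypotheses (sf : star_hom f) (fK : cancel f g) (gK : cancel g f).
Context {r m : nat} {cl : 'I_r -> 'I_m} {e : 'I_r -> 'I_r -> F}.
Hypothesis mu : matrix_units cl e.
Local Notation CY := (Cfun cY (Cplx R)).

Lemma mu_norm a b : cl a = cl b -> nrm (e a b) = 1.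
Proof.
have np c : nrm (e c c) = 1.
  have h : nrm (e c c) ^+ 2 = nrm (e c c).
    by rewrite -nrm_cstar (mu_adj mu)// (mu_mul mu)// eqxx.
  have h0 : nrm (e c c) != 0.
    by apply: contraNneq (mu_neq0 mu c) => /nrm_eq0 ->.
  by apply: (mulfI h0); rewrite -expr2 h mulr1.
move=> ab; apply/eqP; rewrite -(eqrXn2 (n := 2)) ?nrm_ge0// -nrm_cstar.
by rewrite (mu_adj mu)// (mu_mul mu)// eqxx np expr1n.
Qed.

(* The matrix coefficient: [e a a * x * e b b = coef x a b *: e a b]. *)
Definition coef (x : F) (a b : 'I_r) : R[i] :=
  xget 0 [set c : R[i] | cmul (cmul (e a a) x) (e b b) = c *: e a b].

Lemma coefE x a b : cl a = cl b -> cmul (cmul (e a a) x) (e b b) = coef x a b *: e a b.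
Proof.
move=> ab; rewrite /coef; case: xgetP => [c _ //|h].
have [c xE] := mu_span mu x; case: (h (c a b)).
rewrite /= xE cmul_sumr cmul_suml (bigD1 a)//= [X in _ + X]big1 ?addr0; last first.
  move=> a' a'a; rewrite cmul_sumr cmul_suml big1// => b' /eqP b'a.
  by rewrite cmulZr (mu_mul mu)// eq_sym (negPf a'a) scaler0 cmul0l.
rewrite cmul_sumr cmul_suml (bigD1 b)/=; last exact/eqP.
rewrite [X in _ + X]big1 ?addr0; last first.
  move=> b' /andP[/eqP ab' b'b].
  by rewrite cmulZr cmulZl (mu_mul mu)// eqxx (mu_mul mu)// (negPf b'b) scaler0.
by rewrite cmulZr cmulZl (mu_mul mu)// eqxx (mu_mul mu)// eqxx.
Qed.

Lemma mu_scaleI a b : cl a = cl b -> injective (fun c : R[i] => c *: e a b).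
Proof.
move=> ab c d /eqP; rewrite -subr_eq0 -scalerBl scaler_eq0 subr_eq0 => /orP[/eqP//|].
move/eqP => h; have := mu_norm ab; rewrite h nrm0 => /eqP.
by rewrite eq_sym oner_eq0.
Qed.

Lemma mu_spanE x : x = \sum_a \sum_(b | cl a == cl b) coef x a b *: e a b.
Proof.
have [c xE] := mu_span mu x; rewrite {1}xE; apply: eq_bigr => a _.
apply: eq_bigr => b /eqP ab; congr (_ *: _); apply: (mu_scaleI ab) => /=.
rewrite -coefE// {1}xE cmul_sumr cmul_suml (bigD1 a)//= [X in _ + X]big1 ?addr0; last first.
  move=> a' a'a; rewrite cmul_sumr cmul_suml big1// => b' /eqP b'a.
  by rewrite cmulZr (mu_mul mu)// eq_sym (negPf a'a) scaler0 cmul0l.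
rewrite cmul_sumr cmul_suml (bigD1 b)/=; last exact/eqP.
rewrite [X in _ + X]big1 ?addr0; last first.
  move=> b' /andP[/eqP ab' b'b].
  by rewrite cmulZr cmulZl (mu_mul mu)// eqxx (mu_mul mu)// (negPf b'b) scaler0.
by rewrite cmulZr cmulZl (mu_mul mu)// eqxx (mu_mul mu)// eqxx.
Qed.

Lemma coefB x y a b : cl a = cl b -> coef (x - y) a b = coef x a b - coef y a b.
Proof.
move=> ab; apply: (mu_scaleI ab) => /=.
by rewrite scalerBl -!coefE// cmulBr cmulBl.
Qed.

Lemma coef_le x a b : cl a = cl b -> complex.Re `|coef x a b| <= nrm x.
Proof.
move=> ab; have := nrmZ (coef x a b) (e a b); rewrite mu_norm// mulr1 => <-.
rewrite -coefE// (le_trans (nrmM _ _))// mu_norm// mulr1.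
by rewrite (le_trans (nrmM _ _))// mu_norm// mul1r.
Qed.

Lemma coef_continuous (x : Cfun cY F) a b : cl a = cl b ->
  continuous (fun y => coef (cev y x) a b : Cplx R).
Proof.
move=> ab; apply/cstar_continuousP => y ep ep0.
have /cstar_continuousP/(_ y _ ep0) := @cev_continuous _ _ cY F x.
apply: filterS => z; apply: le_lt_trans; rewrite nrmC_E.
by rewrite -[(_ - _ : Cplx R)]/((_ - _ : R[i])) -coefB// coef_le.
Qed.

Lemma unit_continuous (h : CY) a b : continuous (fun y => (cev y h : R[i]) *: e a b).
Proof.
apply/cstar_continuousP => y ep ep0; set c := nrm (e a b).
have c0 : 0 <= c by exact: nrm_ge0.
have e2 : 0 < ep / (c + 1) by rewrite divr_gt0// ltr_wpDl.
have /cstar_continuousP/(_ y _ e2) := @cev_continuous _ _ cY (Cplx R) h.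
apply: filterS => z; rewrite -scalerBl nrmZ -/c nrmC_E ltr_pdivlMr ?ltr_wpDl//.
rewrite -[(_ - _ : Cplx R)]/((_ - _ : R[i])); apply: le_lt_trans.
by rewrite ler_wpM2l ?lerDl// -ler0c RRe_real// ger0_real.
Qed.

(** The elementary tensor $h\otimes e_{ab}$, carried over to [D]. *)
Definition cu (a b : 'I_r) (h : CY) : D :=
  g (mkf (fun y => (cev y h : R[i]) *: e a b)).

Let cuf a b h y : cev y (f (cu a b h)) = (cev y h : R[i]) *: e a b.
Proof. by rewrite /cu gK mkfE//; exact: unit_continuous. Qed.

Definition cuE := cuf.

Let fI := can_inj fK.

Lemma cu_linear a b (k : R[i]) h h' : cu a b (k *: h + h') = k *: cu a b h + cu a b h'.
Proof.
have [fl _ _] := sf; apply: fI; apply: CfunP => y.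
by rewrite fl cevD cevZ !cuf scalerA -scalerDl cevD cevZ.
Qed.

Lemma cu_mul a b c d h h' : cl a = cl b -> cl c = cl d ->
  cmul (cu a b h) (cu c d h') = if b == c then cu a d (cmul h h') else 0.
Proof.
move=> ab cd; have [_ fM _] := sf; apply: fI; apply: CfunP => y.
rewrite fM cevM !cuf cmulZl cmulZr scalerA (mu_mul mu)//.
case: eqP => _; first by rewrite cuf.
by rewrite scaler0 (star_hom0 sf).
Qed.

Lemma cu_adj a b h : cl a = cl b -> cadj (cu a b h) = cu b a (cadj h).
Proof.
move=> ab; have [_ _ fa] := sf; apply: fI; apply: CfunP => y.
by rewrite fa cev_adj !cuf cadjZ (mu_adj mu).
Qed.

Lemma cu_inj a b h : cl a = cl b -> cu a b h = 0 -> h = 0.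
Proof.
move=> ab h0; apply: CfunP => y; have := cuf a b h y.
rewrite h0 (star_hom0 sf) => /eqP; rewrite eq_sym scaler_eq0 => /orP[/eqP//|].
move/eqP => e0; have := mu_norm ab; rewrite e0 nrm0 => /eqP.
by rewrite eq_sym oner_eq0.
Qed.

Definition ccoef (d : D) (a b : 'I_r) : CY := mkf (fun y => coef (cev y (f d)) a b : Cplx R).

Lemma ccoefE d a b y : cl a = cl b -> cev y (ccoef d a b) = coef (cev y (f d)) a b.
Proof. by move=> ab; rewrite /ccoef mkfE//; exact: coef_continuous. Qed.

Lemma cu_span d : d = \sum_a \sum_(b | cl a == cl b) cu a b (ccoef d a b).
Proof.
apply: fI; apply: CfunP => y; rewrite [LHS]mu_spanE.
rewrite star_hom_sum// cev_sum; apply: eq_bigr => a _.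
rewrite star_hom_sum// cev_sum; apply: eq_bigr => b /eqP ab.
by rewrite cuf ccoefE.
Qed.

End Coordinates.

Arguments coef {R F r} e x a b.
Arguments cu {R Y cY D F} g {r} e a b h.
Arguments ccoef {R Y cY D F} f {r} e d a b.

Section FiniteMatrices.
Context {R : realType} {A : zmodType} {K : cstarType R} (mx : nat -> nat -> A -> K).
Hypothesis mxD : forall i j, {morph mx i j : x y / x + y}.

Let mx0 i j : mx i j 0 = 0.
Proof. by apply: (addrI (mx i j 0)); rewrite -mxD !addr0. Qed.

Definition fins (s : K) := exists n (a : nat -> nat -> A),
  s = \sum_(i < n) \sum_(j < n) mx i j (a i j).

Lemma fins_widen n (a : nat -> nat -> A) N : (n <= N)%N ->
  \sum_(i < n) \sum_(j < n) mx i j (a i j) =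
  \sum_(i < N) \sum_(j < N) mx i j (if ((i < n) && (j < n))%N then a i j else 0).
Proof.
move=> nN; rewrite (big_ord_widen _ (fun i => \sum_(j < n) mx i j (a i j)) nN).
rewrite big_mkcond; apply: eq_bigr => i _; case: ifP => ilt; last first.
  by rewrite big1// => j _; rewrite mx0.
rewrite (big_ord_widen _ (fun j => mx i j (a i j)) nN) big_mkcond.
by apply: eq_bigr => j _; case: ifP => //; rewrite mx0.
Qed.

Lemma fins_add x y : fins x -> fins y -> fins (x + y).
Proof.
move=> [n [a ->]] [n' [a' ->]].
rewrite (fins_widen _ (leq_maxl n n')) (fins_widen a' (leq_maxr n n')).
exists (maxn n n'), (fun i j => (if ((i < n) && (j < n))%N then a i j else 0) +
  (if ((i < n') && (j < n'))%N then a' i j else 0)).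
rewrite -big_split; apply: eq_bigr => i _; rewrite -big_split; apply: eq_bigr => j _.
by rewrite mxD.
Qed.

Lemma fins0 : fins 0.
Proof. by exists 0%N, (fun _ _ => 0); rewrite big_ord0. Qed.

Lemma fins_sum (I : Type) (r : seq I) (P : pred I) (f : I -> K) :
  (forall k, P k -> fins (f k)) -> fins (\sum_(k <- r | P k) f k).
Proof. by move=> h; elim/big_ind : _ => //; [exact: fins0|exact: fins_add]. Qed.

Lemma fins_mx p q x : fins (mx p q x).
Proof.
exists (maxn p q).+1, (fun i j => if (i == p) && (j == q) then x else 0).
have hp : (p < (maxn p q).+1)%N by rewrite ltnS leq_maxl.
have hq : (q < (maxn p q).+1)%N by rewrite ltnS leq_maxr.
rewrite (bigD1 (Ordinal hp))//= (bigD1 (Ordinal hq))//= !eqxx.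
rewrite big1 ?addr0 => [|j jq]; last first.
  by rewrite (_ : nat_of_ord j == q = false) ?mx0//; apply: contraNF jq => /eqP h; apply/eqP/val_inj.
rewrite big1 ?addr0// => i ip; rewrite big1// => j _.
by rewrite (_ : nat_of_ord i == p = false) ?mx0//; apply: contraNF ip => /eqP h; apply/eqP/val_inj.
Qed.

End FiniteMatrices.

(* [mx] extends to a *-homomorphism on the finitely supported matrices over [A]. *)
Record matrix_system (R : realType) (A K : cstarType R) (mx : nat -> nat -> A -> K) : Prop :=
  MatrixSystem {
  ms_linear : forall i j, linear (mx i j) ;
  ms_mul : forall i j k l a b,
    cmul (mx i j a) (mx k l b) = if j == k then mx i l (cmul a b) else 0 ;
  ms_adj : forall i j a, cadj (mx i j a) = mx j i (cadj a) }.

Section MatrixSystem.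
Context {R : realType} {A K : cstarType R} {mx : nat -> nat -> A -> K}.
Hypothesis sys : matrix_system mx.

Lemma msD i j : {morph mx i j : x y / x + y}.
Proof. by move=> x y; have := ms_linear sys i j 1 x y; rewrite !scale1r. Qed.

Lemma ms0 i j : mx i j 0 = 0.
Proof. by apply: (addrI (mx i j 0)); rewrite -msD !addr0. Qed.

Lemma msZ i j (k : R[i]) x : mx i j (k *: x) = k *: mx i j x.
Proof. by have := ms_linear sys i j k x 0; rewrite ms0 !addr0. Qed.

Lemma ms_sum i j (I : Type) (r : seq I) (P : pred I) (f : I -> A) :
  mx i j (\sum_(k <- r | P k) f k) = \sum_(k <- r | P k) mx i j (f k).
Proof. by apply: (big_morph (mx i j)); [exact: msD|exact: ms0]. Qed.

Lemma ms_comp (A' : cstarType R) (phi : A' -> A) : star_hom phi ->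
  matrix_system (fun i j a => mx i j (phi a)).
Proof.
move=> [pl pM pa]; split=> [i j k a b|i j k l a b|i j a].
- by rewrite pl ms_linear.
- by rewrite (ms_mul sys) pM.
- by rewrite (ms_adj sys) pa.
Qed.

End MatrixSystem.

Lemma mxu_system (R : realType) (A : cstarType R) (K : stabilization A) :
  matrix_system (mxu K).
Proof. by split; [exact: mxu_linear|exact: mxu_mul|exact: mxu_adj]. Qed.

Section Mxu.
Context {R : realType} {A : cstarType R} (K : stabilization A).

Lemma mxuD i j : {morph mxu K i j : x y / x + y}.
Proof. exact: msD (mxu_system K) i j. Qed.

Lemma mxu0 i j : mxu K i j 0 = 0.
Proof. exact: ms0 (mxu_system K) i j. Qed.

Lemma mxuZ i j (k : R[i]) x : mxu K i j (k *: x) = k *: mxu K i j x.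
Proof. exact: msZ (mxu_system K) i j k x. Qed.

Lemma mxuN i j : {morph mxu K i j : x / - x}.
Proof. by move=> x; rewrite -scaleN1r mxuZ scaleN1r. Qed.

Lemma mxuB i j : {morph mxu K i j : x y / x - y}.
Proof. by move=> x y; rewrite mxuD mxuN. Qed.

Lemma mxu_sum i j (I : Type) (r : seq I) (P : pred I) (f : I -> A) :
  mxu K i j (\sum_(k <- r | P k) f k) = \sum_(k <- r | P k) mxu K i j (f k).
Proof. exact: (ms_sum (mxu_system K)). Qed.

Lemma mxu_star_hom i : star_hom (mxu K i i).
Proof.
split; first exact: mxu_linear.
  by move=> a b; rewrite mxu_mul eqxx.
by move=> a; rewrite mxu_adj.
Qed.

Lemma nrm_mxu i j a : nrm (mxu K i j a) <= nrm a.
Proof.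
rewrite -(ler_pXn2r (n := 2)) ?nnegrE ?nrm_ge0// -!nrm_cstar mxu_adj mxu_mul eqxx.
exact: star_hom_le (mxu_star_hom j) _.
Qed.

Lemma fins_dense (s : K) (e : R) : 0 < e -> exists2 x, fins (mxu K) x & nrm (s - x) < e.
Proof.
move=> e0; have : closure (fins (mxu K) : set K) s.
  by rewrite /fins (mxu_dense K).
have ec : (0 : R[i]) < e%:C by rewrite ltcR.
move=> /(_ (ball s e%:C))[|x [xs]]; first exact: nbhsx_ballx.
by rewrite -ball_normE/= nrmE ltcR => h; exists x.
Qed.

End Mxu.

Lemma denseP (R : realType) (K : cstarType R) (S : set K) :
  (forall s (e : R), 0 < e -> exists2 x, S x & nrm (s - x) < e) -> closure S = setT.
Proof.
move=> h; rewrite -subTset => s _ U; rewrite -filter_from_ballE => -[e /= e0 eU].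
have ee : e = (complex.Re e)%:C by rewrite RRe_real// gtr0_real.
have e1 : 0 < complex.Re e by rewrite -ltcR -ee.
have [x Sx sx] := h s _ e1; exists x; split=> //; apply: eU.
by rewrite -ball_normE/= nrmE ee ltcR.
Qed.

Section Flatten.
Context {R : realType} {Y : topologicalType} (cY : compact [set: Y]).
Context {D F : cstarType R} (f : D -> Cfun cY F) (g : Cfun cY F -> D).
Hypotheses (sf : star_hom f) (fK : cancel f g) (gK : cancel g f).
Context {r m : nat} {cl : 'I_r -> 'I_m} {e : 'I_r -> 'I_r -> F}.
Hypothesis mu : matrix_units cl e.
Variable rep : 'I_m -> 'I_r.
Hypothesis repK : forall j, cl (rep j) = j.
Local Notation CY := (Cfun cY (Cplx R)).
Local Notation Z := (Y * discrete_topology 'I_m)%type.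
Variable cZ : compact [set: Z].
Local Notation CZ := (Cfun cZ (Cplx R)).
Local Notation u := (cu g e).

(** Flattening merges the index of the compact operators with the rows of a block. In block [j], of
    size [bs j], position [p] is row [el j p] in copy [p %/ bs j], and [idx] inverts this. The
    numbering differs from block to block, which is harmless because distinct blocks are
    orthogonal. *)
Definition blk j : seq 'I_r := enum [pred a | cl a == j].
Definition bs j := size (blk j).
Definition el j (p : nat) : 'I_r := nth (rep j) (blk j) (p %% bs j).
Definition idx (a : 'I_r) (i : nat) : nat := (i * bs (cl a) + index a (blk (cl a)))%N.

Lemma bs_gt0 j : (0 < bs j)%N.
Proof.
have : rep j \in blk j by rewrite mem_enum inE repK.
by rewrite /bs; case: (blk j).
Qed.

Lemma cl_el j p : cl (el j p) = j.
Proof.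
have : el j p \in blk j by rewrite mem_nth// ltn_mod bs_gt0.
by rewrite mem_enum inE => /eqP.
Qed.

Lemma el_eq j p q : ((p %/ bs j == q %/ bs j)%N && (el j p == el j q)) = (p == q).
Proof.
apply/andP/eqP => [[/eqP pq]|->//].
rewrite nth_uniq ?enum_uniq ?ltn_mod ?bs_gt0// => /eqP h.
by rewrite (divn_eq p (bs j)) pq h -divn_eq.
Qed.

Lemma idx_div a i : (idx a i %/ bs (cl a))%N = i.
Proof.
have h : (index a (blk (cl a)) < bs (cl a))%N by rewrite index_mem mem_enum inE.
by rewrite /idx divnMDl ?bs_gt0// divn_small// addn0.
Qed.

Lemma el_idx a i : el (cl a) (idx a i) = a.
Proof.
have h : a \in blk (cl a) by rewrite mem_enum inE.
by rewrite /el /idx modnMDl modn_small ?index_mem// nth_index.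
Qed.

Definition sl j (h : CZ) : CY := mkf (fun y => cev (y, j : discrete_topology 'I_m) h).

Lemma slE j h y : cev y (sl j h) = cev (y, j : discrete_topology 'I_m) h.
Proof.
rewrite /sl mkfE// => {}y.
apply: (cvg_comp (fun y => (y, j : discrete_topology 'I_m))); last exact: cev_continuous.
move=> U [[P Q] /= [Py Qj] PQ]; rewrite nbhs_simpl/=; apply: filterS Py => y' Py'.
by apply: PQ; split => //=; exact: nbhs_singleton.
Qed.

Lemma glue_continuous (T : topologicalType) (h : Z -> T) :
  (forall j, continuous (fun y => h (y, j : discrete_topology 'I_m))) -> continuous h.
Proof.
move=> ch [y j] U hU; have /= h1 := ch j y U hU.
exists ([set y' | U (h (y', j))], [set j]); first by split.
by move=> [y' j'] /= [h2 ->].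
Qed.

Definition gl (h : 'I_m -> CY) : CZ := mkf (fun z : Z => cev z.1 (h z.2)).

Lemma glE h y j : cev (y, j : discrete_topology 'I_m) (gl h) = cev y (h j).
Proof.
rewrite /gl mkfE//; apply: glue_continuous => {}j /=; exact: cev_continuous.
Qed.

Opaque sl gl.

Lemma slZD j (k : R[i]) h h' : sl j (k *: h + h') = k *: sl j h + sl j h'.
Proof.
by apply: CfunP => y; rewrite slE cevD cevZ [in RHS]cevD cevZ [X in _ = _ + X](slE j h' y) [X in _ = _ *: X + _](slE j h y).
Qed.

Lemma slM j h h' : sl j (cmul h h') = cmul (sl j h) (sl j h').
Proof. by apply: CfunP => y; rewrite slE [in RHS]cevM [X in _ = cmul _ X](slE j h' y) [X in _ = cmul X _](slE j h y) cevM. Qed.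

Lemma sl_adj j h : sl j (cadj h) = cadj (sl j h).
Proof. by apply: CfunP => y; rewrite slE [in RHS]cev_adj [X in _ = cadj X](slE j h y) cev_adj. Qed.

Lemma sl_gl h j : sl j (gl h) = h j.
Proof. by apply: CfunP => y; rewrite slE glE. Qed.

Section System.
Context {K0 : cstarType R} {mx : nat -> nat -> D -> K0}.
Hypothesis sys : matrix_system mx.

(** The matrix unit over $C(Z)$: within block [j] it places the slice of [h] at the position that
    [p] and [q] encode there. *)
Definition fmx p q (h : CZ) : K0 :=
  \sum_j mx (p %/ bs j) (q %/ bs j) (u (el j p) (el j q) (sl j h)).

Lemma cu00 a b : cl a = cl b -> u a b 0 = 0.
Proof.
move=> ab; have := cu_linear sf fK gK (e := e) a b 1 0 0.
by rewrite !scale1r addr0 => /eqP; rewrite -subr_eq0 opprD addrA subrr add0r oppr_eq0 => /eqP.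
Qed.

Lemma fmx_linear p q : linear (fmx p q).
Proof.
move=> k h h'; rewrite /fmx scaler_sumr -big_split; apply: eq_bigr => j _ /=.
rewrite -(msZ sys) -(msD sys) -(cu_linear sf fK gK); congr (mx _ _ (cu _ _ _ _ _)).
exact: slZD.
Qed.

Lemma fmx_mul p q p' q' h h' : cmul (fmx p q h) (fmx p' q' h') =
  if q == p' then fmx p q' (cmul h h') else 0.
Proof.
rewrite /fmx cmul_suml.
have step j : cmul (mx (p %/ bs j) (q %/ bs j) (u (el j p) (el j q) (sl j h)))
    (\sum_j0 mx (p' %/ bs j0) (q' %/ bs j0) (u (el j0 p') (el j0 q') (sl j0 h'))) =
   if q == p' then mx (p %/ bs j) (q' %/ bs j) (u (el j p) (el j q') (sl j (cmul h h'))) else 0.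
  rewrite cmul_sumr (bigD1 j)//= [X in _ + X]big1 ?addr0; last first.
    move=> j' jj; rewrite (ms_mul sys); case: ifP => // _.
    rewrite (cu_mul sf fK gK mu) ?cl_el//; case: eqP => [h0|_]; last exact: (ms0 sys).
    by move: jj; rewrite -(cl_el j q) h0 cl_el eqxx.
  rewrite (ms_mul sys) (cu_mul sf fK gK mu) ?cl_el// -(el_eq j q p').
  case: eqP => //= _; case: eqP => //= _; last by rewrite (ms0 sys).
  congr (mx _ _ (cu _ _ _ _ _)); exact/esym/slM.
rewrite (eq_bigr _ (fun j _ => step j)); case: eqP => // _.
by rewrite big1.
Qed.

Lemma fmx_adj p q h : cadj (fmx p q h) = fmx q p (cadj h).
Proof.
rewrite /fmx cadj_sum; apply: eq_bigr => j _.
rewrite (ms_adj sys) (cu_adj sf fK gK mu) ?cl_el//.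
by rewrite sl_adj.
Qed.

Lemma fmx_gl p q j x : fmx p q (gl (fun j' => if j' == j then x else 0)) =
  mx (p %/ bs j) (q %/ bs j) (u (el j p) (el j q) x).
Proof.
rewrite /fmx (bigD1 j)//= [X in _ + X]big1 ?addr0; first by rewrite sl_gl eqxx.
by move=> j' jj; rewrite sl_gl (negPf jj) cu00 ?(ms0 sys)// !cl_el.
Qed.

Lemma fmx_cu i i' a b x : cl a = cl b ->
  mx i i' (u a b x) =
  fmx (idx a i) (idx b i') (gl (fun j' => if j' == cl a then x else 0)).
Proof. by move=> ab; rewrite fmx_gl idx_div el_idx ab idx_div el_idx. Qed.


Lemma fmx_system : matrix_system fmx.
Proof. by split; [exact: fmx_linear|exact: fmx_mul|exact: fmx_adj]. Qed.

End System.
Arguments fmx {K0} mx p q h.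

Variable K : stabilization D.
Let sys := mxu_system K.
Local Notation fm := (fmx (mxu K)).

Lemma mxu_cu i i' a b x : cl a = cl b -> mxu K i i' (u a b x) =
  fm (idx a i) (idx b i') (gl (fun j' => if j' == cl a then x else 0)).
Proof. exact: (fmx_cu sys). Qed.

(** Multiplying by the indicator of a block isolates one summand, and there [mxu] and [cu] are
    injective. *)
Lemma fmx_inj p q : injective (fm p q).
Proof.
move=> h h' hh.
have : fm p q (h - h') = 0.
  have := (fmx_linear sys) p q (-1) h' h; rewrite hh !scaleN1r => h0.
  by rewrite addrC h0 addNr.
move=> h0; apply/eqP; rewrite -subr_eq0; apply/eqP; move: (h - h') h0 => x h0.
have sx j : sl j x = 0.
  apply: (cu_inj sf gK mu (a := el j p) (b := el j q)); first by rewrite !cl_el.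
  apply: (@mxu_inj _ _ K (p %/ bs j)%N (q %/ bs j)%N); rewrite mxu0 -(fmx_gl sys).
  have -> : gl (fun j' => if j' == j then sl j x else 0) =
      cmul (gl (fun j' => if j' == j then cone else 0)) x.
    apply: CfunP => -[z j']; rewrite [LHS]glE [RHS]cevM [X in _ = cmul X _]glE.
    case: (eqVneq j' j) => [->|_]; first by rewrite slE cev1 cmul1l.
    by rewrite cev0 cmul0l.
  by have := fmx_mul sys p p p q (gl (fun j' => if j' == j then cone else 0)) x;
     rewrite eqxx h0 cmul0r => <-.
by apply: CfunP => -[y j]; rewrite -slE sx cev0.
Qed.

Lemma fmx_dense : closure [set s | exists n (a : nat -> nat -> CZ),
    s = \sum_(i < n) \sum_(j < n) fm i j (a i j)] = setT.
Proof.
have fD i j : {morph fm i j : x y / x + y}.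
  by move=> x y; have := fmx_linear sys i j 1 x y; rewrite !scale1r.
apply: denseP => s ep ep0; have [x [n [a ->]] sx] := fins_dense s ep0.
exists (\sum_(i < n) \sum_(j < n) mxu K i j (a i j)) => //.
apply: fins_sum => // i _; apply: fins_sum => // j _.
rewrite (cu_span sf fK gK mu (a i j)) mxu_sum; apply: fins_sum => // b _.
rewrite mxu_sum; apply: fins_sum => // c /eqP bc.
by rewrite mxu_cu//; exact: fins_mx.
Qed.

(** The algebra is still [K]; only its matrix units change. Cuntz comparison in [K] can thus be
    computed in a stabilization of the commutative $C(Z)$. *)
Definition flat : stabilization CZ :=
  Stabilization (fmx_linear sys) (fmx_mul sys) (fmx_adj sys) fmx_inj fmx_dense.

End Flatten.

Lemma max_continuous (R : realType) (T : topologicalType) (f g : T -> R) :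
  continuous f -> continuous g -> continuous (fun x => Num.max (f x) (g x)).
Proof. by move=> cf cg x; apply: continuous_max; [exact: cf|exact: cg]. Qed.

Lemma expr_small (R : realType) (c M e : R) : 0 <= c < 1 -> 0 < e -> 
  exists n, M * c ^+ n < e.
Proof.
move=> /andP[c0 c1] e0; have /cvgrPdist_lt cc : (fun n => c ^+ n : R) @ \oo --> (0 : R).
  by apply: cvg_expr; rewrite ger0_norm.
have d0 : 0 < e / (`|M| + 1) by rewrite divr_gt0// ltr_wpDl.
have [N _ /(_ N (leqnn N))] := cc _ d0; rewrite /= sub0r normrN ger0_norm ?exprn_ge0//.
rewrite ltr_pdivlMr ?ltr_wpDl// => h; exists N; apply: le_lt_trans h.
have := ler_norm M; have := exprn_ge0 N c0; nra.
Qed.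

Lemma invS_small (R : realType) (e : R) : 0 < e ->
  exists N, forall n, (N <= n)%N -> n.+1%:R^-1 < e.
Proof.
move=> e0; exists (Num.bound e^-1) => n Nn.
rewrite -[e]invrK ltf_pV2 ?posrE ?invr_gt0// ?ltr0n//.
apply: (@lt_le_trans _ _ (Num.bound e^-1)%:R).
  by rewrite archi_boundP// invr_ge0 ltW.
by rewrite ler_nat leqW.
Qed.

(** * Entries and pointwise ranks in a stabilization of $C(Z)$ *)

Section Entries.
Context {R : realType} {Z : topologicalType} {cZ : compact [set: Z]}.
Local Notation CZ := (Cfun cZ (Cplx R)).
Variable S : stabilization CZ.
Local Notation E := (mxu S).

Definition rcf (f : Z -> R) : CZ := mkf (fun z => (f z)%:C : Cplx R).

Lemma rcfE f z : continuous f -> cev z (rcf f) = (f z)%:C :> R[i].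
Proof. by move=> cf; rewrite /rcf mkfE//; exact: rtoc_continuous. Qed.

Lemma nrm_rcf_le f c : continuous f -> 0 <= c -> (forall z, `|f z| <= c) -> nrm (rcf f) <= c.
Proof.
move=> cf c0 fc; apply: nrm_Cfun_le => // z; rewrite rcfE// nrmC_E.
by rewrite normc_def/= expr0n addr0 sqrtr_sqr.
Qed.

Lemma cev_cstar z (f : CZ) : cev z (cmul (cadj f) f) = (nrm (cev z f) ^+ 2)%:C :> R[i].
Proof.
by rewrite cevM cev_adj cmulC_E cadjC_E mulrC -normCK nrmC_E rmorphXn.
Qed.

(* If [E q q] shrank [f], it would kill a bump function supported where |f| is large. *)
Lemma mxu_diag_isometry q f : nrm (E q q f) = nrm f.
Proof.
apply/eqP; rewrite eq_le nrm_mxu/= leNgt; apply/negP => lt.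
pose c1 := (nrm (E q q f) + nrm f) / 2.
have f0 := nrm_ge0 (E q q f).
have [z0 z0f] : exists z0, c1 < nrm (cev z0 f).
  apply: contrapT => /forallNP h; have : nrm f <= c1.
    by apply: nrm_Cfun_le => [|z]; [rewrite /c1; lra|rewrite leNgt; exact/negP/h].
  by rewrite /c1; lra.
pose h := cmul (cadj f) f; pose rho z := nrm (cev z f) ^+ 2; pose s := c1 ^+ 2.
have c10 : 0 < c1 by rewrite /c1; lra.
have s0 : 0 < s by rewrite exprn_gt0.
have crho : continuous rho.
  have cn : continuous (fun z => nrm (cev z f)) by apply/nrm_continuous/cev_continuous.
  by move=> z; rewrite /rho; under eq_fun do rewrite expr2; apply: cvgM; exact: cn.
have hE z : cev z h = (rho z)%:C :> R[i] by exact: cev_cstar.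
pose c := nrm (E q q f) ^+ 2.
have cs : c < s by rewrite ltr_pXn2r ?nnegrE ?(ltW c10)// /c1; lra.
have Eh : nrm (E q q h) = c.
  by rewrite /c -nrm_cstar mxu_adj mxu_mul eqxx.
pose g z := Num.max (rho z - s) 0.
have cg : continuous g.
  apply: max_continuous; last by move=> z; exact: cvg_cst.
  by move=> z; apply: cvgB; [exact: crho|exact: cvg_cst].
pose w z := s / Num.max (rho z) s.
have m0 z : 0 < Num.max (rho z) s by rewrite lt_max s0 orbT.
have cw : continuous w.
  move=> z; apply: cvgM; first exact: cvg_cst.
  apply: cvgV; first by rewrite gt_eqF.
  by apply: max_continuous => // y; exact: cvg_cst.
have w01 z : 0 <= w z <= 1.
  by rewrite /w divr_ge0 ?(ltW s0) ?(ltW (m0 z))//= ler_pdivrMr// mul1r le_max lexx orbT.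
(* On the support of [g] one has $w=s/\rho$, so $h^nk_n=s^ng$. As [E q q h] has norm [c < s], the
   norm of [E q q (rcf g)] is at most $(c/s)^nM$ for every [n]. *)
pose k n z := g z * w z ^+ n.
have ck n : continuous (k n).
  elim: n => [|n IH] z.
    by rewrite /k; under eq_fun do rewrite expr0 mulr1; exact: cg.
  rewrite /k; under eq_fun do rewrite exprSr mulrA.
  by apply: cvgM; [exact: IH|exact: cw].
have key n : iter n (cmul h) (rcf (k n)) = (s ^+ n)%:C *: rcf g.
  apply: CfunP => z; rewrite cevZ rcfE//.
  have -> : forall x, cev z (iter n (cmul h) x) = (rho z ^+ n)%:C * (cev z x : R[i]) :> R[i].
    elim: {+}n => [|m IH] x /=; first by rewrite expr0 mul1r.
    rewrite cevM cmulC_E IH hE exprS.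
    rewrite [in RHS]rmorphM /=.
    by rewrite mulrA.
  rewrite rcfE// -rmorphM; transitivity ((s ^+ n * g z)%:C : R[i]); last by rewrite rmorphM.
  congr (_%:C); rewrite /k mulrCA -exprMn mulrC; have [gz|] := lerP (rho z) s.
    by rewrite /g (max_r (x := _ - _)) ?subr_le0// !mulr0.
  by move=> /ltW gz; rewrite /w max_l// mulrCA mulfV ?mulr1// gt_eqF// (lt_le_trans s0).
pose M := nrm (rcf g).
have kM n : nrm (rcf (k n)) <= M.
  apply: nrm_rcf_le; [exact: ck|exact: nrm_ge0|move=> z].
  have g0 : 0 <= g z by rewrite le_max lexx orbT.
  apply: (@le_trans _ _ (g z)).
    rewrite ger0_norm ?mulr_ge0 ?exprn_ge0//; last by have /andP[] := w01 z.
    by rewrite ler_piMr// exprn_ile1//; have /andP[] := w01 z.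
  rewrite (le_trans _ (nrm_cev z _))// nrmC_E rcfE//.
  by rewrite normc_def/= expr0n addr0 sqrtr_sqr ger0_norm.
have EM n x : nrm (E q q (iter n (cmul h) x)) <= c ^+ n * nrm x.
  elim: n => [|n IH] /=; first by rewrite expr0 mul1r nrm_mxu.
  have := mxu_mul S q q q q h (iter n (cmul h) x); rewrite eqxx => <-.
  by rewrite (le_trans (nrmM _ _))// Eh exprS -mulrA ler_wpM2l// exprn_ge0.
have Eg : E q q (rcf g) = 0.
  apply: nrm_small => ep ep0.
  have cs1 : 0 <= c / s < 1.
    apply/andP; split; last by rewrite ltr_pdivrMr// mul1r.
    by apply: divr_ge0; [exact: sqr_ge0|exact: ltW].
  have [n nep] := expr_small M cs1 ep0; apply: le_lt_trans nep.
  have := EM n (rcf (k n)); rewrite key mxuZ nrmZ.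
  have sn0 : 0 <= s ^+ n by rewrite exprn_ge0// ltW.
  rewrite ger0_norm ?ler0c//= => h1.
  rewrite expr_div_n mulrA ler_pdivlMr ?exprn_gt0// mulrC (le_trans h1)// mulrC.
  have c0n : 0 <= c ^+ n by apply/exprn_ge0/sqr_ge0.
  exact: ler_wpM2r c0n _ _ (kM n).
have := mxu_inj (etrans Eg (esym (mxu0 S q q))) => g0.
have := congr1 (cev z0) g0; rewrite rcfE// cev0 => /(congr1 (@complex.Re R))/=.
have : s < rho z0 by rewrite ltr_pXn2r ?nnegrE ?nrm_ge0 ?(ltW c10).
rewrite /g => lts; rewrite max_l ?subr_ge0 ?ltW// => /eqP.
by rewrite subr_eq0 gt_eqF.
Qed.

Lemma mxu_isometry p q f : nrm (E p q f) = nrm f.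
Proof.
apply/eqP; rewrite -(eqrXn2 (n := 2)) ?nrm_ge0// -!nrm_cstar mxu_adj mxu_mul eqxx.
by rewrite mxu_diag_isometry.
Qed.

Let one : CZ := cone.

Lemma cadj_cone : cadj (cone : CZ) = cone.
Proof. by rewrite -[LHS]cmul1r -[RHS]cadjK -[in RHS](cmul1r (cadj cone)) cadjM cadjK. Qed.

Lemma nrm_Eone p q : nrm (E p q one) <= 1.
Proof.
apply: (le_trans (nrm_mxu _ _ _ _)); apply: nrm_Cfun_le => // z.
by rewrite cev1 nrmC_E normr1.
Qed.

Lemma corner_fins p q n (a : nat -> nat -> CZ) :
  cmul (cmul (E p p one) (\sum_(i < n) \sum_(j < n) E i j (a i j))) (E q q one) =
  E p q (if ((p < n) && (q < n))%N then a p q else 0).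
Proof.
rewrite cmul_sumr cmul_suml.
under eq_bigr => i _ do rewrite cmul_sumr cmul_suml.
have step (i j : 'I_n) : cmul (cmul (E p p one) (E i j (a i j))) (E q q one) =
    if (p == i) && (j == q :> nat) then E p q (a p q) else 0.
  rewrite mxu_mul; case: eqP => [->|_]/=; last by rewrite cmul0l.
  by rewrite mxu_mul cmul1l cmul1r; case: eqP => [->|].
under eq_bigr do under eq_bigr do rewrite step.
case: ltnP => [pn|pn] /=; last first.
  rewrite mxu0 big1// => i _; rewrite big1// => j _.
  by rewrite gtn_eqF// (leq_trans (ltn_ord i)).
case: ltnP => [qn|qn] /=; last first.
  rewrite mxu0 big1// => i _; rewrite big1// => j _.
  by rewrite [nat_of_ord j == q]ltn_eqF ?andbF// (leq_trans (ltn_ord j)).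
rewrite (bigD1 (Ordinal pn))//= (bigD1 (Ordinal qn))//= !eqxx/=.
rewrite big1 ?addr0 => [|j jq]; last first.
  by rewrite (_ : nat_of_ord j == q = false)//; apply: contraNF jq => /eqP h; apply/eqP/val_inj.
rewrite big1 ?addr0// => i ip; rewrite big1// => j _.
by rewrite (_ : p == nat_of_ord i = false)//; apply: contraNF ip => /eqP h; apply/eqP/val_inj.
Qed.

Lemma nrm_corner p q x : nrm (cmul (cmul (E p p one) x) (E q q one)) <= nrm x.
Proof.
have h1 := nrm_Eone p p; have h2 := nrm_Eone q q.
have h3 := nrmM (cmul (E p p one) x) (E q q one); have h4 := nrmM (E p p one) x.
have := nrm_ge0 x; have := nrm_ge0 (cmul (E p p one) x).
have := nrm_ge0 (E q q one); have := nrm_ge0 (E p p one); nra.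
Qed.

(** Clear for finitely supported matrices; the isometry of [E p q] turns an approximating sequence
    of these into a Cauchy sequence of entries. *)
Lemma corner_ex a p q : exists f, cmul (cmul (E p p one) a) (E q q one) = E p q f.
Proof.
have h n : exists xf : S * CZ, nrm (a - xf.1) < n.+1%:R^-1 /\
    cmul (cmul (E p p one) xf.1) (E q q one) = E p q xf.2.
  have n0 : 0 < (n.+1%:R^-1 : R) by rewrite invr_gt0.
  have [_ [N [b ->]] ax] := fins_dense a n0.
  by eexists (_, _); split; [exact: ax|exact: corner_fins].
have [xf xfP] := choice h.
have xa : ccvg (fun n => (xf n).1) a.
  move=> ep ep0; have [N HN] := invS_small ep0.
  exists N => n /HN ne; rewrite nrm_distC.
  exact: lt_trans (xfP n).1 ne.
have cf : ccauchy (fun n => (xf n).2).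
  move=> ep ep0; have ep2 : 0 < ep / 2 by lra.
  have [N HN] := xa _ ep2; exists N => n Nn.
  rewrite -(mxu_isometry p q) mxuB -(xfP n).2 -(xfP N).2 -cmulBl -cmulBr.
  apply: (le_lt_trans (nrm_corner _ _ _)).
  have := HN n Nn; have := HN N (leqnn N); have := nrm_dist (xf n).1 a (xf N).1.
  by rewrite (nrm_distC a); lra.
have [f ff] := ccauchy_cvg cf; exists f.
have c1 : ccvg (fun n => cmul (cmul (E p p one) (xf n).1) (E q q one))
   (cmul (cmul (E p p one) a) (E q q one)).
  by apply: ccvgM; [apply: ccvgM => //|]; exact: ccvg_cst.
apply: (ccvg_unique c1) => ep /ff[N HN]; exists N => n /HN.
by rewrite (xfP n).2 -mxuB mxu_isometry.
Qed.

Definition ent a p q : CZ :=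
  xget 0 [set f | cmul (cmul (E p p one) a) (E q q one) = E p q f].

Lemma entE a p q : cmul (cmul (E p p one) a) (E q q one) = E p q (ent a p q).
Proof.
rewrite /ent; case: xgetP => [f _ //|h].
by have [f /h] := corner_ex a p q.
Qed.

Lemma ent_uniq a p q f : cmul (cmul (E p p one) a) (E q q one) = E p q f -> ent a p q = f.
Proof. by rewrite entE => /mxu_inj. Qed.

Lemma entD a b p q : ent (a + b) p q = ent a p q + ent b p q.
Proof. by apply: ent_uniq; rewrite cmulDr cmulDl !entE mxuD. Qed.

Lemma entB a b p q : ent (a - b) p q = ent a p q - ent b p q.
Proof. by apply: ent_uniq; rewrite cmulBr cmulBl !entE mxuB. Qed.

Lemma entZ (k : R[i]) a p q : ent (k *: a) p q = k *: ent a p q.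
Proof. by apply: ent_uniq; rewrite cmulZr cmulZl !entE mxuZ. Qed.

Lemma ent0 p q : ent 0 p q = 0.
Proof. by apply: ent_uniq; rewrite cmul0r cmul0l mxu0. Qed.

Lemma ent_sum (I : Type) (r : seq I) (P : pred I) (f : I -> S) p q :
  ent (\sum_(i <- r | P i) f i) p q = \sum_(i <- r | P i) ent (f i) p q.
Proof. by apply: (big_morph (fun a => ent a p q)) => [x y|]; [exact: entD|exact: ent0]. Qed.

Lemma ent_adj a p q : ent (cadj a) p q = cadj (ent a q p).
Proof.
apply: ent_uniq; rewrite -mxu_adj -entE !cadjM !mxu_adj /one cadj_cone.
by rewrite cmulA.
Qed.

Lemma nrm_ent a p q : nrm (ent a p q) <= nrm a.
Proof. by rewrite -(mxu_isometry p q) -entE nrm_corner. Qed.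

Lemma ent_mxu i j f p q : ent (E i j f) p q = if (p == i) && (j == q) then f else 0.
Proof.
apply: ent_uniq; rewrite mxu_mul; case: eqP => [->|_]; last by rewrite cmul0l mxu0.
by rewrite mxu_mul cmul1l cmul1r; case: eqP => //=; rewrite mxu0.
Qed.

Definition Pn n : S := \sum_(i < n) E i i one.

Lemma Pn_mxu n i j f : cmul (Pn n) (E i j f) = if (i < n)%N then E i j f else 0.
Proof.
rewrite /Pn cmul_suml; case: ltnP => ni; last first.
  by rewrite big1// => k _; rewrite mxu_mul ltn_eqF// (leq_trans (ltn_ord k)).
rewrite (bigD1 (Ordinal ni))//= mxu_mul eqxx cmul1l big1 ?addr0// => k ki.
rewrite mxu_mul (_ : nat_of_ord k == i = false)//.
by apply: contraNF ki => /eqP h; apply/eqP/val_inj.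
Qed.

Lemma Pn_adj n : cadj (Pn n) = Pn n.
Proof. by rewrite cadj_sum; apply: eq_bigr => i _; rewrite mxu_adj /one cadj_cone. Qed.

Lemma mxu_Pn n i j f : cmul (E i j f) (Pn n) = if (j < n)%N then E i j f else 0.
Proof.
rewrite -[LHS]cadjK cadjM Pn_adj mxu_adj Pn_mxu; case: ifP; rewrite ?cadj0//.
by rewrite mxu_adj cadjK.
Qed.

Lemma PnPn n : cmul (Pn n) (Pn n) = Pn n.
Proof.
by rewrite {2}/Pn cmul_sumr; apply: eq_bigr => i _; rewrite Pn_mxu ltn_ord.
Qed.

Lemma proj_nrm_le1 (p : S) : is_proj p -> nrm p <= 1.
Proof.
move=> [pa pp]; have : nrm p ^+ 2 = nrm p by rewrite -nrm_cstar pa pp.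
have := nrm_ge0 p; rewrite expr2; move: (nrm p) => x x0 h {pa pp}.
by rewrite leNgt; apply/negP => p1; nra.
Qed.

Lemma nrm_Pn n : nrm (Pn n) <= 1.
Proof. by apply: proj_nrm_le1; split; [exact: Pn_adj|exact: PnPn]. Qed.

Definition cutn n a := cmul (cmul (Pn n) a) (Pn n).

Lemma cutnE n a : cutn n a = \sum_(i < n) \sum_(j < n) E i j (ent a i j).
Proof.
rewrite /cutn {1}/Pn !cmul_suml; apply: eq_bigr => i _.
by rewrite cmul_sumr; apply: eq_bigr => j _; rewrite entE.
Qed.

Lemma nrm_cutn n a : nrm (cutn n a) <= nrm a.
Proof.
have h1 := nrm_Pn n; have h3 := nrmM (cmul (Pn n) a) (Pn n).
have h4 := nrmM (Pn n) a; have := nrm_ge0 a; have := nrm_ge0 (cmul (Pn n) a).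
have := nrm_ge0 (Pn n); rewrite /cutn; nra.
Qed.

Lemma cutn_cvg a : ccvg (fun n => cutn n a) a.
Proof.
move=> ep ep0; have ep2 : 0 < ep / 2 by lra.
have [x [N [b xb]] ax] := fins_dense a ep2; exists N => n Nn.
have xn : cutn n x = x.
  rewrite xb /cutn [cmul (Pn n) _]cmul_sumr [LHS]cmul_suml; apply: eq_bigr => i _.
  rewrite [cmul (Pn n) _]cmul_sumr [LHS]cmul_suml; apply: eq_bigr => j _.
  by rewrite Pn_mxu (leq_trans (ltn_ord i))// mxu_Pn (leq_trans (ltn_ord j)).
have : nrm (cutn n a - x) <= nrm (a - x).
  by rewrite -{1}xn /cutn -cmulBl -cmulBr; exact: nrm_cutn.
by have := nrm_dist (cutn n a) x a; rewrite (nrm_distC x); lra.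
Qed.

Lemma ent_PnM n a b p q : ent (cmul a (cmul (Pn n) b)) p q =
  \sum_(k < n) cmul (ent a p k) (ent b k q).
Proof.
apply: ent_uniq; rewrite mxu_sum /Pn cmul_suml cmul_sumr cmul_sumr cmul_suml.
apply: eq_bigr => k _.
have := mxu_mul S p k k q (ent a p k) (ent b k q); rewrite eqxx => <-.
rewrite -!entE -!cmulA; congr cmul; congr cmul.
by rewrite (cmulA (E k k one) (E k k one)) mxu_mul eqxx cmul1l.
Qed.

Lemma ent_mulE i j f a p q : ent (cmul (E i j f) a) p q =
  if p == i then cmul f (ent a j q) else 0.
Proof.
apply: ent_uniq; rewrite cmulA mxu_mul cmul1l; case: eqP => [->|_]; last first.
  by rewrite !cmul0l mxu0.
have -> : E i j f = cmul (E i j f) (E j j one) by rewrite mxu_mul eqxx cmul1r.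
by rewrite -cmulA -cmulA (cmulA _ a) entE mxu_mul eqxx.
Qed.

Lemma ent_mulEr i j f a p q : ent (cmul a (E i j f)) p q =
  if j == q then cmul (ent a p i) f else 0.
Proof.
have -> : cmul a (E i j f) = cadj (cmul (E j i (cadj f)) (cadj a)).
  by rewrite cadjM cadjK mxu_adj cadjK.
rewrite ent_adj ent_mulE eq_sym; case: eqP; rewrite ?cadj0//.
by rewrite cadjM cadjK ent_adj cadjK.
Qed.

End Entries.

Section MatrixLemmas.
Context {R : realType}.

(** If [w] were a kernel vector and [w 0 i0] its largest coordinate, the equation at [i0] would
    bound the modulus of that coordinate by the fraction $k/(k+1)$ of itself. *)
Lemma near_id_unit k (M : 'M[R[i]]_k) :
  (forall i j, complex.Re `|M i j - (i == j)%:R| < k.+1%:R^-1) -> M \in unitmx.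
Proof.
move=> h; rewrite -row_full_unit -[row_full _]negbK; apply/negP => nf.
have : kermx M^T != 0.
  by rewrite kermx_eq0 row_free_unit unitmx_tr -row_full_unit.
move=> /rowV0Pn[w /sub_kermxP wM w0].
case: k M h nf w wM w0 => [|k] M h nf w wM w0.
  by move/eqP: w0; apply; apply/rowP => -[].
pose f i := complex.Re `|w 0 i|.
have [i0 _ i0max] := @arg_maxP _ _ 'I_k.+1 ord0 xpredT f isT.
have i0m j : f j <= f i0 by exact: i0max.
have f0 i : 0 <= f i by rewrite /f -ler0c RRe_real// ger0_real.
have fi0 : 0 < f i0.
  rewrite lt_neqAle f0 andbT; apply: contraNneq w0 => h0.
  apply/eqP/rowP => i; rewrite mxE; apply/normr0_eq0.
  have := i0m i; rewrite -h0 => fi.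
  have : f i = 0 by apply/eqP; rewrite eq_le f0 andbT.
  by rewrite /f => fi0; rewrite -[LHS]RRe_real ?ger0_real// fi0.
have : w 0 i0 = - \sum_j w 0 j * (M i0 j - (i0 == j)%:R).
  move/rowP: wM => /(_ i0); rewrite !mxE => wM.
  under eq_bigr do rewrite mulrBr.
  rewrite sumrB.
  rewrite (_ : \sum_j w 0 j * M i0 j = 0); last by rewrite -[RHS]wM; apply: eq_bigr => j _; rewrite mxE.
  rewrite sub0r opprK (bigD1 i0)//= eqxx mulr1 big1 ?addr0// => j ji.
  by rewrite eq_sym (negPf ji) mulr0.
move/(congr1 (fun z => `|z|)); rewrite normrN => /(congr1 (@complex.Re R)).
rewrite -/(f i0) => fE.
have : f i0 <= \sum_(j < k.+1) f i0 * k.+2%:R^-1.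
  rewrite {1}fE -lecR RRe_real ?ger0_real//.
  apply: (le_trans (ler_norm_sum _ _ _)); rewrite rmorph_sum/=.
  apply: ler_sum => j _; rewrite normrM rmorphM/=.
  apply: ler_pM => //.
    by have := i0m j; rewrite -lecR {1}/f RRe_real ?ger0_real.
  by have := ltW (h i0 j); rewrite -lecR RRe_real ?ger0_real.
rewrite sumr_const card_ord -[leRHS]mulr_natl mulrCA -[leLHS]mulr1 ler_pM2l//.
by rewrite ler_pdivlMr ?ltr0n// mul1r ler_nat ltnn.
Qed.

Lemma rank_le_factor m n (A : 'M[R[i]]_(m, n)) k : (k <= \rank A)%N ->
  exists (P : 'M_(k, m)) (Q : 'M_(n, k)), P *m A *m Q = 1%:M.
Proof.
move=> kr; exists (pid_mx k *m invmx (col_ebase A)), (invmx (row_ebase A) *m pid_mx k).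
rewrite -{2}(mulmx_ebase A) !mulmxA mulmxKV ?col_ebase_unit//.
rewrite -!mulmxA (mulmxA (row_ebase A)) mulmxV ?row_ebase_unit// mul1mx.
have km : (k <= m)%N by rewrite (leq_trans kr)// rank_leq_row.
have kn : (k <= n)%N by rewrite (leq_trans kr)// rank_leq_col.
rewrite !mul_pid_mx (_ : minn _ _ = k) ?pid_mx_1//; lia.
Qed.

Lemma finite_gap (I : finType) (f : I -> R) (c : R) : (forall i, f i < c) ->
  exists2 d, 0 < d & forall i, f i + d <= c.
Proof.
move=> h; case: (pickP (@predT I)) => [i0 _|I0]; last by exists 1 => // i; have := I0 i.
have [i _ im] := @arg_maxP _ _ I i0 xpredT f isT.
exists (c - f i); first by rewrite subr_gt0.
by move=> j; rewrite addrCA gerDl subr_le0; exact: im.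
Qed.

End MatrixLemmas.

Section Rank.
Context {R : realType} {Z : topologicalType} {cZ : compact [set: Z]}.
Local Notation CZ := (Cfun cZ (Cplx R)).
Variable S : stabilization CZ.
Local Notation E := (mxu S).
Implicit Types a b : S.

Definition mt m n a z : 'M[R[i]]_(m, n) := \matrix_(i, j) (cev z (ent a i j) : R[i]).

Lemma mtD m n a b z : mt m n (a + b) z = mt m n a z + mt m n b z.
Proof. by apply/matrixP => i j; rewrite !mxE entD cevD. Qed.

Lemma mtB m n a b z : mt m n (a - b) z = mt m n a z - mt m n b z.
Proof. by apply/matrixP => i j; rewrite !mxE entB cevB. Qed.

Lemma mt_PnM m k n a b z : mt m n (cmul a (cmul (Pn S k) b)) z = mt m k a z *m mt k n b z.
Proof.
apply/matrixP => i j; rewrite !mxE ent_PnM cev_sum; apply: eq_bigr => l _.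
by rewrite cevM !mxE.
Qed.

Lemma mt_le m n a z i j : complex.Re `|mt m n a z i j| <= nrm a.
Proof.
by rewrite mxE -nrmC_E (le_trans (nrm_cev _ _))// nrm_ent.
Qed.

Definition cstf (c : R[i]) : CZ := mkf (fun=> c : Cplx R).

Lemma cstfE c z : cev z (cstf c) = c :> R[i].
Proof. by rewrite /cstf mkfE//; exact: cst_continuous. Qed.

Definition kel m n (M : 'M[R[i]]_(m, n)) : S :=
  \sum_(i < m) \sum_(j < n) E i j (cstf (M i j)).

Lemma kel_mt m k n (M : 'M_(m, k)) b z : mt m n (cmul (kel M) b) z = M *m mt k n b z.
Proof.
apply/matrixP => i j; rewrite !mxE /kel cmul_suml ent_sum cev_sum (bigD1 i)//=.
rewrite [X in _ + X]big1 ?addr0 => [|i' ii]; last first.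
  rewrite cmul_suml ent_sum cev_sum big1// => l _; rewrite ent_mulE.
  rewrite (_ : nat_of_ord i == i' = false) ?cev0//.
  by apply: contraNF ii => /eqP h; apply/eqP/val_inj.
rewrite cmul_suml ent_sum cev_sum; apply: eq_bigr => l _.
by rewrite ent_mulE eqxx cevM cmulC_E cstfE mxE.
Qed.

Lemma mt_kel m k n (M : 'M_(k, n)) b z : mt m n (cmul b (kel M)) z = mt m k b z *m M.
Proof.
apply/matrixP => i j; rewrite !mxE /kel cmul_sumr ent_sum cev_sum; apply: eq_bigr => l _.
rewrite cmul_sumr ent_sum cev_sum (bigD1 j)//= [X in _ + X]big1 ?addr0 => [|j' jj].
  by rewrite ent_mulEr eqxx cevM cmulC_E cstfE mxE.
rewrite ent_mulEr (_ : nat_of_ord j' == j = false) ?cev0//.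
by apply: contraNF jj => /eqP h; apply/eqP/val_inj.
Qed.

(* At [z], some [p * b * q] has an upper left [k x k] corner close to the identity:
   the rank of [b] at [z] is at least [k]. *)
Definition rk b z k := exists p q, forall i j : 'I_k,
  complex.Re `|mt k k (cmul (cmul p b) q) z i j - (i == j)%:R| < k.+1%:R^-1.

Lemma Re_normD (x y : R[i]) : complex.Re `|x + y| <= complex.Re `|x| + complex.Re `|y|.
Proof.
exact: le_normcD.
Qed.

Lemma rk_stable b z k p q : (forall i j : 'I_k,
    complex.Re `|mt k k (cmul (cmul p b) q) z i j - (i == j)%:R| < k.+1%:R^-1) ->
  exists2 d : R, 0 < d & forall x, nrm (x - cmul (cmul p b) q) < d ->
  forall i j : 'I_k, complex.Re `|mt k k x z i j - (i == j)%:R| < k.+1%:R^-1.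
Proof.
move=> h; have [|d d0 hd] := @finite_gap _ ('I_k * 'I_k)%type (fun ij =>
   complex.Re `|mt k k (cmul (cmul p b) q) z ij.1 ij.2 - (ij.1 == ij.2)%:R|) k.+1%:R^-1.
  by move=> [i j]; exact: h.
exists d => // x xd i j; apply: lt_le_trans (hd (i, j)) => /=.
rewrite -[mt k k x z i j](subrK (mt k k (cmul (cmul p b) q) z i j)) -addrA.
apply: (le_lt_trans (Re_normD _ _)); rewrite [ltLHS]addrC ltrD2l.
apply: le_lt_trans xd; have := mt_le (x - cmul (cmul p b) q) z i j.
by rewrite mtB !mxE.
Qed.

Lemma nrm_sandwich (p q x : S) (d : R) : nrm x < d / ((nrm p + 1) * (nrm q + 1)) ->
  nrm (cmul (cmul p x) q) < d.
Proof.
have p0 := nrm_ge0 p; have q0 := nrm_ge0 q; have x0 := nrm_ge0 x.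
have pq : 0 < (nrm p + 1) * (nrm q + 1) by apply: mulr_gt0; lra.
rewrite ltr_pdivlMr// => h; have h1 := nrmM (cmul p x) q; have h2 := nrmM p x.
apply: le_lt_trans h; apply: (le_trans h1).
apply: (@le_trans _ _ (nrm p * nrm x * nrm q)); first by apply: ler_wpM2r.
have : 0 <= nrm p * nrm x by apply: mulr_ge0.
have : 0 <= nrm x * nrm q by apply: mulr_ge0.
have : 0 <= nrm x * nrm p by apply: mulr_ge0.
nra.
Qed.

Lemma sandwich_gt0 (p q : S) (d : R) : 0 < d -> 0 < d / ((nrm p + 1) * (nrm q + 1)).
Proof. by move=> d0; rewrite divr_gt0// mulr_gt0// ltr_wpDl// nrm_ge0. Qed.

(** The approximate form of [rk] passes to limits and through Cuntz comparison; ranks of truncations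
    are what linear algebra computes. Elimination by constant matrices gives one direction. For the
    other, a block near the identity that factors through a truncation is invertible. *)
Lemma rk_rank b z k : rk b z k <-> exists n, (k <= \rank (mt n n b z))%N.
Proof.
split=> [[p [q h]]|[n kr]].
  have [d d0 hd] := rk_stable h.
  have [n /(_ n (leqnn n)) nb] := cutn_cvg b (sandwich_gt0 p q d0).
  exists n; have /hd/near_id_unit : nrm (cmul (cmul p (cutn n b)) q - cmul (cmul p b) q) < d.
    by rewrite -cmulBl -cmulBr; exact: nrm_sandwich.
  rewrite /cutn -!cmulA !mt_PnM.
  move=> /mxrank_unit rk1; rewrite -[X in (X <= _)%N]rk1.
  by rewrite (leq_trans (mxrankM_maxr _ _))// mxrankM_maxl.
have [P [Q PQ]] := rank_le_factor kr; exists (kel P), (kel Q) => i j.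
rewrite mt_kel kel_mt PQ mxE subrr normr0 invr_gt0 ltr0n//.
Qed.

Lemma rk_leq b z k l : (l <= k)%N -> rk b z k -> rk b z l.
Proof. by move=> lk /rk_rank[n h]; apply/rk_rank; exists n; exact: leq_trans h. Qed.

Lemma rk0 b z : rk b z 0.
Proof. by apply/rk_rank; exists 0%N. Qed.

Lemma cuntz_leP (K : cstarType R) (x y : K) : cuntz_le x y <->
  forall e : R, 0 < e -> exists r, nrm (cmul (cmul r y) (cadj r) - x) < e.
Proof.
split=> [[r /cvgrPdist_lt h] e e0|h].
  have ec : (0 : R[i]) < e%:C by rewrite ltcR.
  have [N _ /(_ N (leqnn N))] := h _ ec; rewrite /= nrmE ltcR nrm_distC.
  by exists (r N).
have hn n : exists r, nrm (cmul (cmul r y) (cadj r) - x) < n.+1%:R^-1.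
  by apply: h; rewrite invr_gt0.
have [r rP] := choice hn; exists r; apply/cvgrPdist_lt => e e0.
have ee : e = (complex.Re e)%:C by rewrite RRe_real// gtr0_real.
have e1 : 0 < complex.Re e by rewrite -ltcR -ee.
have [N HN] := invS_small e1; exists N => // n /HN ne.
by rewrite /= nrmE ee ltcR nrm_distC; exact: lt_trans (rP n) ne.
Qed.

Lemma rk_cuntz a b z k : cuntz_le a b -> rk a z k -> rk b z k.
Proof.
move=> /cuntz_leP ab [p [q h]]; have [d d0 hd] := rk_stable h.
have [r hr] := ab _ (sandwich_gt0 p q d0).
exists (cmul p r), (cmul (cadj r) q) => i j; apply: hd.
rewrite (_ : cmul (cmul (cmul p r) b) (cmul (cadj r) q) =
  cmul (cmul p (cmul (cmul r b) (cadj r))) q); last by rewrite !cmulA.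
by rewrite -cmulBl -cmulBr; exact: nrm_sandwich.
Qed.

Lemma rk_cvg u b z k : ccvg u b -> rk b z k -> exists N, forall n, (N <= n)%N -> rk (u n) z k.
Proof.
move=> ub [p [q h]]; have [d d0 hd] := rk_stable h.
have [N HN] := ub _ (sandwich_gt0 p q d0); exists N => n /HN hn.
exists p, q => i j; apply: hd; rewrite -cmulBl -cmulBr; exact: nrm_sandwich.
Qed.

Lemma rk_open b z k : rk b z k -> \forall z' \near z, rk b z' k.
Proof.
move=> [p [q h]]; set x := cmul (cmul p b) q in h.
have : forall ij : 'I_k * 'I_k, \forall z' \near z,
    complex.Re `|mt k k x z' ij.1 ij.2 - (ij.1 == ij.2)%:R| < k.+1%:R^-1.
  move=> [i j] /=; pose f z' : Cplx R := (cev z' (ent x i j) : R[i]) - (i == j)%:R.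
  have fE z' : nrm (f z') = complex.Re `|mt k k x z' i j - (i == j)%:R| by rewrite mxE.
  have cf : continuous (fun z' => nrm (f z')).
    apply: nrm_continuous => z'; rewrite /f.
    by apply: cvgB; [exact: cev_continuous|exact: cvg_cst].
  have lt : nrm (f z) < k.+1%:R^-1 by rewrite fE. have := cf z; move/cvgrPdist_lt.
  move=> /(_ (k.+1%:R^-1 - nrm (f z))); rewrite subr_gt0 => /(_ lt).
  apply: filterS => z'; rewrite ltr_norml => /andP[h1 _].
  have : nrm (f z') < k.+1%:R^-1.
    by move: h1; move: (nrm (f z)) (nrm (f z')) (k.+1%:R^-1) => u v w; lra.
  by rewrite fE.
move=> hh; have : \forall z' \near z, forall ij : 'I_k * 'I_k,
    complex.Re `|mt k k x z' ij.1 ij.2 - (ij.1 == ij.2)%:R| < k.+1%:R^-1.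
  by apply: filter_forall.
by apply: filterS => z' hz'; exists p, q => i j; exact: (hz' (i, j)).
Qed.

Lemma rk_add a b z m : rk (a + b) z m -> exists k l, [/\ (k + l)%N = m, rk a z k & rk b z l].
Proof.
move=> /rk_rank[n]; rewrite mtD => h.
have := leq_trans h (mxrank_add _ _).
set ra := \rank (mt n n a z); set rb := \rank (mt n n b z) => h1.
exists (minn m ra), (m - minn m ra)%N; split.
- by rewrite subnKC// geq_minl.
- by apply/rk_rank; exists n; exact: geq_minr.
- by apply/rk_rank; exists n; rewrite leq_subLR -/rb; lia.
Qed.

End Rank.

(** * Approximate diagonalisation *)

Section Forms.
Context {R : realType} {N : nat}.
Local Notation C := R[i].
Implicit Types (A B T : 'M[C]_N) (u v w : 'cV[C]_N).

Definition adjm m n (A : 'M[C]_(m, n)) : 'M[C]_(n, m) := (map_mx Num.conj A)^T.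

Lemma adjmE m n (A : 'M[C]_(m, n)) i j : adjm A i j = (A j i)^*%R.
Proof. by rewrite !mxE. Qed.

Lemma adjmD m n (A B : 'M[C]_(m, n)) : adjm (A + B) = adjm A + adjm B.
Proof. by apply/matrixP => i j; rewrite !mxE rmorphD. Qed.

Lemma adjmN m n (A : 'M[C]_(m, n)) : adjm (- A) = - adjm A.
Proof. by apply/matrixP => i j; rewrite !mxE rmorphN. Qed.

Lemma adjmZ m n (k : C) (A : 'M[C]_(m, n)) : adjm (k *: A) = k^*%R *: adjm A.
Proof. by apply/matrixP => i j; rewrite !mxE rmorphM. Qed.

Lemma adjmM m n p (A : 'M[C]_(m, n)) (B : 'M[C]_(n, p)) :
  adjm (A *m B) = adjm B *m adjm A.
Proof. by rewrite /adjm map_mxM trmx_mul. Qed.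

Lemma adjmK m n (A : 'M[C]_(m, n)) : adjm (adjm A) = A.
Proof. by apply/matrixP => i j; rewrite !mxE conjCK. Qed.

Lemma adjm1 n : adjm (1%:M : 'M[C]_n) = 1%:M.
Proof. by apply/matrixP => i j; rewrite !mxE eq_sym rmorph_nat. Qed.

Lemma adjm_sum m n I (r : seq I) (P : pred I) (F : I -> 'M[C]_(m, n)) :
  adjm (\sum_(i <- r | P i) F i) = \sum_(i <- r | P i) adjm (F i).
Proof.
apply: (big_morph (@adjm m n)) => [x y|]; first exact: adjmD.
by apply/matrixP => i j; rewrite !mxE rmorph0.
Qed.

Definition sf T u v : C := (adjm u *m T *m v) 0 0.
Definition qf T v : R := complex.Re (sf T v v).
Definition n2 v : R := qf 1%:M v.

Lemma sfDl T u u' v : sf T (u + u') v = sf T u v + sf T u' v.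
Proof. by rewrite /sf adjmD !mulmxDl mxE. Qed.
Lemma sfDr T u v v' : sf T u (v + v') = sf T u v + sf T u v'.
Proof. by rewrite /sf !mulmxDr mxE. Qed.
Lemma sfZl T (k : C) u v : sf T (k *: u) v = k^*%R * sf T u v.
Proof. by rewrite /sf adjmZ -!scalemxAl mxE. Qed.
Lemma sfZr T (k : C) u v : sf T u (k *: v) = k * sf T u v.
Proof. by rewrite /sf -!scalemxAr mxE. Qed.
Lemma sfD T T' u v : sf (T + T') u v = sf T u v + sf T' u v.
Proof. by rewrite /sf mulmxDr mulmxDl mxE. Qed.
Lemma sfN T u v : sf (- T) u v = - sf T u v.
Proof. by rewrite /sf mulmxN mulNmx mxE. Qed.
Lemma sfB T T' u v : sf (T - T') u v = sf T u v - sf T' u v.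
Proof. by rewrite sfD sfN. Qed.
Lemma sfS (k : C) u v : sf k%:M u v = k * sf 1%:M u v.
Proof. by rewrite /sf mul_mx_scalar mulmx1 -scalemxAl mxE. Qed.
Lemma sf_herm T u v : adjm T = T -> sf T v u = (sf T u v)^*%R.
Proof. by move=> hT; rewrite /sf -adjmE !adjmM adjmK hT mulmxA. Qed.
Lemma sf_mul A T B u v : sf (adjm A *m T *m B) u v = sf T (A *m u) (B *m v).
Proof. by rewrite /sf adjmM !mulmxA. Qed.
Lemma sfE T u v : sf T u v = \sum_i \sum_j (u i 0)^*%R * T i j * v j 0.
Proof.
rewrite /sf mxE exchange_big/=; apply: eq_bigr => j _.
rewrite mxE mulr_suml; apply: eq_bigr => i _.
by rewrite adjmE.
Qed.
Lemma sf1E u v : sf 1%:M u v = \sum_i (u i 0)^*%R * v i 0.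
Proof.
by rewrite /sf mulmx1 mxE; apply: eq_bigr => i _; rewrite adjmE.
Qed.

Lemma conj_mul (z : C) : z^*%R * z = ((complex.Re `|z|) ^+ 2)%:C.
Proof. by rewrite mulrC -normCK rmorphXn. Qed.

Lemma n2E v : n2 v = \sum_i (complex.Re `|v i 0|) ^+ 2.
Proof.
rewrite /n2 /qf sf1E (raddf_sum (@complex.Re R)); apply: eq_bigr => i _.
by rewrite conj_mul.
Qed.

Lemma n2C v : (n2 v)%:C = sf 1%:M v v.
Proof.
rewrite n2E sf1E rmorph_sum; apply: eq_bigr => i _.
by rewrite conj_mul.
Qed.

Lemma n2_ge0 v : 0 <= n2 v.
Proof. by rewrite n2E sumr_ge0// => i _; rewrite sqr_ge0. Qed.

Lemma ReM_real (a : R) (z : C) : complex.Re (a%:C * z) = a * complex.Re z.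
Proof. by case: z => x y /=; rewrite mul0r subr0. Qed.

Lemma qfZ T (k : C) v : qf T (k *: v) = (complex.Re `|k|) ^+ 2 * qf T v.
Proof.
by rewrite /qf sfZl sfZr mulrA conj_mul ReM_real.
Qed.

(** A weighted parallelogram identity. For a positive form the term in [u - v] may be dropped, which
    yields [q_conv]. *)
Lemma qf_par T (a b : R) u v : qf T (a%:C *: u + b%:C *: v) + a * b * qf T (u - v) =
  (a + b) * (a * qf T u + b * qf T v).
Proof.
have cr (x : R) : (x%:C : C)^*%R = x%:C by exact: conjc_real.
rewrite -scaleN1r /qf !(sfDl, sfDr, sfZl, sfZr) !cr rmorphN rmorph1.
rewrite !mulN1r; move: (sf T u u) (sf T u v) (sf T v u) (sf T v v).
by move=> [x1 y1] [x2 y2] [x3 y3] [x4 y4] /=; ring.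
Qed.

Lemma qf_le T v : `|qf T v| <= (\sum_i \sum_j complex.Re `|T i j|) * n2 v.
Proof.
have vi i : complex.Re `|v i 0| ^+ 2 <= n2 v.
  by rewrite n2E (bigD1 i)//= lerDl sumr_ge0// => j _; rewrite sqr_ge0.
have v0 i : 0 <= complex.Re `|v i 0| by rewrite -ler0c RRe_real ?normr_real.
rewrite /qf sfE (le_trans (Re_norm_le _))// -lecR RRe_real ?normr_real//.
rewrite (le_trans (ler_norm_sum _ _ _))// mulr_suml rmorph_sum; apply: ler_sum => i _.
rewrite (le_trans (ler_norm_sum _ _ _))// mulr_suml rmorph_sum; apply: ler_sum => j _.
rewrite !normrM norm_conjC -[`|v i 0|]RRe_real ?normr_real// -[`|v j 0|]RRe_real ?normr_real//.
rewrite -[`|T i j|]RRe_real ?normr_real// -!rmorphM lecR.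
have := vi i; have := vi j; have := v0 i; have := v0 j.
have : 0 <= complex.Re `|T i j| by rewrite -ler0c RRe_real ?normr_real.
move: (complex.Re `|v i 0|) (complex.Re `|v j 0|) (complex.Re `|T i j|) (n2 v).
move=> x y t n t0 y0 x0 yn xn.
have : x * y <= n by nra.
move=> xy; rewrite mulrAC mulrC; exact: ler_wpM2l.
Qed.

Lemma n2Z (k : C) v : n2 (k *: v) = (complex.Re `|k|) ^+ 2 * n2 v.
Proof. exact: qfZ. Qed.

Lemma qfB T T' v : qf (T - T') v = qf T v - qf T' v.
Proof. by rewrite /qf sfB raddfB. Qed.

Lemma qfD T T' v : qf (T + T') v = qf T v + qf T' v.
Proof. by rewrite /qf sfD raddfD. Qed.

Lemma qfS (k : R) v : qf (k%:C)%:M v = k * n2 v.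
Proof. by rewrite /qf sfS ReM_real. Qed.

Definition normal_ v : 'cV[C]_N := ((Num.sqrt (n2 v))^-1)%:C *: v.

Lemma Re_norm_real (x : R) : complex.Re `|x%:C : C| = `|x|.
Proof. by rewrite normc_def/= expr0n addr0 sqrtr_sqr. Qed.

Lemma qf_normal T v : qf T (normal_ v) = qf T v / n2 v.
Proof.
rewrite /normal_ qfZ Re_norm_real ger0_norm ?invr_ge0 ?sqrtr_ge0//.
by rewrite exprVn sqr_sqrtr ?n2_ge0// mulrC.
Qed.

Lemma n2_normal v : 0 < n2 v -> n2 (normal_ v) = 1.
Proof. by move=> v0; rewrite /n2 qf_normal mulfV ?gt_eqF. Qed.

(** The squared norm is at least $1-3s(1-s)$, whose minimum is $1/4$. *)
Lemma n2_lower (s : R) u v : 0 <= s <= 1 -> n2 u = 1 -> n2 v = 1 ->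
  - (1 / 2) <= complex.Re (sf 1%:M u v) ->
  1 / 4 <= n2 ((1 - s)%:C *: u + s%:C *: v).
Proof.
move=> /andP[s0 s1] u1 v1 uv.
have cr (x : R) : (x%:C : C)^*%R = x%:C by exact: conjc_real.
have h : complex.Re (sf 1%:M v u) = complex.Re (sf 1%:M u v).
  by rewrite (sf_herm _ _ (adjm1 _)); case: (sf _ _ _).
move: u1 v1 uv h; rewrite /n2 /qf !(sfDl, sfDr, sfZl, sfZr) !cr.
move: (sf _ u u) (sf _ u v) (sf _ v u) (sf _ v v).
move=> [x1 y1] [x2 y2] [x3 y3] [x4 y4] /= -> -> r -> {cr}.
have h1 : 0 <= s * (1 - s) by apply: mulr_ge0 => //; lra.
have h2 : 0 <= s * (1 - s) * (x2 + 1 / 2) by apply: mulr_ge0 => //; lra.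
by have := sqr_ge0 (2 * s - 1); nra.
Qed.

(** The reverse triangle inequality: the worst case is [v = - u]. *)
Lemma n2_lower' (s : R) u v : n2 u = 1 -> n2 v = 1 -> 
  0 <= s <= 1 -> (1 - 2 * s) ^+ 2 <= n2 ((1 - s)%:C *: u + s%:C *: v).
Proof.
move=> u1 v1 /andP[s0 s1].
have := qf_par 1%:M (1 - s) s u (- v); have := n2_ge0 (u + v).
have := qf_par 1%:M (1 - s) s u v; have := qf_par 1%:M 1 1 u v.
have nN : n2 (- v) = 1 by rewrite -scaleN1r n2Z normrN normr1 expr1n mul1r.
rewrite -!/(n2 _) u1 v1 nN opprK scale1r scale1r.
move=> h1 h2 h3 _; have h4 : 0 <= s * (1 - s) * n2 (u + v).
  by apply: mulr_ge0 => //; apply: mulr_ge0 => //; lra.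
nra.
Qed.

End Forms.

Section ComplexContinuity.
Context {R : realType} {T : topologicalType}.
Local Notation C := (Cplx R).

Lemma cC_mul (f g : T -> C) : continuous f -> continuous g ->
  continuous (fun x => (f x : R[i]) * g x : C).
Proof. by move=> cf cg x; apply: (cmul_cvg (A := C)); [exact: cf|exact: cg]. Qed.

Lemma cC_conj (f : T -> C) : continuous f -> continuous (fun x => (f x : R[i])^*%R : C).
Proof. by move=> cf x; apply: (cadj_cvg (A := C)); exact: cf. Qed.

Lemma cC_add (f g : T -> C) : continuous f -> continuous g ->
  continuous (fun x => (f x : R[i]) + g x : C).
Proof. by move=> cf cg x; apply: (@cvgD _ C); [exact: cf|exact: cg]. Qed.

Lemma cC_opp (f : T -> C) : continuous f -> continuous (fun x => - (f x : R[i]) : C).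
Proof. by move=> cf x; apply: (@cvgN _ C); exact: cf. Qed.

Lemma cC_cst (c : C) : continuous (fun _ : T => c).
Proof. by move=> x; exact: cvg_cst. Qed.

Lemma cC_sum (I : Type) (r : seq I) (P : pred I) (f : I -> T -> C) :
  (forall i, P i -> continuous (f i)) ->
  continuous (fun x => \sum_(i <- r | P i) (f i x : R[i]) : C).
Proof.
move=> cf; elim: r => [|a r IH].
  by under eq_fun do rewrite big_nil; exact: cC_cst.
under eq_fun do rewrite big_cons; case: (boolP (P a)) => [Pa|_]; last exact: IH.
exact: (cC_add (cf a Pa) IH).
Qed.

Lemma cC_prod (I : Type) (r : seq I) (P : pred I) (f : I -> T -> C) :
  (forall i, P i -> continuous (f i)) ->
  continuous (fun x => \prod_(i <- r | P i) (f i x : R[i]) : C).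
Proof.
move=> cf; elim: r => [|a r IH].
  by under eq_fun do rewrite big_nil; exact: cC_cst.
under eq_fun do rewrite big_cons; case: (boolP (P a)) => [Pa|_]; last exact: IH.
exact: (cC_mul (cf a Pa) IH).
Qed.

Lemma cR_sum (I : Type) (r : seq I) (P : pred I) (f : I -> T -> R) :
  (forall i, P i -> continuous (f i)) ->
  continuous (fun x => \sum_(i <- r | P i) f i x).
Proof.
move=> cf; elim: r => [|a r IH].
  by under eq_fun do rewrite big_nil; move=> x; exact: cvg_cst.
under eq_fun do rewrite big_cons; case: (boolP (P a)) => [Pa|_]; last exact: IH.
by move=> x; apply: cvgD; [exact: (cf a Pa)|exact: IH].
Qed.

Lemma cR_mul (f g : T -> R) : continuous f -> continuous g -> continuous (fun x => f x * g x).
Proof. by move=> cf cg x; apply: cvgM; [exact: cf|exact: cg]. Qed.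
Lemma cR_add (f g : T -> R) : continuous f -> continuous g -> continuous (fun x => f x + g x).
Proof. by move=> cf cg x; apply: cvgD; [exact: cf|exact: cg]. Qed.
Lemma cR_sub (f g : T -> R) : continuous f -> continuous g -> continuous (fun x => f x - g x).
Proof. by move=> cf cg x; apply: cvgB; [exact: cf|exact: cg]. Qed.
Lemma cR_cst (c : R) : continuous (fun _ : T => c).
Proof. by move=> x; exact: cvg_cst. Qed.
Lemma cR_max (f g : T -> R) : continuous f -> continuous g -> continuous (fun x => Num.max (f x) (g x)).
Proof. by move=> cf cg x; apply: continuous_max; [exact: cf|exact: cg]. Qed.
Lemma cR_min (f g : T -> R) : continuous f -> continuous g -> continuous (fun x => Num.min (f x) (g x)).
Proof. by move=> cf cg x; apply: continuous_min; [exact: cf|exact: cg]. Qed.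
Lemma cR_inv (f : T -> R) : (forall x, f x != 0) -> continuous f -> continuous (fun x => (f x)^-1).
Proof. by move=> f0 cf x; apply: cvgV; [exact: f0|exact: cf]. Qed.
Lemma cR_sqrt (f : T -> R) : continuous f -> continuous (fun x => Num.sqrt (f x)).
Proof. by move=> cf x; apply: (cvg_comp f Num.sqrt (cf x)); exact: sqrt_continuous. Qed.
Lemma cR_norm (f : T -> R) : continuous f -> continuous (fun x => `|f x|).
Proof. by move=> cf x; apply: cvg_norm; exact: cf. Qed.

Definition mcont m n (A : T -> 'M[R[i]]_(m, n)) := forall i j, continuous (fun x => A x i j : C).

Lemma mcont_scale m n (f : T -> C) (A : T -> 'M[R[i]]_(m, n)) :
  continuous f -> mcont A -> mcont (fun x => (f x : R[i]) *: A x).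
Proof.
move=> cf cA i j; under eq_fun do rewrite mxE; exact: (cC_mul cf (cA i j)).
Qed.

Lemma mcont_add m n (A B : T -> 'M[R[i]]_(m, n)) : mcont A -> mcont B ->
  mcont (fun x => A x + B x).
Proof.
move=> cA cB i j; under eq_fun do rewrite mxE; exact: (cC_add (cA i j) (cB i j)).
Qed.

Lemma mcont_opp m n (A : T -> 'M[R[i]]_(m, n)) : mcont A -> mcont (fun x => - A x).
Proof. by move=> cA i j; under eq_fun do rewrite mxE; exact: (cC_opp (cA i j)). Qed.

Lemma mcont_mul m n p (A : T -> 'M[R[i]]_(m, n)) (B : T -> 'M[R[i]]_(n, p)) :
  mcont A -> mcont B -> mcont (fun x => A x *m B x).
Proof.
move=> cA cB i j; under eq_fun do rewrite mxE.
by apply: cC_sum => k _; exact: (cC_mul (cA i k) (cB k j)).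
Qed.

Lemma mcont_adj m n (A : T -> 'M[R[i]]_(m, n)) : mcont A -> mcont (fun x => adjm (A x)).
Proof. by move=> cA i j; under eq_fun do rewrite adjmE; exact: (cC_conj (cA j i)). Qed.

Lemma mcont_cst m n (A : 'M[R[i]]_(m, n)) : mcont (fun=> A).
Proof. by move=> i j; exact: cC_cst. Qed.

Lemma mcont_sum m n (I : Type) (r : seq I) (P : pred I) (A : I -> T -> 'M[R[i]]_(m, n)) :
  (forall k, P k -> mcont (A k)) -> mcont (fun x => \sum_(k <- r | P k) A k x).
Proof.
move=> cA i j; under eq_fun do rewrite summxE.
by apply: cC_sum => k Pk; exact: (cA k Pk i j).
Qed.

Lemma n2_continuous N (v : T -> 'cV[R[i]]_N) : mcont v -> continuous (fun x => n2 (v x)).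
Proof.
move=> cv; rewrite /n2 /qf /sf; apply: Re_continuous.
have h : mcont (fun x => adjm (v x) *m 1%:M *m v x).
  apply: mcont_mul; last exact: cv.
  by apply: mcont_mul; [exact: mcont_adj|exact: mcont_cst].
exact: (h 0 0).
Qed.

Lemma normal_continuous N (v : T -> 'cV[R[i]]_N) : mcont v -> (forall x, 0 < n2 (v x)) ->
  mcont (fun x => normal_ (v x)).
Proof.
move=> cv v0; apply: mcont_scale; last exact: cv.
apply: rtoc_continuous; apply: cR_inv.
  by move=> x; rewrite gt_eqF// sqrtr_gt0.
by apply: cR_sqrt; exact: n2_continuous.
Qed.

End ComplexContinuity.

Section PiecewiseLinear.
Context {R : realType}.
Local Notation C := R[i].

Definition hat (j : nat) (x : R) : R := Num.max 0 (1 - `|x - j%:R|).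

Lemma hat_continuous j : continuous (hat j).
Proof.
apply: cR_max; first exact: cR_cst.
apply: cR_sub; first exact: cR_cst.
by apply: cR_norm; apply: cR_sub; [move=> x; exact: cvg_id|exact: cR_cst].
Qed.

Lemma hatP (n : nat) (x : R) : 0 <= x <= n%:R -> exists k (s : R),
  [/\ (k <= n)%N, 0 <= s <= 1, x = k%:R + s &
  forall j, hat j x = if j == k then 1 - s else if j == k.+1 then s else 0].
Proof.
move=> /andP[x0 xn]; pose k := Num.truncn x.
have /andP[kx xk] : k%:R <= x < k.+1%:R by exact: truncn_itv.
exists k, (x - k%:R); rewrite -natr1 in xk; split.
- by rewrite -(ler_nat R) (le_trans kx).
- by apply/andP; split; lra.
- lra.
move=> j; rewrite /hat; case: eqP => [->|jk].
  by rewrite ger0_norm ?subr_ge0// max_r//; lra.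
case: eqP => [->|jk1].
  by rewrite -natr1 ler0_norm; [rewrite max_r; lra|lra].
rewrite max_l//; have [jk2|jk2] := ltnP j k.
  have : j%:R + 1 <= k%:R :> R by rewrite natr1 ler_nat.
  by move=> h; rewrite ger0_norm; lra.
have : k%:R + 1 + 1 <= j%:R :> R by rewrite !natr1 ler_nat; lia.
by move=> h; rewrite ler0_norm; lra.
Qed.

(** Polygonal interpolation of [f] on $[0,n]$. The nodes run up to [n.+1] because the segment found
    for [x = n] starts at [n]. *)
Definition pl (V : lmodType C) (n : nat) (f : nat -> V) (x : R) : V :=
  \sum_(j < n.+2) (hat j x)%:C *: f j.

Lemma plP (V : lmodType C) (n : nat) (x : R) : 0 <= x <= n%:R -> exists k (s : R),
  [/\ (k <= n)%N, 0 <= s <= 1, x = k%:R + s &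
  forall f : nat -> V, pl n f x = (1 - s)%:C *: f k + s%:C *: f k.+1].
Proof.
move=> /hatP[k [s [kn s01 xk h]]]; exists k, s; split=> // f.
have k2 : (k < n.+2)%N by lia.
have k3 : (k.+1 < n.+2)%N by lia.
rewrite /pl (bigD1 (Ordinal k2))//= (bigD1 (Ordinal k3))/=; last first.
  by rewrite -val_eqE/= eq_sym ltn_eqF.
rewrite !h !eqxx (_ : (k.+1 == k) = false) ?gtn_eqF// big1 ?addr0// => j /andP[jk jk1].
by rewrite -val_eqE/= in jk; rewrite -val_eqE/= in jk1; rewrite h (negPf jk) (negPf jk1) scale0r.
Qed.

Definition clamp (t : R) : R := Num.max 0 (Num.min t 1).

Lemma clamp01 t : 0 <= clamp t <= 1.
Proof. by rewrite /clamp le_max lexx/= ge_max ler01 ge_min lexx orbT. Qed.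

Lemma clamp_id t : 0 <= t <= 1 -> clamp t = t.
Proof. by move=> /andP[t0 t1]; rewrite /clamp min_l// max_r. Qed.

Lemma clamp_continuous : continuous clamp.
Proof.
apply: cR_max; first exact: cR_cst.
by apply: cR_min; [move=> x; exact: cvg_id|exact: cR_cst].
Qed.

(** A Lebesgue number for $[a,b]$. *)
Lemma segment_uniform (a b : R) (P : R -> R -> Prop) :
  (forall t0, a <= t0 <= b -> exists2 d : R, 0 < d & forall s t, a <= s <= b -> a <= t <= b ->
    `|s - t0| < d -> `|t - t0| < d -> P s t) ->
  exists n : nat, forall s t, a <= s <= b -> a <= t <= b -> `|s - t| <= n.+1%:R^-1 -> P s t.
Proof.
have tri (t0 s t d e : R) : `|t0 - s| < d / 2 -> `|s - t| <= e -> e < d / 2 -> `|t - t0| < d.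
  by have := ler_distD s t t0; rewrite (distrC t s) (distrC s t0); lra.
move=> h; have /compact_near_coveringP cov := @segment_compact R a b.
have [N _ HN] : \forall n \near \oo, `[a, b] `<=` (fun s => forall t, a <= s <= b ->
    a <= t <= b -> `|s - t| <= n.+1%:R^-1 -> P s t).
  apply: cov => t0; rewrite /= in_itv/= => t0ab; have [d d0 hd] := h t0 t0ab.
  have d2 : 0 < d / 2 by lra.
  have [N HN] : exists N, forall n, (N <= n)%N -> n.+1%:R^-1 < d / 2.
    exists (Num.bound (d / 2)^-1) => n Nn.
    rewrite -[d / 2]invrK ltf_pV2 ?posrE ?invr_gt0// ?ltr0n//.
    apply: (@lt_le_trans _ _ (Num.bound (d / 2)^-1)%:R); last by rewrite ler_nat leqW.
    by rewrite archi_boundP// invr_ge0 ltW.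
  exists (ball t0 (d / 2), [set n | (N <= n)%N]) => /=.
    by split; [exact: nbhsx_ballx|exists N].
  move=> [s n] /= [st0 Nn] t sab tab stn; apply: hd => //.
    by move: st0; rewrite /ball/= distrC; lra.
  exact: (tri t0 s t d n.+1%:R^-1 st0 stn (HN n Nn)).
exists N => s t sab tab st; apply: (HN N (leqnn N) s) => //.
Qed.

End PiecewiseLinear.

Lemma clamp_near (R : realType) (a b x y : R) : a <= x <= b ->
  `|x - Num.max a (Num.min y b)| <= `|x - y|.
Proof.
move=> /andP[ax xb]; have H (d : R) : y - x <= d -> x - y <= d ->
    - d <= x - Num.max a (Num.min y b) <= d.
  move=> h1 h2; rewrite !maxEle !minEle; case: (lerP y b) => ?.
    by case: (lerP a y) => ?; apply/andP; split; lra.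
  by case: (lerP a b) => ?; apply/andP; split; lra.
by rewrite ler_norml; apply: H; [rewrite distrC|]; exact: ler_norm.
Qed.

(* Families of positive semidefinite quadratic forms taking arbitrarily small values on
   unit vectors; the intended one is [v |-> mu |v|^2 - <T v, v>] with [mu] the top of
   the spectrum of [T]. *)
Record qform (R : realType) (N : nat) (q : 'cV[R[i]]_N -> R) : Prop := QForm {
  q_hom : forall (c : R[i]) v, q (c *: v) = complex.Re `|c| ^+ 2 * q v ;
  q_conv : forall (a b : R) u v, 0 <= a -> 0 <= b ->
    q (a%:C *: u + b%:C *: v) <= (a + b) * (a * q u + b * q v) ;
  q_top : forall e : R, 0 < e -> exists v, n2 v = 1 /\ q v <= e }.

Lemma q_normal (R : realType) (N : nat) (q : 'cV[R[i]]_N -> R) v :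
  qform q -> q (normal_ v) = q v / n2 v.
Proof.
move=> Q; rewrite /normal_ (q_hom Q) Re_norm_real ger0_norm ?invr_ge0 ?sqrtr_ge0//.
by rewrite exprVn sqr_sqrtr ?n2_ge0// mulrC.
Qed.

(** * Continuous fields of nearly extremal unit vectors *)

Section Paths.
Context {R : realType} {N : nat}.
Variable q : R -> 'cV[R[i]]_N -> R.
Hypothesis Q : forall t, qform (q t).
Hypothesis qc : forall t0 (e : R), 0 <= t0 <= 1 -> 0 < e -> exists2 d : R, 0 < d &
  forall s, 0 <= s <= 1 -> `|s - t0| < d -> forall v, `|q s v - q t0 v| <= e * n2 v.

(** Sample vectors are joined by segments, after sign changes that make the real parts of
    consecutive inner products non-negative and so keep the segments away from 0. Convexity bounds
    the form by $2e'$ on them; dividing by a squared norm of at least $1/4$ gives $8e'=e$. *)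
Lemma near_top_path (e : R) : 0 < e -> exists v : R -> 'cV[R[i]]_N,
  [/\ mcont v, forall t, n2 (v t) = 1 & forall t, 0 <= t <= 1 -> q t (v t) <= e].
Proof.
move=> e0; pose e' := e / 8; have e'0 : 0 < e' by rewrite /e'; lra.
have [t0 h0|n hn] := @segment_uniform R 0 1 (fun s t => forall v, `|q s v - q t v| <= e' * n2 v).
  have e2 : 0 < e' / 2 by lra.
  have [d d0 hd] := qc h0 e2; exists d => // s t s01 t01 st tt v.
  have := hd s s01 st v; have := hd t t01 tt v; have := ler_distD (q t0 v) (q s v) (q t v).
  by rewrite (distrC (q t0 v)); lra.
pose m := n.+1; have m0 : 0 < m%:R :> R by rewrite ltr0n.
pose tk k : R := clamp (k%:R / m%:R).
have /choice[w hw] : forall k, exists w, n2 w = 1 /\ q (tk k) w <= e'.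
  by move=> k; exact: q_top (Q _) _ e'0.
pose u := fix u k : 'cV[R[i]]_N := if k is j.+1 then
  (if 0 <= complex.Re (sf 1%:M (u j) (w k)) then w k else - w k) else w 0%N.
have u1 k : n2 (u k) = 1 /\ q (tk k) (u k) <= e'.
  case: k => [|k]; first exact: hw.
  rewrite /=; case: ifP => _; first exact: hw.
  have [w1 w2] := hw k.+1.
  by rewrite -scaleN1r n2Z (q_hom (Q _)) normrN normr1 expr1n !mul1r.
have uu k : 0 <= complex.Re (sf 1%:M (u k) (u k.+1)).
  rewrite /=; case: ifP => // /negbT; rewrite -ltNge => /ltW h.
  by rewrite -scaleN1r sfZr mulN1r raddfN oppr_ge0.
pose v' t := pl m u (m%:R * clamp t).
have key t : exists k (s : R), [/\ 0 <= s <= 1, v' t = (1 - s)%:C *: u k + s%:C *: u k.+1,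
    `|clamp t - tk k| <= m%:R^-1 & `|clamp t - tk k.+1| <= m%:R^-1].
  have /andP[c0 c1] := clamp01 t.
  have tm : 0 <= m%:R * clamp t <= m%:R.
    by rewrite mulr_ge0 ?(ltW m0)//= -[leRHS]mulr1 ler_wpM2l// ltW.
  have [k [s [_ s01 tk_ pE]]] := plP ('cV[R[i]]_N : lmodType R[i]) tm; exists k, s; split=> //; first exact: pE.
    apply: (le_trans (clamp_near _ (clamp01 t))).
    have -> : clamp t - k%:R / m%:R = s / m%:R.
      by apply: (mulfI (lt0r_neq0 m0)); rewrite mulrBr tk_ !mulrA ![m%:R * _]mulrC !mulfK ?lt0r_neq0//; ring.
    rewrite ger0_norm ?mulr_ge0 ?invr_ge0 ?(ltW m0)//; last by have /andP[] := s01.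
    by rewrite ler_piMl ?invr_ge0 ?(ltW m0)//; have /andP[] := s01.
  apply: (le_trans (clamp_near _ (clamp01 t))).
  have -> : clamp t - k.+1%:R / m%:R = - ((1 - s) / m%:R).
    apply: (mulfI (lt0r_neq0 m0)); rewrite mulrBr mulrN tk_ !mulrA ![m%:R * _]mulrC !mulfK ?lt0r_neq0//.
    by rewrite -natr1; ring.
  rewrite normrN ger0_norm ?mulr_ge0 ?invr_ge0 ?(ltW m0)//; last by have /andP[] := s01; lra.
  by rewrite ler_piMl ?invr_ge0 ?(ltW m0)//; have /andP[] := s01; lra.
have lower t : 1 / 4 <= n2 (v' t).
  have [k [s [s01 -> _ _]]] := key t; apply: n2_lower => //; try exact: (u1 _).1.
  by have := uu k; lra.
exists (fun t => normal_ (v' t)); split.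
- apply: normal_continuous; last by move=> t; have := lower t; lra.
  apply: mcont_sum => k _; apply: mcont_scale; last exact: mcont_cst.
  apply: rtoc_continuous => t.
  apply: (cvg_comp (fun t => m%:R * clamp t) (hat k)); last exact: hat_continuous.
  by apply: cvgM; [exact: cvg_cst|exact: clamp_continuous].
- by move=> t; rewrite n2_normal//; have := lower t; lra.
move=> t t01; have lt := lower t; rewrite q_normal// ler_pdivrMr; last by lra.
have [k [s [s01 vE d1 d2]]] := key t; rewrite clamp_id// in d1 d2.
suff : q t (v' t) <= 2 * e' by rewrite /e'; nra.
have b k' : `|t - tk k'| <= m%:R^-1 -> q t (u k') <= 2 * e'.
  move=> dk; have := hn t (tk k') t01 (clamp01 _) dk (u k'); have [-> h] := u1 k'.
  by rewrite mulr1 ler_norml => /andP[_]; lra.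
have /andP[s0 s1] := s01; have s1' : 0 <= 1 - s by lra.
rewrite vE; apply: (le_trans (q_conv (Q t) _ _ s1' s0)).
by have := b k d1; have := b k.+1 d2; nra.
Qed.

End Paths.

Section Winding.
Context {R : realType}.
Local Notation C := (Cplx R).

(** With [c t] the inner product of two vector fields, [g] is the phase by which the second one is
    turned: not at all when the first argument is 0, and when it is 1, so far that the two are not
    nearly opposite. The curve [c'] runs from 1 to [c 0] and then along [c]. A polygon that avoids 0
    follows it, and [g (s, t)] is the conjugate phase of that polygon at [s * (1 + t)]. *)
Lemma unimodular_path (c : R -> C) : continuous c -> exists g : R * R -> C,
  [/\ continuous g, forall p, complex.Re `|g p : R[i]| = 1, forall t, g (0, t) = 1 :> R[i] &
  forall t, 0 <= t <= 1 -> - (1 / 2) <= complex.Re ((g (1, t) : R[i]) * c t)].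
Proof.
move=> cc; pose c' (x : R) : C := (1 - Num.min x 1)%:C + (Num.min x 1)%:C * (c (Num.max (x - 1) 0) : R[i]).
have cc' : continuous c'.
  have cm : continuous (fun x : R => Num.min x 1).
    by apply: cR_min; [move=> x; exact: cvg_id|exact: cR_cst].
  apply: cC_add; first by apply: rtoc_continuous; apply: cR_sub; [exact: cR_cst|exact: cm].
  apply: cC_mul; first exact: rtoc_continuous.
  have cm2 : continuous (fun x : R => Num.max (x - 1) 0).
    by apply: cR_max; [apply: cR_sub; [move=> x; exact: cvg_id|exact: cR_cst]|exact: cR_cst].
  move=> x; apply: (cvg_comp (fun x : R => Num.max (x - 1) 0) c); [exact: cm2|exact: cc].
have [t0 _|n hn] := @segment_uniform R 0 2 (fun s t => nrm (c' s - c' t) <= 1 / 8).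
  have e16 : 0 < 1 / 16 :> R by lra.
  have /cstar_continuousP/(_ t0 _ e16) := cc'.
  case=> d /= d0 hd; exists d => // s t _ _.
  rewrite ![`|_ - t0|]distrC => /hd/= h1 /hd/= h2.
  by have := nrm_dist (c' s) (c' t0) (c' t); rewrite (nrm_distC (c' s) (c' t0)); lra.
pose m := (2 * n.+1)%N; have n0 : 0 < n.+1%:R :> R by rewrite ltr0n.
pose cl2 (x : R) := Num.max 0 (Num.min x 2).
have cl2_01 x : 0 <= cl2 x <= 2.
  by rewrite /cl2 le_max lexx/= ge_max ler0n ge_min lexx orbT.
have cl2_id x : 0 <= x <= 2 -> cl2 x = x by move=> /andP[x0 x2]; rewrite /cl2 min_l// max_r.
pose tk k : R := cl2 (k%:R / n.+1%:R).
(* A vertex on the real line through 0 and its predecessor is shifted by $1/8$ at a right angle to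
   that line, so that no edge meets 0. *)
pose z := fix z k : R[i] := if k is j.+1 then
  (if complex.Im ((z j)^*%R * (c' (tk k) : R[i])) != 0 then (c' (tk k) : R[i])
   else (c' (tk k) : R[i]) + (1 / 8)%:C * ('i * z j / `|z j|)) else 1.
have zim k : z k != 0 -> complex.Im ((z k)^*%R * z k.+1) != 0.
  move=> zk0; rewrite [z k.+1]/=; case: ifP => // /negbFE/eqP h.
  rewrite mulrDr raddfD/= h add0r.
  have -> : (z k)^*%R * ((1 / 8)%:C * ('i * z k / `|z k|)) = 'i * (1 / 8 * complex.Re `|z k|)%:C.
    have -> : (1 / 8 * complex.Re `|z k|)%:C = (1 / 8)%:C * `|z k| :> R[i].
      rewrite -[X in _ = _ * X]RRe_real ?normr_real//; exact: (rmorphM (real_complex R)).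
    rewrite (_ : _ * _ = 'i * ((1 / 8)%:C * ((z k)^*%R * z k / `|z k|))); last by ring.
    by rewrite [_^*%R * _]mulrC -normCK expr2 mulfK// normr_eq0.
  have zk1 : complex.Re `|z k| != 0.
    apply: contra zk0 => /eqP h0; rewrite -normr_eq0 -[`|z k|]RRe_real ?normr_real//.
    by rewrite h0.
  rewrite -complexiE; move: zk1; move: (complex.Re `|z k|) => r r0.
  by rewrite /= mul0r mul1r add0r mulf_neq0//; lra.
have znz k : z k != 0.
  elim: k => [|k IH]; first exact: oner_neq0.
  by apply: contraNneq (zim k IH) => ->; rewrite mulr0.
have zc k : nrm ((z k : C) - c' (tk k)) <= 1 / 8.
  case: k => [|k].
    have -> : tk 0%N = 0 by rewrite /tk mul0r cl2_id// lexx ler0n.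
    rewrite /c' min_l// subr0 mul0r addr0 subrr nrm0; lra.
  rewrite /=; case: ifP => _; first by rewrite subrr nrm0; lra.
  rewrite addrC addKr nrmC_E normrM normrM normfV normrM normCi mul1r normr_id.
  by rewrite mul1r mulfV ?normr_eq0// mulr1 Re_norm_real ger0_norm; lra.
pose zt x : C := pl (V := (R[i])^o) m z (n.+1%:R * cl2 x).
have key x : exists k (s : R), [/\ 0 <= s <= 1, zt x = (1 - s)%:C * z k + s%:C * z k.+1 :> R[i],
    `|cl2 x - tk k| <= n.+1%:R^-1 & `|cl2 x - tk k.+1| <= n.+1%:R^-1].
  have /andP[c0 c1] := cl2_01 x.
  have tm : 0 <= n.+1%:R * cl2 x <= m%:R.
    by rewrite mulr_ge0 ?(ltW n0)//= /m natrM mulrC ler_wpM2r// ltW.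
  have [k [s [_ s01 tk_ pE]]] := plP ((R[i])^o : lmodType R[i]) tm; exists k, s.
  split=> //; first exact: pE.
    apply: (le_trans (clamp_near _ (cl2_01 x))).
    have -> : cl2 x - k%:R / n.+1%:R = s / n.+1%:R.
      by apply: (mulfI (lt0r_neq0 n0)); rewrite mulrBr tk_ !mulrA ![n.+1%:R * _]mulrC !mulfK ?lt0r_neq0//; ring.
    rewrite ger0_norm ?mulr_ge0 ?invr_ge0 ?(ltW n0)//; last by have /andP[] := s01.
    by rewrite ler_piMl ?invr_ge0 ?(ltW n0)//; have /andP[] := s01.
  apply: (le_trans (clamp_near _ (cl2_01 x))).
  have -> : cl2 x - k.+1%:R / n.+1%:R = - ((1 - s) / n.+1%:R).
    apply: (mulfI (lt0r_neq0 n0)); rewrite mulrBr mulrN tk_ !mulrA ![n.+1%:R * _]mulrC !mulfK ?lt0r_neq0//.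
    by rewrite -natr1; ring.
  rewrite normrN ger0_norm ?mulr_ge0 ?invr_ge0 ?(ltW n0)//; last by have /andP[] := s01; lra.
  by rewrite ler_piMl ?invr_ge0 ?(ltW n0)//; have /andP[] := s01; lra.
have zt0 x : zt x != 0 :> R[i].
  have [k [s [_ -> _ _]]] := key x; apply/eqP => h.
  have := congr1 (fun y => complex.Im ((z k)^*%R * y)) h; rewrite mulr0/=.
  rewrite mulrDr raddfD/= !(mulrCA (z k)^*%R) (mulrC (z k)^*%R) -normCK.
  have -> : complex.Im ((1 - s)%:C * `|z k| ^+ 2) = 0.
    by rewrite -[`|z k|]RRe_real ?normr_real// -rmorphXn -rmorphM.
  have ImM (a : R) (y : R[i]) : complex.Im (a%:C * y) = a * complex.Im y.
    by case: y => y1 y2 /=; rewrite mul0r addr0.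
  rewrite add0r ImM => /eqP; rewrite mulf_eq0 (negPf (zim k (znz k))) orbF => /eqP s0.
  by move/eqP: h; rewrite s0 subr0 mul0r addr0 mul1r (negPf (znz k)).
have ztc x : 0 <= x <= 2 -> nrm (zt x - c' x) <= 1 / 4.
  move=> x02; have [k [s [/andP[s0 s1] zE d1 d2]]] := key x; rewrite cl2_id// in d1 d2.
  have b k' : `|x - tk k'| <= n.+1%:R^-1 -> nrm ((z k' : C) - c' x) <= 1 / 4.
    move=> dk; have := hn x (tk k') x02 (cl2_01 _) dk; have := zc k'.
    by have := nrm_dist (z k' : C) (c' (tk k')) (c' x); rewrite (nrm_distC (c' (tk k')) (c' x)); lra.
  have -> : zt x - c' x = (1 - s)%:C *: ((z k : C) - c' x) + s%:C *: ((z k.+1 : C) - c' x).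
    rewrite !scalerBr addrACA -opprD -scalerDl -rmorphD/= subrK scale1r; congr (_ - _).
    exact: zE.
  apply: (le_trans (nrmD _ _)); rewrite !nrmZ !Re_norm_real !ger0_norm//; last by lra.
  by have := b k d1; have := b k.+1 d2; nra.
have czt : continuous zt.
  apply: cC_sum => k _; apply: cC_mul; last exact: cC_cst.
  apply: rtoc_continuous => t.
  apply: (cvg_comp (fun t => n.+1%:R * cl2 t) (hat k)); last exact: hat_continuous.
  have ccl2 : continuous cl2.
    by apply: cR_max; [exact: cR_cst|apply: cR_min; [move=> y; exact: cvg_id|exact: cR_cst]].
  by apply: cvgM; [exact: cvg_cst|exact: ccl2].
pose r x := nrm (zt x); have r0 x : 0 < r x.
  rewrite lt_neqAle nrm_ge0 andbT; apply: contraNneq (zt0 x) => h.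
  by apply/eqP; exact: (nrm_eq0 (esym h)).
pose w x : C := ((r x)^-1)%:C * (zt x : R[i])^*%R.
have cw : continuous w.
  apply: cC_mul; last exact: cC_conj.
  apply: rtoc_continuous; apply: cR_inv; first by move=> x; rewrite gt_eqF.
  exact: nrm_continuous.
have w1 x : complex.Re `|w x : R[i]| = 1.
  rewrite normrM norm_conjC -[`|zt x : R[i]|]RRe_real ?normr_real// -nrmC_E.
  rewrite -[`|_%:C|]RRe_real ?normr_real// Re_norm_real ger0_norm ?invr_ge0 ?nrm_ge0//.
  by rewrite -rmorphM/= mulVf// gt_eqF.
exists (fun p => w (p.1 * (1 + p.2))); split.
- move=> p; apply: (cvg_comp (fun p : R * R => p.1 * (1 + p.2)) w); last exact: cw.
  apply: cvgM; first exact: cvg_fst.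
  by apply: cvgD; [exact: cvg_cst|exact: cvg_snd].
- by move=> p; exact: w1.
- move=> t; rewrite /= mul0r.
  have z0 : zt 0 = 1 :> R[i].
    rewrite /zt /pl cl2_id ?lexx ?ler0n// mulr0 big_ord_recl/= big1 ?addr0.
      by rewrite /hat subr0 normr0 subr0 max_r// [LHS]mul1r.
    move=> k _; rewrite /hat sub0r normrN ger0_norm// max_l ?scale0r//.
    by rewrite subr_le0 (ler_nat R 1).
  by rewrite /w /r nrmC_E z0 normr1 rmorph1 mulr1 invr1.
move=> t /andP[t0 t1] /=.
have x02 : 0 <= 1 + t <= 2 by apply/andP; split; lra.
have -> : c t = c' (1 + t).
  rewrite /c' min_r; last by lra.
  by rewrite subrr [1 + t]addrC addrK max_l// [X in _ = X + _](_ : _ = 0)// add0r [RHS]mul1r.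
rewrite [1 * (1 + t)]mul1r; move: {t0 t1 t} (1 + t) x02 => x x02.
(* The first summand is positive, and the second has modulus at most $1/4$, since the polygon is
   that close to [c']. *)
have -> : (w x : R[i]) * c' x = (r x)%:C + (w x : R[i]) * (c' x - zt x).
  rewrite mulrBr (_ : (w x : R[i]) * zt x = (r x)%:C); first by rewrite addrC subrK.
  rewrite /w -mulrA [_^*%R * _]mulrC -normCK -[`|_|]RRe_real ?normr_real// -nrmC_E -/(r x).
  by rewrite -rmorphXn -rmorphM/= expr2 mulKf// gt_eqF.
rewrite raddfD/=; have := Re_norm_le ((w x : R[i]) * (c' x - zt x)).
have -> : complex.Re `|(w x : R[i]) * (c' x - zt x)| = nrm (c' x - zt x).
  rewrite nrmC_E normrM -[`|w x|]RRe_real ?normr_real// w1.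
  by rewrite [X in X * _](_ : _ = 1)// mul1r.
rewrite nrm_distC => /ler_normlP[h1 h2].
by have := ztc x x02; have := r0 x; lra.
Qed.

End Winding.

(** The near-covering form of compactness, for the filter on lists generated by containing a given
    list. *)
Lemma finite_cover (X : topologicalType) (cX : compact [set: X]) (W : X -> set X) :
  (forall x, nbhs x (W x)) -> exists s : seq X, forall y, exists2 x, x \in s & W x y.
Proof.
move=> hW; pose F : set_system (seq X) :=
  [set P : set (seq X) | exists s0 : seq X, forall s : seq X, {subset s0 <= s} -> P s].
have FF : Filter F.
  split; first by exists [::].
    move=> P Q [s1 h1] [s2 h2]; exists (s1 ++ s2) => s hs; split.
      by apply: h1 => x xs; apply: hs; rewrite mem_cat xs.
    by apply: h2 => x xs; apply: hs; rewrite mem_cat xs orbT.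
  by move=> P Q PQ [s0 h]; exists s0 => s hs; apply: PQ; exact: h.
have /compact_near_coveringP/(_ _ F (fun s y => exists2 x, x \in s & W x y) FF) := cX.
case=> [x _|s0 h]; last by exists s0 => y; exact: (h s0 (fun _ => id) y I).
exists (W x, [set s : seq X | x \in s]) => /=.
  by split; [exact: hW|exists [:: x] => s; apply; rewrite inE].
by move=> [y s] /= [Wy xs]; exists x.
Qed.

Lemma pair_continuous (T U V : topologicalType) (f : T -> U) (g : T -> V) :
  continuous f -> continuous g -> continuous (fun x => (f x, g x)).
Proof. by move=> cf cg x; apply: cvg_pair; [exact: cf|exact: cg]. Qed.

Lemma comp_continuous (T U V : topologicalType) (f : T -> U) (g : U -> V) :
  continuous f -> continuous g -> continuous (fun x => g (f x)).
Proof. by move=> cf cg x; apply: (cvg_comp f g (cf x)); exact: cg. Qed.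

Lemma fst_continuous (T U : topologicalType) : continuous (@fst T U).
Proof. by move=> x; exact: cvg_fst. Qed.

Lemma snd_continuous (T U : topologicalType) : continuous (@snd T U).
Proof. by move=> x; exact: cvg_snd. Qed.

Lemma sf_continuous (R : realType) (Y : topologicalType) N (A : Y -> 'M[R[i]]_N)
    (u v : Y -> 'cV[R[i]]_N) : mcont A -> mcont u -> mcont v ->
  continuous (fun y => sf (A y) (u y) (v y) : Cplx R).
Proof.
move=> cA cu cv; have h : mcont (fun y => adjm (u y) *m A y *m v y).
  by apply: mcont_mul; [apply: mcont_mul; [exact: mcont_adj|exact: cA]|exact: cv].
exact: (h 0 0).
Qed.

Section Depth.
Context {R : realType} {X : pseudoMetricType R}.

(** The distance to the complement of [A], capped at 1 and expressed by balls alone; 0 is adjoined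
    to keep the set non-empty. *)
Definition depth (A : set X) (x : X) : R :=
  sup [set r | r = 0 \/ [/\ 0 < r, r <= 1 & ball x r `<=` A]].

Lemma depth_le A x r : 0 < r -> r <= 1 -> ball x r `<=` A -> r <= depth A x.
Proof.
move=> r0 r1 xA; apply: ub_le_sup; last by right.
by exists 1; move=> s [->|[]].
Qed.

Lemma depth_ge0 A x : 0 <= depth A x.
Proof. by apply: ub_le_sup; [exists 1; move=> s [->|[]]|left]. Qed.

Lemma depth_lip A x y r : ball x r y -> 0 < r -> depth A x <= depth A y + r.
Proof.
move=> xy r0; apply: ge_sup; first by exists 0; left.
move=> s [->|[s0 s1 xA]]; first by rewrite addr_ge0 ?depth_ge0// ltW.
have [sr|rs] := leP s r; first by rewrite (le_trans sr)// lerDr depth_ge0.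
rewrite -lerBlDr; apply: depth_le; [lra|lra|].
move=> z yz; apply: xA; rewrite -[s](subrKC r); exact: ball_triangle yz.
Qed.

Lemma depth_continuous A : continuous (depth A).
Proof.
apply/real_continuousP => x e e0; have e2 : 0 < e / 2 by lra.
near=> y.
have xy : ball x (e / 2) y by near: y; exact: nbhsx_ballx.
have := depth_lip A xy e2; have := depth_lip A (ball_sym xy) e2.
by move=> h1 h2; rewrite ltr_norml; apply/andP; split; lra.
Unshelve. all: by end_near. Qed.

Lemma depth_gt0 A x : open A -> A x -> 0 < depth A x.
Proof.
move=> oA Ax; have /nbhs_ballP[r /= r0 rA] := open_nbhs_nbhs (conj oA Ax).
have m0 : 0 < Num.min r 1 by rewrite lt_min r0 ltr01.
apply: (lt_le_trans m0); apply: depth_le => //; first by rewrite ge_min lexx orbT.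
by apply: subset_trans rA; apply: le_ball; rewrite ge_min lexx.
Qed.

Lemma depth_out A x : ~ A x -> depth A x = 0.
Proof.
move=> Ax; apply/eqP; rewrite eq_le depth_ge0 andbT.
apply: ge_sup; first by exists 0; left.
by move=> r [->//|[r0 _ rA]]; case: Ax; apply: rA; exact: ballxx.
Qed.

End Depth.

Definition qcont (R : realType) (Y : topologicalType) (N : nat)
    (q : Y -> 'cV[R[i]]_N -> R) :=
  forall y0 (e : R), 0 < e -> \forall y \near y0, forall v, `|q y v - q y0 v| <= e * n2 v.

Section NearTopField.
Context {R : realType} {X : pseudoMetricType R}.
Hypotheses (cX : compact [set: X]) (dimX : covering_dim_le X 1).
Local Notation C := (Cplx R).

(** A path that works over one fibre $\{x\}\times[0,1]$ works over all nearby fibres, by compactness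
    of the interval. The dimension of [X] enters in the multiplicity of the cover. *)
Lemma near_top_cover (N : nat) (q : X * R -> 'cV[R[i]]_N -> R) (e : R) :
  (forall y, qform (q y)) -> qcont q -> 0 < e ->
  exists n (V : 'I_n -> set X) (v : 'I_n -> R -> 'cV[R[i]]_N),
  [/\ forall j, open (V j), \bigcup_j V j = [set: X],
   forall (x : X) (J : {set 'I_n}), (forall j, j \in J -> V j x) -> (#|J| <= 2)%N,
   forall j, mcont (v j) /\ forall t, n2 (v j t) = 1 &
   forall j x t, V j x -> 0 <= t <= 1 -> q (x, t) (v j t) <= e].
Proof.
move=> Q qc e0; have e2 : 0 < e / 2 by lra.
have /choice[v hv] : forall x, exists v : R -> 'cV[R[i]]_N, [/\ mcont v,
    forall t, n2 (v t) = 1 & forall t, 0 <= t <= 1 -> q (x, t) (v t) <= e / 2].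
  move=> x; apply: (near_top_path (q := fun t => q (x, t))) => // t0 d _ d0.
  have [[U W] /= [Ux [r /= r0 rW]] UW] := qc (x, t0) d d0; exists r => // s _ st.
  by apply: (UW (x, s)); split; [exact: nbhs_singleton|apply: rW; rewrite /= distrC].
pose G (x : X) : set X := [set x' | forall t, 0 <= t <= 1 -> q (x', t) (v x t) <= e].
have nG x : nbhs x (G x).
  have [_ v1 vq] := hv x.
  have /compact_near_coveringP/(_ _ (nbhs x)
      (fun x' t => `|q (x', t) (v x t) - q (x, t) (v x t)| <= e / 2)) := @segment_compact R 0 1.
  move=> h; have {}h : \forall x' \near x, `[0, 1] `<=`
      (fun t => `|q (x', t) (v x t) - q (x, t) (v x t)| <= e / 2).
    apply: h => t0 _; have e4 : 0 < e / 4 by lra.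
    have [[U W] /= [Ux Wt] UW] := qc (x, t0) (e / 4) e4; exists (W, U) => //= -[t x'] /= [Wt' Ux'].
    have := UW (x', t) (conj Ux' Wt') (v x t); have := UW (x, t) (conj (nbhs_singleton Ux) Wt') (v x t).
    rewrite v1 mulr1; have := ler_distD (q (x, t0) (v x t)) (q (x', t) (v x t)) (q (x, t) (v x t)).
    by rewrite (distrC (q (x, t0) _)); lra.
  apply: filterS h => x' h t t01; have := vq t t01.
  have := h t; rewrite /= in_itv/= => /(_ t01).
  by move=> /ler_normlP[]; lra.
have [s hs] := @finite_cover X cX (fun x => (G x)^°) (fun x => nbhs_interior (nG x)).
pose U (i : 'I_(size s)) := (G (tnth (in_tuple s) i))^°.
have [||n [V [oV V1 VU Vm]]] := dimX (U := U).
- by move=> i; exact: open_interior.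
- rewrite -subTset => y _; have [x xs Wxy] := hs y.
  have sx : (index x s < size s)%N by rewrite index_mem.
  exists (Ordinal sx) => //; rewrite /U (tnth_nth x)/= nth_index//.
have [c hc] := choice VU.
exists n, V, (fun j => v (tnth (in_tuple s) (c j))); split=> // [j|j x t Vx t01].
  by have [] := hv (tnth (in_tuple s) (c j)).
by have /interior_subset := hc j x Vx; exact.
Qed.

(** The paths are averaged with a partition of unity, the later of two being turned by a phase.
    Where the weight of the earlier one is at least $1/3$, the phase is fully applied and [n2_lower]
    bounds the squared norm below by $1/4$. Where it is smaller, the later vector dominates and
    [n2_lower'] gives $1/9$. Hence the factor 9. *)
Lemma near_top_strip (N : nat) (q : X * R -> 'cV[R[i]]_N -> R) (e : R) :
  (forall y, qform (q y)) -> qcont q -> 0 < e ->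
  exists v : X * R -> 'cV[R[i]]_N, [/\ mcont v, forall y, n2 (v y) = 1 &
    forall x t, 0 <= t <= 1 -> q (x, t) (v (x, t)) <= e].
Proof.
move=> Q qc e0; have e9 : 0 < e / 9 by lra.
have [n [V [v [oV V1 Vm hv vq]]]] := near_top_cover Q qc e9.
pose D x := \sum_j depth (V j) x; have D0 x : 0 < D x.
  have [j _ Vx] : (\bigcup_j V j) x by rewrite V1.
  rewrite /D (bigD1 j)//= ltr_pwDl ?depth_gt0// sumr_ge0// => k _; exact: depth_ge0.
have cD : continuous D by apply: cR_sum => j _; exact: depth_continuous.
pose rho j x := depth (V j) x / D x.
have crho j : continuous (rho j).
  apply: cR_mul; first exact: depth_continuous.
  by apply: cR_inv => // x; rewrite gt_eqF.
have rho_ge0 j x : 0 <= rho j x by rewrite mulr_ge0 ?invr_ge0 ?depth_ge0// ltW.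
have rho_sum x : \sum_j rho j x = 1 by rewrite -mulr_suml -/(D x) mulfV// gt_eqF.
have rhoV j x : rho j x != 0 -> V j x.
  by move=> r0; apply: contrapT => Vx; move: r0; rewrite /rho depth_out// mul0r eqxx.
have /choice[g hg] (p : 'I_n * 'I_n) : exists g : R * R -> C,
    [/\ continuous g, forall p, complex.Re `|g p : R[i]| = 1, forall t, g (0, t) = 1 :> R[i] &
    forall t, 0 <= t <= 1 -> - (1 / 2) <= complex.Re ((g (1, t) : R[i]) * sf 1%:M (v p.1 t) (v p.2 t))].
  apply: (@unimodular_path R (fun t => sf 1%:M (v p.1 t) (v p.2 t))).
  by apply: sf_continuous; [exact: mcont_cst|exact: (hv p.1).1|exact: (hv p.2).1].
(* The factor 3 completes the phase when [rho i x] reaches $1/3$. At [rho i x = 0] the phase is 1,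
   so members of the cover that do not contain [x] leave no trace. *)
pose G i j x t : R[i] := g (i, j) (clamp (3 * rho i x), t).
pose u (y : X * R) := \sum_j (rho j y.1)%:C *: ((\prod_(i < n | (i < j)%N) G i j y.1 y.2) *: v j y.2).
have cu : mcont u.
  apply: mcont_sum => j _; apply: mcont_scale.
    apply: rtoc_continuous; apply: (comp_continuous (g := rho j)); [exact: fst_continuous|exact: crho].
  apply: (@mcont_scale _ _ _ _ (fun y => \prod_(i < n | (i < j)%N) G i j y.1 y.2)).
    apply: cC_prod => i _.
    apply: (comp_continuous (f := fun y : X * R => (clamp (3 * rho i y.1), y.2)) (g := g (i, j))).
      apply: pair_continuous; last exact: snd_continuous.
      apply: (comp_continuous (f := fun y : X * R => 3 * rho i y.1) (g := @clamp R)).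
        apply: cR_mul; first exact: cR_cst.
        by apply: (comp_continuous (g := rho i)); [exact: fst_continuous|exact: crho].
      exact: clamp_continuous.
    by have [cg _ _ _] := hg (i, j); exact: cg.
  move=> i k; apply: (comp_continuous (g := fun t => v j t i k : C)); first exact: snd_continuous.
  by have [cv _] := hv j; exact: cv.
have G1 i j x t : complex.Re `|G i j x t| = 1 by have [_ h _ _] := hg (i, j); exact: h.
have G0 i j x t : rho i x = 0 -> G i j x t = 1.
  move=> r0; rewrite /G r0 mulr0 clamp_id ?lexx ?ler01//.
  by have [_ _ h _] := hg (i, j); exact: h.
have key x t : 0 <= t <= 1 -> 1 / 9 <= n2 (u (x, t)) /\ q (x, t) (u (x, t)) <= e / 9.
  move=> t01; pose J : {set 'I_n} := [set j | rho j x != 0]%SET.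
  have uJ : u (x, t) = \sum_(j in J) (rho j x)%:C *: ((\prod_(i in J | (i < j)%N) G i j x t) *: v j t).
    rewrite /u/= (bigID [in J])/= [X in _ + X]big1 ?addr0; last first.
      by move=> j; rewrite inE negbK => /eqP->; rewrite scale0r.
    apply: eq_bigr => j _; congr (_ *: (_ *: _)); rewrite (bigID [in J])/=.
    rewrite [X in _ * X]big1 ?mulr1; last by move=> i; rewrite inE negbK => /andP[_ /eqP]; exact: G0.
    by apply: eq_bigl => i; rewrite andbC.
  have sJ : \sum_(j in J) rho j x = 1.
    rewrite -[RHS](rho_sum x) [RHS](bigID [in J])/= [X in _ + X]big1 ?addr0// => j.
    by rewrite inE negbK => /eqP.
  have J2 : (#|J| <= 2)%N by apply: (Vm x) => j; rewrite inE; exact: rhoV.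
  have qv j : j \in J -> q (x, t) (v j t) <= e / 9.
    by rewrite inE => /rhoV Vx; exact: vq.
  have n21 j := (hv j).2 t.
  have [J1|J1] := leqP #|J| 1.
    have /cards1P[j Jj] : #|J| == 1%N.
      rewrite eqn_leq J1 lt0n cards_eq0; apply/eqP => JE.
      by move: sJ; rewrite JE big_set0 => /eqP; rewrite eq_sym oner_eq0.
    move: uJ sJ; rewrite Jj !big_set1 => -> ->.
    rewrite big_pred0 ?scale1r; last by move=> i; rewrite inE; case: eqP => //= ->; rewrite ltnn.
    by rewrite n21; split; [lra|apply: qv; rewrite Jj set11].
  have /cards2P[a [b [ab Jab]]] : #|J| == 2%N by rewrite eqn_leq J2.
  wlog lab : a b ab Jab / (a < b)%N.
    move=> h; move: (ab); rewrite -val_eqE neq_ltn => /orP[|] l; first exact: (h a b).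
    by apply: (h b a) => //; [rewrite eq_sym|rewrite Jab finset.setUC].
  clear J1 J2; clearbody J; subst J.
  have Pa (F : 'I_n -> R[i]) : \prod_(i in [set a; b]%SET | (i < a)%N) F i = 1.
    rewrite big_pred0// => i; rewrite !inE; case: eqP => [->|_]; first by rewrite ltnn.
    by case: eqP => //= ->; rewrite ltnNge ltnW.
  have Pb (F : 'I_n -> R[i]) : \prod_(i in [set a; b]%SET | (i < b)%N) F i = F a.
    rewrite (big_pred1 a)// => i; rewrite !inE; case: eqP => [->//|_].
    by case: eqP => //= ->; rewrite ltnn.
  rewrite uJ; move: sJ; have qa := qv a (set21 a b); have qb := qv b (set22 a b).
  rewrite !big_setU1 ?inE//= !big_set1 Pa Pb scale1r => sJ.
  have ra := rho_ge0 a x; have rb := rho_ge0 b x.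
  have gb : n2 (G a b x t *: v b t) = 1 by rewrite n2Z G1 expr1n mul1r n21.
  split; last first.
    apply: (le_trans (q_conv (Q _) _ _ ra rb)); rewrite (q_hom (Q _)) G1 expr1n mul1r.
    by rewrite sJ mul1r; nra.
  have raE : rho a x = 1 - rho b x by lra.
  rewrite raE; have [h|h] := leP (1 / 3) (rho a x).
    have : 1 / 4 <= n2 ((1 - rho b x)%:C *: v a t + (rho b x)%:C *: (G a b x t *: v b t)).
      apply: n2_lower => //; first by apply/andP; split; lra.
      rewrite sfZr /G (_ : clamp _ = 1); last by rewrite /clamp min_r ?max_r//; lra.
      by have [_ _ _ h2] := hg (a, b); have := h2 t t01; lra.
    by lra.
  have : (1 - 2 * rho b x) ^+ 2 <= n2 ((1 - rho b x)%:C *: v a t + (rho b x)%:C *: (G a b x t *: v b t)).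
    by apply: n2_lower' => //; apply/andP; split; lra.
  by nra.
pose w (y : X * R) := u (y.1, clamp y.2).
have w0 y : 0 < n2 (w y) by have [h _] := key y.1 _ (clamp01 y.2); rewrite /w; lra.
have cw : mcont w.
  move=> i j; apply: (comp_continuous (f := fun y : X * R => (y.1, clamp y.2))
    (g := fun y => u y i j : C)); last exact: cu.
  apply: pair_continuous; first exact: fst_continuous.
  by apply: (comp_continuous (g := @clamp R)); [exact: snd_continuous|exact: clamp_continuous].
exists (fun y => normal_ (w y)); split.
- exact: normal_continuous.
- by move=> y; exact: n2_normal.
move=> x t t01; rewrite q_normal// ler_pdivrMr// /w/= clamp_id//.
by have [] := key x t t01; nra.
Qed.

End NearTopField.

(** All that the rest of the proof takes from the dimension of [X]. It is stated for a general base
    so that it can be passed on to $X\times[0,1]$ times a finite set. *)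
Definition near_top_fields (R : realType) (Y : topologicalType) :=
  forall (N : nat) (q : Y -> 'cV[R[i]]_N -> R), (forall y, qform (q y)) -> qcont q ->
  forall e : R, 0 < e ->
  exists v : Y -> 'cV[R[i]]_N, mcont v /\ forall y, n2 (v y) = 1 /\ q y (v y) <= e.

Section UnitInterval.
Context {R : realType}.
Local Notation I := (`[0, 1 : R]%classic).

Definition mkI (t : R) : I := exist _ (clamp t) (mem_set (A := I) (clamp01 t)).

Lemma set_val_continuous : continuous (set_val : I -> R).
Proof. exact: initial_continuous. Qed.

Lemma mkI_continuous : continuous mkI.
Proof. by apply: continuous_comp_initial; exact: clamp_continuous. Qed.

Lemma set_val01 (t : I) : 0 <= (set_val t : R) <= 1.
Proof. exact: (set_valP t). Qed.

Lemma mkIK (t : I) : mkI (set_val t) = t.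
Proof. by apply: val_inj; rewrite /= clamp_id// set_val01. Qed.

Lemma near_top_interval (X : pseudoMetricType R) (cX : compact [set: X]) :
  covering_dim_le X 1 -> near_top_fields R (X * I)%type.
Proof.
move=> dimX N q Q qc e e0.
have cm : continuous (fun y : X * R => (y.1, mkI y.2)).
  apply: pair_continuous; first exact: fst_continuous.
  by apply: (comp_continuous (g := mkI)); [exact: snd_continuous|exact: mkI_continuous].
have [|v [cv v1 vq]] := near_top_strip cX dimX (q := fun y => q (y.1, mkI y.2)) (fun y => Q _) _ e0.
  by move=> y d d0; have := cm y _ (qc (y.1, mkI y.2) d d0).
exists (fun y => v (y.1, set_val y.2)); split=> [i j|[x t]]; last first.
  by split=> //=; have := vq x _ (set_val01 t); rewrite /= mkIK.
apply: (comp_continuous (f := fun y : X * I => (y.1, set_val y.2)) (g := fun y => v y i j : Cplx R)).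
  apply: pair_continuous; first exact: fst_continuous.
  by apply: (comp_continuous (g := set_val)); [exact: snd_continuous|exact: set_val_continuous].
exact: cv.
Qed.

End UnitInterval.

Lemma near_top_glue (R : realType) (Y : topologicalType) m :
  near_top_fields R Y -> near_top_fields R (Y * discrete_topology 'I_m)%type.
Proof.
move=> h N q Q qc e e0.
have /choice[v hv] (j : 'I_m) : exists v : Y -> 'cV[R[i]]_N, mcont v /\ forall y, n2 (v y) = 1 /\
    q (y, j : discrete_topology 'I_m) (v y) <= e.
  apply: (h N (fun y => q (y, j : discrete_topology 'I_m))) => // y d d0; have := qc (y, j : discrete_topology 'I_m) d d0.
  have cp : continuous (fun y : Y => (y, j : discrete_topology 'I_m)).
    by apply: pair_continuous => [x|x]; [exact: cvg_id|exact: cvg_cst].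
  by move=> h2; exact: (cp y _ h2).
exists (fun z => v z.2 z.1); split=> [i k|[y j]]; last by have [_] := hv j; exact.
by apply: glue_continuous => j /=; have [cv _] := hv j; exact: cv.
Qed.

Lemma le_add_dist (R : realType) (a b c d : R) : a <= c -> `|a - b| <= d -> b <= c + d.
Proof. by move=> ac; rewrite ler_norml => /andP[]; lra. Qed.

Lemma sf_sumr (R : realType) N (T : 'M[R[i]]_N) u (I : finType) (F : I -> 'cV[R[i]]_N) :
  sf T u (\sum_i F i) = \sum_i sf T u (F i).
Proof. by rewrite /sf mulmx_sumr summxE. Qed.

Lemma n2_pyth (R : realType) N (u z : 'cV[R[i]]_N) : sf 1%:M u z = 0 -> n2 (u + z) = n2 u + n2 z.
Proof.
move=> h; rewrite /n2 /qf sfDl !sfDr h (sf_herm u z (adjm1 _)) h conjC0 addr0 add0r.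
by rewrite raddfD.
Qed.

Section Top.
Context {R : realType}.
Local Notation C := (Cplx R).

Lemma cauchy_schwarz N (S : 'M[R[i]]_N) u w (e M : R) : (forall v, 0 <= qf S v) -> adjm S = S ->
  qf S u <= e -> qf S w <= M -> 0 < M -> complex.Re `|sf S u w| ^+ 2 <= e * M.
Proof.
move=> S0 hS Su Sw M0; set s := sf S u w.
(* The minimising multiple of [w], with [qf S w] replaced by its bound [M]. *)
have := S0 (u + ((- M^-1)%:C * s^*%R) *: w).
rewrite /qf !(sfDl, sfDr, sfZl, sfZr) (sf_herm u w hS) -/s.
have -> : ((- M^-1)%:C * s^*%R)^*%R = (- M^-1)%:C * s :> R[i].
  apply: (etrans (rmorphM (@Num.conj _) _ _)); congr (_ * _); last first.
    by first [exact: conjCK|exact: conjcK].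
  exact: conjc_real.
have hs := conj_mul s; have n0 := sqr_ge0 (complex.Re `|s|).
rewrite [X in complex.Re X](_ : _ = sf S u u + ((- M^-1)%:C + (- M^-1)%:C) * (s^*%R * s) +
  (- M^-1)%:C * (- M^-1)%:C * (s^*%R * s) * sf S w w); last by ring.
rewrite hs; move: (complex.Re `|s| ^+ 2) n0 => n n0; move: Su Sw; rewrite /qf.
move: (sf S u u) (sf S w w) => [p p'] [r r'] /= pe rM.
rewrite !(mul0r, mulr0, addr0, subr0).
move: (M^-1) (mulfV (lt0r_neq0 M0)) => k kM h.
have k0 : 0 < k by nra.
have {}h : 0 <= p - 2 * k * n + k ^+ 2 * n * r by lra.
have : k ^+ 2 * n * r <= k ^+ 2 * n * M by rewrite ler_wpM2l// mulr_ge0 ?sqr_ge0.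
have -> : k ^+ 2 * n * M = k * n * (M * k) by ring.
rewrite kM mulr1 => h2; have h3 : k * n <= e by lra.
have -> : n = k * n * M by rewrite mulrAC [k * M]mulrC kM mul1r.
by rewrite ler_wpM2r// ltW.
Qed.

(** With [mu] the supremum of the form over unit vectors, $\mu\|v\|^2-\langle Tv,v\rangle$ is
    positive with infimum 0 on them, which is the situation of [near_top_fields]. *)
Lemma top_form (Y : topologicalType) (N : nat) (T : Y -> 'M[R[i]]_N) :
  near_top_fields R Y -> (0 < N)%N -> mcont T -> (forall y v, 0 <= qf (T y) v) ->
  exists mu : Y -> R, [/\ continuous mu, forall y v, qf (T y) v <= mu y * n2 v,
    forall y (M : R), (forall v, n2 v = 1 -> qf (T y) v <= M) -> mu y <= M &
    forall e : R, 0 < e -> exists v, mcont v /\ forall y, n2 (v y) = 1 /\ mu y - e <= qf (T y) (v y)].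
Proof.
move=> vf N0 cT T0.
pose E y := [set qf (T y) v | v in [set v | n2 v = 1]].
have E0 y : E y !=set0.
  exists (qf (T y) (delta_mx (Ordinal N0) 0)); exists (delta_mx (Ordinal N0) 0) => //=.
  rewrite n2E (bigD1 (Ordinal N0) isT) big1 ?addr0; last first.
    by move=> i /negPf i0; rewrite mxE i0 normr0 (_ : complex.Re 0 = 0)// expr0n.
  by rewrite [LHS]addr0 mxE !eqxx normr1 (_ : complex.Re 1 = 1)// expr1n.
have Eb y : has_ubound (E y).
  exists (\sum_i \sum_j complex.Re `|T y i j|) => _ [v /= v1 <-].
  by rewrite -[leRHS]mulr1 -v1 (le_trans (ler_norm _))// qf_le.
pose mu y := sup (E y).
have muE y v : qf (T y) v <= mu y * n2 v.
  have [/eqP v0|v0] := boolP (n2 v == 0).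
    by have := qf_le (T y) v; rewrite v0 !mulr0 normr_le0 => /eqP->.
  have n0 : 0 < n2 v by rewrite lt_neqAle eq_sym v0 n2_ge0.
  rewrite -ler_pdivrMr// -qf_normal; apply: ub_le_sup => //.
  by exists (normal_ v) => //=; exact: n2_normal.
have mu_le y (M : R) : (forall v, n2 v = 1 -> qf (T y) v <= M) -> mu y <= M.
  by move=> h; apply: ge_sup => // _ [v /= v1 <-]; exact: h.
have mu_adh y (d : R) : 0 < d -> exists2 v, n2 v = 1 & mu y - d < qf (T y) v.
  move=> d0; have [_ [v /= v1 <-] h] := sup_adherent d0 (conj (E0 y) (Eb y)).
  by exists v.
clearbody mu; clear E E0 Eb.
pose D y0 y := \sum_i \sum_j complex.Re `|(T y - T y0) i j|.
have D0 y0 (e : R) : 0 < e -> \forall y \near y0, D y0 y < e.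
  move=> e0; have cD : continuous (D y0).
    apply: cR_sum => i _; apply: cR_sum => j _.
    have h : mcont (fun y => T y - T y0) by apply: mcont_add; [exact: cT|exact: mcont_cst].
    exact: (nrm_continuous (A := C) (f := fun y => (T y - T y0) i j) (h i j)).
  move/real_continuousP: cD => /(_ y0 e e0); apply: filterS => y.
  rewrite [D y0 y0]big1 ?sub0r ?normrN => [/ltr_normlP[]//|i _].
  by rewrite big1// => j _; rewrite subrr mxE normr0.
have TD y0 y v : `|qf (T y) v - qf (T y0) v| <= D y0 y * n2 v by rewrite -qfB qf_le.
clearbody D.
have muD y0 y : `|mu y - mu y0| <= D y0 y.
  have := mu_le y (mu y0 + D y0 y); have := mu_le y0 (mu y + D y0 y).
  move=> h1 h2; have {}h1 : mu y0 <= mu y + D y0 y.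
    apply: h1 => v v1; have := TD y0 y v; have := muE y v; rewrite v1 !mulr1; exact: le_add_dist.
  have {}h2 : mu y <= mu y0 + D y0 y.
    apply: h2 => v v1; have := TD y0 y v; have := muE y0 v; rewrite v1 !mulr1 distrC; exact: le_add_dist.
  by rewrite ler_norml; apply/andP; split; lra.
have cmu : continuous mu.
  apply/real_continuousP => y0 e e0; apply: filterS (D0 y0 e e0) => y.
  by rewrite distrC; exact: le_lt_trans.
exists mu; split=> // e e0.
have [||v [cv hv]] := vf N (fun y v => mu y * n2 v - qf (T y) v) _ _ e e0.
- move=> y; split.
  + by move=> c v; rewrite qfZ n2Z; ring.
  + move=> a b u v a0 b0.
    have F w : mu y * n2 w - qf (T y) w = qf ((mu y)%:C%:M - T y) w by rewrite qfB qfS.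
    rewrite !F; have := qf_par ((mu y)%:C%:M - T y) a b u v.
    have : 0 <= a * b * qf ((mu y)%:C%:M - T y) (u - v).
      by rewrite mulr_ge0 ?mulr_ge0// -F subr_ge0.
    by lra.
  + by move=> d d0; have [v v1 h] := mu_adh y d d0; exists v; rewrite v1 mulr1; split=> //; lra.
- move=> y0 d d0; have d2 : 0 < d / 2 by lra.
  apply: filterS (D0 y0 _ d2) => y Dy v.
  have := TD y0 y v; have := muD y0 y; have := n2_ge0 v; move: Dy.
  move: (D y0 y) (n2 v) (mu y) (mu y0) (qf (T y) v) (qf (T y0) v) => x n m m0 t t0 xd n0 h1 h2.
  have -> : m * n - t - (m0 * n - t0) = (m - m0) * n - (t - t0) by ring.
  apply: (le_trans (ler_normB _ _)); rewrite normrM (ger0_norm n0).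
  by have := ler_wpM2r n0 h1; have := ler_wpM2r n0 (ltW xd); lra.
exists v; split=> // y; have [v1 vq] := hv y; split=> //.
by move: vq; rewrite v1; lra.
Qed.


Section Peel.
Variables (Y : topologicalType) (N : nat) (a : Y -> 'M[R[i]]_N) (M e : R).
Hypotheses (vf : near_top_fields R Y) (ca : mcont a) (ha : forall y, adjm (a y) = a y).
Hypotheses (a1 : forall y v, n2 v <= qf (a y) v) (aM : forall y v, qf (a y) v <= M * n2 v).
Hypotheses (e0 : 0 < e) (e1 : e < 1) (M0 : 0 < M).

(** The induction state: [k] orthonormal fields with decreasing approximate eigenvalues. By the last
    clause [mu i] bounds the form on the complement of the fields up to [i]; through Cauchy-Schwarz
    this makes the off-diagonal entries at most $\sqrt{eM}$. *)
Definition peeled k (v : nat -> Y -> 'cV[R[i]]_N) (mu : nat -> Y -> R) :=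
  [/\ forall i, (i < k)%N -> mcont (v i) /\ continuous (mu i),
   forall i j y, (i < k)%N -> (j < k)%N -> sf 1%:M (v i y) (v j y) = (i == j)%:R,
   forall i y, (i < k)%N -> [/\ 1 <= mu i y, mu i y <= M & `|qf (a y) (v i y) - mu i y| <= e],
   forall i j y, (i <= j)%N -> (j < k)%N -> mu j y <= mu i y &
   forall i y w, (i < k)%N -> (forall j, (j <= i)%N -> sf 1%:M (v j y) w = 0) ->
     qf (a y) w <= mu i y * n2 w /\ (n2 w = 1 -> complex.Re `|sf (a y) (v i y) w| ^+ 2 <= e * M)].

Lemma peel_step k v mu : (k < N)%N -> peeled k v mu ->
  exists v' mu', peeled k.+1 v' mu'.
Proof.
move=> kN [cv vo vmu mumono vtop].
pose Q y : 'M[R[i]]_N := 1%:M - \sum_(i < k) v i y *m adjm (v i y).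
have hQ y : adjm (Q y) = Q y.
  rewrite /Q adjmD adjmN adjm1 adjm_sum; congr (_ - _); apply: eq_bigr => i _.
  by rewrite adjmM adjmK.
have cQ : mcont Q.
  apply: mcont_add; first exact: mcont_cst.
  apply: mcont_opp; apply: mcont_sum => i _; have [cvi _] := cv i (ltn_ord i).
  by apply: mcont_mul; [exact: cvi|exact: mcont_adj].
have QE y w : Q y *m w = w - \sum_(i < k) sf 1%:M (v i y) w *: v i y.
  rewrite mulmxBl mul1mx mulmx_suml; congr (_ - _); apply: eq_bigr => i _.
  rewrite -mulmxA [adjm _ *m w](_ : _ = (sf 1%:M (v i y) w)%:M) ?mul_mx_scalar//.
  by rewrite /sf mulmx1 -mx11_scalar.
have vQ y w i : (i < k)%N -> sf 1%:M (v i y) (Q y *m w) = 0.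
  move=> ik; rewrite QE -scaleN1r sfDr sfZr mulN1r.
  rewrite sf_sumr (bigD1 (Ordinal ik))//= big1 => [|j /negPf ji].
    by rewrite addr0 sfZr vo// eqxx mulr1 subrr.
  by rewrite sfZr vo// eq_sym; move: ji; rewrite -val_eqE/= => ->; rewrite mulr0.
have Qid y w : (forall i, (i < k)%N -> sf 1%:M (v i y) w = 0) -> Q y *m w = w.
  by move=> h; rewrite QE big1 ?subr0// => i _; rewrite h// scale0r.
have QQ y (w : 'cV[R[i]]_N) : Q y *m (Q y *m w) = Q y *m w by apply: Qid => i; exact: vQ.
have n2Q y w : n2 (Q y *m w) <= n2 w.
  have h : sf 1%:M (Q y *m w) (w - Q y *m w) = 0.
    rewrite -{1}[Q y]hQ /sf adjmM adjmK mulmx1 -mulmxA mulmxBr QQ subrr mulmx0 mxE//.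
  by rewrite -[leRHS](congr1 n2 (subrKC (Q y *m w) w)) n2_pyth// lerDl n2_ge0.
pose T y := adjm (Q y) *m a y *m Q y.
have TE y u w : sf (T y) u w = sf (a y) (Q y *m u) (Q y *m w) by rewrite sf_mul.
have TqE y w : qf (T y) w = qf (a y) (Q y *m w) by rewrite /qf TE.
have cT : mcont T.
  by apply: mcont_mul; [apply: mcont_mul; [exact: mcont_adj|exact: ca]|exact: cQ].
have hT y : adjm (T y) = T y by rewrite /T !adjmM adjmK ha mulmxA.
have T0 y w : 0 <= qf (T y) w by rewrite TqE (le_trans _ (a1 _ _))// n2_ge0.
have [mk [cmk mkT mk_le mk_v]] := top_form vf (leq_ltn_trans (leq0n k) kN) cT T0.
have mk1 y : 1 <= mk y.
  have [w w0] : exists w : 'cV[R[i]]_N, Q y *m w != 0.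
    apply: contrapT => /forallNP h.
    have Q0 : Q y = 0.
      apply/matrixP => i j; have /negP := h (delta_mx j 0); rewrite negbK => /eqP/matrixP/(_ i 0).
      by rewrite -colE !mxE.
    (* The projection [Q y] has trace [N - k], which is positive. *)
    have := congr1 mxtrace Q0; rewrite /Q linearB/= mxtrace1 mxtrace0 (big_morph _ (@mxtraceD _ _) (@mxtrace0 _ _)).
    rewrite (eq_bigr (fun=> 1)) => [|i _]; last first.
      rewrite mxtrace_mulC trace_mx11 -[adjm _]mulmx1 -/(sf _ _ _) vo// eqxx//.
    rewrite sumr_const card_ord => /eqP; rewrite subr_eq0 eqr_nat => /eqP NE.
    by move: kN; rewrite NE ltnn.
  have n0 : 0 < n2 (Q y *m w).
    rewrite lt_neqAle n2_ge0 andbT eq_sym; apply: contra w0 => /eqP.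
    rewrite n2E => /eqP; rewrite psumr_eq0 => [/allP h|i _]; last exact: sqr_ge0.
    apply/eqP/matrixP => i j; rewrite ord1 [RHS]mxE; have := h i (mem_index_enum _).
    rewrite sqrf_eq0 => /eqP h2; apply/eqP; rewrite -normr_eq0 -[`|_|]RRe_real ?normr_real//.
    by rewrite h2.
  have := mkT y (Q y *m w); rewrite TqE QQ => h.
  by have := a1 y (Q y *m w); nra.
have mkM y : mk y <= M.
  apply: mk_le => w w1; rewrite TqE (le_trans (aM _ _))// -[leRHS]mulr1 -w1 ler_pM2l//.
have [w [cw hw]] := mk_v e e0.
(* [w] is nearly extremal for the compression [T] but need not lie in the complement of the earlier
   vectors. Its projection does, and is non-zero because [mk y] is at least 1, hence larger than
   [e]. *)
pose u y := Q y *m w y.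
have uE y : qf (a y) (u y) = qf (T y) (w y) by rewrite TqE.
have un y : qf (a y) (u y) <= mk y * n2 (u y) by have := mkT y (u y); rewrite TqE QQ.
have u0 y : 0 < n2 (u y) <= 1.
  have [w1 hwy] := hw y; rewrite -w1 n2Q andbT; have := un y; rewrite uE.
  move=> h; have m1 := mk1 y; have : 0 < mk y * n2 (u y).
    by apply: lt_le_trans h; apply: lt_le_trans hwy; rewrite subr_gt0 (lt_le_trans e1).
  by rewrite pmulr_rgt0// (lt_le_trans ltr01).
pose vk y := normal_ (u y).
have cvk : mcont vk.
  apply: normal_continuous; last by move=> y; have /andP[] := u0 y.
  by apply: mcont_mul; [exact: cQ|exact: cw].
have vk1 y : n2 (vk y) = 1 by apply: n2_normal; have /andP[] := u0 y.
have vk11 y : sf 1%:M (vk y) (vk y) = 1 by rewrite -n2C vk1.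
have vvk y i : (i < k)%N -> sf 1%:M (v i y) (vk y) = 0.
  by move=> ik; rewrite /vk /normal_ sfZr vQ// mulr0.
have vkv y i : (i < k)%N -> sf 1%:M (vk y) (v i y) = 0.
  by move=> ik; rewrite (sf_herm _ _ (adjm1 _)) vvk// conjC0.
have Qvk y : Q y *m vk y = vk y by apply: Qid => i; exact: vvk.
have qvk y : mk y - e <= qf (a y) (vk y) <= mk y.
  rewrite /vk qf_normal; have /andP[n0 n1] := u0 y; have := un y; have [_] := hw y.
  rewrite -uE; move: (qf _ _) (n2 _) n0 n1 (mk1 y) => x n n0 n1 m1 h1 h2.
  rewrite ler_pdivlMr// ler_pdivrMr// h2 andbT; apply: le_trans h1.
  by rewrite ler_piMr// subr_ge0 ltW// (lt_le_trans e1).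
pose v' i := if i == k then vk else v i.
pose mu' i := if i == k then mk else mu i.
have ltk i : (i < k.+1)%N -> i = k \/ (i < k)%N by rewrite ltnS leq_eqVlt => /orP[/eqP|]; [left|right].
have vlt i : (i < k)%N -> v' i = v i by rewrite /v' => h; rewrite ltn_eqF.
have mlt i : (i < k)%N -> mu' i = mu i by rewrite /mu' => h; rewrite ltn_eqF.
have vkk : v' k = vk by rewrite /v' eqxx.
have mkk : mu' k = mk by rewrite /mu' eqxx.
clearbody v' mu'; exists v', mu'; split.
- move=> i /ltk[->|ik]; last by rewrite (vlt _ ik) (mlt _ ik); exact: cv.
  by rewrite vkk mkk; split; [exact: cvk|exact: cmk].
- move=> i j y /ltk[->|ik] /ltk[->|jk]; rewrite ?vkk ?(vlt i)// ?(vlt j)//.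
  + by rewrite eqxx vk11.
  + by rewrite gtn_eqF// vkv.
  + by rewrite ltn_eqF// vvk.
  + exact: vo.
- move=> i y /ltk[->|ik]; last by rewrite vlt// mlt//; exact: vmu.
  rewrite vkk mkk; split=> //; have /andP[h1 h2] := qvk y.
  by rewrite ler_norml; apply/andP; split; lra.
- move=> i j y ij /ltk[jE|jk]; last by rewrite !mlt//; [exact: mumono|exact: leq_ltn_trans jk].
  move: ij; rewrite jE leq_eqVlt => /orP[/eqP->//|ik]; rewrite mkk mlt//.
  apply: mk_le => x x1; rewrite TqE.
  have [|+ _] := vtop i y (Q y *m x) ik; first by move=> j' ji; apply: vQ; exact: leq_ltn_trans ik.
  move/le_trans; apply; have [m1 _ _] := vmu i y ik; have := n2Q y x; rewrite x1.
  by move=> h; rewrite ler_piMr// (le_trans ler01).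
move=> i y x /ltk[->|ik] h; last first.
  rewrite vlt// mlt//; apply: vtop => // j ji; rewrite -vlt; last exact: leq_ltn_trans ik.
  exact: h.
have Qx : Q y *m x = x by apply: Qid => j jk; rewrite -vlt//; apply: h; exact: ltnW.
have xk : sf 1%:M (vk y) x = 0 by rewrite -vkk; exact: h.
have qx : qf (a y) x <= mk y * n2 x by have := mkT y x; rewrite TqE Qx.
rewrite mkk vkk; split=> // x1.
pose S := (mk y)%:C%:M - T y.
have -> : complex.Re `|sf (a y) (vk y) x| = complex.Re `|sf S (vk y) x|.
  by rewrite sfB sfS xk mulr0 sub0r normrN TE Qvk Qx.
apply: cauchy_schwarz => //.
- by move=> z; rewrite /S qfB qfS subr_ge0.
- by rewrite /S adjmD adjmN hT -scalemx1 adjmZ adjm1; congr (_ *: _ - _); exact: conjc_real.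
- by rewrite /S qfB qfS vk1 mulr1 TqE Qvk; have /andP[] := qvk y; lra.
- rewrite /S qfB qfS x1 mulr1 (le_trans _ (mkM y))// lerBlDr lerDl//.
Qed.

Lemma peel k : (k <= N)%N -> exists v mu, peeled k v mu.
Proof.
elim: k => [|k IH] kN; first by exists (fun=> fun=> 0), (fun=> fun=> 0).
by have [v [mu h]] := IH (ltnW kN); exact: peel_step h.
Qed.

End Peel.

Lemma diagonalise (Y : topologicalType) (N : nat) (a : Y -> 'M[R[i]]_N) (M eta : R) :
  near_top_fields R Y -> mcont a -> (forall y, adjm (a y) = a y) ->
  (forall y v, 0 <= qf (a y) v) -> (forall y v, qf (a y) v <= M * n2 v) -> 0 <= M -> 0 < eta ->
  exists (V : Y -> 'M[R[i]]_N) (d : nat -> Y -> R),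
  [/\ mcont V, forall y, adjm (V y) *m V y = 1%:M, forall i, continuous (d i),
   forall i y, 0 <= d i y /\ d i.+1 y <= d i y &
   forall y i j, complex.Re `|(adjm (V y) *m a y *m V y) i j - (d i y)%:C *+ (i == j)| < eta].
Proof.
move=> vf ca ha a0 aM M0 eta0.
pose M' := M + 1; have M'0 : 0 < M' by rewrite /M'; lra.
(* [e] bounds the diagonal error, and [e * M'] the square of the off-diagonal one. *)
have [e [e0 e1 ee eM]] : exists e : R, [/\ 0 < e, e < 1, e < eta & e * M' < eta ^+ 2].
  pose h := Num.min eta 1 / 2; have h0 : 0 < h by rewrite divr_gt0// lt_min eta0 ltr01.
  have h1 : h <= 1 / 2 by rewrite ler_pM2r ?invr_gt0// ge_min lexx orbT.
  have h2 : h <= eta / 2 by rewrite ler_pM2r ?invr_gt0// ge_min lexx.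
  have k0 : 0 < M' + 1 by lra.
  exists (h ^+ 2 / (M' + 1)); have hk : h ^+ 2 / (M' + 1) * (M' + 1) = h ^+ 2 by rewrite divfK// gt_eqF.
  have : 0 < h ^+ 2 / (M' + 1) by rewrite divr_gt0 ?exprn_gt0.
  by move: (h ^+ 2 / _) hk => x hk x0; split=> //; nra.
(* The shift keeps every extremal value above [e], as the peeling requires; between orthogonal
   vectors it changes nothing. *)
pose b y := a y + 1%:M.
have bqf y v : qf (b y) v = qf (a y) v + n2 v by rewrite qfD.
have [||||v [mu [cv vo vmu mumono vtop]]] := @peel Y N b M' e vf _ _ _ _ e0 e1 M'0 N (leqnn N).
- by apply: mcont_add; [exact: ca|exact: mcont_cst].
- by move=> y; rewrite /b adjmD ha adjm1.
- by move=> y v; rewrite bqf lerDr.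
- by move=> y v; rewrite bqf /M' mulrDl mul1r lerD2r.
have sfab y i j : (i < N)%N -> (j < N)%N -> i != j -> sf (a y) (v i y) (v j y) = sf (b y) (v i y) (v j y).
  by move=> iN jN /negPf ij; rewrite /b sfD vo// ij addr0.
have off y i j : (i < N)%N -> (j < N)%N -> (i < j)%N -> complex.Re `|sf (a y) (v i y) (v j y)| < eta.
  move=> iN jN ij; rewrite sfab ?ltn_eqF//.
  have [|_] := vtop i y (v j y) iN.
    by move=> l li; rewrite vo// ?ltn_eqF//; [exact: leq_ltn_trans ij|exact: leq_ltn_trans iN].
  have n1 : n2 (v j y) = 1 by rewrite /n2 /qf vo// eqxx.
  move=> /(_ n1) h; rewrite -(ltr_pXn2r (n := 2)) ?nnegrE ?(ltW eta0)//.
    exact: le_lt_trans eM.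
  by rewrite -ler0c RRe_real ?normr_real.
pose W y : 'M[R[i]]_N := \matrix_(i, j) v j y i 0.
have entry (A : 'M[R[i]]_N) y (i j : 'I_N) :
    (adjm (W y) *m A *m W y) i j = sf A (v i y) (v j y).
  rewrite sfE exchange_big/= mxE; apply: eq_bigr => l _; rewrite mxE mxE mulr_suml.
  by apply: eq_bigr => m _; rewrite adjmE mxE.
exists W, (fun i y => if (i < N)%N then mu i y - 1 else 0).
split.
- by move=> i j; under eq_fun do rewrite mxE; have [h _] := cv j (ltn_ord j); exact: h.
- move=> y; apply/matrixP => i j; rewrite -[X in X *m _]mulmx1 entry.
  by rewrite vo// mxE.
- move=> i; case: (ltnP i N) => iN; last exact: cR_cst.
  by have [_ h] := cv i iN; apply: cR_sub; [exact: h|exact: cR_cst].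
- move=> i y; case: (ltnP i N) => iN; last by rewrite ltnNge (leq_trans iN).
  have [m1 _ _] := vmu i y iN; split; first by rewrite subr_ge0.
  case: (ltnP i.+1 N) => iN'; last by rewrite subr_ge0.
  by rewrite lerB//; exact: mumono.
move=> y i j; rewrite entry ltn_ord; have [<-|ij] := eqVneq i j; last first.
  rewrite mulr0n subr0; move: (ij); rewrite -val_eqE neq_ltn => /orP[] l; first exact: off.
  by rewrite (sf_herm _ _ (ha y)) norm_conjC; exact: off.
have [_ _ h] := vmu i y (ltn_ord i).
have rl : sf (a y) (v i y) (v i y) = (qf (a y) (v i y))%:C.
  rewrite /qf RRe_real//; apply/CrealP; exact: esym (sf_herm _ _ (ha y)).
have n1 : n2 (v i y) = 1 by rewrite /n2 /qf vo// eqxx.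
rewrite rl mulr1n -rmorphB Re_norm_real.
have := bqf y (v i y); rewrite n1; move: h; move: (qf _ _) (qf _ _) => p q h qE.
rewrite (_ : p - (mu i y - 1) = q - mu i y); last by rewrite qE; ring.
exact: le_lt_trans ee.
Qed.

End Top.

(** * Cuntz comparison by ranks *)

Lemma compact_uniform (Z : topologicalType) (cZ : compact [set: Z]) (P : nat -> Z -> Prop) :
  (forall z0 : Z, exists N, \forall z \near z0, forall n, (N <= n)%N -> P n z) ->
  exists N, forall n z, (N <= n)%N -> P n z.
Proof.
move=> h; have /compact_near_coveringP/(_ _ \oo P _) := cZ.
have hh : forall x, [set: Z] x -> \forall x' \near x & i \near \oo, P i x'.
  move=> z0 _; have [N hN] := h z0.
  exists ([set z | forall n, (N <= n)%N -> P n z], [set n | (N <= n)%N]) => /=.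
    by split; [exact: hN|exists N].
  by move=> [z n] /= [hz Nn]; exact: hz.
by move=> /(_ hh)[N _ hN]; exists N => n z Nn; exact: (hN n Nn z I).
Qed.

(* [x] is the real part of [u := x + 'i *: y], and [u^* u = x^2 + y^2]. *)
Lemma nrm_real_part (R : realType) (K : cstarType R) (x y : K) (c : R) : cadj x = x -> cadj y = y ->
  cmul x y = cmul y x -> 0 <= c -> nrm (cmul x x + cmul y y) <= c ^+ 2 -> nrm x <= c.
Proof.
move=> xa ya xy c0 h; pose u := x + 'i *: y.
have ua : cadj u = x - 'i *: y by rewrite /u cadjD cadjZ xa ya conjCi scaleNr.
have uu : cmul (cadj u) u = cmul x x + cmul y y.
  rewrite ua /u cmulDr !cmulBl !cmulZl !cmulZr scalerA -expr2 sqrCi scaleN1r opprK xy.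
  by rewrite addrA subrK.
have uc : nrm u <= c.
  by rewrite -(ler_pXn2r (n := 2)) ?nnegrE ?nrm_ge0// -nrm_cstar uu.
have -> : x = (2^-1)%:C *: (u + cadj u).
  rewrite ua /u addrACA subrr addr0 -[x + x]mulr2n -[x *+ 2]scaler_nat scalerA.
  rewrite (_ : _ * _ = 1) ?scale1r//.
  rewrite (_ : (2%:R : R[i]) = (2%:R)%:C); last by rewrite rmorph_nat.
  by rewrite -rmorphM mulVf// pnatr_eq0.
rewrite nrmZ Re_norm_real ger0_norm ?invr_ge0//.
have := nrmD u (cadj u); rewrite nrm_cadj.
by move: (nrm u) (nrm (u + _)) uc => s t; lra.
Qed.

Lemma four_dist (R : realType) (K : cstarType R) (p q v w a : K) (e : R) :
  nrm (p - q) <= e -> nrm (q - v) <= e -> nrm (w - v) <= e -> nrm (w - a) <= e ->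
  nrm (p - a) <= 4 * e.
Proof.
move=> h1 h2 h3 h4; have := nrm_dist p q a; have := nrm_dist q v a; have := nrm_dist v w a.
rewrite nrm_distC in h3; move: h1 h2 h3 h4.
move: (nrm (p - q)) (nrm (q - v)) (nrm (v - w)) (nrm (w - a)) (nrm (p - a)) (nrm (q - a)) (nrm (v - a)).
by move=> *; lra.
Qed.

Section Diagonal.
Context {R : realType} {Z : topologicalType} {cZ : compact [set: Z]}.
Local Notation CZ := (Cfun cZ (Cplx R)).
Variable S : stabilization CZ.
Local Notation E := (mxu S).
Implicit Types (a b x y U : S) (f g d : nat -> Z -> R).

Definition is_cut n x := cmul (Pn S n) x = x /\ cmul x (Pn S n) = x.

Lemma cut_ext n x y : is_cut n x -> is_cut n y -> (forall z, mt n n x z = mt n n y z) -> x = y.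
Proof.
move=> [x1 x2] [y1 y2] xy.
have -> : x = cutn n x by rewrite /cutn x1 x2.
have -> : y = cutn n y by rewrite /cutn y1 y2.
rewrite !cutnE; apply: eq_bigr => i _; apply: eq_bigr => j _; congr (E _ _ _).
by apply: CfunP => z; have /matrixP/(_ i j) := xy z; rewrite !mxE.
Qed.

Lemma is_cut_mul n x y : is_cut n x -> is_cut n y -> is_cut n (cmul x y).
Proof. by move=> [x1 _] [_ y2]; split; [rewrite cmulA x1|rewrite -cmulA y2]. Qed.

Lemma is_cut_add n x y : is_cut n x -> is_cut n y -> is_cut n (x + y).
Proof. by move=> [x1 x2] [y1 y2]; split; rewrite ?cmulDl ?cmulDr ?x1 ?y1 ?x2 ?y2. Qed.

Lemma is_cutZ n (c : R[i]) x : is_cut n x -> is_cut n (c *: x).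
Proof. by move=> [x1 x2]; split; rewrite ?cmulZl ?cmulZr ?x1 ?x2. Qed.

Lemma is_cut_adj n x : is_cut n x -> is_cut n (cadj x).
Proof. by move=> [x1 x2]; split; rewrite -[Pn S n]Pn_adj -cadjM ?x1 ?x2. Qed.

Lemma is_cut_Pn n : is_cut n (Pn S n).
Proof. by split; exact: PnPn. Qed.

Lemma is_cut_mxu n i j h : (i < n)%N -> (j < n)%N -> is_cut n (E i j h).
Proof. by move=> i1 j1; split; rewrite ?Pn_mxu ?mxu_Pn ?i1 ?j1. Qed.

Lemma is_cut_sum n (I : Type) (r : seq I) (P : pred I) (F : I -> S) :
  (forall k, P k -> is_cut n (F k)) -> is_cut n (\sum_(k <- r | P k) F k).
Proof.
move=> h; apply: big_ind => //; last exact: is_cut_add.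
by split; rewrite ?cmul0r ?cmul0l.
Qed.

Lemma is_cut_cutn n a : is_cut n (cutn n a).
Proof. by split; rewrite /cutn ?cmulA ?PnPn// -!cmulA PnPn. Qed.

Lemma mt_mul n x y z : is_cut n y -> mt n n (cmul x y) z = mt n n x z *m mt n n y z.
Proof. by move=> [y1 _]; rewrite -mt_PnM y1. Qed.

Lemma mtB_coef m n x y z i j : mt m n (x - y) z i j = mt m n x z i j - mt m n y z i j.
Proof. by rewrite mtB mxE [X in _ + X = _]mxE. Qed.

Lemma mt_adj m n x z : mt m n (cadj x) z = adjm (mt n m x z).
Proof. by apply/matrixP => i j; rewrite adjmE !mxE ent_adj. Qed.

Lemma mt_msum n (F : 'I_n -> 'I_n -> CZ) z i j :
  mt n n (\sum_(i < n) \sum_(j < n) E i j (F i j)) z i j = cev z (F i j).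
Proof.
rewrite mxE ent_sum cev_sum (bigD1 i)//=.
rewrite ent_sum cev_sum (bigD1 j)//=.
rewrite ent_mxu !eqxx !big1 ?addr0// => [k ki|k kj].
  rewrite ent_sum cev_sum big1// => l _; rewrite ent_mxu.
  by rewrite (_ : (i == k :> nat) = false)//; apply: contraNF ki => /eqP h; apply/eqP/val_inj.
rewrite ent_mxu eqxx/= (_ : (k == j :> nat) = false)//.
by apply: contraNF kj => /eqP h; apply/eqP/val_inj.
Qed.

Lemma mt_cutn n a z : mt n n (cutn n a) z = mt n n a z.
Proof. by apply/matrixP => i j; rewrite cutnE mt_msum mxE. Qed.

Lemma mt_mcont m n a : mcont (mt m n a).
Proof. by move=> i j; under eq_fun do rewrite mxE; exact: cev_continuous. Qed.

Definition mel n (V : Z -> 'M[R[i]]_n) : S :=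
  \sum_(i < n) \sum_(j < n) E i j (mkf (fun z => V z i j : Cplx R)).

Lemma is_cut_mel n V : is_cut n (mel (n := n) V).
Proof. by apply: is_cut_sum => i _; apply: is_cut_sum => j _; exact: is_cut_mxu. Qed.

Lemma mt_mel n V z : mcont V -> mt n n (mel V) z = V z.
Proof.
move=> cV; apply/matrixP => i j.
by rewrite mt_msum mkfE; last exact: cV.
Qed.

Lemma nrm_cut_le n x (c : R) : 0 <= c -> is_cut n x ->
  (forall z i j, complex.Re `|mt n n x z i j| <= c) -> nrm x <= (n * n)%:R * c.
Proof.
move=> c0 [x1 x2] h; have -> : x = cutn n x by rewrite /cutn x1 x2.
rewrite cutnE; apply: (le_trans (nrm_sum _ _ _)).
have -> : (n * n)%:R * c = \sum_(i < n) \sum_(j < n) c.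
  by rewrite !sumr_const !card_ord -mulrnA mulr_natl.
apply: ler_sum => i _; apply: (le_trans (nrm_sum _ _ _)); apply: ler_sum => j _.
rewrite mxu_isometry; apply: nrm_Cfun_le => // z.
by have := h z i j; rewrite mxE.
Qed.

(* A [Variant], because unfolding continuity makes [done] diverge. *)
Variant fcont f : Prop := Fcont of forall i, continuous (f i).

Lemma fcontP f i : fcont f -> continuous (f i).
Proof. by case=> cf; exact: cf. Qed.

Lemma fcont_mul f g : fcont f -> fcont g -> fcont (fun i z => f i z * g i z).
Proof. by case=> cf [cg]; split=> i; apply: cR_mul; [exact: cf|exact: cg]. Qed.

Lemma fcont_sub f g : fcont f -> fcont g -> fcont (fun i z => f i z - g i z).
Proof. by case=> cf [cg]; split=> i; apply: cR_sub; [exact: cf|exact: cg]. Qed.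

Lemma fcont_cst (c : R) : fcont (fun _ _ => c).
Proof. by split=> i; exact: cR_cst. Qed.

Definition dg n f : S := \sum_(i < n) E i i (rcf (f i)).

Lemma is_cut_dg n f : is_cut n (dg n f).
Proof. by apply: is_cut_sum => i _; exact: is_cut_mxu. Qed.

Lemma ent_dg n f p q : ent (dg n f) p q = if (p == q) && (p < n)%N then rcf (f p) else 0.
Proof.
rewrite /dg ent_sum; case: (ltnP p n) => pn; last first.
  rewrite andbF big1// => k' _; rewrite ent_mxu (_ : (p == k' :> nat) = false)//.
  by apply/negbTE/eqP => h; move: pn; rewrite h leqNgt ltn_ord.
rewrite andbT (bigD1 (Ordinal pn) isT) big1; last first.
  move=> k' /negPf kk; rewrite ent_mxu (_ : (p == k' :> nat) = false)//; apply: contraFF kk => /eqP h.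
  by apply/eqP/val_inj.
by rewrite [LHS]addr0 ent_mxu eqxx eq_sym.
Qed.

Lemma rcf_add (h k : Z -> R) : continuous h -> continuous k ->
  rcf (cZ := cZ) h + rcf k = rcf (fun z => h z + k z).
Proof.
move=> ch ck; apply: CfunP => z.
have e1 : cev z (rcf (cZ := cZ) h) = (h z)%:C :> R[i] by exact: rcfE.
have e2 : cev z (rcf (cZ := cZ) k) = (k z)%:C :> R[i] by exact: rcfE.
have e3 : cev z (rcf (cZ := cZ) (fun z => h z + k z)) = (h z + k z)%:C :> R[i].
  by apply: rcfE; exact: cR_add.
rewrite e3; apply: (etrans (congr2 (fun a b : R[i] => a + b) e1 e2)).
exact/esym/(rmorphD (real_complex R)).
Qed.

Lemma rcf_mul (h k : Z -> R) : continuous h -> continuous k ->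
  cmul (rcf (cZ := cZ) h) (rcf k) = rcf (fun z => h z * k z).
Proof.
move=> ch ck; apply: CfunP => z.
have e1 : cev z (rcf (cZ := cZ) h) = (h z)%:C :> R[i] by exact: rcfE.
have e2 : cev z (rcf (cZ := cZ) k) = (k z)%:C :> R[i] by exact: rcfE.
have e3 : cev z (rcf (cZ := cZ) (fun z => h z * k z)) = (h z * k z)%:C :> R[i].
  by apply: rcfE; exact: cR_mul.
rewrite e3; apply: (etrans (congr2 (fun a b : R[i] => a * b) e1 e2)).
exact/esym/(rmorphM (real_complex R)).
Qed.

Lemma dg_mul n f g : fcont f -> fcont g ->
  cmul (dg n f) (dg n g) = dg n (fun i z => f i z * g i z).
Proof.
move=> cf cg; rewrite /dg cmul_suml; apply: eq_bigr => i _.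
rewrite cmul_sumr (bigD1 i) 1?big1 => [|j /negPf ji|//].
  by rewrite [LHS]addr0 mxu_mul eqxx rcf_mul; [|exact: (@fcontP _ _ cf)|exact: (@fcontP _ _ cg)].
by rewrite mxu_mul -[(i == j :> nat)]/(i == j) eq_sym ji.
Qed.

Lemma dg_add n f g : fcont f -> fcont g ->
  dg n f + dg n g = dg n (fun i z => f i z + g i z).
Proof.
move=> cf cg; rewrite /dg -big_split; apply: eq_bigr => i _ /=; rewrite -mxuD; congr (E _ _ _).
by apply: rcf_add; [exact: (@fcontP _ _ cf)|exact: (@fcontP _ _ cg)].
Qed.

Lemma dg_sub n f g : fcont f -> fcont g ->
  dg n f - dg n g = dg n (fun i z => f i z - g i z).
Proof.
move=> cf cg; apply/eqP; rewrite subr_eq dg_add; [|exact: fcont_sub|by []].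
by apply/eqP; congr (dg n); apply/funext => i; apply/funext => z; rewrite subrK.
Qed.

Lemma dg_adj n f : fcont f -> cadj (dg n f) = dg n f.
Proof.
move=> cf; rewrite /dg cadj_sum; apply: eq_bigr => i _; rewrite mxu_adj; congr (E _ _ _).
by apply: CfunP => z; rewrite cev_adj rcfE; [exact: conjc_real|exact: (@fcontP _ _ cf)].
Qed.

Lemma dg_cst n (c : R) : dg n (fun _ _ => c) = c%:C *: Pn S n.
Proof.
rewrite /dg /Pn scaler_sumr; apply: eq_bigr => i _; rewrite -mxuZ; congr (E _ _ _).
by apply: CfunP => z; rewrite cevZ cev1 rcfE; [rewrite [RHS]mulr1|exact: cR_cst].
Qed.

Lemma eq_dg n f g : (forall i z, (i < n)%N -> f i z = g i z) -> dg n f = dg n g.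
Proof.
move=> fg; apply: eq_bigr => i _; congr (E _ _ (mkf _)); apply/funext => z.
by rewrite fg.
Qed.

Lemma dg_pad n m f : (n <= m)%N -> (forall i z, (n <= i)%N -> f i z = 0) -> dg m f = dg n f.
Proof.
move=> nm f0; rewrite /dg (big_ord_widen _ (fun i => E i i (rcf (f i))) nm) [RHS]big_mkcond.
apply: eq_bigr => i _; case: ltnP => // ni.
rewrite (_ : rcf (f i) = 0) ?mxu0//; apply: CfunP => z.
have -> : f i = fun=> 0 by apply/funext => w; exact: f0.
by rewrite rcfE; [|exact: cR_cst].
Qed.

Lemma dg0 f : dg 0 f = 0.
Proof. exact: big_ord0. Qed.

Lemma dgS n f : dg n.+1 f = dg n f + E n n (rcf (f n)).
Proof. exact: big_ord_recr. Qed.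

Opaque dg.

Lemma mt_dg k l n f z (i : 'I_k) (j : 'I_l) : fcont f ->
  mt k l (dg n f) z i j = if (i == j :> nat) && (i < n)%N then (f i z)%:C else 0.
Proof. by move=> cf; rewrite mxE ent_dg; case: ifP => // _; rewrite rcfE; last exact: (@fcontP _ _ cf). Qed.

(* [dg f] is the real part of [c] times a partial unitary. *)
Lemma nrm_dg n f (c : R) : fcont f -> 0 <= c ->
  (forall i z, `|f i z| <= c) -> nrm (dg n f) <= c.
Proof.
move=> cf c0 fc; pose g i z : R := Num.sqrt (c ^+ 2 - f i z ^+ 2).
have cg : fcont g.
  split=> i; apply: cR_sqrt; apply: cR_sub; first exact: cR_cst.
  by apply: cR_mul; exact: (@fcontP _ _ cf).
have fg i z : f i z * f i z + g i z * g i z = c ^+ 2.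
  rewrite -!expr2 sqr_sqrtr ?subrKC// subr_ge0 -[f i z ^+ 2]real_normK ?num_real//.
  by rewrite lerXn2r ?nnegrE.
have fgC i z : (i < n)%N -> f i z * g i z = g i z * f i z by move=> _; exact: mulrC.
apply: (nrm_real_part (y := dg n g) (dg_adj n cf) (dg_adj n cg) _ c0).
  exact: (etrans (dg_mul n cf cg) (etrans (eq_dg fgC) (esym (dg_mul n cg cf)))).
have fgc i z : (i < n)%N -> f i z * f i z + g i z * g i z = c ^+ 2 by move=> _; exact: fg.
have -> : cmul (dg n f) (dg n f) + cmul (dg n g) (dg n g) = (c ^+ 2)%:C *: Pn S n.
  apply: (etrans (congr2 +%R (dg_mul n cf cf) (dg_mul n cg cg))).
  apply: (etrans (dg_add n (fcont_mul cf cf) (fcont_mul cg cg))).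
  exact: (etrans (eq_dg fgc) (dg_cst n (c ^+ 2))).
rewrite nrmZ Re_norm_real ger0_norm ?sqr_ge0//.
by rewrite ler_piMr ?sqr_ge0// nrm_Pn.
Qed.

Definition uni n U := [/\ is_cut n U, cmul (cadj U) U = Pn S n & cmul U (cadj U) = Pn S n].

Lemma nrm_uni n U : uni n U -> nrm U <= 1.
Proof.
move=> [_ h _]; rewrite -(ler_pXn2r (n := 2)) ?nnegrE ?nrm_ge0// -nrm_cstar h expr1n.
exact: nrm_Pn.
Qed.

(** The factor [c] is in general an infinite matrix; truncating it to [m] rows gives Gram matrices,
    which converge to the given one. *)
Lemma mt_psd n a z v : cpositive a -> 0 <= qf (mt n n a z) v.
Proof.
move=> [c ->]; rewrite leNgt; apply/negP => q0.
pose K := (n * n)%:R * n2 v + 1.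
have K0 : 0 < K by rewrite ltr_wpDl// mulr_ge0// n2_ge0.
have e0 : 0 < - qf (mt n n (cmul (cadj c) c) z) v / K by rewrite divr_gt0// oppr_gt0.
have cc : ccvg (fun m => cmul (cadj c) (cmul (Pn S m) c)) (cmul (cadj c) c).
  apply: ccvgM; first exact: ccvg_cst.
  move=> e' e'0; have e2 : 0 < e' / 2 by lra.
  have [N hN] := cutn_cvg c e2; exists N => m Nm; have := hN m Nm.
  have h : cmul (Pn S m) (c - cutn m c) = cmul (Pn S m) c - cutn m c.
    by rewrite cmulBr (is_cut_cutn m c).1.
  have := nrm_dist (cmul (Pn S m) c) (cutn m c) c; rewrite -h.
  have := nrmM (Pn S m) (c - cutn m c); have := nrm_Pn S m; have := nrm_ge0 (c - cutn m c).
  rewrite (nrm_distC (cutn m c) c).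
  move: (nrm (Pn S m)) (nrm (c - cutn m c)) (nrm (cmul _ _)) (nrm (_ - c)) => x1 x2 x3 x4.
  by nra.
have [N /(_ N (leqnn N)) hN] := cc _ e0.
set y := cmul _ (cmul (Pn S N) c) in hN.
have : 0 <= qf (mt n n y z) v.
  rewrite mt_PnM mt_adj.
  have : 0 <= n2 (mt N n c z *m v) by exact: n2_ge0.
  by rewrite /n2 /qf /sf adjmM mulmx1 !mulmxA.
rewrite leNgt => /negP; apply.
have := qf_le (mt n n y z - mt n n (cmul (cadj c) c) z) v; rewrite qfB -mtB.
have : \sum_(i < n) \sum_(j < n) complex.Re `|mt n n (y - cmul (cadj c) c) z i j| <=
    (n * n)%:R * nrm (y - cmul (cadj c) c).
  have -> : (n * n)%:R * nrm (y - cmul (cadj c) c) = \sum_(i < n) \sum_(j < n) nrm (y - cmul (cadj c) c).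
    by rewrite !sumr_const !card_ord -mulrnA mulr_natl.
  by apply: ler_sum => i _; apply: ler_sum => j _; exact: mt_le.
move: (\sum_(i < n) _) => s; move: hN; rewrite ltr_pdivlMr//.
have := n2_ge0 v; have := nrm_ge0 (y - cmul (cadj c) c); rewrite /K.
move: (nrm _) (n2 v) (qf _ v) (qf _ v) ((n * n)%:R : R) => t m q1 q2 nn t0 m0 h1 h2.
move=> /ler_normlP[_ h3].
have h4 : s * m <= nn * t * m by rewrite ler_wpM2r.
lra.
Qed.

Lemma cpositive_adj a : cpositive a -> cadj a = a.
Proof. by move=> [c ->]; rewrite cadjM cadjK. Qed.


Lemma uni_pad n U : uni n U -> cmul (Pn S n) U = U /\ cmul U (Pn S n) = U.
Proof. by case=> -[]. Qed.

Lemma nrm_sand x y w (s t : R) : nrm x <= s -> nrm w <= t ->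
  nrm (cmul (cmul x y) w) <= s * t * nrm y.
Proof.
move=> xs wt; apply: (le_trans (nrmM _ _)).
have := nrmM x y; have := nrm_ge0 x; have := nrm_ge0 y; have := nrm_ge0 w; have := nrm_ge0 (cmul x y).
move: xs wt; move: (nrm (cmul x y)) (nrm x) (nrm y) (nrm w) => c p q r ps rt c0 r0 q0 p0 h.
have h1 : c * r <= p * q * r by rewrite ler_wpM2r.
have h2 : p * q * r <= s * q * r by rewrite ler_wpM2r// ler_wpM2r.
have h3 : s * q * r <= s * q * t by rewrite ler_wpM2l// mulr_ge0// (le_trans p0).
lra.
Qed.

Lemma uni_sand n U x : uni n U -> is_cut n x ->
  cmul (cmul (cadj U) (cmul (cmul U x) (cadj U))) U = x.
Proof.
move=> [_ h1 _] [x1 x2]; rewrite !cmulA h1 x1 -!cmulA h1 x2//.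
Qed.

Lemma uni_sand' n U x : uni n U -> is_cut n x ->
  cmul (cmul U (cmul (cmul (cadj U) x) U)) (cadj U) = x.
Proof.
move=> [_ _ h1] [x1 x2]; rewrite !cmulA h1 x1 -!cmulA h1 x2//.
Qed.

(** The eigenvalues are listed in decreasing order, so that [d k z] alone decides whether the rank
    of the diagonal matrix exceeds [k]. *)
Definition spectral n U d :=
  [/\ uni n U, fcont d & forall i z, 0 <= d i z /\ d i.+1 z <= d i z].

Lemma spectral_le n U d i j z : spectral n U d -> (i <= j)%N -> d j z <= d i z.
Proof.
move=> [_ _ h]; elim: j => [|j IH]; first by rewrite leqn0 => /eqP->.
by rewrite leq_eqVlt => /orP[/eqP->//|/IH]; apply: le_trans; have [] := h j z.
Qed.

Hypothesis nt : near_top_fields R Z.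

Lemma approx_diag a n (e : R) : cpositive a -> 0 < e -> exists U d, spectral n U d /\
  nrm (cutn n a - cmul (cmul U (dg n d)) (cadj U)) < e.
Proof.
move=> pa e0.
pose k : R := (n * n)%:R; have k0 : 0 <= k by rewrite ler0n.
have eta0 : 0 < e / (k + 1) by rewrite divr_gt0// ltr_wpDl.
pose M := (n * n)%:R * nrm a.
have [|||||V [d [cV VV cd hd hV]]] := @diagonalise R Z n (mt n n a) M _ nt _ _ _ _ _ eta0.
- exact: mt_mcont.
- by move=> z; rewrite -mt_adj cpositive_adj.
- by move=> z v; exact: mt_psd.
- move=> z v; apply: (le_trans (ler_norm _)); apply: (le_trans (qf_le _ _)).
  rewrite ler_wpM2r ?n2_ge0// /M.
  have -> : (n * n)%:R * nrm a = \sum_(i < n) \sum_(j < n) nrm a.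
    by rewrite !sumr_const !card_ord -mulrnA mulr_natl.
  by apply: ler_sum => i _; apply: ler_sum => j _; exact: mt_le.
- by rewrite mulr_ge0// nrm_ge0.
pose U := mel V; have cU : is_cut n U by exact: is_cut_mel.
have cUa := is_cut_adj cU.
have mU z : mt n n U z = V z by exact: mt_mel.
have mP z : mt n n (Pn S n) z = 1%:M.
  apply/matrixP => i j; rewrite -[Pn S n]scale1r -dg_cst (mt_dg n z i j (fcont_cst 1)).
  by rewrite ltn_ord andbT !mxE -val_eqE; case: eqP.
have uU : uni n U.
  split=> //; (apply: (@cut_ext n); [exact: is_cut_mul|exact: is_cut_Pn|]) => z.
    by rewrite mt_mul// mt_adj mU VV mP.
  by rewrite mt_mul// mt_adj mU mP; apply: mulmx1C.
have cd' : fcont d by split.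
exists U, d; split; first by split.
pose w := cmul (cmul (cadj U) (cutn n a)) U - dg n d.
have cw : is_cut n w.
  rewrite /w -scaleN1r; apply: is_cut_add; last by apply: is_cutZ; exact: is_cut_dg.
  by do 2![apply: is_cut_mul => //]; exact: is_cut_cutn.
have -> : cutn n a - cmul (cmul U (dg n d)) (cadj U) = cmul (cmul U w) (cadj U).
  rewrite /w cmulBr cmulBl; congr (_ - _); rewrite (uni_sand' (n := n))//; exact: is_cut_cutn.
have nU := nrm_uni uU.
apply: (le_lt_trans (nrm_sand (s := 1) (t := 1) w nU _)); first by rewrite nrm_cadj.
rewrite !mul1r; apply: (le_lt_trans (nrm_cut_le (ltW eta0) cw _)).
  move=> z i j; have h := hV z i j.
  rewrite /w mtB mxE [X in complex.Re `|_ + X|]mxE (mt_dg n z i j cd') ltn_ord andbT.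
  rewrite mt_mul// mt_mul; last exact: is_cut_cutn.
  rewrite mt_adj mU mt_cutn ltW//; move: h; rewrite -[(i == j :> nat)]/(i == j).
  by case: eqP.
by rewrite -/k mulrA ltr_pdivrMr ?ltr_wpDl// [k * e]mulrC ltr_pM2l// ltrDl.
Qed.

(** An inverse of [d], truncated at $1/e$, turns the diagonal approximant into the identity on the
    first [k.+1] entries. This multiplies the error by at most $1/e$, and $1/(n+1)\le 1/(k+2)$. *)
Lemma rk_spectral a n U d (e : R) z k : spectral n U d -> 0 < e -> (k < n)%N -> e <= d k z ->
  nrm (cutn n a - cmul (cmul U (dg n d)) (cadj U)) < e / n.+1%:R -> rk a z k.+1.
Proof.
move=> sp e0 kn ek h; have [uU cd hd] := sp; have [PU UP] := uni_pad uU.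
pose f i z := (Num.max (d i z) e)^-1.
have m0 i z' : 0 < Num.max (d i z') e by rewrite lt_max e0 orbT.
have cf : fcont f.
  split=> i; apply: cR_inv; first by move=> z'; rewrite gt_eqF.
  by apply: cR_max; [exact: (@fcontP _ _ cd)|exact: cR_cst].
have nf : nrm (dg n f) <= e^-1.
  apply: nrm_dg => //; first by rewrite invr_ge0 ltW.
  move=> i z'; rewrite ger0_norm ?invr_ge0 ?(ltW (m0 _ _))// lef_pV2 ?posrE//.
  by rewrite le_max lexx orbT.
pose p := cmul (cmul (dg n f) (cadj U)) (Pn S n); pose q := cmul (Pn S n) U.
exists p, q => i j.
have nU := nrm_uni uU.
have -> : cmul (cmul p a) q = cmul (cmul (cmul (dg n f) (cadj U)) (cutn n a)) U.
  by rewrite /p /q /cutn !cmulA.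
set B := cmul (cmul U (dg n d)) (cadj U) in h.
have x0 : cmul (cmul (cmul (dg n f) (cadj U)) B) U = dg n (fun i z => f i z * d i z).
  have eB : cmul (cmul (cadj U) B) U = dg n d by exact: uni_sand uU (is_cut_dg n d).
  by rewrite -(dg_mul n cf cd) -[in RHS]eB !cmulA.
have kn' (i' : 'I_k.+1) : (i' < n)%N by exact: leq_trans kn.
have -> : (i == j)%:R = mt k.+1 k.+1 (dg n (fun i z => f i z * d i z)) z i j.
  rewrite (mt_dg n z i j (fcont_mul cf cd)) kn' andbT -[(i == j :> nat)]/(i == j).
  case: eqP => // _; rewrite /f max_l ?mulVf// ?gt_eqF ?(lt_le_trans e0)//;
    by rewrite (le_trans ek)// (spectral_le _ sp)// -ltnS.
rewrite -x0 -[X in complex.Re `|X|]mtB_coef -cmulBl -cmulBr.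
apply: (le_lt_trans (mt_le _ _ _ _)).
have nd : nrm (cmul (dg n f) (cadj U)) <= e^-1.
  apply: (le_trans (nrmM _ _)); rewrite nrm_cadj -[leRHS]mulr1 ler_pM ?nrm_ge0//.
apply: (le_lt_trans (nrm_sand _ nd nU)); rewrite mulr1.
rewrite ltr_pdivrMl//; apply: (lt_le_trans h).
by rewrite ler_pM2l// lef_pV2 ?posrE ?ltr0n// ler_nat.
Qed.

Lemma rk_near b z0 k : rk b z0 k -> exists2 D : R, 0 < D &
  \forall z \near z0, forall x, nrm (x - b) < D -> rk x z k.
Proof.
move=> [p [q h]]; set y := cmul (cmul p b) q in h.
have [g g0 hg] := finite_gap (fun ij : 'I_k * 'I_k => h ij.1 ij.2).
have g2 : 0 < g / 2 by lra.
exists (g / 2 / ((nrm p + 1) * (nrm q + 1))); first exact: sandwich_gt0.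
have : \forall z \near z0, forall ij : 'I_k * 'I_k,
    nrm (cev z0 (ent y ij.1 ij.2) - cev z (ent y ij.1 ij.2)) < g / 2.
  apply: filter_forall => ij.
  have /cstar_continuousP := @cev_continuous R Z cZ (Cplx R) (ent y ij.1 ij.2).
  exact.
apply: filterS => z hz x xb; exists p, q => i j.
have h1 : complex.Re `|mt k k y z0 i j - (i == j)%:R| + g <= k.+1%:R^-1 := hg (i, j); have h2 := hz (i, j).
have h3 : nrm (cmul (cmul p (x - b)) q) < g / 2 by exact: nrm_sandwich.
have h4 := mt_le (m := k) (n := k) (cmul (cmul p (x - b)) q) z i j.
have e1 : mt k k (cmul (cmul p x) q) z i j - (i == j)%:R =
    (mt k k y z0 i j - (i == j)%:R) + (mt k k y z i j - mt k k y z0 i j) +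
    mt k k (cmul (cmul p (x - b)) q) z i j.
  by rewrite cmulBr cmulBl mtB_coef -/y; ring.
have e2 : complex.Re `|mt k k y z i j - mt k k y z0 i j| < g / 2.
  by move: h2; rewrite nrm_distC nrmC_E /= !mxE.
rewrite e1; apply: (le_lt_trans (Re_normD _ _)); apply: (lt_le_trans _ h1).
apply: (le_lt_trans (lerD (Re_normD _ _) h4)).
by rewrite -addrA ltrD2l [X in _ < X]splitr; exact: ltrD e2 h3.
Qed.

(** Lowering the eigenvalues from the [k]-th on by at most [D / 2] keeps the matrix within [D] of
    [b], hence of rank above [k]. If [d k z] were below [D / 2], this would have removed all of
    them. *)
Lemma spectral_rk b z0 k : rk b z0 k.+1 -> exists2 c : R, 0 < c &
  \forall z \near z0, forall n U d, spectral n U d ->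
    nrm (cmul (cmul U (dg n d)) (cadj U) - b) < c -> c <= d k z /\ (k < n)%N.
Proof.
move=> /rk_near[D D0 hD]; have D2 : 0 < D / 2 by lra.
exists (D / 2) => //; apply: filterS hD => z hz n U d sp xb.
have [uU cd hd] := sp; have [PU UP] := uni_pad uU; have [_ U1 U2] := uU.
set B := cmul (cmul U (dg n d)) (cadj U) in xb.
pose t i z := if (i < k)%N then 0 else Num.min (d i z) (D / 2).
have ct : fcont t.
  split=> i; rewrite /t; case: (i < k)%N; first exact: cR_cst.
  by apply: cR_min; [exact: (@fcontP _ _ cd)|exact: cR_cst].
have nT : nrm (dg n t) <= D / 2.
  apply: nrm_dg => //; first exact: ltW.
  move=> i z'; rewrite /t; case: (i < k)%N; first by rewrite normr0 ltW.
  rewrite ger0_norm ?ge_min ?lexx ?orbT//.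
  by rewrite le_min (hd i z').1 ltW.
have nU := nrm_uni uU.
have nB : nrm (B - cmul (cmul U (dg n t)) (cadj U) - b) < D.
  have : nrm (cmul (cmul U (dg n t)) (cadj U)) <= D / 2.
    by apply: (le_trans (nrm_sand (s := 1) (t := 1) _ nU _)); rewrite ?nrm_cadj// !mul1r.
  have := nrmB (B - b) (cmul (cmul U (dg n t)) (cadj U)).
  rewrite addrAC; move: xb; move: (nrm _) (nrm _) (nrm _) => u v w; lra.
have := hz _ nB; rewrite rk_rank => -[N].
set x := B - _.
have -> : x = cmul (cmul U (dg n (fun i z => d i z - t i z))) (cadj U).
  by rewrite /x /B -(dg_sub n cd ct) cmulBr cmulBl.
have cdt := fcont_sub cd ct; set T := dg n _.
have [T1 T2] : is_cut n T by exact: is_cut_dg.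
have -> : cmul (cmul U T) (cadj U) = cmul U (cmul (Pn S n) (cmul T (cmul (Pn S n) (cadj U)))).
  by rewrite [cmul T (cmul (Pn S n) _)]cmulA T2 [cmul (Pn S n) (cmul T _)]cmulA T1 cmulA.
rewrite mt_PnM mt_PnM => rkx.
have rT : (k.+1 <= \rank (mt n n T z))%N.
  by apply: (leq_trans rkx); apply: (leq_trans (mxrankM_maxr _ _)); exact: mxrankM_maxl.
have kn : (k < n)%N by apply: (leq_trans rT); exact: rank_leq_row.
split=> //; rewrite leNgt; apply/negP => dk.
have : (\rank (mt n n T z) <= k)%N.
  have -> : mt n n T z = mt n n T z *m pid_mx k.
    apply/matrixP => i j; rewrite [RHS]mxE (bigD1 j)//= big1 ?addr0 => [|l lj].
      rewrite [pid_mx _ _ _]mxE eqxx/=; case: (ltnP j k) => jk; first by rewrite mulr1.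
      rewrite mulr0 (mt_dg n z i j cdt); case: eqP => //= ij; rewrite ltn_ord ij /t ltnNge jk/=.
      rewrite min_l ?subrr//; apply: le_trans (ltW dk); exact: (spectral_le _ sp).
    rewrite [pid_mx _ _ _]mxE (_ : (l == j :> nat) = false) ?mulr0//.
    by apply: negbTE; rewrite -[(l == j :> nat)]/(l == j).
  by apply: (leq_trans (mxrankM_maxr _ _)); rewrite rank_pid_mx// ltnW.
by rewrite leqNgt rT.
Qed.

(** The constant must not depend on the diagonal approximant of [b], whose accuracy is chosen
    afterwards in terms of it. Compactness makes it uniform in [z]. *)
Lemma uniform_gap a b n U d (e : R) : spectral n U d -> 0 < e ->
  nrm (cutn n a - cmul (cmul U (dg n d)) (cadj U)) < e / n.+1%:R ->
  (forall z k, rk a z k -> rk b z k) ->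
  exists2 c : R, 0 < c & forall z k m W d', (k < n)%N -> e <= d k z -> spectral m W d' ->
    nrm (cmul (cmul W (dg m d')) (cadj W) - b) < c -> c <= d' k z.
Proof.
move=> sp e0 ha ab; have [_ cd _] := sp.
pose P N z := forall k m W d', (k < n)%N -> e <= d k z -> spectral m W d' ->
    nrm (cmul (cmul W (dg m d')) (cadj W) - b) < N.+1%:R^-1 -> N.+1%:R^-1 <= d' k z.
have [|N hN] := @compact_uniform Z cZ P; last first.
  by exists N.+1%:R^-1; [rewrite invr_gt0 ltr0n|move=> z; exact: hN N z (leqnn N)].
move=> z0.
have /choice[Nk hk] (k : 'I_n) : exists N, \forall z \near z0, forall M, (N <= M)%N ->
    forall m W d', e <= d k z -> spectral m W d' ->
    nrm (cmul (cmul W (dg m d')) (cadj W) - b) < M.+1%:R^-1 -> M.+1%:R^-1 <= d' k z.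
  have [ek|ek] := leP e (d k z0); last first.
    exists 0%N; have e1 : 0 < e - d k z0 by rewrite subr_gt0.
    have /real_continuousP/(_ z0 _ e1) := @fcontP d k cd.
    apply: filterS => z hz M _ m W d' h; exfalso; move: hz.
    by move=> /ltr_normlP[hz _]; lra.
  have [c c0 hc] := spectral_rk (ab _ _ (rk_spectral sp e0 (ltn_ord k) ek ha)).
  have [N hN] := invS_small c0; exists N; apply: filterS hc => z hz M NM m W d' _ sp' h.
  have h2 := hN M NM; have [h3 _] := hz m W d' sp' (lt_trans h h2).
  exact: le_trans (ltW h2) h3.
exists (\max_k Nk k)%N; have : \forall z \near z0, forall k : 'I_n, forall M, (Nk k <= M)%N ->
    forall m W d', e <= d k z -> spectral m W d' ->
    nrm (cmul (cmul W (dg m d')) (cadj W) - b) < M.+1%:R^-1 -> M.+1%:R^-1 <= d' k z.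
  by apply: filter_forall.
apply: filterS => z hz M NM k m W d' kn; apply: (hz (Ordinal kn)).
by apply: leq_trans NM; exact: (leq_bigmax (Ordinal kn)).
Qed.

Lemma spectral_approx b n0 (e : R) : cpositive b -> 0 < e -> exists n U d,
  [/\ (n0 <= n)%N, spectral n U d & nrm (cmul (cmul U (dg n d)) (cadj U) - b) < e].
Proof.
move=> pb e0; have e2 : 0 < e / 2 by lra.
have [N hN] := cutn_cvg b e2; pose n := maxn n0 N.
have [U [d [sp h]]] := approx_diag n pb e2; exists n, U, d; split; [exact: leq_maxl|exact: sp|].
have := nrm_dist (cmul (cmul U (dg n d)) (cadj U)) (cutn n b) b.
have := hN n (leq_maxr _ _); move: h; rewrite (nrm_distC (cutn n b) (cmul _ _)).
by move: (nrm _) (nrm _) (nrm _) => x y z; lra.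
Qed.

(** Between diagonal approximants comparison is explicit: [r] carries the eigenvalues $d'_i$ to
    $(d_i-e)_+$, and stays bounded because $d'_i\ge c$ wherever $d_i\ge e$. Four errors of at most
    [e] arise. *)
Theorem cuntz_compare a b : cpositive a -> cpositive b ->
  (forall z k, rk a z k -> rk b z k) -> cuntz_le a b.
Proof.
move=> pa pb ab; apply/cuntz_leP => e' e'0; pose e := e' / 8; have e0 : 0 < e by rewrite /e; lra.
have e48 : 4 * e < e' by rewrite /e; lra.
clearbody e.
have [n hn0] := cutn_cvg a e0; have hn := hn0 n (leqnn n).
have en : 0 < e / n.+1%:R by rewrite divr_gt0// ltr0n.
have [U [d [sp hd]]] := approx_diag n pa en; have [uU cd dd] := sp.
have hde : nrm (cutn n a - cmul (cmul U (dg n d)) (cadj U)) < e.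
  by apply: (lt_le_trans hd); rewrite ler_pdivrMr ?ltr0n// ler_peMr ?(ltW e0)// ler1n.
have [c c0 gap] := uniform_gap sp e0 hd ab.
pose K := nrm (dg n d); have K0 : 0 <= K by exact: nrm_ge0.
have dK i z : (i < n)%N -> d i z <= K.
  move=> i1; have := mt_le (m := n) (n := n) (dg n d) z (Ordinal i1) (Ordinal i1).
  rewrite (mt_dg n z _ _ cd) eqxx i1 Re_norm_real.
  by apply: le_trans; exact: ler_norm.
clearbody K; have K1 : 0 < K + 1 by rewrite ltr_wpDl.
(* The bound [c] makes [gap] applicable; the other one compensates $\|r\|^2\le K/c$. *)
pose dl := Num.min c (e * c / (K + 1)).
have dl0 : 0 < dl by rewrite lt_min c0 divr_gt0// mulr_gt0.
have [m [W [d' [nm sp' hW]]]] := spectral_approx n pb dl0; have [uW cd' dd'] := sp'.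
set B := cmul (cmul W (dg m d')) (cadj W) in hW.
have gap' z k : (k < n)%N -> e <= d k z -> c <= d' k z.
  move=> kn ek; apply: gap kn ek sp' _; apply: (lt_le_trans hW).
  by rewrite ge_min lexx.
pose g i z : R := if (i < n)%N then
  Num.sqrt (Num.max (d i z - e) 0 / Num.max (d' i z) c) else 0.
have mx0 i z : 0 < Num.max (d' i z) c by rewrite lt_max c0 orbT.
have cg : fcont g.
  split=> i; rewrite /g; case: (i < n)%N; last exact: cR_cst.
  apply: cR_sqrt; apply: cR_mul.
    apply: cR_max; last exact: cR_cst.
    by apply: cR_sub; [exact: (@fcontP _ _ cd)|exact: cR_cst].
  apply: cR_inv; first by move=> z; rewrite gt_eqF.
  by apply: cR_max; [exact: (@fcontP _ _ cd')|exact: cR_cst].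
have gsq i z : (i < n)%N -> g i z * g i z = Num.max (d i z - e) 0 / Num.max (d' i z) c.
  move=> i1; rewrite /g i1 -expr2 sqr_sqrtr// mulr_ge0 ?invr_ge0 ?(ltW (mx0 _ _))//.
  by rewrite le_max lexx orbT.
have nG : nrm (dg m g) <= Num.sqrt (K / c).
  apply: nrm_dg; [exact: cg|exact: sqrtr_ge0|] => i z; rewrite /g.
  case: ltnP => i1; last by rewrite normr0 sqrtr_ge0.
  rewrite ger0_norm ?sqrtr_ge0// ler_wsqrtr//; apply: ler_pM.
  - by rewrite le_max lexx orbT.
  - by rewrite invr_ge0 ltW.
  - by rewrite ge_max K0 andbT (le_trans _ (dK i z i1))// gerBl ltW.
  - by rewrite lef_pV2 ?posrE// le_max lexx orbT.
pose r := cmul (cmul U (dg m g)) (cadj W).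
have nU := nrm_uni uU; have nW := nrm_uni uW.
have nr : nrm r <= Num.sqrt (K / c).
  have nW' : nrm (cadj W) <= 1 by rewrite nrm_cadj.
  by apply: (le_trans (nrm_sand _ nU nW')); rewrite !mul1r.
have ra : cadj r = cmul (cmul W (dg m g)) (cadj U).
  by rewrite /r !cadjM cadjK (dg_adj m cg) cmulA.
pose h i z := Num.max (d i z - e) 0.
have ch : fcont h.
  split=> i; apply: cR_max; last exact: cR_cst.
  by apply: cR_sub; [exact: (@fcontP _ _ cd)|exact: cR_cst].
have rBr : cmul (cmul r B) (cadj r) = cmul (cmul U (dg n h)) (cadj U).
  have eB : cmul (cmul (cadj W) B) W = dg m d' by exact: uni_sand uW (is_cut_dg m d').
  have -> : dg n h = cmul (cmul (dg m g) (dg m d')) (dg m g).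
    rewrite (dg_mul m cg cd') (dg_mul m (fcont_mul cg cd') cg).
    rewrite (dg_pad nm); last by move=> i z ni; rewrite /g ltnNge ni !mul0r.
    apply: eq_dg => i z i1; rewrite mulrAC gsq// /h; have [le|lt] := leP e (d i z).
      by rewrite [X in _ / X]max_l ?divfK ?gt_eqF//; [exact: lt_le_trans (gap' _ _ i1 le)|exact: gap'].
    by rewrite max_r ?mul0r// subr_le0 ltW.
  by rewrite -eB ra /r !cmulA.
exists r.
have t1 : nrm (cmul (cmul r (b - B)) (cadj r)) <= e.
  have nr' : nrm (cadj r) <= Num.sqrt (K / c) by rewrite nrm_cadj.
  apply: (le_trans (nrm_sand _ nr nr')).
  rewrite -expr2 sqr_sqrtr ?divr_ge0 ?(ltW c0)// nrm_distC.
  apply: (@le_trans _ _ (K / c * (e * c / (K + 1)))).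
    rewrite ler_wpM2l ?divr_ge0 ?(ltW c0)// (le_trans (ltW hW))//.
    by rewrite ge_min lexx orbT.
  have -> : K / c * (e * c / (K + 1)) = e * (K / (K + 1)).
    by field; rewrite !gt_eqF.
  by rewrite ler_piMr ?(ltW e0)// ler_pdivrMr ?mul1r ?lerDl.
have t2 : nrm (cmul (cmul U (dg n h)) (cadj U) - cmul (cmul U (dg n d)) (cadj U)) <= e.
  rewrite -cmulBl -cmulBr (dg_sub n ch cd).
  have nU' : nrm (cadj U) <= 1 by rewrite nrm_cadj.
  apply: (le_trans (nrm_sand _ nU nU')); rewrite !mul1r.
  apply: nrm_dg; [exact: fcont_sub|exact: ltW|] => i z; rewrite /h.
  have [d0 _] := dd i z; case: (leP (d i z - e) 0) => hh.
    by rewrite sub0r normrN ger0_norm//; lra.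
  by rewrite addrAC subrr sub0r normrN ger0_norm// ltW.
rewrite cmulBr cmulBl rBr in t1.
exact: le_lt_trans (four_dist t1 t2 (ltW hde) (ltW hn)) e48.
Qed.

End Diagonal.

Lemma big_single (V : nmodType) n (F : nat -> V) i : (i < n)%N ->
  (forall k, k != i -> F k = 0) -> \sum_(k < n) F k = F i.
Proof.
move=> i1 h; rewrite (bigD1 (Ordinal i1))//= big1 ?addr0// => k ki; apply: h.
by apply: contraNneq ki => ki; apply/eqP/val_inj.
Qed.

(** * Extension of matrix systems and amplifications *)

Section SystemExtension.
Context {R : realType} {Z : topologicalType} {cZ : compact [set: Z]}.
Local Notation CZ := (Cfun cZ (Cplx R)).
Variable S : stabilization CZ.
Local Notation E := (mxu S).
Context {K : cstarType R} {psi : nat -> nat -> CZ -> K}.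
Hypothesis sys : matrix_system psi.

Let ext n (x : S) : K := \sum_(p < n) \sum_(q < n) psi p q (ent x p q).

Let ext_lin n (k : R[i]) x y : ext n (k *: x + y) = k *: ext n x + ext n y.
Proof.
rewrite /ext scaler_sumr -big_split; apply: eq_bigr => p _ /=.
rewrite scaler_sumr -big_split; apply: eq_bigr => q _ /=.
by rewrite entD entZ (ms_linear sys).
Qed.

Let ext0 n : ext n 0 = 0.
Proof. by rewrite /ext big1// => p _; rewrite big1// => q _; rewrite ent0 (ms0 sys). Qed.

Let extD n x y : ext n (x + y) = ext n x + ext n y.
Proof. by rewrite -[x]scale1r ext_lin !scale1r. Qed.

Let extB n x y : ext n (x - y) = ext n x - ext n y.
Proof. by rewrite addrC -scaleN1r ext_lin scaleN1r addrC. Qed.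

Let ext_sum n (I : Type) (r : seq I) (P : pred I) (F : I -> S) :
  ext n (\sum_(i <- r | P i) F i) = \sum_(i <- r | P i) ext n (F i).
Proof. by apply: (big_morph (ext n)); [exact: extD|exact: ext0]. Qed.

Let ext_mxu n i j f : (i < n)%N -> (j < n)%N -> ext n (E i j f) = psi i j f.
Proof.
move=> i1 j1; rewrite /ext.
rewrite (big_single (F := fun p => \sum_(q < n) psi p q (ent (E i j f) p q)) i1); last first.
  by move=> p /negPf pi; rewrite big1// => q _; rewrite ent_mxu pi (ms0 sys).
rewrite (big_single (F := fun q => psi i q (ent (E i j f) i q)) j1).
  by rewrite ent_mxu !eqxx.
by move=> q /negPf qj; rewrite ent_mxu eqxx eq_sym qj (ms0 sys).
Qed.

Let ext_cut n m x : (n <= m)%N -> ext m (cutn n x) = ext n (cutn n x).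
Proof.
move=> nm; rewrite cutnE !ext_sum; apply: eq_bigr => p _; rewrite !ext_sum; apply: eq_bigr => q _.
by rewrite !ext_mxu// (leq_trans _ nm).
Qed.

Let ext_psh n : partial_star_hom (fun x => is_cut n x) (ext n).
Proof.
split.
- by move=> k a b ca cb; split; [apply: is_cut_add => //; exact: is_cutZ|exact: ext_lin].
- move=> a b ca cb; split; first exact: is_cut_mul.
  rewrite /ext cmul_suml; apply: eq_bigr => p _.
  transitivity (\sum_(q < n) \sum_(k < n) psi p q (cmul (ent a p k) (ent b k q))).
    apply: eq_bigr => q _; rewrite -{1}cb.1 ent_PnM; exact: (ms_sum sys).
  rewrite exchange_big cmul_suml; apply: eq_bigr => k _.
  rewrite cmul_sumr (big_single (F := fun k' => cmul (psi p k (ent a p k))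
    (\sum_(q < n) psi k' q (ent b k' q))) (ltn_ord k)); last first.
    by move=> k' /negPf kk; rewrite cmul_sumr big1// => q _; rewrite (ms_mul sys) eq_sym kk.
  by rewrite cmul_sumr; apply: eq_bigr => q _; rewrite (ms_mul sys) eqxx.
- move=> a ca; split; first exact: is_cut_adj.
  rewrite /ext cadj_sum exchange_big; apply: eq_bigr => p _.
  rewrite cadj_sum; apply: eq_bigr => q _.
  by rewrite (ms_adj sys) ent_adj.
- by split; rewrite ?cmul0r ?cmul0l.
move=> u l ul hl; split.
  apply: (ccvg_unique _ hl); apply: (eq_ccvg (u := fun k => cmul (Pn S n) (u k))).
    by move=> k; have [] := ul k.
  exact: (ccvgM (ccvg_cst (Pn S n)) hl).
apply: (ccvg_unique _ hl); apply: (eq_ccvg (u := fun k => cmul (u k) (Pn S n))).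
  by move=> k; have [] := ul k.
exact: (ccvgM hl (ccvg_cst (Pn S n))).
Qed.

Let ext_le n x : is_cut n x -> nrm (ext n x) <= nrm x.
Proof. exact: partial_star_hom_le (ext_psh n) x. Qed.

(** On each corner the entrywise map is a *-homomorphism, hence contractive, so its values on the
    truncations of [x] converge. Multiplicativity survives because truncation is multiplicative up
    to an error tending to 0. *)
Lemma system_extend : exists2 Phi : S -> K, star_hom Phi & forall p q f, Phi (E p q f) = psi p q f.
Proof.
pose u x n := ext n (cutn n x).
have cut_le m n x : (n <= m)%N -> is_cut m (cutn n x).
  by move=> nm; rewrite cutnE; apply: is_cut_sum => i _; apply: is_cut_sum => j _;
     apply: is_cut_mxu; exact: leq_trans nm.
have uc x : exists l, ccvg (u x) l.
  apply: ccauchy_cvg => e e0; have e2 : 0 < e / 2 by lra.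
  have [n hN] := cutn_cvg x e2; exists n => m nm.
  rewrite /u -(ext_cut x nm) -extB.
  have cc : is_cut m (cutn m x - cutn n x).
    rewrite -scaleN1r; apply: is_cut_add; first exact: is_cut_cutn.
    by apply: is_cutZ; exact: cut_le.
  apply: (le_lt_trans (ext_le cc)); have := nrm_dist (cutn m x) x (cutn n x).
  by have := hN m nm; have := hN n (leqnn n); rewrite (nrm_distC x (cutn n x)); lra.
have [Phi hP] := choice uc.
exists Phi; last first.
  move=> p q f; apply: (ccvg_unique (hP _)) => e e0; exists (maxn p q).+1 => n.
  rewrite gtn_max => /andP[pn qn]; rewrite /u.
  have -> : cutn n (E p q f) = E p q f by rewrite /cutn Pn_mxu pn mxu_Pn qn.
  by rewrite ext_mxu// subrr nrm0.
split.
- move=> k x y; apply: (ccvg_unique (hP _)).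
  apply: (eq_ccvg (u := fun n => k *: u x n + u y n)); last by apply: ccvgD => //; exact: ccvgZ.
  by move=> n; rewrite /u -ext_lin; congr (ext n _); rewrite /cutn cmulDr cmulDl cmulZr cmulZl.
- move=> x y; apply: (ccvg_unique _ (ccvgM (hP x) (hP y))) => e e0.
  have hxy := ccvgB (ccvgM (cutn_cvg x) (cutn_cvg y)) (cutn_cvg (cmul x y)).
  have e2 : 0 < e / 2 by lra.
  have [N hN] := hxy _ e2; have [M hM] := hP (cmul x y) _ e2.
  exists (maxn N M) => n; rewrite geq_max => /andP[Nn Mn].
  have cx := is_cut_cutn n x; have cy := is_cut_cutn n y; have cxy := is_cut_cutn n (cmul x y).
  have e1 : cmul (u x n) (u y n) = ext n (cmul (cutn n x) (cutn n y)).
    by have [_ ->] := psh_mul (ext_psh n) cx cy.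
  have cc : is_cut n (cmul (cutn n x) (cutn n y) - cutn n (cmul x y)).
    rewrite -scaleN1r; apply: is_cut_add; first exact: is_cut_mul.
    exact: is_cutZ.
  have := ext_le cc; rewrite extB -e1 -/(u (cmul x y) n).
  have := hN n Nn; rewrite subrr subr0 => h1 h2.
  have := nrm_dist (cmul (u x n) (u y n)) (u (cmul x y) n) (Phi (cmul x y)).
  by have := hM n Mn; lra.
move=> x; apply: (ccvg_unique (hP _)).
apply: (eq_ccvg (u := fun n => cadj (u x n))); last exact: ccvg_adj.
move=> n; have [_ <-] := psh_adj (ext_psh n) (is_cut_cutn n x).
by rewrite /u /cutn !cadjM Pn_adj cmulA.
Qed.

End SystemExtension.

Section Amplification.
Context {R : realType} {Y : topologicalType} (cY : compact [set: Y]).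
Context {D F : cstarType R} (f : D -> Cfun cY F) (g : Cfun cY F -> D).
Hypotheses (sf : star_hom f) (fK : cancel f g) (gK : cancel g f).
Context {r m : nat} {cl : 'I_r -> 'I_m} {e : 'I_r -> 'I_r -> F}.
Hypothesis mu : matrix_units cl e.
Variable rep : 'I_m -> 'I_r.
Hypothesis repK : forall j, cl (rep j) = j.
Variable K : stabilization D.
Variable cZ : compact [set: (Y * discrete_topology 'I_m)%type].

(** Flattening supplies entries in a commutative algebra, where [mxu] is isometric and
    [system_extend] applies. *)
Lemma amplification_exists (D' : cstarType R) (K' : stabilization D') (phi : D -> D') :
  star_hom phi -> exists Phi : K -> K', amplification phi Phi.
Proof.
move=> sp; pose S := flat sf fK gK mu repK cZ K.
have sys' := ms_comp (mxu_system K') sp.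
have [Phi sP hP] := system_extend S (fmx_system sf fK gK mu repK cZ sys').
exists Phi; split=> // i j a.
rewrite (cu_span sf fK gK mu a) (star_hom_sum sp) !mxu_sum (star_hom_sum sP).
apply: eq_bigr => b _; rewrite (star_hom_sum sp) !mxu_sum (star_hom_sum sP).
apply: eq_bigr => c /eqP bc.
rewrite (mxu_cu sf fK gK repK cZ K)// [RHS](fmx_cu sf fK gK repK cZ sys')//; exact: hP.
Qed.

End Amplification.

Lemma amplification_uniq (R : realType) (D D' : cstarType R) (K : stabilization D)
    (K' : stabilization D') (phi : D -> D') (P Q : K -> K') :
  amplification phi P -> amplification phi Q -> P = Q.
Proof.
move=> [sP hP] [sQ hQ]; apply/funext => x; apply/eqP; rewrite -subr_eq0; apply/eqP/nrm_small => e e0.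
have e2 : 0 < e / 2 by lra.
have [y [n [a yE]] xy] := fins_dense x e2.
have PQ : P y = Q y.
  rewrite yE !(star_hom_sum sP) !(star_hom_sum sQ); apply: eq_bigr => i _.
  rewrite (star_hom_sum sP) (star_hom_sum sQ); apply: eq_bigr => j _.
  by rewrite hP hQ.
have := nrm_dist (P x) (P y) (Q x); rewrite {2}PQ -(star_homB sP) -(star_homB sQ).
have := star_hom_le sP (x - y); have := star_hom_le sQ (y - x); rewrite (nrm_distC y x).
by lra.
Qed.

Lemma cuntz_le_trans (R : realType) (K : cstarType R) (a b c : K) :
  cuntz_le a b -> cuntz_le b c -> cuntz_le a c.
Proof.
move=> /cuntz_leP ab /cuntz_leP bc; apply/cuntz_leP => e e0.
have e2 : 0 < e / 2 by lra.
have [r hr] := ab _ e2; have M0 : 0 < nrm r * nrm r + 1.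
  by rewrite ltr_wpDl// mulr_ge0 ?nrm_ge0.
have d0 : 0 < e / 2 / (nrm r * nrm r + 1) by rewrite divr_gt0.
have [s hs] := bc _ d0; exists (cmul r s).
have -> : cmul (cmul (cmul r s) c) (cadj (cmul r s)) = cmul (cmul r (cmul (cmul s c) (cadj s))) (cadj r).
  by rewrite cadjM !cmulA.
have := nrm_dist (cmul (cmul r (cmul (cmul s c) (cadj s))) (cadj r)) (cmul (cmul r b) (cadj r)) a.
rewrite -cmulBl -cmulBr.
have h : nrm (cmul (cmul r (cmul (cmul s c) (cadj s) - b)) (cadj r)) <=
    nrm r * nrm r * nrm (cmul (cmul s c) (cadj s) - b).
  apply: (le_trans (nrmM _ _)); rewrite nrm_cadj mulrAC ler_wpM2r ?nrm_ge0//; exact: nrmM.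
have h2 : nrm r * nrm r * nrm (cmul (cmul s c) (cadj s) - b) <= e / 2.
  move: hs; rewrite ltr_pdivlMr//; have := nrm_ge0 (cmul (cmul s c) (cadj s) - b).
  by move: (nrm _) => t t0 ht; lra.
by move: hr h h2; lra.
Qed.

Lemma Cu_set_inj (R : realType) (A : cstarType R) (K : stabilization A) (x y : Cu K) :
  Cu_set x = Cu_set y -> x = y.
Proof.
case: x y => X px [Y py] /= XY; subst Y; congr (MkCu _); exact: Prop_irrelevance.
Qed.

Lemma Cu_eq (R : realType) (A : cstarType R) (K : stabilization A) (x y : Cu K) a :
  Cu_set x a -> Cu_set y a -> x = y.
Proof.
case: x => X [b pb XE]; case: y => Y [c pc YE] /= Xa Ya.
have XY : X = Y.
  move: Xa Ya; rewrite XE YE => -[pa ba ab] [_ ca ac]; apply/seteqP; split=> z [pz z1 z2]; split=> //.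
  - exact: cuntz_le_trans (cuntz_le_trans ca ab) z1.
  - exact: cuntz_le_trans z2 (cuntz_le_trans ba ac).
  - exact: cuntz_le_trans (cuntz_le_trans ba ac) z1.
  - exact: cuntz_le_trans z2 (cuntz_le_trans ca ab).
by apply: Cu_set_inj; exact: XY.
Qed.

Lemma star_hom_cuntz (R : realType) (K K' : cstarType R) (P : K -> K') a b :
  star_hom P -> cuntz_le a b -> cuntz_le (P a) (P b).
Proof.
move=> sP /cuntz_leP ab; apply/cuntz_leP => e e0; have [r hr] := ab e e0.
have [_ PM Pa] := sP; exists (P r); rewrite -Pa -!PM -(star_homB sP).
exact: le_lt_trans (star_hom_le sP _) hr.
Qed.

Lemma star_hom_pos (R : realType) (K K' : cstarType R) (P : K -> K') a :
  star_hom P -> cpositive a -> cpositive (P a).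
Proof. by move=> [_ PM Pa] [c ->]; exists (P c); rewrite PM Pa. Qed.

Lemma open_superlevel (R : realType) (Z : topologicalType) (f : Z -> R) (c : R) :
  continuous f -> open [set z | c < f z].
Proof.
move=> cf; rewrite openE => z /= cz; have d0 : 0 < f z - c by rewrite subr_gt0.
by have /real_continuousP/(_ z _ d0) := cf; apply: filterS => y /= /ltr_normlP[_]; lra.
Qed.

(** * The Cuntz semigroup described by pointwise ranks *)

Definition cozeros (R : realType) (Z : topologicalType) := forall O : set Z, open O ->
  exists s : Z -> R, [/\ continuous s, forall z, 0 <= s z <= 1 & forall z, 0 < s z <-> O z].

(** The interface between matrices and the Cuntz semigroup. It speaks of the bare algebra [K], so
    that ranks computed in the flattened stabilization describe classes in the original one.
    [rt_ortho] provides a sequence of rank one elements with prescribed open supports, each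
    orthogonal to the sum of the previous ones, from which sums of classes are formed. *)
Record rank_theory (R : realType) (Z : topologicalType) (K : cstarType R)
    (rk : K -> Z -> nat -> Prop) : Prop := RankTheory {
  rt_le : forall a b, cpositive a -> cpositive b ->
    (cuntz_le a b <-> forall z k, rk a z k -> rk b z k) ;
  rt_0 : forall a z, rk a z 0 ;
  rt_leq : forall a z k l, (l <= k)%N -> rk a z k -> rk a z l ;
  rt_open : forall a z k, rk a z k -> \forall z' \near z, rk a z' k ;
  rt_sum : forall a b z m, cpositive a -> cpositive b -> cmul a b = 0 ->
    (rk (a + b) z m <-> exists k l, [/\ (k + l)%N = m, rk a z k & rk b z l]) ;
  rt_diag : forall O : nat -> set Z, (forall k, open (O k)) -> (forall k, O k.+1 `<=` O k) ->
    exists2 D, cpositive D & forall z k, rk D z k.+1 <-> O k z ;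
  rt_ortho : forall O : nat -> set Z, (forall k, open (O k)) ->
    exists a : nat -> K, forall k, [/\ cpositive (\sum_(i < k) a i), cpositive (a k),
      cmul (\sum_(i < k) a i) (a k) = 0 & forall z j, rk (a k) z j.+1 <-> j = 0%N /\ O k z] }.

Lemma cube_diff (R : realType) (K : cstarType R) (a x : K) :
  cmul x (cmul x x) - cmul a (cmul a a) =
  cmul (x - a) (cmul a a) + cmul x (cmul (x - a) a) + cmul x (cmul x (x - a)).
Proof.
by rewrite !cmulBl !cmulBr [X in _ = X + _]addrC subrKA [RHS]addrC subrKA.
Qed.

Section Instance.
Context {R : realType} {Z : topologicalType} {cZ : compact [set: Z]}.
Local Notation CZ := (Cfun cZ (Cplx R)).
Variable S : stabilization CZ.
Local Notation E := (mxu S).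
Implicit Types (a b x y U : S).
Hypotheses (nt : near_top_fields R Z) (co : cozeros R Z).

Lemma sand_mul n U x y : uni n U -> is_cut n x ->
  cmul (cmul (cmul U x) (cadj U)) (cmul (cmul U y) (cadj U)) = cmul (cmul U (cmul x y)) (cadj U).
Proof.
move=> [_ h1 _] [_ x2].
by rewrite !cmulA -[cmul (cmul (cmul U x) (cadj U)) U]cmulA h1 -[cmul (cmul U x) (Pn S n)]cmulA x2.
Qed.

Lemma rk_cube a z k : cpositive a -> rk a z k -> rk (cmul a (cmul a a)) z k.
Proof.
case: k => [|k] pa ra; first exact: rk0.
have [c c0 hc] := spectral_rk ra.
pose M := nrm a + 1; have M0 : 0 < M by rewrite /M ltr_wpDl ?nrm_ge0.
pose c3 := c * (c * c); have c30 : 0 < c3 by rewrite !mulr_gt0.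
(* Accuracy [c] makes [spectral_rk] applicable, accuracy 1 bounds [x] by [M], and the last term
   absorbs the factor $3M^2$ from the cubes and $1/c_3$ from [p]. *)
pose eta := Num.min (Num.min c 1) (c3 / (3 * (M * M) * k.+2%:R)).
have eta0 : 0 < eta by rewrite !lt_min c0 ltr01 divr_gt0// !mulr_gt0// ltr0n.
have [n [U [d [_ sp h]]]] := spectral_approx nt 0 pa eta0.
have etac : eta <= c by rewrite !ge_min lexx.
have eta1 : eta <= 1 by rewrite !ge_min lexx orbT.
have eta3 : eta <= c3 / (3 * (M * M) * k.+2%:R) by rewrite !ge_min lexx !orbT.
have [dc kn] := nbhs_singleton hc n U d sp (lt_le_trans h etac).
have [uU cd hd] := sp; have nU := nrm_uni uU.
set x := cmul (cmul U (dg S n d)) (cadj U) in h.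
pose d3 i (y : Z) := d i y * (d i y * d i y).
have cd2 := fcont_mul cd cd; have cd3 : fcont d3 := fcont_mul cd cd2.
have x3 : cmul x (cmul x x) = cmul (cmul U (dg S n d3)) (cadj U).
  have cD := is_cut_dg S n d.
  by rewrite /x !(sand_mul _ uU)// (dg_mul S n cd cd) (dg_mul S n cd cd2).
pose f i (y : Z) := (Num.max (d3 i y) c3)^-1.
have m0 i (y : Z) : 0 < Num.max (d3 i y) c3 by rewrite lt_max c30 orbT.
have cf : fcont f.
  split=> i; apply: cR_inv; first by move=> y; rewrite gt_eqF.
  by apply: cR_max; [exact: (@fcontP _ _ _ _ cd3)|exact: cR_cst].
have nf : nrm (dg S n f) <= c3^-1.
  apply: nrm_dg; [exact: cf|by rewrite invr_ge0 ltW|].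
  move=> i y; rewrite ger0_norm ?invr_ge0 ?(ltW (m0 _ _))// lef_pV2 ?posrE//.
  by rewrite le_max lexx orbT.
pose p := cmul (dg S n f) (cadj U).
have np : nrm p <= c3^-1.
  apply: (le_trans (nrmM _ _)); rewrite nrm_cadj -[leRHS]mulr1 ler_pM ?nrm_ge0//.
exists p, U => i j.
have kn' (i' : 'I_k.+1) : (i' < n)%N by exact: leq_trans kn.
have -> : (i == j)%:R = mt k.+1 k.+1 (cmul (cmul p (cmul x (cmul x x))) U) z i j.
  have e1 : cmul (cmul (cadj U) (cmul x (cmul x x))) U = dg S n d3.
    by rewrite x3; exact: uni_sand uU (is_cut_dg S n d3).
  have -> : cmul (cmul p (cmul x (cmul x x))) U = cmul (dg S n f) (dg S n d3).
    by rewrite /p -e1 !cmulA.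
  rewrite (dg_mul S n cf cd3) (mt_dg S n z i j (fcont_mul cf cd3)) kn' andbT -[(i == j :> nat)]/(i == j).
  case: eqP => // _; rewrite /f max_l ?mulVf//.
    rewrite gt_eqF// /d3; have h1 : 0 < d i z.
      by apply: (lt_le_trans c0); apply: (le_trans dc); apply: (spectral_le _ sp); rewrite -ltnS.
    by rewrite !mulr_gt0.
  have h1 : c <= d i z by apply: (le_trans dc); apply: (spectral_le _ sp); rewrite -ltnS.
  by rewrite /c3 /d3 !ler_pM ?mulr_ge0 ?(ltW c0).
rewrite -mtB_coef -cmulBl -cmulBr.
apply: (le_lt_trans (mt_le _ _ _ _)); apply: (le_lt_trans (nrm_sand _ np nU)); rewrite mulr1.
have nx : nrm x <= M.
  have := nrmD (x - a) a; rewrite subrK; move: h eta1; rewrite /M.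
  by move: (nrm x) (nrm a) (nrm (x - a)) => *; lra.
have na : nrm a <= M by rewrite /M lerDl.
have n3 : nrm (cmul a (cmul a a) - cmul x (cmul x x)) <= 3 * (M * M) * nrm (x - a).
  rewrite nrm_distC cube_diff; apply: (le_trans (nrmD _ _)); have h0 := nrmD (cmul (x - a) (cmul a a)) (cmul x (cmul (x - a) a)).
  have g1 : nrm (cmul (x - a) (cmul a a)) <= nrm (x - a) * (M * M).
    by apply: (le_trans (nrmM _ _)); rewrite ler_wpM2l ?nrm_ge0// (le_trans (nrmM _ _))// ler_pM ?nrm_ge0.
  have g2 : nrm (cmul x (cmul (x - a) a)) <= M * (nrm (x - a) * M).
    apply: (le_trans (nrmM _ _)); rewrite ler_pM ?nrm_ge0// (le_trans (nrmM _ _))// ler_wpM2l ?nrm_ge0//.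
  have g3 : nrm (cmul x (cmul x (x - a))) <= M * (M * nrm (x - a)).
    apply: (le_trans (nrmM _ _)); rewrite ler_pM ?nrm_ge0// (le_trans (nrmM _ _))// ler_wpM2r ?nrm_ge0//.
  move: h0 g1 g2 g3; move: (nrm _) (nrm _) (nrm _) (nrm _) (nrm _) => *; lra.
have k0 : 0 < c3^-1 by rewrite invr_gt0.
apply: (le_lt_trans (ler_wpM2l (ltW k0) n3)).
have M20 : 0 < 3 * (M * M) by rewrite !mulr_gt0.
rewrite ltr_pdivrMl//; apply: (@lt_le_trans _ _ (3 * (M * M) * eta)); first by rewrite ltr_pM2l.
apply: (le_trans (ler_wpM2l (ltW M20) eta3)).
have k2 : 0 < k.+2%:R :> R by rewrite ltr0n.
have cancel (u v w : R) : 0 < u -> 0 < v -> u * (w / (u * v)) = w / v.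
  by move=> *; field; rewrite !gt_eqF.
by rewrite cancel.
Qed.

(** By orthogonality $(P_1a+P_2b)(a+b)(aQ_1+bQ_2)=P_1a^3Q_1+P_2b^3Q_2$, which is block diagonal.
    This is why cubes occur; [rk_cube] removes them. *)
Lemma rk_orth a b z k l : cadj a = a -> cadj b = b -> cmul a b = 0 ->
  rk (cmul a (cmul a a)) z k -> rk (cmul b (cmul b b)) z l -> rk (a + b) z (k + l).
Proof.
move=> sa sb ab; have ba : cmul b a = 0.
  by rewrite -sa -sb -cadjM ab cadj0.
rewrite rk_rank => -[n /rank_le_factor[P [Q PQ]]]; rewrite rk_rank => -[n' /rank_le_factor[P' [Q' PQ']]].
pose P1 : 'M[R[i]]_(k + l, n) := col_mx P 0; pose P2 : 'M[R[i]]_(k + l, n') := col_mx 0 P'.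
pose Q1 : 'M[R[i]]_(n, k + l) := row_mx Q 0; pose Q2 : 'M[R[i]]_(n', k + l) := row_mx 0 Q'.
exists (cmul (kel S P1) a + cmul (kel S P2) b), (cmul a (kel S Q1) + cmul b (kel S Q2)) => i j.
have -> : cmul (cmul (cmul (kel S P1) a + cmul (kel S P2) b) (a + b)) (cmul a (kel S Q1) + cmul b (kel S Q2)) =
    cmul (cmul (kel S P1) (cmul a (cmul a a))) (kel S Q1) + cmul (cmul (kel S P2) (cmul b (cmul b b))) (kel S Q2).
  have e1 : cmul (cmul (kel S P1) a + cmul (kel S P2) b) (a + b) =
      cmul (kel S P1) (cmul a a) + cmul (kel S P2) (cmul b b).
    by rewrite cmulDl !cmulDr -!cmulA ab ba !cmul0r addr0 add0r.
  rewrite e1 cmulDl !cmulDr -!cmulA ![cmul a (cmul b _)]cmulA ![cmul b (cmul a _)]cmulA ab ba.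
  by rewrite !cmul0l !cmul0r addr0 add0r.
rewrite mtD !mt_kel !kel_mt /P1 /P2 /Q1 /Q2 !mul_col_mx !mul0mx !mul_mx_row !mulmx0.
rewrite PQ PQ' add_col_mx addr0 add0r -[col_mx _ _]/(block_mx 1%:M 0 0 1%:M) -scalar_mx_block.
by rewrite !mxE subrr normr0 (_ : complex.Re 0 = 0)// invr_gt0 ltr0n.
Qed.

(** Zeros propagate down the diagonal, so the non-zero entries at [z] form an initial segment and
    their number is read off from a single entry. *)
Lemma diag_rk (D : S) (h : nat -> Z -> R) z k :
  (forall p q, ent D p q = if p == q then rcf (h p) else 0) -> fcont h ->
  (forall i, 0 <= h i z) -> (forall i, h i z = 0 -> h i.+1 z = 0) -> (rk D z k.+1 <-> 0 < h k z).
Proof.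
move=> eD ch h0 hd.
have mE n (i j : 'I_n) : mt n n D z i j = if i == j then (h i z)%:C else 0.
  rewrite mxE eD -[(i == j :> nat)]/(i == j); case: eqP => // _.
  by rewrite rcfE; last exact: (@fcontP _ _ _ _ ch).
have hz i j : h i z = 0 -> (i <= j)%N -> h j z = 0.
  move=> hk; elim: j => [|j IH]; first by rewrite leqn0 => /eqP<-.
  by rewrite leq_eqVlt => /orP[/eqP<-//|/IH/hd].
split=> [/rk_rank[n rn]|hk]; last first.
  rewrite rk_rank; exists k.+1; rewrite mxrank_unit// unitmxE.
  have -> : mt k.+1 k.+1 D z = diag_mx (\row_i (h i z)%:C).
    by apply/matrixP => i j; rewrite mE !mxE; case: eqP => _; rewrite ?mulr1n ?mulr0n.
  rewrite det_diag unitfE; apply/prodf_neq0 => i _; rewrite mxE.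
  have hi : h i z != 0.
    apply: contraTneq hk => hi; rewrite -leNgt (_ : h k z = 0)//.
    by apply: (hz i k hi); rewrite -ltnS.
  by apply: contraNneq hi => /(congr1 (@complex.Re R)) /= ->.
rewrite lt_neqAle h0 andbT eq_sym; apply/eqP => hk.
have : (\rank (mt n n D z) <= k)%N.
  have kn : (k < n)%N by apply: (leq_trans rn); exact: rank_leq_row.
  have -> : mt n n D z = mt n n D z *m pid_mx k.
    apply/matrixP => i j; rewrite [RHS]mxE (bigD1 j)//= big1 ?addr0 => [|l lj].
      rewrite [pid_mx _ _ _]mxE eqxx/=; case: (ltnP j k) => jk; first by rewrite mulr1.
      by rewrite mulr0 mE; case: eqP => // ->; rewrite (hz k).
    rewrite [pid_mx _ _ _]mxE (_ : (l == j :> nat) = false) ?mulr0//.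
    by apply: negbTE; rewrite -[(l == j :> nat)]/(l == j).
  by apply: (leq_trans (mxrankM_maxr _ _)); rewrite rank_pid_mx// ltnW.
by rewrite leqNgt rn.
Qed.

Lemma diag_limit (s : nat -> Z -> R) : fcont s ->
  (forall i z, 0 <= s i z) -> (forall i z, s i z <= (1 / 2) ^+ i) ->
  exists C, [/\ ccvg (fun n => dg S n s) C, cadj C = C &
   forall p q, ent (cmul C C) p q = if p == q then rcf (fun z => s p z * s p z) else 0].
Proof.
move=> cs s0 s1.
have [|n|C hC] := @geometric_ccvg _ _ (fun n => dg S n s) (1 / 2) 1; first by apply/andP; split; lra.
  rewrite mul1r (_ : dg S n.+1 s - dg S n s = E n n (rcf (s n))).
    rewrite mxu_isometry; apply: nrm_rcf_le; [exact: (@fcontP _ _ _ _ cs)|by rewrite exprn_ge0//; lra|].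
    by move=> z; rewrite ger0_norm.
  by rewrite dgS addrC addKr.
exists C; split=> //.
  apply: (ccvg_unique _ hC); have := ccvg_adj hC; apply: eq_ccvg => n; exact: dg_adj.
move=> p q; apply/eqP; rewrite -subr_eq0; apply/eqP/nrm_small => e e0.
have [N hN] := ccvgM hC hC e0; pose n := maxn N p.+1.
have := hN n (leq_maxl _ _); rewrite (dg_mul S n cs cs) nrm_distC.
have <- : ent (dg S n (fun i z => s i z * s i z)) p q = if p == q then rcf (fun z => s p z * s p z) else 0.
  by rewrite ent_dg leq_maxr andbT.
by apply: le_lt_trans; rewrite -entB; exact: nrm_ent.
Qed.

Lemma mxu_pos p (s : Z -> R) : continuous s -> (forall z, 0 <= s z) -> cpositive (E p p (rcf s)).
Proof.
move=> cs s0; have cq : continuous (fun z => Num.sqrt (s z)) by exact: cR_sqrt.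
exists (E p p (rcf (fun z => Num.sqrt (s z)))).
have -> : cadj (E p p (rcf (fun z => Num.sqrt (s z)))) = E p p (rcf (fun z => Num.sqrt (s z))).
  rewrite mxu_adj; congr (E _ _ _); apply: CfunP => z; rewrite cev_adj rcfE; [exact: conjc_real|exact: cq].
rewrite mxu_mul eqxx rcf_mul; [|exact: cq|exact: cq].
by congr (E _ _ (rcf _)); apply/funext => z; rewrite -expr2 sqr_sqrtr.
Qed.

Lemma mxu_cuntz p q h : cuntz_le (E p p h) (E q q h).
Proof.
apply/cuntz_leP => e e0; exists (E p q cone).
by rewrite mxu_adj !mxu_mul !eqxx mxu_mul eqxx cadj_cone cmul1l cmul1r subrr nrm0.
Qed.

Lemma rk_mxu p (s : Z -> R) z j : continuous s -> (forall z, 0 <= s z) ->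
  (rk (E p p (rcf s)) z j.+1 <-> j = 0%N /\ 0 < s z).
Proof.
move=> cs s0; have -> : rk (E p p (rcf s)) z j.+1 <-> rk (E 0 0 (rcf s)) z j.+1.
  by split; apply: rk_cuntz; exact: mxu_cuntz.
pose h (i : nat) (y : Z) : R := if i == 0%N then s y else 0.
have ch : fcont h by split=> -[|i]; [exact: cs|exact: cR_cst].
have eh (a b : nat) : ent (E 0 0 (rcf s)) a b = if a == b then rcf (h a) else 0.
  rewrite ent_mxu; case: a => [|a]; case: b => [|b] //=; case: eqP => // _.
  by apply: CfunP => y; rewrite rcfE//; exact: cR_cst.
rewrite (diag_rk j eh ch); first by case: j => [|j] /=; split=> [|[]]//; rewrite ltxx.
- by case.
- by case.
Qed.

Lemma diag_model (O : nat -> set Z) : (forall k, open (O k)) -> (forall k, O k.+1 `<=` O k) ->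
  exists (D : S) (h : nat -> Z -> R), [/\ cpositive D, fcont h,
    forall k z, 0 <= h k z /\ (0 < h k z <-> O k z),
    forall p q, ent D p q = if p == q then rcf (h p) else 0 & forall z k, rk D z k.+1 <-> O k z].
Proof.
move=> oO dO; have /choice[t ht] := fun k => co (oO k).
(* The weights make the infinite diagonal converge in norm without changing the cozero sets. *)
pose s k z := (1 / 2) ^+ k * t k z.
have h2 k : 0 < (1 / 2) ^+ k :> R by rewrite exprn_gt0//; lra.
have cs : fcont s.
  by split=> k; apply: cR_mul; [exact: cR_cst|have [ct _ _] := ht k; exact: ct].
have s0 i z : 0 <= s i z by rewrite mulr_ge0 ?(ltW (h2 _))//; have [_ /(_ z)/andP[]] := ht i.
have s1 i z : s i z <= (1 / 2) ^+ i by rewrite ler_piMr ?(ltW (h2 _))//; have [_ /(_ z)/andP[]] := ht i.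
have [C [_ Ca eC]] := diag_limit cs s0 s1.
have sO k z : 0 < s k z <-> O k z by rewrite pmulr_rgt0//; have [_ _] := ht k; exact.
have hO k z : 0 < s k z * s k z <-> O k z.
  by rewrite -sO; split=> [|h]; [rewrite -expr2 exprn_even_gt0//= lt_neqAle eq_sym s0 => ->|rewrite mulr_gt0].
exists (cmul C C), (fun k z => s k z * s k z); split.
- by exists C; rewrite Ca.
- exact: (fcont_mul cs cs).
- by move=> k z; split; [rewrite mulr_ge0|exact: hO].
- exact: eC.
move=> z k; rewrite (diag_rk k eC (fcont_mul cs cs)) ?hO//.
  by move=> i; rewrite mulr_ge0.
move=> i /eqP; rewrite mulf_eq0 orbb => /eqP si; have : ~ O i.+1 z.
  by move=> /dO/sO; rewrite si ltxx.
move=> nO; have -> : s i.+1 z = 0; last by rewrite mulr0.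
by apply/eqP; rewrite eq_le s0 andbT leNgt; apply/negP => /sO.
Qed.

Lemma stab_rank_theory : rank_theory (@rk R Z cZ S).
Proof.
split.
- move=> a b pa pb; split=> [ab z k|]; first exact: rk_cuntz.
  exact: cuntz_compare.
- exact: rk0.
- by move=> a z k l lk; exact: rk_leq.
- by move=> a z k; exact: rk_open.
- move=> a b z m pa pb ab; split=> [|[k [l [<- ra rb]]]]; first exact: rk_add.
  by apply: rk_orth => //; [exact: cpositive_adj|exact: cpositive_adj|exact: rk_cube|exact: rk_cube].
- by move=> O oO dO; have [D [h [pD _ _ _ hD]]] := diag_model oO dO; exists D.
move=> O oO; have /choice[t ht] := fun k => co (oO k).
have ct k : continuous (t k) by have [h _ _] := ht k; exact: h.
have t0 k z : 0 <= t k z by have [_ /(_ z)/andP[]] := ht k.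
have cs : fcont t by split=> k; exact: ct.
have dgE k : \sum_(i < k) E i i (rcf (t i)) = dg S k t.
  by elim: k => [|k IH]; [rewrite big_ord0 dg0|rewrite big_ord_recr dgS -IH].
exists (fun k => E k k (rcf (t k))) => k; split.
- rewrite dgE; have cq : fcont (fun i z => Num.sqrt (t i z)).
    by split=> i; apply: cR_sqrt; exact: ct.
  exists (dg S k (fun i z => Num.sqrt (t i z))); rewrite (dg_adj S k cq) (dg_mul S k cq cq).
  by apply: eq_dg => i z _; rewrite -expr2 sqr_sqrtr.
- exact: mxu_pos.
- rewrite cmul_suml big1// => i _; rewrite mxu_mul ltn_eqF//.
move=> z j; rewrite rk_mxu; [|exact: ct|exact: t0].
by have [_ _ h] := ht k; split=> -[-> /h].
Qed.
End Instance.

Section CuRank.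
Context {R : realType} {Z : topologicalType} {A : cstarType R} {K : stabilization A}.
Context {rk : K -> Z -> nat -> Prop}.
Hypothesis T : rank_theory rk.
Implicit Types x y w : Cu K.

Definition crk x z k := exists2 a, Cu_set x a & rk a z k.

Lemma Cu_rep x : exists2 a, cpositive a & Cu_set x a.
Proof.
case: x => X [a pa XE]; exists a => //=; rewrite XE.
by split=> //; apply/(rt_le T pa pa).
Qed.

Lemma Cu_set_pos x a : Cu_set x a -> cpositive a.
Proof. by case: x => X [b pb XE] /=; rewrite XE => -[]. Qed.

Lemma Cu_set_rk x a b : Cu_set x a -> Cu_set x b -> forall z k, rk a z k -> rk b z k.
Proof.
case: x => X [c pc XE] /=; rewrite XE => -[pa ca ac] [pb cb bc] z k.
by move=> /((rt_le T pa pc).1 ac)/((rt_le T pc pb).1 cb).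
Qed.

Lemma crkE x a z k : Cu_set x a -> (crk x z k <-> rk a z k).
Proof.
move=> xa; split=> [[b xb rb]|ra]; last by exists a.
exact: Cu_set_rk xb xa _ _ rb.
Qed.

Lemma Cu_leP x y : Cu_le x y <-> forall z k, crk x z k -> crk y z k.
Proof.
split=> [[a [b [xa yb ab]]] z k|h].
  rewrite (crkE _ _ xa) (crkE _ _ yb).
  exact: (rt_le T (Cu_set_pos xa) (Cu_set_pos yb)).1 ab z k.
have [a pa xa] := Cu_rep x; have [b pb yb] := Cu_rep y; exists a, b; split=> //.
apply/(rt_le T pa pb) => z k ra; apply/(crkE _ _ yb); apply: h.
exact/(crkE _ _ xa).
Qed.

Lemma crk_le x y z k : Cu_le x y -> crk x z k -> crk y z k.
Proof. by move=> /Cu_leP; exact. Qed.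

Lemma Cu_set_crk y b : cpositive b -> (forall z k, rk b z k <-> crk y z k) -> Cu_set y b.
Proof.
move=> pb h; have [a pa ya] := Cu_rep y.
have e z k : rk b z k <-> rk a z k by rewrite h; exact: crkE.
clear h; case: y ya => Y [c pc XE] /=; rewrite XE => -[_ ca ac].
split=> //.
  by apply/(rt_le T pc pb) => z k /((rt_le T pc pa).1 ca); rewrite e.
by apply/(rt_le T pb pc) => z k; rewrite e; exact: (rt_le T pa pc).1.
Qed.

Lemma crk_of a (pa : cpositive a) z k : crk (Cu_of pa) z k <-> rk a z k.
Proof. by apply: crkE; split=> //; apply/(rt_le T pa pa). Qed.

Lemma crk0 x z : crk x z 0.
Proof. by have [a _ xa] := Cu_rep x; exists a => //; exact: (rt_0 T). Qed.

Lemma crk_leq x z k l : (l <= k)%N -> crk x z k -> crk x z l.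
Proof. by move=> lk [a xa ra]; exists a => //; exact: (rt_leq T) lk ra. Qed.

Lemma crk_open x k : open [set z | crk x z k].
Proof.
rewrite openE => z [a xa ra]; apply: filterS (rt_open T ra) => y ry.
by exists a.
Qed.

Lemma crk_add x y w z m : Cu_add x y w ->
  (crk w z m <-> exists k l, [/\ (k + l)%N = m, crk x z k & crk y z l]).
Proof.
move=> [a [b [xa yb ab wab]]]; rewrite (crkE _ _ wab).
rewrite (rt_sum T _ _ (Cu_set_pos xa) (Cu_set_pos yb) ab).
split=> -[k [l [kl ra rb]]]; exists k, l; split=> //; try by [exists a|exists b].
  by apply/(crkE _ _ xa).
by apply/(crkE _ _ yb).
Qed.

Lemma Cu_diag (O : nat -> set Z) : (forall k, open (O k)) -> (forall k, O k.+1 `<=` O k) ->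
  exists x, forall z k, crk x z k.+1 <-> O k z.
Proof.
move=> oO dO; have [D pD hD] := rt_diag T oO dO; exists (Cu_of pD) => z k.
by rewrite crk_of.
Qed.

(** [Cu_diag] realises the pointwise supremum of the ranks as a class. It is an upper bound of [u],
    so it dominates [x]. *)
Lemma crk_sup u x z k : Cu_sup u x -> (crk x z k <-> exists n, crk (u n) z k).
Proof.
move=> [ux xu]; split; last by move=> [n]; exact: crk_le.
case: k => [_|k]; first by exists 0%N; exact: crk0.
have [||y hy] := @Cu_diag (fun k => [set z | exists n, crk (u n) z k.+1]).
- move=> k'; have -> : [set z | exists n, crk (u n) z k'.+1] = \bigcup_n [set z | crk (u n) z k'.+1].
    by apply/seteqP; split=> z' /= [n]; [exists n|move=> _; exists n].
  by apply: bigcup_open => n _; exact: crk_open.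
- by move=> k' z' /= [n hn]; exists n; exact: crk_leq hn.
have uy n : Cu_le (u n) y.
  by apply/Cu_leP => z' [_|k' h]; [exact: crk0|apply/hy; exists n].
by move=> h; apply/hy; exact: crk_le (xu _ uy) h.
Qed.

Lemma Cu_supP u x : (forall z k, crk x z k <-> exists n, crk (u n) z k) -> Cu_sup u x.
Proof.
move=> h; split=> [n|y hy]; first by apply/Cu_leP => z k hn; apply/h; exists n.
by apply/Cu_leP => z k /h[n]; exact: crk_le.
Qed.

Hypothesis co : cozeros R Z.

(** The class of a function with cozero set [O]. *)
Definition is_ind x (O : set Z) := forall z k, crk x z k.+1 <-> k = 0%N /\ O z.

Lemma crk_inj x y : (forall z k, crk x z k <-> crk y z k) -> x = y.
Proof.
move=> h; have [a pa xa] := Cu_rep x; apply: (Cu_eq xa); apply: Cu_set_crk => // z k.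
by rewrite -h; apply: iff_sym; exact: crkE.
Qed.

Lemma ind_inj x y O : is_ind x O -> is_ind y O -> x = y.
Proof.
by move=> hx hy; apply: crk_inj => z [|k]; [split=> _; exact: crk0|rewrite hx hy].
Qed.

Lemma crk_zero z k : crk (Cu_zero : Cu K) z k.+1 -> False.
Proof.
have [O h] := @Cu_diag (fun _ => set0) (fun _ => open0) (fun _ _ => id).
have e : Cu_le (Cu_zero : Cu K) O.
  have [a pa xa] := Cu_rep O; exists 0, a; split=> //.
    have p0 : cpositive (0 : K) by exact: cpositive0.
    by split=> //; apply/(rt_le T p0 p0).
  by apply/cuntz_leP => e e0; exists 0; rewrite !cmul0l subrr nrm0.
by move=> /(crk_le e)/h.
Qed.

Lemma ind_sums (O : nat -> set Z) : (forall k, open (O k)) ->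
  exists x w : nat -> Cu K, [/\ w 0%N = Cu_zero, forall k, is_ind (x k) (O k) &
    forall k, Cu_add (w k) (x k) (w k.+1)].
Proof.
move=> oO; have [a ha] := rt_ortho T oO.
have pw k : cpositive (\sum_(i < k) a i) by have [] := ha k.
have px k : cpositive (a k) by have [] := ha k.
have refl b (pb : cpositive b) : Cu_set (Cu_of pb : Cu K) b by split=> //; apply/(rt_le T pb pb).
exists (fun k => Cu_of (px k)), (fun k => Cu_of (pw k)); split.
- apply: (@Cu_eq _ _ _ _ _ (\sum_(i < 0) a i)); first exact: refl.
  by rewrite big_ord0; exact: refl.
- by move=> k z j; rewrite crk_of; have [_ _ _] := ha k; exact.
move=> k; exists (\sum_(i < k) a i), (a k); have [_ _ h _] := ha k; split; rewrite ?h//.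
suff -> : \sum_(i < k) a i + a k = \sum_(i < k.+1) a i by exact: refl.
by rewrite big_ord_recr.
Qed.

(** [x] is the supremum of the classes whose layers are cut down to the sets [n.+1%:R^-1 < m j z].
    Being compact it lies below one of these, whose rank is at most [k] near every zero of [m k]. *)
Lemma ll_clopen x z0 k : Cu_ll x x -> ~ crk x z0 k -> \forall z \near z0, ~ crk x z k.
Proof.
move=> xx; case: k => [[]|k nk]; first exact: crk0.
have /choice[t ht] := fun k => co (crk_open x k.+1).
(* Running minima, so that the superlevel sets decrease with [k] as [Cu_diag] requires. *)
pose m := fix m k : Z -> R := if k is j.+1 then (fun z => Num.min (m j z) (t k z)) else t 0%N.
have cm j : continuous (m j).
  elim: j => [|j IH]; first by have [ct _ _] := ht 0%N; exact: ct.
  by apply: cR_min; [exact: IH|have [ct _ _] := ht j.+1; exact: ct].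
have mP j z : 0 < m j z <-> crk x z j.+1.
  elim: j => [|j IH]; first by have [_ _ h] := ht 0%N; exact: h.
  rewrite /= lt_min; have [_ _ h] := ht j.+1; split=> [/andP[_ /h]//|r].
  by rewrite (h z).2// andbT; apply/IH; exact: crk_leq r.
have mS j z : m j.+1 z <= m j z by rewrite /= ge_min lexx.
have /choice[u hu] (n : nat) : exists y : Cu K, forall z k, crk y z k.+1 <-> n.+1%:R^-1 < m k z.
  apply: Cu_diag => j; first by exact: open_superlevel.
  by move=> z /= h; exact: lt_le_trans (mS j z).
have [|||n hn] := xx u x.
- move=> n; apply/Cu_leP => z [_|j]; first exact: crk0.
  move/hu => h; apply/hu; apply: lt_trans h; rewrite ltf_pV2 ?posrE ?ltr0n// ltr_nat//.
- apply: Cu_supP => z [|j]; first by split=> _; [exists 0%N|]; exact: crk0.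
  split=> [/mP h|[n /hu h]]; last by apply/mP; apply: lt_trans h; rewrite invr_gt0 ltr0n.
  by have [N hN] := invS_small h; exists N; apply/hu; exact: hN.
- by apply/Cu_leP.
have m0 : m k z0 = 0.
  have : ~~ (0 < m k z0) by apply/negP => /mP.
  rewrite -leNgt => h; apply/eqP; rewrite eq_le h/=.
  elim: {nk h}k => [|j IH]; first by have [_ /(_ z0)/andP[]] := ht 0%N.
  by rewrite /= le_min IH; have [_ /(_ z0)/andP[]] := ht j.+1.
have n0 : 0 < n.+1%:R^-1 :> R by rewrite invr_gt0 ltr0n.
have /real_continuousP/(_ z0 _ n0) := cm k; apply: filterS => z.
rewrite m0 sub0r normrN => /ltr_normlP[_ h] /((Cu_leP _ _).1 hn)/hu.
by rewrite ltNge ltW.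
Qed.

(** The support is open and closed, hence compact, so an increasing sequence covering it does so at
    a finite stage. *)
Lemma clopen_ll x (cZ : compact [set: Z]) : (forall z, ~ crk x z 2) ->
  (forall z, ~ crk x z 1 -> \forall z' \near z, ~ crk x z' 1) -> Cu_ll x x.
Proof.
move=> x2 x1 u y iu uy xy.
have um n m : (n <= m)%N -> forall z k, crk (u n) z k -> crk (u m) z k.
  move=> nm z k; rewrite -(subnKC nm); elim: (m - n)%N => [|j IH]; first by rewrite addn0.
  by move=> /IH; rewrite addnS; apply: crk_le; exact: iu.
have [|N hN] := @compact_uniform Z cZ (fun n z => crk x z 1 -> crk (u n) z 1).
  move=> z0; have [h|h] := pselect (crk x z0 1); last first.
    by exists 0%N; apply: filterS (x1 _ h) => z h' n _ /h'.
  have /(crk_sup _ _ uy)[n hn] := (Cu_leP _ _).1 xy _ _ h.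
  exists n; have := crk_open (u n) 1; rewrite openE => /(_ z0 hn).
  by apply: filterS => z hz m nm _; exact: um hz.
exists N; apply/Cu_leP => z [_|[h|k h]]; first exact: crk0.
  exact: hN (leqnn N) h.
by case: (x2 z); exact: crk_leq h.
Qed.

End CuRank.

(** * Integer valuations *)

(** A valuation on $[0,1]$ is extended by zero to [R], so that intervals and half-lines need no
    distinction at the end points. *)
Record valuation1 (R : realType) (w : set R -> nat) : Prop := Valuation1 {
  w_mono : forall U V : set R, open U -> open V -> U `<=` V -> (w U <= w V)%N ;
  w_mod : forall U V : set R, open U -> open V -> (w U + w V = w (U `|` V) + w (U `&` V))%N ;
  w_sup : forall (U : nat -> set R) k, (forall n, open (U n)) -> (forall n, U n `<=` U n.+1) ->
    (k < w (\bigcup_n U n))%N -> exists n, (k < w (U n))%N ;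
  w_out : forall U : set R, open U -> (forall t : R, 0 <= t <= 1 -> ~ U t) -> w U = 0%N }.

Section Valuation.
Context {R : realType} {w : set R -> nat}.
Hypothesis W : valuation1 w.
Let M := w setT.
Local Notation up s := [set t : R | s < t].
Local Notation dn s := [set t : R | t < s].

Let oup (s : R) : open (up s).
Proof. by apply: (@open_superlevel R R id) => x; exact: cvg_id. Qed.

Let odn (s : R) : open (dn s).
Proof.
have -> : dn s = [set t : R | - s < - t] by apply/seteqP; split=> t /=; rewrite ltrN2.
by apply: (@open_superlevel R R (fun t => - t)) => x; apply: cvgN; exact: cvg_id.
Qed.

Let wM (U : set R) : open U -> (w U <= M)%N.
Proof. by move=> oU; apply: (w_mono W) => //; exact: openT. Qed.

Let w0 : w set0 = 0%N.
Proof. by apply: (w_out W); [exact: open0|move=> t _ []]. Qed.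

Let w_disj (U V : set R) : open U -> open V -> U `&` V = set0 -> (w U + w V = w (U `|` V))%N.
Proof. by move=> oU oV UV; rewrite (w_mod W)// UV w0 addn0. Qed.

(** The order statistics: the points of the valuation, repeated with multiplicity and listed from
    the largest, [l] starting at 0. The value 0 is adjoined for the empty case. *)
Definition lam l : R := sup [set t : R | t = 0 \/ [/\ 0 <= t, t <= 1 & (l < w (up t))%N]].

Let lamE l : has_sup [set t : R | t = 0 \/ [/\ 0 <= t, t <= 1 & (l < w (up t))%N]].
Proof. by split; [exists 0; left|exists 1; move=> t [->|[]]]. Qed.

Lemma lam_ge0 l : 0 <= lam l.
Proof. by apply: ub_le_sup; [have [] := lamE l|left]. Qed.

Lemma lam_anti l l' : (l <= l')%N -> lam l' <= lam l.
Proof.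
move=> ll; apply: ge_sup; first by have [] := lamE l'.
move=> t [->|[t0 t1 h]]; first exact: lam_ge0.
by apply: ub_le_sup; [have [] := lamE l|right; split=> //; exact: leq_ltn_trans h].
Qed.

Lemma w_up (s : R) l : (l < M)%N -> (l < w (up s))%N = (s < lam l).
Proof.
move=> lM; have [s0|s0] := ltP s 0.
  rewrite (lt_le_trans s0 (lam_ge0 l)).
  have e : up s `|` dn 0 = setT.
    apply/seteqP; split=> // t _ /=; have [t0|t0] := ltP t 0; [by right|left].
    exact: lt_le_trans t0.
  have h1 : w (dn 0) = 0%N.
    by apply: (w_out W) => // t /andP[t0 _] /=; rewrite ltNge t0.
  by have := w_mod W (@oup s) (@odn 0); rewrite e h1 addn0 => ->; rewrite (leq_trans lM)// leq_addr.
apply/idP/idP => [h|h].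
  (* Continuity from below leaves room to the right of [s], which makes the inequality with the
     supremum strict. *)
  have e : up s = \bigcup_n up (s + n.+1%:R^-1).
    apply/seteqP; split=> t /=.
      move=> st; have d0 : 0 < t - s by rewrite subr_gt0.
      by have [N hN] := invS_small d0; exists N => //=; rewrite -ltrBrDl; exact: hN.
    by move=> [n _ /=]; apply: lt_trans; rewrite ltrDl invr_gt0 ltr0n.
  rewrite e in h; have [|n|n hn] := w_sup W _ _ h; first by move=> n; exact: oup.
    by move=> t /=; apply: le_lt_trans; rewrite lerD2l lef_pV2 ?posrE ?ltr0n// ler_nat.
  set t := s + n.+1%:R^-1 in hn.
  have st : s < t by rewrite ltrDl invr_gt0 ltr0n.
  have t1 : t < 1.
    rewrite ltNge; apply/negP => t1; move: hn; rewrite (w_out W)// => u /andP[_ u1] /=.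
    by rewrite ltNge (le_trans u1).
  apply: (lt_le_trans st); apply: ub_le_sup; first by have [] := lamE l.
  by right; split=> //; [exact: ltW (le_lt_trans s0 st)|exact: ltW].
have d0 : 0 < lam l - s by rewrite subr_gt0.
have [t ht] := sup_adherent d0 (lamE l); rewrite -/(lam l) subKr => st.
move: ht => [t0|[_ _ lt]]; first by move: st; rewrite t0 ltNge s0.
by apply: (leq_trans lt); apply: (w_mono W) => // u /=; exact: lt_trans.
Qed.

Definition cnt (P : set R) : nat := (\sum_(l < M) `[< P (lam l) >])%N.

Let cnt_le P Q : (forall t, P t -> Q t) -> (cnt P <= cnt Q)%N.
Proof.
move=> PQ; apply: leq_sum => l _; case: asboolP => // /PQ Pl.
by rewrite asboolT.
Qed.

Let cnt_split P Q Q' : (forall t, P t -> Q t \/ Q' t) -> (cnt P <= cnt Q + cnt Q')%N.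
Proof.
move=> h; rewrite /cnt -big_split; apply: leq_sum => l _; case: asboolP => // /h[] Pl /=.
  by rewrite (asboolT Pl).
by rewrite (asboolT Pl) addn1.
Qed.

Let cnt_disj P Q Q' : (forall t, Q t -> P t /\ ~ Q' t) -> (forall t, Q' t -> P t) ->
  (cnt Q + cnt Q' <= cnt P)%N.
Proof.
move=> h h'; rewrite /cnt -big_split; apply: leq_sum => l _ /=.
case: (asboolP (Q _)) => [/h[Pl nQ]|_]; first by rewrite (asboolF nQ) (asboolT Pl).
by case: (asboolP (Q' _)) => // /h' Pl; rewrite (asboolT Pl).
Qed.

Let cntT P : (forall t, P t) -> cnt P = M.
Proof.
move=> h; rewrite /cnt (eq_bigr (fun=> 1%N)) => [|l _]; last by rewrite asboolT.
by rewrite sum_nat_const card_ord muln1.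
Qed.

Let cnt_not P : (cnt P + cnt (~` P) = M)%N.
Proof.
have e := @cntT setT (fun _ => I); apply/eqP; rewrite eqn_leq; apply/andP; split; rewrite -e.
  by apply: cnt_disj => // t Pt; split=> // nP; exact: nP.
by apply: cnt_split => t _; have [h|h] := pselect (P t); [left|right].
Qed.

Let w_upE (s : R) : w (up s) = cnt (up s).
Proof.
have -> : cnt (up s) = (\sum_(l < M) (l < w (up s))%N)%N.
  by apply: eq_bigr => l _; rewrite w_up//; congr nat_of_bool; exact: asboolb.
have := wM (@oup s); move: (w (up s)) => k.
elim: M => [|n IH]; first by rewrite leqn0 big_ord0 => /eqP.
rewrite big_ord_recr/= leq_eqVlt => /orP[/eqP->|kn].
  rewrite ltnSn (eq_bigr (fun=> 1%N)) => [|l _]; first by rewrite sum_nat_const card_ord muln1 addn1.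
  by rewrite ltnS ltnW.
by rewrite -IH// [(n < k)%N]ltnNge -ltnS kn addn0.
Qed.

Let gap (v : R) : exists2 d : R, 0 < d & forall l : 'I_M, lam l < v -> lam l + d <= v.
Proof.
have [|d d0 hd] := @finite_gap R _ (fun l : 'I_M => if lam l < v then lam l else v - 1) v.
  by move=> l; case: ifP => //; lra.
by exists d => // l lv; have := hd l; rewrite lv.
Qed.

Let w_dnE (t : R) : w (dn t) = cnt (dn t).
Proof.
apply/eqP; rewrite eqn_leq; apply/andP; split.
  rewrite leqNgt; apply/negP => h.
  have e : dn t = \bigcup_n dn (t - n.+1%:R^-1).
    apply/seteqP; split=> u /=.
      move=> st; have d0 : 0 < t - u by rewrite subr_gt0.
      by have [N hN] := invS_small d0; exists N => //=; rewrite ltrBrDr -ltrBrDl; exact: hN.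
    by move=> [n _ /=] h2; apply: (lt_trans h2); rewrite gtrBl invr_gt0 ltr0n.
  rewrite {2}e in h; have [|n|n hn] := w_sup W _ _ h; first by move=> n; exact: odn.
    by move=> u /= h2; apply: (lt_le_trans h2); rewrite lerD2l lerN2 lef_pV2 ?posrE ?ltr0n// ler_nat.
  set t' := t - n.+1%:R^-1 in hn.
  have tt : t' < t by rewrite gtrBl invr_gt0 ltr0n.
  have h1 : (w (dn t') + w (up t') <= M)%N.
    rewrite w_disj ?wM//; first exact: openU.
    by rewrite -subset0 => u /= [h1 h2]; have := lt_trans h1 h2; rewrite ltxx.
  have h2 := cnt_not (up t'); rewrite w_upE in h1.
  have h3 : (cnt (~` up t') <= cnt (dn t))%N.
    by apply: cnt_le => u /= /negP; rewrite -leNgt => h3; exact: le_lt_trans tt.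
  move: h1; rewrite -h2 addnC leq_add2l => /leq_trans/(_ h3); by rewrite leqNgt hn.
(* No point of the valuation lies strictly between [s] and [t]. *)
have [d d0 hd] := gap t; pose s := t - d.
have e : dn t `|` up s = setT.
  apply/seteqP; split=> // u _ /=; have [h|h] := ltP u t; [by left|right].
  by apply: lt_le_trans h; rewrite gtrBl.
have := w_mod W (@odn t) (@oup s); rewrite e -/M w_upE => h1.
have h2 := cnt_not (up s).
have h3 : (cnt (dn t) <= cnt (~` up s))%N.
  apply: leq_sum => l _; case: asboolP => // /= lt; rewrite asboolT// => /= sl.
  by have := hd l lt; rewrite /s in sl; lra.
have h4 : (M <= w (dn t) + cnt (up s))%N by rewrite h1 leq_addr.
by move: h4; rewrite -h2 addnC leq_add2r; exact: leq_trans.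
Qed.

Let w_itv (s t : R) : s < t -> w (up s `&` dn t) = cnt (up s `&` dn t).
Proof.
move=> st; have e : up s `|` dn t = setT.
  apply/seteqP; split=> // u _ /=; have [h|h] := ltP u t; [by right|left].
  exact: lt_le_trans h.
have := w_mod W (@oup s) (@odn t); rewrite e -/M w_upE w_dnE => h1.
have h2 : (cnt (up s) + cnt (dn t) = M + cnt (up s `&` dn t))%N.
  rewrite -(@cntT setT)// /cnt -!big_split; apply: eq_bigr => l _ /=; rewrite (asboolT I).
  case: (asboolP (s < lam l)) => h; case: (asboolP (lam l < t)) => h'.
  - by rewrite (asboolT (conj h h')).
  - by rewrite asboolF// => -[_ /h'].
  - by rewrite asboolF// => -[/h].
  - by move/negP: h; rewrite -leNgt => h; case: h'; exact: le_lt_trans st.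
lia.
Qed.

(** Induction on the number of points in [V]. The largest one, [v], is caught with its multiplicity
    in an interval inside [V]. The others lie in the part of [V] to the left of that interval,
    because [s] is chosen in the gap below [v]. *)
Let w_ge (V : set R) : open V -> (cnt V <= w V)%N.
Proof.
move: {2}(cnt V) (leqnn (cnt V)) => n; elim: n V => [|n IH] V Vn oV.
  by move: Vn; rewrite leqn0 => /eqP->.
have [V0|V0] := posnP (cnt V); first by rewrite V0.
have ex : exists l, (l < M)%N && `[< V (lam l) >].
  apply: contrapT => /forallNP h; move: V0; rewrite /cnt big1// => l _.
  by have := h l; rewrite ltn_ord/=; case: asboolP.
have [l0 /andP[l0M /asboolP Vl0] lmin] := ex_minnP ex.
have [v vE] : exists v, v = lam l0 by exists (lam l0).
rewrite -vE in Vl0; have /nbhs_ballP[rho /= r0 rV] := open_nbhs_nbhs (conj oV Vl0).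
have [d d0 hd] := gap v.
have [s [sv sr sd]] : exists s, [/\ s < v, v - rho < s & v - d < s].
  have [h|h] := leP rho d; [exists (v - rho / 2)|exists (v - d / 2)]; split; lra.
pose V1 := up s `&` dn (v + rho); pose V2 := V `&` dn s.
have oV1 : open V1 by exact: openI. have oV2 : open V2 by exact: openI.
have V1V : V1 `<=` V.
  by move=> t [/= t1 t2]; apply: rV; rewrite /ball/= ltr_norml; apply/andP; split; lra.
have dj : V1 `&` V2 = set0.
  by rewrite -subset0 => t /= [[/= t1 _] [_ /= t2]]; have := lt_trans t1 t2; rewrite ltxx.
have h1 : (w V1 + w V2 <= w V)%N.
  rewrite w_disj//; apply: (w_mono W) => //; first exact: openU.
  by move=> t [/V1V|[]].
have e1 : w V1 = cnt V1 by apply: w_itv; lra.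
have h2 : (cnt V <= cnt V1 + cnt V2)%N.
  rewrite /cnt -big_split; apply: leq_sum => l _; case: asboolP => //= Vl.
  have lv : lam l <= v by rewrite vE; apply: lam_anti; apply: lmin; rewrite ltn_ord asboolT.
  case: (ltP (lam l) v) => lv'.
    rewrite [`[< V2 _ >]]asboolT ?addn1//; split=> //=.
    by have := hd l lv'; lra.
  have lE : lam l = v by apply/eqP; rewrite eq_le lv.
  by rewrite asboolT//; split=> /=; rewrite lE//; lra.
have h3 : (cnt V1 + cnt V2 <= cnt V)%N.
  apply: cnt_disj => [t V1t|t []//]; split; first exact: V1V.
  by move=> V2t; have : (V1 `&` V2) t by []; rewrite dj.
have h4 : (0 < cnt V1)%N.
  rewrite /cnt (bigD1 (Ordinal l0M))//= asboolT//; split=> /=; rewrite -vE; lra.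
have h5 : (cnt V2 <= w V2)%N by apply: IH => //; lia.
lia.
Qed.

Let sum_lt n k : (k <= n)%N -> (\sum_(l < n) (l < k)%N = k)%N.
Proof.
elim: n => [|n IH]; first by rewrite leqn0 big_ord0 => /eqP.
rewrite big_ord_recr/= leq_eqVlt => /orP[/eqP->|kn].
  rewrite ltnSn (eq_bigr (fun=> 1%N)) => [|l _]; first by rewrite sum_nat_const card_ord muln1 addn1.
  by rewrite ltnS ltnW.
by rewrite IH// [(n < k)%N]ltnNge -ltnS kn addn0.
Qed.

Lemma w_dn (t : R) l : (l < M)%N -> (M <= w (dn t) + l)%N = (lam l < t).
Proof.
move=> lM; rewrite w_dnE -(cnt_not (dn t)) leq_add2l.
have -> : cnt (~` dn t) = (\sum_(l' < M) (t <= lam l')%R)%N.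
  apply: eq_bigr => l' _; congr nat_of_bool; rewrite leNgt.
  by case: (asboolP ((~` dn t) (lam l'))) => /= h; [apply/esym/negP|apply/esym/negbTE; rewrite negbK; apply: contrapT].
have [h|h] := ltP (lam l) t.
  apply: (@leq_trans (\sum_(l' < M) (l' < l)%N)); last by rewrite sum_lt// ltnW.
  apply: leq_sum => l' _; case: (ltnP l' l) => [_|/lam_anti h']; first exact: leq_b1.
  by rewrite leNgt (le_lt_trans h' h).
apply: negbTE; rewrite -ltnNge.
apply: (@leq_trans (\sum_(l' < M) (l' < l.+1)%N)); first by rewrite sum_lt.
by apply: leq_sum => l' _; rewrite ltnS; case: (leqP l' l) => [/lam_anti h'|_]; rewrite ?(le_trans h h').
Qed.

Lemma lam_out l : (M <= l)%N -> lam l = 0.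
Proof.
move=> Ml; apply/eqP; rewrite eq_le lam_ge0 andbT; apply: ge_sup; first by have [] := lamE l.
by move=> t [->//|[_ _ h]]; have := leq_trans h (wM (@oup t)); rewrite ltnNge Ml.
Qed.

(** For the upper bound [V] is exhausted by the sets on which [depth V] is not small. Each of them
    leaves room for a disjoint open neighbourhood of the complement of [V], to which [w_ge]
    applies. *)
Lemma w_cnt (V : set R) : open V -> w V = cnt V.
Proof.
move=> oV; apply/eqP; rewrite eqn_leq w_ge// andbT leqNgt; apply/negP => h.
pose U n := [set t : R | n.+1%:R^-1 < depth V t].
have oU n : open (U n) by apply: open_superlevel; exact: depth_continuous.
have e : V = \bigcup_n U n.
  apply/seteqP; split=> t /=.
    move=> Vt; have d0 := depth_gt0 oV Vt.
    by have [N hN] := invS_small d0; exists N => //=; exact: hN.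
  move=> [n _ h2]; apply: contrapT => /depth_out h3; move: h2; rewrite /U/= h3.
  by rewrite ltNge invr_ge0 ler0n.
rewrite {2}e in h; have [//|n|n hn] := w_sup W _ _ h.
  by move=> t /=; apply: le_lt_trans; rewrite lef_pV2 ?posrE ?ltr0n// ler_nat.
pose O := [set t : R | - n.+1%:R^-1 < - depth V t].
have oO : open O.
  apply: (@open_superlevel R R (fun t => - depth V t)) => t; apply: cvgN; exact: depth_continuous.
have h1 : (w (U n) + w O <= M)%N.
  rewrite w_disj ?wM//; first exact: openU.
  rewrite -subset0 => t [h1 h2]; rewrite /U/O/= in h1 h2; rewrite ltrN2 in h2.
  by have := lt_trans h1 h2; rewrite ltxx.
have h2 := w_ge oO; have h3 := cnt_not V.
have h4 : (cnt (~` V) <= cnt O)%N.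
  by apply: cnt_le => t /depth_out h5; rewrite /O/= h5 ltrN2 invr_gt0 ltr0n.
lia.
Qed.

End Valuation.

Section ValuationField.
Context {R : realType} {X V : topologicalType} {m : nat}.
Local Notation I := (`[0, 1 : R]%classic : Type).
Local Notation Z := ((X * I) * discrete_topology 'I_m)%type.
Hypothesis X_open : forall x : X, open [set x' | x' <> x].
Context {px : V -> X} {nu : V -> set Z -> nat}.

Record valuation_field : Prop := ValuationField {
  vf_mono : forall y (O O' : set Z), open O -> open O' -> O `<=` O' -> (nu y O <= nu y O')%N ;
  vf_mod : forall y (O O' : set Z), open O -> open O' ->
    (nu y O + nu y O' = nu y (O `|` O') + nu y (O `&` O'))%N ;
  vf_sup : forall y (O : nat -> set Z) k, (forall n, open (O n)) -> (forall n, O n `<=` O n.+1) ->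
    (k < nu y (\bigcup_n O n))%N -> exists n, (k < nu y (O n))%N ;
  vf_out : forall y (O : set Z), open O -> (forall t i, ~ O ((px y, t), i)) -> nu y O = 0%N ;
  vf_open : forall y (O : set Z) k, open O -> (k < nu y O)%N -> \forall y' \near y, (k < nu y' O)%N ;
  vf_class : forall y (i : 'I_m), \forall y' \near y, nu y' [set z | z.2 = i] = nu y [set z | z.2 = i] }.

Hypothesis N : valuation_field.

Definition cyl (i : 'I_m) (U : set R) : set Z := [set z | z.2 = i /\ U (set_val z.1.2)].

Lemma cyl_open i U : open U -> open (cyl i U).
Proof.
rewrite !openE => oU [[x t] j] [/= -> Ut].
have := @set_val_continuous R t _ (oU _ Ut) => h.
exists ([set p : X * I | U (set_val p.2)], [set i]); first by split=> //=; exists (setT, [set s : I | U (set_val s)]); [split=> //; exact: filterT|case=> ? ? []].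
by move=> [[x' t'] j'] /= [h1 ->].
Qed.

Let class_cyl (i : 'I_m) : [set z : Z | z.2 = i] = cyl i setT.
Proof. by apply/seteqP; split=> z /= => [|[]]. Qed.

Let w y i (U : set R) := nu y (cyl i U).

Let valuation1_w y i : valuation1 (w y i).
Proof.
split.
- move=> U U' oU oU' UU; apply: (vf_mono N); [exact: cyl_open|exact: cyl_open|].
  by move=> z [zi /UU].
- move=> U U' oU oU'; rewrite /w (vf_mod N); [|exact: cyl_open|exact: cyl_open].
  congr (nu y _ + nu y _)%N; apply/seteqP; split=> z.
  + by move=> [[zi h]|[zi h]]; split=> //; [left|right].
  + by move=> [zi [h|h]]; [left|right].
  + by move=> [[zi h] [_ h']].
  + by move=> [zi [h h']].
- move=> U k oU iU; rewrite /w.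
  have -> : cyl i (\bigcup_n U n) = \bigcup_n cyl i (U n).
    by apply/seteqP; split=> z; [move=> [zi [n _ h]]; exists n|move=> [n _ [zi h]]; split=> //; exists n].
  apply: (vf_sup N); first by move=> n; exact: cyl_open.
  by move=> n z [zi /iU].
move=> U oU U01; apply: (vf_out N); first exact: cyl_open.
move=> t j [_ /= h]; exact: U01 (set_val01 t) h.
Qed.

Definition mult (i : 'I_m) y : nat := nu y [set z | z.2 = i].
Definition atom (i : 'I_m) l y : R := @lam R (w y i) l.

Let multE i y : mult i y = w y i setT.
Proof. by rewrite /mult class_cyl. Qed.

Lemma mult_near i y : \forall y' \near y, mult i y' = mult i y.
Proof. exact: (vf_class N). Qed.

Let atom_lt i l y (s : R) : (l < mult i y)%N -> s < atom i l y -> \forall y' \near y, s < atom i l y'.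
Proof.
move=> lm; rewrite /atom -(w_up (valuation1_w y i)) -?multE// => h.
have oc : open (cyl i [set t : R | s < t]).
  by apply: cyl_open; apply: (@open_superlevel R R id) => u; exact: cvg_id.
apply: filterS2 (mult_near i y) (vf_open N oc h) => y' e h'.
by rewrite -(w_up (valuation1_w y' i)) -?multE ?e.
Qed.

Let atom_gt i l y (s : R) : (l < mult i y)%N -> atom i l y < s -> \forall y' \near y, atom i l y' < s.
Proof.
move=> lm; rewrite /atom -(w_dn (valuation1_w y i)) -?multE// => h.
have oc : open (cyl i [set t : R | t < s]).
  apply: cyl_open; have -> : [set t : R | t < s] = [set t : R | - s < - t] by apply/seteqP; split=> t /=; rewrite ltrN2.
  by apply: (@open_superlevel R R (fun t => - t)) => u; apply: cvgN; exact: cvg_id.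
have [M0|M0] := posnP (mult i y); first by rewrite M0 in lm.
(* [vf_open] expects a strict lower bound, hence the predecessor. *)
have hk : ((mult i y - l).-1 < nu y (cyl i [set t : R | (t < s)%R]))%N.
  by rewrite prednK ?subn_gt0// leq_subLR addnC.
apply: filterS2 (mult_near i y) (vf_open N oc hk) => y' e h'.
rewrite -(w_dn (valuation1_w y' i)) -?multE ?e//.
by move: h'; rewrite prednK ?subn_gt0// leq_subLR addnC.
Qed.

(** [nu] is lower semicontinuous. Applied to the half-lines above and below, with the total mass
    constant near [y], this bounds the atom from both sides. *)
Lemma atom_continuous i l : continuous (atom i l).
Proof.
apply/real_continuousP => y e e0; have [lm|lm] := ltnP l (mult i y); last first.
  apply: filterS (mult_near i y) => y' me.
  rewrite /atom (lam_out (valuation1_w y i)) -?multE// (lam_out (valuation1_w y' i)) -?multE ?me//.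
  by rewrite subrr normr0.
have h1 : atom i l y - e < atom i l y by lra.
have h2 : atom i l y < atom i l y + e by lra.
apply: filterS2 (atom_lt lm h1) (atom_gt lm h2) => y' h3 h4.
by rewrite ltr_norml; apply/andP; split; lra.
Qed.

Let nu0 y : nu y set0 = 0%N.
Proof. by apply: (vf_out N); [exact: open0|move=> t i []]. Qed.

Let nu_cyls y (U : 'I_m -> set R) : (forall i, open (U i)) ->
  nu y [set z | cyl z.2 (U z.2) z] = (\sum_i w y i (U i))%N.
Proof.
move=> oU; pose C n := [set z : Z | (z.2 < n)%N /\ cyl z.2 (U z.2) z].
have CE n (nm : (n < m)%N) : C n.+1 = C n `|` cyl (Ordinal nm) (U (Ordinal nm)).
  apply/seteqP; split=> z.
    move=> [zn zU]; move: zn; rewrite ltnS leq_eqVlt => /orP[/eqP zn|zn]; [right|by left].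
    by have <- : z.2 = Ordinal nm by exact/val_inj.
  by move=> [[zn h]|[zn h]]; split; rewrite ?ltnS ?(ltnW zn)//; rewrite zn//.
have oC n : (n <= m)%N -> open (C n).
  elim: n => [_|n IH nm]; last by rewrite CE; apply: openU; [exact: IH (ltnW nm)|exact: cyl_open].
  have -> : C 0%N = set0 by apply/seteqP; split=> z [].
  exact: open0.
have h n : (n <= m)%N -> nu y (C n) = (\sum_(i < m | (i < n)%N) w y i (U i))%N.
  elim: n => [_|n IH nm].
    have -> : C 0%N = set0 by apply/seteqP; split=> z [].
    by rewrite nu0 big_pred0.
  rewrite CE (bigD1 (Ordinal nm))//= addnC.
  rewrite (eq_bigl (fun i : 'I_m => (i < n)%N)) => [|i]; last by rewrite -val_eqE/= ltnS ltn_neqAle andbC.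
  have dj : C n `&` cyl (Ordinal nm) (U (Ordinal nm)) = set0.
    rewrite -subset0; move=> [z i] [[zn _] [zi _]]; move: zn zi => /= zn zi.
    by move: zn; rewrite zi/= ltnn.
  have oc : open (cyl (Ordinal nm) (U (Ordinal nm))) by exact: cyl_open.
  have := vf_mod N y (oC n (ltnW nm)) oc; rewrite dj nu0 addn0 => <-.
  by rewrite (IH (ltnW nm)).
rewrite (eq_bigl (fun i : 'I_m => (i < m)%N)) => [|i]; last by rewrite ltn_ord.
rewrite -(h m (leqnn m)).
by congr (nu y _); apply/seteqP; split=> z; [|case].
Qed.

(** Off the fibre over [px y] there is no mass. So [O] may be enlarged by the open complement of
    that fibre, after which it coincides with the equally enlarged union of cylinders over its trace
    on the fibre. *)
Lemma nu_atom y (O : set Z) : open O -> nu y O =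
  (\sum_i \sum_(l < mult i y) `[< O ((px y, mkI (atom i l y)), i) >])%N.
Proof.
move=> oO; pose U i := [set t : R | O ((px y, mkI t), i)].
have oU i : open (U i).
  have c : continuous (fun t : R => ((px y, mkI t), i) : Z).
    apply: pair_continuous; last exact: cst_continuous.
    by apply: pair_continuous; [exact: cst_continuous|exact: mkI_continuous].
  by have /continuousP := c; exact.
pose O' := [set z : Z | cyl z.2 (U z.2) z].
have oO' : open O'.
  have -> : O' = \bigcup_i cyl i (U i).
    by apply/seteqP; split=> z; [move=> h; exists z.2|move=> [i _ h]; have := h; rewrite /O'/= => -[<-]].
  by apply: bigcup_open => i _; exact: cyl_open.
pose Nx := [set z : Z | z.1.1 <> px y].
have oN : open Nx.
  have c : continuous (fun z : Z => z.1.1).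
    apply: (@comp_continuous _ _ _ fst fst); exact: fst_continuous.
  exact: ((continuousP _).1 c _ (X_open (px y))).
have N0 (P : set Z) : open P -> P `<=` Nx -> nu y P = 0%N.
  by move=> oP PN; apply: (vf_out N) => // t i /PN; apply.
have add_N (P : set Z) : open P -> nu y P = nu y (P `|` Nx).
  move=> oP; have := vf_mod N y oP oN; rewrite (N0 Nx)// addn0 (N0 (P `&` Nx)) ?addn0//.
    exact: openI.
rewrite (add_N O)// (_ : O `|` Nx = O' `|` Nx) -?add_N//; last first.
  apply/seteqP; split=> -[[x t] i]; have [->|xy] := pselect (x = px y); try by move=> _; right.
    by move=> [h|h]; [left; split=> //=; rewrite /U/= mkIK|right].
  by move=> [[_ /=]|h]; [rewrite /U/= mkIK; left|right].
rewrite nu_cyls//; apply: eq_bigr => i _.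
by rewrite (w_cnt (valuation1_w y i))// /cnt -multE.
Qed.

End ValuationField.

(** * Lifting the morphism *)

(** The upper bound is also applied to the diagonal matrix that fills the zeros of [d]; the sum of
    the two is invertible. *)
Lemma rank_diag_mx (F : fieldType) n (d : 'rV[F]_n) :
  \rank (diag_mx d) = (\sum_(i < n) (d 0 i != 0)%R)%N.
Proof.
have le (c : 'rV[F]_n) : (\rank (diag_mx c) <= \sum_(i < n) (c 0 i != 0)%R)%N.
  have -> : diag_mx c = \sum_(i < n) c 0 i *: delta_mx i i.
    apply/matrixP => i j; rewrite mxE summxE (bigD1 i)//= big1 ?addr0 => [|k ki].
      by rewrite !mxE eqxx/= eq_sym; case: eqP => _; rewrite ?mulr1 ?mulr0.
    by rewrite !mxE eq_sym (negPf ki) mulr0.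
  apply: (@big_ind2 _ _ (fun (M : 'M[F]_n) k => \rank M <= k)%N); first by rewrite mxrank0.
    by move=> M k M' k' h h'; apply: (leq_trans (mxrank_add _ _)); exact: leq_add.
  move=> i _; have [->|c0] := eqVneq (c 0 i) 0; first by rewrite scale0r mxrank0.
  by rewrite mxrank_scale_nz// mxrank_delta.
pose c : 'rV[F]_n := \row_i (d 0 i == 0)%:R.
apply/eqP; rewrite eqn_leq le/=.
have full : (n <= \rank (diag_mx (d + c)))%N.
  rewrite mxrank_unit// unitmxE det_diag unitfE; apply/prodf_neq0 => i _.
  by rewrite !mxE; have [->|d0] := eqVneq (d 0 i) 0; rewrite ?add0r ?oner_eq0 ?addr0.
have h : (n <= \rank (diag_mx d) + \sum_(i < n) (c 0 i != 0)%R)%N.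
  apply: (leq_trans full); rewrite raddfD; apply: (leq_trans (mxrank_add _ _)).
  exact: leq_add (leqnn _) (le _).
have e : (\sum_(i < n) (d 0 i != 0)%R + \sum_(i < n) (c 0 i != 0)%R = n)%N.
  rewrite -big_split -[RHS]card_ord -sum1_card; apply: eq_bigr => i _ /=.
  by rewrite mxE; case: eqVneq => _; rewrite ?eqxx ?oner_eq0.
by move: h; rewrite -{1}e leq_add2r.
Qed.

Section DiagonalRank.
Context {R : realType} {Z : topologicalType} {cZ : compact [set: Z]}.
Variable S : stabilization (Cfun cZ (Cplx R)).

Lemma rk_diagonal (b : S) z (ks : seq nat) k : uniq ks ->
  (forall p q, p <> q -> cev z (ent b p q) = 0) ->
  (forall p, ((cev z (ent b p p) : R[i]) != 0) = (p \in ks)) ->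
  rk b z k <-> (k <= size ks)%N.
Proof.
move=> uk off on.
have rE n : \rank (mt n n b z) = count [in ks] (iota 0 n).
  have -> : mt n n b z = diag_mx (\row_i (cev z (ent b i i) : R[i])).
    apply/matrixP => i j; rewrite !mxE; case: eqVneq => [->|ij]; first by rewrite mulr1n.
    by rewrite off// => /val_inj/eqP; rewrite (negPf ij).
  rewrite rank_diag_mx -val_enum_ord count_map -sum1_count [RHS]big_mkcond [RHS]big_enum/=.
  by apply: eq_bigr => i _; rewrite mxE on; case: (_ \in ks).
rewrite rk_rank; split=> [[n]|kk].
  rewrite rE -size_filter => /leq_trans; apply; apply: uniq_leq_size.
    by rewrite filter_uniq// iota_uniq.
  by move=> i; rewrite mem_filter => /andP[].
exists (\max_(i <- ks) i).+1; rewrite rE -size_filter; apply: (leq_trans kk).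
apply: uniq_leq_size => // i ik; rewrite mem_filter ik mem_iota/= add0n ltnS.
by rewrite (big_rem i ik) leq_max leqnn.
Qed.

End DiagonalRank.

Section FlatEntries.
Context {R : realType} {Y : topologicalType} (cY : compact [set: Y]).
Context {D F : cstarType R} (f : D -> Cfun cY F) (g : Cfun cY F -> D).
Hypotheses (sf : star_hom f) (fK : cancel f g) (gK : cancel g f).
Context {r m : nat} {cl : 'I_r -> 'I_m} {e : 'I_r -> 'I_r -> F}.
Hypothesis mu : matrix_units cl e.
Variable rep : 'I_m -> 'I_r.
Hypothesis repK : forall j, cl (rep j) = j.
Variable cZ : compact [set: (Y * discrete_topology 'I_m)%type].
Variable K : stabilization D.
Local Notation S := (flat sf fK gK mu repK cZ K).
Local Notation bs := (@bs _ _ cl).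
Local Notation el := (@el _ _ cl rep).
Local Notation idx := (@idx _ _ cl).

Lemma ent_flat s s' d p q y j : cev (y, j : discrete_topology 'I_m)
    (@ent R _ cZ S (mxu K s s' d) p q) =
  if (p %/ bs j == s)%N && (q %/ bs j == s')%N then coef e (cev y (f d)) (el j p) (el j q) : Cplx R else 0.
Proof.
have pidx a t n : cl a = j -> (n == idx a t) = (n %/ bs j == t)%N && (el j n == a).
  move=> aj; subst j; rewrite -(el_eq repK (cl a) n (idx a t)) (idx_div repK) (el_idx rep).
  by [].
have glj a (h : Cfun cY (Cplx R)) :
    cev (y, j : discrete_topology 'I_m) (gl cZ (fun j' => if j' == cl a then h else 0)) =
    if j == cl a then cev y h else 0 by rewrite glE; case: eqP.
have -> : mxu K s s' d = \sum_a \sum_(b | cl a == cl b)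
    mxu S (idx a s) (idx b s') (gl cZ (fun j' => if j' == cl a then ccoef f e d a b else 0)).
  rewrite {1}(cu_span sf fK gK mu d) mxu_sum; apply: eq_bigr => a _.
  rewrite mxu_sum; apply: eq_bigr => b /eqP ab.
  exact: (mxu_cu sf fK gK repK cZ K).
rewrite ent_sum cev_sum (bigD1 (el j p))//= [X in _ + X]big1 ?addr0; last first.
  move=> a /negPf ap; rewrite ent_sum cev_sum big1// => b /eqP ab; rewrite ent_mxu.
  case: ifP => [/andP[h _]|_]; last exact: cev0.
  rewrite glj; case: eqP => // ja; move: h; by rewrite pidx// [el j p == a]eq_sym ap andbF.
rewrite ent_sum cev_sum (bigD1 (el j q))/=; last by rewrite !(cl_el repK).
rewrite [X in _ + X]big1 ?addr0; last first.
  move=> b /andP[/eqP ab /negPf bq]; rewrite ent_mxu; case: ifP => [/andP[_ h]|_]; last exact: cev0.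
  move: h; rewrite eq_sym pidx; last by rewrite -ab (cl_el repK).
  by rewrite [el j q == b]eq_sym bq andbF.
rewrite ent_mxu pidx ?(cl_el repK)// eqxx andbT [idx _ _ == q]eq_sym pidx ?(cl_el repK)// eqxx andbT.
case: ifP => _; last exact: cev0.
by rewrite glE eqxx (ccoefE f mu)// !(cl_el repK).
Qed.

Lemma coef_unit x a b : cl a = cl b -> cmul (e a a) x = e a a -> coef e x a b = (a == b)%:R.
Proof.
move=> ab xa; apply: (mu_scaleI mu ab) => /=.
rewrite -(coefE mu)// xa (mu_mul mu)//.
by case: eqP => _; rewrite ?scale1r ?scale0r.
Qed.

End FlatEntries.

Section UnitRank.
Context {R : realType} {Y : topologicalType} (cY : compact [set: Y]).
Context {D : ucstarType R} {F : cstarType R} (f : D -> Cfun cY F) (g : Cfun cY F -> D).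
Hypotheses (sf : star_hom f) (fK : cancel f g) (gK : cancel g f).
Context {r m : nat} {cl : 'I_r -> 'I_m} {e : 'I_r -> 'I_r -> F}.
Hypothesis mu : matrix_units cl e.
Variable rep : 'I_m -> 'I_r.
Hypothesis repK : forall j, cl (rep j) = j.
Variable cZ : compact [set: (Y * discrete_topology 'I_m)%type].
Variable K : stabilization D.
Local Notation S := (flat sf fK gK mu repK cZ K).

Lemma coef_cone y a b : cl a = cl b -> coef e (cev y (f cone)) a b = (a == b)%:R.
Proof.
move=> ab; apply: (coef_unit mu) => //; have [_ fM _] := sf.
have h : cev y (f (cu g e a a (cone : Cfun cY (Cplx R)))) = e a a.
  by rewrite (cuE gK) cev1 scale1r.
by rewrite -{1}h -cevM -fM cmul1r h.
Qed.

Local Notation bs := (@bs _ _ cl).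

Lemma rk_one y j k : @rk R _ cZ S (mxu K 0 0 cone) (y, j : discrete_topology 'I_m) k <-> (k <= bs j)%N.
Proof.
have b0 := bs_gt0 repK j.
have entE p q : cev (y, j : discrete_topology 'I_m) (@ent R _ cZ S (mxu K 0 0 cone) p q) =
    if (p == q) && (p < bs j)%N then (1 : R[i]) : Cplx R else 0.
  rewrite ent_flat coef_cone ?(cl_el repK)// -(el_eq repK j p q).
  have dv n : (n %/ bs j == 0)%N = (n < bs j)%N by rewrite -leqn0 -ltnS ltn_divLR// mul1n.
  rewrite -(dv p); case: (eqVneq (p %/ bs j)%N 0%N) => [->|_]; last by rewrite andbF.
  by rewrite andbT eq_sym; case: eqP => // _; case: eqP.
rewrite (@rk_diagonal _ _ _ S _ _ (iota 0 (bs j))) ?size_iota// ?iota_uniq//.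
  by move=> p q pq; rewrite entE; case: eqP.
move=> p; rewrite entE eqxx/= mem_iota/= add0n; case: ifP => _; rewrite ?eqxx//.
exact: (@oner_neq0 R[i]).
Qed.

End UnitRank.

Section FibreEvaluation.
Context {R : realType} {X W : topologicalType} (cX : compact [set: X]) (cW : compact [set: W]).
Context {A F : cstarType R} (fA : A -> Cfun cW F) (gA : Cfun cW F -> A).
Hypotheses (sA : star_hom fA) (fK : cancel fA gA) (gK : cancel gA fA).
Context {r m : nat} {cl : 'I_r -> 'I_m} {e : 'I_r -> 'I_r -> F}.
Hypothesis mu : matrix_units cl e.
Variable rep : 'I_m -> 'I_r.
Hypothesis repK : forall j, cl (rep j) = j.
Variables (cZ : compact [set: ((X * W) * discrete_topology 'I_m)%type])
  (cZ1 : compact [set: (W * discrete_topology 'I_m)%type]).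
Variables (K : stabilization (Cfun cX A)) (K1 : stabilization A).
Local Notation S := (flat (curry_star cX sA) (curry_fK (cX := cX) sA fK gK) (curry_gK (cX := cX) sA fK gK) mu repK cZ K).
Local Notation S1 := (flat sA fK gK mu repK cZ1 K1).
Variables (x : X) (Psi : K -> K1).
Hypothesis aP : amplification (cev x) Psi.

Definition restr (h : Cfun cZ (Cplx R)) : Cfun cZ1 (Cplx R) :=
  mkf (fun z => cev ((x, z.1), z.2) h).

Lemma restrE h z : cev z (restr h) = cev ((x, z.1), z.2) h.
Proof.
rewrite /restr mkfE//.
apply: (@comp_continuous _ _ _ (fun z => ((x, z.1), z.2)) (fun z => cev z h)); last exact: cev_continuous.
apply: pair_continuous; last exact: snd_continuous.
by apply: pair_continuous; [exact: cst_continuous|exact: fst_continuous].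
Qed.

Lemma fibre_mxu p q h : Psi (mxu S p q h) = mxu S1 p q (restr h).
Proof.
have [sP hP] := aP; rewrite (star_hom_sum sP); apply: eq_bigr => j _; rewrite hP.
congr (mxu K1 _ _ _); rewrite (curry_gE sA fK gK) /cu; congr gA; congr mkf; apply/funext => t.
rewrite mkfE; last exact: unit_continuous.
by rewrite !slE restrE.
Qed.

Lemma fibre_rank b t j : Psi b = 0 -> ~ @rk R _ cZ S b ((x, t), j : discrete_topology 'I_m) 1.
Proof.
move=> b0; have [[_ PM _] _] := aP.
have h p q : cev ((x, t), j : discrete_topology 'I_m) (@ent R _ cZ S b p q) = 0.
  have : mxu S1 p q (restr (@ent R _ cZ S b p q)) = mxu S1 p q 0.
    by rewrite -fibre_mxu -entE !PM b0 cmul0r cmul0l mxu0.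
  move=> /mxu_inj h; have := restrE (@ent R _ cZ S b p q) (t, j : discrete_topology 'I_m).
  by rewrite h cev0 => <-.
rewrite rk_rank => -[n]; rewrite (_ : mt n n _ _ = 0) ?mxrank0//.
by apply/matrixP => i k; rewrite !mxE; exact: h.
Qed.

End FibreEvaluation.

Lemma leq_iff_eq (a b : nat) : (forall j, (j <= a)%N <-> (j <= b)%N) -> a = b.
Proof.
move=> h; apply/eqP; rewrite eqn_leq; apply/andP; split; [exact/(h a).1|exact/(h b).2].
Qed.

Lemma sum_bool_le n (b : 'I_n -> bool) : (\sum_(i < n) b i <= n)%N.
Proof.
apply: (@leq_trans (\sum_(i < n) 1)%N); first by apply: leq_sum => i _; exact: leq_b1.
by rewrite sum_nat_const card_ord muln1.
Qed.

Section Sums.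
Context {R : realType} {Z : topologicalType} {A : cstarType R} {K : stabilization A}.
Context {rk : K -> Z -> nat -> Prop}.
Hypothesis T : rank_theory rk.
Local Notation crk := (@crk _ _ _ _ rk).

Lemma crk_sums (x w : nat -> Cu K) z (n : nat -> nat) : w 0%N = Cu_zero ->
  (forall k, Cu_add (w k) (x k) (w k.+1)) -> (forall k j, crk (x k) z j <-> (j <= n k)%N) ->
  forall k j, crk (w k) z j <-> (j <= \sum_(i < k) n i)%N.
Proof.
move=> w0 ws xn; elim=> [|k IH] j.
  rewrite w0 big_ord0 leqn0; case: j => [|j]; first by split=> // _; exact: (crk0 T).
  by split=> // /(crk_zero T).
rewrite (crk_add T _ _ (ws k)) big_ord_recr/=; split=> [[a [b [<- /IH ha /xn hb]]]|h].
  exact: leq_add.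
exists (minn j (\sum_(i < k) n i)), (j - minn j (\sum_(i < k) n i))%N; split.
- by rewrite subnKC// geq_minl.
- by apply/IH; exact: geq_minr.
by apply/xn; move: h; set s := (\sum_(i < k) n i)%N; lia.
Qed.

Lemma is_ind_leq x O z : is_ind (rk := rk) x O -> forall j, crk x z j <-> (j <= `[< O z >])%N.
Proof.
move=> h [|j]; first by split=> // _; exact: (crk0 T).
rewrite (h z j); split=> [[-> Oz]|]; first by rewrite asboolT.
by case: asboolP => // Oz; rewrite ltnS leqn0 => /eqP.
Qed.

End Sums.

(** * The valuation attached to a Cu-morphism *)

Section Transfer.
Context {R : realType} {Z V : topologicalType} {A B : cstarType R}.
Context {KA : stabilization A} {KB : stabilization B}.
Context {rkA : KA -> Z -> nat -> Prop} {rkB : KB -> V -> nat -> Prop}.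
Hypotheses (TA : rank_theory rkA) (TB : rank_theory rkB).
Hypotheses (cZ : compact [set: Z]) (coV : cozeros R V).
Variables (alpha : Cu KA -> Cu KB) (N : nat).
Hypothesis aC : Cu_morphism alpha.
Local Notation is_ind := (@is_ind _ _ _ _ rkA).
Local Notation crkA := (@crk _ _ _ _ rkA).
Local Notation crkB := (@crk _ _ _ _ rkB).
Hypothesis bound : forall O x y k, is_ind x O -> crkB (alpha x) y k -> (k <= N)%N.

(** The rank at [y] of the image of the class of [O]. Ranks are given as predicates, so the number
    is obtained by counting the levels reached, of which there are at most [N]. *)
Definition nu (y : V) (O : set Z) : nat :=
  (\sum_(k < N) `[< exists2 x, is_ind x O & crkB (alpha x) y k.+1 >])%N.

Lemma nuP O x y k : is_ind x O -> (crkB (alpha x) y k <-> (k <= nu y O)%N).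
Proof.
move=> xO; have e : nu y O = (\sum_(k < N) `[< crkB (alpha x) y k.+1 >])%N.
  apply: eq_bigr => j _; congr nat_of_bool; apply: asbool_equiv_eq; split=> [[x' hx]|h]; last by exists x.
  by rewrite (ind_inj TA hx xO).
have h n : (n <= N)%N -> crkB (alpha x) y n <-> (n <= nu y O)%N.
  move=> nN; rewrite e; split=> [h|].
    rewrite -{1}(card_ord n) -sum1_card (big_ord_widen N (fun=> 1%N) nN) big_mkcond.
    apply: leq_sum => i _; case: ifP => // ni; rewrite asboolT//.
    exact: (crk_leq TB ni h).
  case: n nN => [_ _|n nN h]; first exact: (crk0 TB).
  apply: contrapT => nh; move: h; rewrite ltnNge => /negP; apply.
  apply: (@leq_trans (\sum_(i < N) (i < n)%N)).
    apply: leq_sum => i _; case: asboolP => // hi; case: (ltnP i n) => // ni; case: nh.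
    by apply: (crk_leq TB _ hi).
  rewrite -{2}(card_ord n) -sum1_card (big_ord_widen N (fun=> 1%N) (ltnW nN)) [X in (_ <= X)%N]big_mkcond.
  by apply: leq_sum => i _; case: ifP.
split=> [hk|kn]; first by apply/h => //; exact: bound xO hk.
apply/h => //; apply: (leq_trans kn); rewrite e; exact: sum_bool_le.
Qed.

Lemma ind_exists O : open O -> exists x, is_ind x O.
Proof.
by move=> oO; have [x [w [_ h _]]] := ind_sums TA (fun _ : nat => oO); exists (x 0%N).
Qed.

Let ind_le x x' O O' : is_ind x O -> is_ind x' O' -> O `<=` O' -> Cu_le x x'.
Proof.
move=> h h' OO; apply/(Cu_leP TA) => z [_|k /h[k0 Oz]]; first exact: (crk0 TA).
by apply/h'; split=> //; exact: OO.
Qed.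

Lemma nu_mono y (O O' : set Z) : open O -> open O' -> O `<=` O' -> (nu y O <= nu y O')%N.
Proof.
move=> oO oO' OO; have [x hx] := ind_exists oO; have [x' hx'] := ind_exists oO'.
have [_ _ am _ _] := aC; have := am _ _ (ind_le hx hx' OO).
move=> /(Cu_leP TB)/(_ y (nu y O)) h; apply/(nuP y _ hx'); apply: h; exact/(nuP y _ hx).
Qed.

Lemma nu_sums (O : nat -> set Z) : (forall k, open (O k)) -> exists w : nat -> Cu KA,
  (forall k z j, crkA (w k) z j <-> (j <= \sum_(i < k) `[< O i z >])%N) /\
  (forall k y j, crkB (alpha (w k)) y j <-> (j <= \sum_(i < k) nu y (O i))%N).
Proof.
move=> oO; have [x [w [w0 xO ws]]] := ind_sums TA oO; exists w; split=> k z j.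
  apply: (crk_sums (n := fun i => nat_of_bool `[< O i z >]) TA w0 ws) => l j'; exact: (is_ind_leq TA).
have [a0 aa _ _ _] := aC.
apply: (crk_sums (x := alpha \o x) (w := alpha \o w) (n := fun i => nu z (O i)) TB) => [|l|l j'] /=.
- by rewrite w0.
- exact: aa.
- exact: nuP.
Qed.

(** The classes satisfy $[O]+[O']=[O\cup O']+[O\cap O']$, since both sides have the same rank at
    every point. *)
Lemma nu_mod y (O O' : set Z) : open O -> open O' ->
  (nu y O + nu y O' = nu y (O `|` O') + nu y (O `&` O'))%N.
Proof.
move=> oO oO'; pose P (a b : set Z) (k : nat) := if k == 0%N then a else b.
have oP a b : open a -> open b -> forall k, open (P a b k) by move=> ? ? k; rewrite /P; case: ifP.
have [w [w1 w2]] := nu_sums (oP _ _ oO oO').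
have [v [v1 v2]] := nu_sums (oP _ _ (openU oO oO') (openI oO oO')).
have wv : w 2%N = v 2%N.
  apply: (crk_inj TA) => z j; rewrite w1 v1 !big_ord_recr !big_ord0/= !add0n /P/=.
  suff -> : (`[< O z >] + `[< O' z >] = `[< (O `|` O') z >] + `[< (O `&` O') z >])%N by [].
  case: (asboolP (O z)) => h; case: (asboolP (O' z)) => h'.
  - by rewrite !asboolT//; left.
  - by rewrite asboolT ?asboolF//; [case|left].
  - by rewrite asboolT ?asboolF//; [case|right].
  - by rewrite !asboolF//; case.
apply: leq_iff_eq => j; have := w2 2%N y j; have := v2 2%N y j; rewrite wv.
by rewrite !big_ord_recr !big_ord0/= !add0n /P/= => <- <-.
Qed.

Lemma nu_sup y (U : nat -> set Z) k : (forall n, open (U n)) -> (forall n, U n `<=` U n.+1) ->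
  (k < nu y (\bigcup_n U n))%N -> exists n, (k < nu y (U n))%N.
Proof.
move=> oU iU; have /choice[x hx] := fun n => ind_exists (oU n).
have [v hv] : exists v, is_ind v (\bigcup_n U n).
  by apply: ind_exists; apply: bigcup_open => n _; exact: oU.
have [_ _ _ asup _] := aC; have : Cu_sup (alpha \o x) (alpha v).
  apply: asup => [n|]; first exact: ind_le (hx n) (hx n.+1) (iU n).
  apply: (Cu_supP TA) => z [|j]; first by split=> _; [exists 0%N|]; exact: (crk0 TA).
  rewrite (hv z j); split=> [[j0 [n _ h]]|[n /hx[j0 h]]]; last by split=> //; exists n.
  by exists n; apply/hx.
move=> hs /(nuP y _ hv)/(crk_sup TB _ _ hs)[n h]; exists n.
exact/(nuP y _ (hx n)).
Qed.

Lemma nu_open y (O : set Z) k : open O -> (k < nu y O)%N -> \forall y' \near y, (k < nu y' O)%N.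
Proof.
move=> oO; have [x hx] := ind_exists oO => /(nuP y _ hx) h.
have := crk_open TB (alpha x) k.+1; rewrite openE => /(_ y h).
by apply: filterS => y' /(nuP y' _ hx).
Qed.

(** The class of an open and closed set is compact, that is, compactly contained in itself, and
    [alpha] preserves this. *)
Lemma nu_class y (O : set Z) : open O -> (forall z, ~ O z -> \forall z' \near z, ~ O z') ->
  \forall y' \near y, nu y' O = nu y O.
Proof.
move=> oO cO; have [x hx] := ind_exists oO; have [_ _ _ _ all] := aC.
have xx : Cu_ll x x.
  apply: (clopen_ll TA cZ) => [z /hx[]//|z h].
  by apply: filterS (cO z _) => [z' nO /hx[]//|Oz]; apply: h; apply/hx.
have nk : ~ crkB (alpha x) y (nu y O).+1 by move=> /(nuP y _ hx); rewrite ltnn.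
have h := ll_clopen TB coV (all _ _ xx) nk.
have := crk_open TB (alpha x) (nu y O); rewrite openE => /(_ y ((nuP y _ hx).2 (leqnn _))).
apply: filterS2 h => y' h1 /(nuP y' _ hx) h2; apply/eqP; rewrite eqn_leq h2 andbT leqNgt.
by apply/negP => /(nuP y' _ hx).
Qed.

(** Every class is the supremum of the finite sums of its layers, the classes of the sets where its
    rank exceeds [i]. *)
Lemma nu_total x y j : crkB (alpha x) y j <->
  exists n, (j <= \sum_(i < n) nu y [set z | crkA x z i.+1])%N.
Proof.
have oO k : open [set z | crkA x z k.+1] by exact: (crk_open TA).
have [w [w1 w2]] := nu_sums oO; have [_ _ _ asup _] := aC.
have xw : Cu_sup w x.
  apply: (Cu_supP TA) => z k; split=> [h|[n]].
    exists k; apply/w1; rewrite -{1}(card_ord k) -sum1_card; apply: leq_sum => i _.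
    by rewrite asboolT//; exact: (crk_leq TA _ h).
  rewrite w1; elim: n k => [|n IH] k; first by rewrite big_ord0 leqn0 => /eqP->; exact: (crk0 TA).
  rewrite big_ord_recr/=; case: (asboolP (crkA x z n.+1)) => h; last by rewrite addn0; exact: IH.
  move=> kn; apply: (crk_leq TA _ h); apply: (leq_trans kn); rewrite addn1 ltnS.
  exact: sum_bool_le.
have iw : Cu_increasing w.
  move=> n; apply/(Cu_leP TA) => z k; rewrite !w1 big_ord_recr/= => /leq_trans; apply; exact: leq_addr.
have := asup _ _ iw xw => /(crk_sup TB) h; rewrite h; split=> -[n hn]; exists n.
  exact/w2.
by apply/w2.
Qed.

End Transfer.

Section CoefficientAlgebra.
Context {R : realType} {F : cstarType R} {r m : nat} {cl : 'I_r -> 'I_m} {e : 'I_r -> 'I_r -> F}.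
Hypothesis mu : matrix_units cl e.

Lemma coef_uniq x a b (c : R[i]) : cl a = cl b ->
  cmul (cmul (e a a) x) (e b b) = c *: e a b -> coef e x a b = c.
Proof. by move=> ab h; apply: (mu_scaleI mu ab) => /=; rewrite -(coefE mu). Qed.

Lemma coef_linear a b : cl a = cl b -> forall (k : R[i]) x y,
  coef e (k *: x + y) a b = k * coef e x a b + coef e y a b.
Proof.
move=> ab k x y; apply: coef_uniq => //.
by rewrite cmulDr cmulDl cmulZr cmulZl !(coefE mu)// scalerA scalerDl.
Qed.

Lemma coef_adj x a b : cl a = cl b -> coef e (cadj x) a b = (coef e x b a)^*%R.
Proof.
move=> ab; apply: coef_uniq => //; have := congr1 cadj (coefE mu x (esym ab)).
by rewrite !cadjM !(mu_adj mu)// cadjZ (mu_adj mu)// => <-; rewrite cmulA.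
Qed.

Lemma coef_mul x y a d : cl a = cl d ->
  coef e (cmul x y) a d = \sum_(b | cl a == cl b) coef e x a b * coef e y b d.
Proof.
move=> ad; apply: coef_uniq => //; rewrite {1}(mu_spanE mu y) cmul_sumr cmul_sumr cmul_suml.
rewrite scaler_suml [RHS]big_mkcond; apply: eq_bigr => b _.
rewrite cmul_sumr cmul_sumr cmul_suml; case: eqP => ab; last first.
  rewrite big1// => d' /eqP bd; rewrite !cmulZr cmulZl -!cmulA (mu_mul mu)//.
  case: eqP => [dd|_]; last by rewrite !cmul0r scaler0.
  by case: ab; rewrite ad -dd.
rewrite (bigD1 d)/=; last by rewrite -ab ad.
rewrite big1 ?addr0 => [|d' /andP[/eqP bd /negPf dd]]; last first.
  by rewrite !cmulZr cmulZl -!cmulA (mu_mul mu)// dd !cmul0r scaler0.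
rewrite !cmulZr cmulZl -!cmulA (mu_mul mu) -?ab ?ad// eqxx.
have -> : cmul (e a a) (cmul x (e b d)) = cmul (cmul (cmul (e a a) x) (e b b)) (e b d).
  by rewrite -!cmulA (mu_mul mu) ?eqxx// -ab ad.
by rewrite (coefE mu)// cmulZl (mu_mul mu) ?eqxx -?ab ?ad// scalerA mulrC.
Qed.

Lemma coef_unit_scale (k : R[i]) a b c d : cl a = cl b -> cl c = cl d ->
  coef e (k *: e a b) c d = if (c == a) && (d == b) then k else 0.
Proof.
move=> ab cd; apply: coef_uniq => //; rewrite cmulZr cmulZl (mu_mul mu)//.
case: eqP => [->|_]; last by rewrite cmul0l scaler0 scale0r.
rewrite (mu_mul mu)// eq_sym; case: eqP => [->//|_].
by rewrite scaler0 scale0r.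
Qed.

End CoefficientAlgebra.

(** * Diagonal homomorphisms between matrix blocks *)

Section BlockHom.
Context {R : realType} {F : cstarType R} {r m : nat} {cl : 'I_r -> 'I_m} {T : finType}.
Context {v : T -> 'I_r -> 'I_r -> F}.
Hypothesis v_mul : forall t t' a b c d, cl a = cl b -> cl c = cl d ->
  cmul (v t a b) (v t' c d) = if (t == t') && (b == c) then v t a d else 0.
Hypothesis v_adj : forall t a b, cl a = cl b -> cadj (v t a b) = v t b a.
Implicit Types p q : T -> 'I_r -> 'I_r -> R[i].

Definition block p : F := \sum_t \sum_a \sum_(b | cl a == cl b) p t a b *: v t a b.

Lemma eq_block p q : (forall t a b, cl a = cl b -> p t a b = q t a b) -> block p = block q.
Proof.
move=> pq; apply: eq_bigr => t _; apply: eq_bigr => a _; apply: eq_bigr => b /eqP ab.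
by rewrite pq.
Qed.

Lemma block_linear (k : R[i]) p q : block (fun t a b => k * p t a b + q t a b) = k *: block p + block q.
Proof.
rewrite /block scaler_sumr -big_split; apply: eq_bigr => t _ /=.
rewrite scaler_sumr -big_split; apply: eq_bigr => a _ /=.
rewrite scaler_sumr -big_split; apply: eq_bigr => b _ /=.
by rewrite scalerDl scalerA.
Qed.

Lemma block_adj p : cadj (block p) = block (fun t a b => (p t b a)^*%R).
Proof.
rewrite /block cadj_sum; apply: eq_bigr => t _; rewrite cadj_sum.
under eq_bigr => a _ do rewrite cadj_sum.
rewrite (exchange_big_dep predT)//=; apply: eq_bigr => b _; apply: eq_big => a.
  by rewrite eq_sym.
by move=> /eqP ab; rewrite cadjZ v_adj.
Qed.

Lemma block_mul p q : cmul (block p) (block q) =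
  block (fun t a d => \sum_(b | cl a == cl b) p t a b * q t b d).
Proof.
have vq t a b : cl a = cl b -> cmul (v t a b) (block q) = \sum_(d | cl a == cl d) q t b d *: v t a d.
  move=> ab; rewrite /block cmul_sumr (bigD1 t)//= [X in _ + X]big1 ?addr0 => [|t' /negPf tt]; last first.
    rewrite cmul_sumr big1// => c _; rewrite cmul_sumr big1// => d /eqP cd.
    by rewrite cmulZr v_mul// eq_sym tt scaler0.
  rewrite cmul_sumr (bigD1 b)//= [X in _ + X]big1 ?addr0 => [|c /negPf cb]; last first.
    rewrite cmul_sumr big1// => d /eqP cd.
    by rewrite cmulZr v_mul// [b == c]eq_sym cb andbF scaler0.
  rewrite cmul_sumr ab; apply: eq_bigr => d /eqP cd.
  by rewrite cmulZr v_mul// !eqxx.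
rewrite {1}/block cmul_suml; apply: eq_bigr => t _; rewrite cmul_suml; apply: eq_bigr => a _.
rewrite cmul_suml.
under eq_bigr => b /eqP ab do rewrite cmulZl vq// scaler_sumr.
rewrite exchange_big; apply: eq_bigr => d _; rewrite scaler_suml; apply: eq_bigr => b _.
by rewrite scalerA.
Qed.

End BlockHom.

Lemma scale_continuous (R : realType) (T : topologicalType) (F : cstarType R)
    (c : T -> Cplx R) (v : F) : continuous c -> continuous (fun y => (c y : R[i]) *: v).
Proof.
move=> /cstar_continuousP cc; apply/cstar_continuousP => y ep ep0.
have c0 := nrm_ge0 v; have e2 : 0 < ep / (nrm v + 1) by rewrite divr_gt0// ltr_wpDl.
apply: filterS (cc y _ e2) => z; rewrite -scalerBl nrmZ nrmC_E ltr_pdivlMr ?ltr_wpDl//.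
rewrite -[(_ - _ : Cplx R)]/((_ - _ : R[i])); apply: le_lt_trans.
by rewrite ler_wpM2l ?lerDl// -ler0c RRe_real// ger0_real.
Qed.

Lemma sum_continuous (R : realType) (T : topologicalType) (F : cstarType R) (J : Type)
    (s : seq J) (P : pred J) (h : J -> T -> F) :
  (forall j, P j -> continuous (h j)) -> continuous (fun y => \sum_(j <- s | P j) h j y).
Proof.
move=> ch; elim: s => [|j s IH].
  by under eq_fun do rewrite big_nil; exact: cst_continuous.
have [Pj|/negPf Pj] := boolP (P j); under eq_fun do rewrite big_cons Pj; last exact: IH.
by move=> y; apply: cvgD; [exact: ch|exact: IH].
Qed.

Lemma pair_cst_continuous (T U : topologicalType) (u : U) : continuous (fun y : T => (y, u)).
Proof. by move=> y; apply: cvg_pair; [exact: cvg_id|exact: cvg_cst]. Qed.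

Section FieldMorphism.
Context {R : realType} {X W : topologicalType} (cX : compact [set: X]) (cW : compact [set: W]).
Local Notation Y := (X * W)%type.
Context {A F : cstarType R} (fA : A -> Cfun cW F) (gA : Cfun cW F -> A).
Hypotheses (sA : star_hom fA) (fK : cancel fA gA) (gK : cancel gA fA).
Context {r m : nat} {cl : 'I_r -> 'I_m} {e : 'I_r -> 'I_r -> F}.
Hypothesis mu : matrix_units cl e.
Context {B F' : cstarType R} (fB : B -> Cfun cW F') (gB : Cfun cW F' -> B).
Hypotheses (sB : star_hom fB) (fK' : cancel fB gB) (gK' : cancel gB fB).
Context {r' m' : nat} {cl' : 'I_r' -> 'I_m'} {e' : 'I_r' -> 'I_r' -> F'}.
Hypothesis mu' : matrix_units cl' e'.
Variable rep' : 'I_m' -> 'I_r'.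
Hypothesis repK' : forall j, cl' (rep' j) = j.
Local Notation Z' := (Y * discrete_topology 'I_m')%type.
Context {N : nat} {mul : 'I_m -> Z' -> nat} {ev : 'I_m -> nat -> Z' -> W}.
Hypothesis mul_near : forall i z, \forall z' \near z, mul i z' = mul i z.
Hypothesis ev_cont : forall i l, continuous (ev i l).
Hypothesis mul_size : forall z, (\sum_a mul (cl a) z <= @bs _ _ cl' z.2)%N.
Local Notation blk' := (@blk _ _ cl').

(** At [z], block [i] is evaluated at [mul i z] points, and each evaluation occupies as many
    diagonal places in block [z.2] as block [i] has rows. [slots] lists the demands, [slot] hands
    out the places in order, and [mul_size] says that they suffice. *)
Definition slots z : seq ('I_r * nat) := [seq (a, l) | a <- enum 'I_r, l <- iota 0 (mul (cl a) z)].

Definition slot (z : Z') a l : 'I_r' := nth (rep' z.2) (blk' z.2) (index (a, l) (slots z)).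

Lemma mem_slots z a l : ((a, l) \in slots z) = (l < mul (cl a) z)%N.
Proof.
apply/allpairsPdep/idP => [[a' [l' [_ + [-> ->]]]]|h]; first by rewrite mem_iota.
by exists a, l; split=> //; rewrite ?mem_enum// mem_iota.
Qed.

Lemma index_slots z a l : (l < mul (cl a) z)%N -> (index (a, l) (slots z) < size (blk' z.2))%N.
Proof.
rewrite -mem_slots -index_mem => /leq_trans; apply; apply: leq_trans (mul_size z).
rewrite size_allpairs_dep sumnE big_map big_enum/=.
by apply: leq_sum => i _; rewrite size_iota.
Qed.

Lemma cl_slot z a l : (l < mul (cl a) z)%N -> cl' (slot z a l) = z.2.
Proof.
move=> /index_slots h; have : slot z a l \in blk' z.2 by exact: mem_nth.
by rewrite mem_enum inE => /eqP.
Qed.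

Lemma slot_inj z a l b l' : (l < mul (cl a) z)%N -> (l' < mul (cl b) z)%N ->
  slot z a l = slot z b l' -> (a, l) = (b, l').
Proof.
move=> h h' /eqP; rewrite nth_uniq ?enum_uniq ?index_slots// => /eqP hi.
rewrite -[LHS](nth_index (a, l) (s := slots z)) ?mem_slots// hi nth_index// mem_slots//.
Qed.

(** Evaluations beyond the multiplicity are set to 0, so that the index type does not depend on
    [y]. *)
Definition vunit y (t : 'I_m' * 'I_N) a b : F' := let z := (y, t.1 : discrete_topology 'I_m') in
  if (t.2 < mul (cl a) z)%N then e' (slot z a t.2) (slot z b t.2) else 0.

Lemma vunit_mul y t t' a b c d : cl a = cl b -> cl c = cl d ->
  cmul (vunit y t a b) (vunit y t' c d) = if (t == t') && (b == c) then vunit y t a d else 0.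
Proof.
case: t t' => [j l] [j' l'] ab cd; rewrite /vunit/=.
set z := (y, j : discrete_topology 'I_m'); set z' := (y, j' : discrete_topology 'I_m').
case: (ltnP l (mul (cl a) z)) => h; last by rewrite cmul0l; case: ifP.
case: (ltnP l' (mul (cl c) z')) => h'; last first.
  rewrite cmul0r; case: ifP => // /andP[/eqP[jj ll] /eqP bc].
  by move: h'; rewrite /z' -jj -ll -bc -ab leqNgt h.
rewrite (mu_mul mu') ?cl_slot -?ab -?cd//; case: eqP => sl; last first.
  by case: ifP => // /andP[/eqP[jj ll] /eqP bc]; case: sl; rewrite /z' -jj -ll -bc.
have hb : (l < mul (cl b) z)%N by rewrite -ab.
have jj : j = j' by have := congr1 cl' sl; rewrite !cl_slot.
have zz : z' = z by rewrite /z' -jj.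
rewrite zz in sl h' *; have [bc ll] := slot_inj hb h' sl.
have lE : l = l' by exact: val_inj.
by rewrite jj lE bc !eqxx.
Qed.

Lemma vunit_adj y t a b : cl a = cl b -> cadj (vunit y t a b) = vunit y t b a.
Proof.
move=> ab; rewrite /vunit -ab; case: ifP => h; last by rewrite cadj0.
by rewrite (mu_adj mu')// !cl_slot// -ab.
Qed.

Lemma vunit_near y : \forall y' \near y, forall t a b, cl a = cl b -> vunit y' t a b = vunit y t a b.
Proof.
have h (t : 'I_m' * 'I_m) : \forall y' \near y,
    mul t.2 (y', t.1 : discrete_topology 'I_m') = mul t.2 (y, t.1 : discrete_topology 'I_m').
  have c : continuous (fun y' : Y => (y', t.1 : discrete_topology 'I_m')).
    exact: pair_cst_continuous.
  exact: c (mul_near t.2 (y, t.1 : discrete_topology 'I_m')).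
apply: filterS (filter_forall _ h) => y' hy t a b ab.
have e1 i : mul i (y', t.1 : discrete_topology 'I_m') = mul i (y, t.1 : discrete_topology 'I_m').
  exact: (hy (t.1, i)).
have e2 : slots (y', t.1 : discrete_topology 'I_m') = slots (y, t.1 : discrete_topology 'I_m').
  rewrite /slots; congr flatten; apply: eq_map => a'; by rewrite e1.
by rewrite /vunit e1 /slot e2.
Qed.

Definition symbol (d : Cfun cX A) (y : Y) (t : 'I_m' * 'I_N) a b : R[i] :=
  coef e (cev (ev (cl a) t.2 (y, t.1 : discrete_topology 'I_m')) (fA (cev y.1 d))) a b.

Definition phi_at d y : F' := block (cl := cl) (v := vunit y) (symbol d y).

Lemma phi_at_continuous d : continuous (phi_at d).
Proof.
apply/cstar_continuousP => y0 ep ep0.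
pose S y := block (cl := cl) (v := vunit y0) (symbol d y).
have cS : continuous S.
  apply: sum_continuous => t _; apply: sum_continuous => a _; apply: sum_continuous => b /eqP ab.
  apply: scale_continuous.
  have c1 : continuous (fun y : Y => (y.1, ev (cl a) t.2 (y, t.1 : discrete_topology 'I_m'))).
    apply: pair_continuous; first exact: fst_continuous.
    apply: (@comp_continuous _ _ _ (fun y : Y => (y, t.1 : discrete_topology 'I_m')) (ev (cl a) t.2)).
      exact: pair_cst_continuous.
    exact: ev_cont.
  have c2 := @coef_continuous _ _ _ _ _ _ _ _ mu (curry_f fA d) a b ab.
  have c3 := comp_continuous c1 c2.
  suff -> : (fun y : Y => symbol d y t a b : Cplx R) = (fun y => coef e (cev
    (y.1, ev (cl a) t.2 (y, t.1 : discrete_topology 'I_m')) (curry_f (cX := cX) fA d)) a b : Cplx R) by exact: c3.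
  by apply/funext => y; rewrite /symbol (curry_fE sA).
have /cstar_continuousP/(_ y0 _ ep0) := cS.
apply: filterS2 (vunit_near y0) => y hy; rewrite /S /phi_at.
suff -> : block (cl := cl) (v := vunit y0) (symbol d y) = block (cl := cl) (v := vunit y) (symbol d y) by [].
by apply: eq_bigr => t _; apply: eq_bigr => a _; apply: eq_bigr => b /eqP ab; rewrite hy.
Qed.

Definition phi (d : Cfun cX A) : Cfun cX B := curry_g gB (mkf (phi_at d)).

Lemma phiE d y : cev y (curry_f fB (phi d)) = phi_at d y.
Proof.
rewrite (_ : curry_f fB (phi d) = mkf (phi_at d)); last exact: (curry_gK sB fK' gK').
by rewrite mkfE//; exact: phi_at_continuous.
Qed.

Lemma phi_star : star_hom phi.
Proof.
have [fl fM fa] := sA.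
have s : star_hom (fun d => mkf (phi_at d) : Cfun (compact_setTX cX cW) F').
  split=> [k d d'|d d'|d]; apply: CfunP => y;
    rewrite ?(cevD, cevZ, cevM, cev_adj) !mkfE; try exact: phi_at_continuous.
  - rewrite -block_linear; apply: eq_block => t a b ab.
    by rewrite /symbol cevD cevZ fl cevD cevZ (coef_linear mu).
  - rewrite /phi_at (block_mul (@vunit_mul y)); apply: eq_block => t a b ab.
    rewrite /symbol cevM fM cevM (coef_mul mu)//; apply: eq_bigr => c /eqP ac.
    by rewrite ac.
  - rewrite /phi_at (block_adj (@vunit_adj y)); apply: eq_block => t a b ab.
    by rewrite /symbol cev_adj fa cev_adj (coef_adj mu)// ab.
have [sl sM sa] := s.
have [gl gM ga] := star_hom_inv (curry_star cX sB) (curry_fK (cX := cX) sB fK' gK') (curry_gK (cX := cX) sB fK' gK').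
split=> [k d d'|d d'|d].
- exact: (eq_trans (congr1 (curry_g gB) (sl k d d')) (gl _ _ _)).
- exact: (eq_trans (congr1 (curry_g gB) (sM d d')) (gM _ _)).
- exact: (eq_trans (congr1 (curry_g gB) (sa d)) (ga _)).
Qed.

Lemma phi_fibre d d' x : cev x d = cev x d' -> cev x (phi d) = cev x (phi d').
Proof.
move=> dd; rewrite /phi !(curry_gE sB fK' gK'); congr gB; congr mkf; apply/funext => t.
by rewrite !mkfE; try exact: phi_at_continuous; rewrite /phi_at /symbol/= dd.
Qed.

Lemma phi_field : field_morphism phi (fun x a => cev x (phi (Cmk (cst_subproof (a := a))))).
Proof.
split; first exact: phi_star.
have [pl pM pa] := phi_star => x; split; last first.
  by apply/funext => d /=; apply: phi_fibre.
have c a : cev x (Cmk (cst_subproof (a := a)) : Cfun cX A) = a by [].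
split=> [k a b|a b|a]; rewrite -?(cevD, cevZ, cevM, cev_adj) -?(pl, pM, pa);
  by apply: phi_fibre; rewrite ?(cevD, cevZ, cevM, cev_adj) !c.
Qed.

Lemma coef_phi a b (k : Cfun (compact_setTX cX cW) (Cplx R)) y (j : 'I_m') c d :
  cl a = cl b -> cl' c = j -> cl' d = j -> let z := (y, j : discrete_topology 'I_m') in
  coef e' (cev y (curry_f fB (phi (cu (curry_g gA) e a b k)))) c d =
  \sum_(l < N) if [&& (l < mul (cl a) z)%N, c == slot z a l & d == slot z b l]
    then cev (y.1, ev (cl a) l z) k : R[i] else 0.
Proof.
move=> ab cj dj z; have cd : cl' c = cl' d by rewrite cj.
have c0 : coef e' 0 c d = 0 by apply: (coef_uniq mu') => //; rewrite cmul0r cmul0l scale0r.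
have csum (J : Type) (s : seq J) (P : pred J) (h : J -> F') :
    coef e' (\sum_(i <- s | P i) h i) c d = \sum_(i <- s | P i) coef e' (h i) c d.
  apply: (big_morph (fun x => coef e' x c d)) => // x x'.
  by have := coef_linear mu' cd 1 x x'; rewrite scale1r mul1r.
have symE t a' b' : cl a' = cl b' -> symbol (cu (curry_g gA) e a b k) y t a' b' =
    if (a' == a) && (b' == b) then cev (y.1, ev (cl a) t.2 (y, t.1 : discrete_topology 'I_m')) k : R[i] else 0.
  move=> ab'; rewrite /symbol -(curry_fE sA) (cuE (curry_gK (cX := cX) sA fK gK)) (coef_unit_scale mu)//.
  by case: ifP => // /andP[/eqP-> _].
rewrite phiE /phi_at /block csum.
transitivity (\sum_(t : 'I_m' * 'I_N) if (t.1 == j) && [&& (t.2 < mul (cl a) z)%N, c == slot z a t.2 & d == slot z b t.2]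
    then cev (y.1, ev (cl a) t.2 z) k : R[i] else 0); last first.
  rewrite -(pair_bigA _ (fun (j' : 'I_m') (l : 'I_N) => if (j' == j) && [&& (l < mul (cl a) z)%N, c == slot z a l & d == slot z b l]
    then cev (y.1, ev (cl a) l z) k : R[i] else 0)) (bigD1 j)//= [X in _ + X]big1 ?addr0 => [|j' /negPf->]; last by rewrite big1.
  by apply: eq_bigr => l _; rewrite eqxx.
apply: eq_bigr => -[j' l] _; rewrite csum (bigD1 a)//= [X in _ + X]big1 ?addr0 => [|a' /negPf aa]; last first.
  by rewrite csum big1// => b' /eqP ab'; rewrite symE// aa scale0r.
rewrite csum (bigD1 b)/=; last exact/eqP.
rewrite [X in _ + X]big1 ?addr0 => [|b' /andP[/eqP ab' /negPf bb]]; last first.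
  by rewrite symE// bb andbF scale0r.
rewrite symE// !eqxx/= /vunit/=.
case: (eqVneq j' j) => [->|jj]/=; rewrite -/z.
  case: ifP => h; last by rewrite scaler0.
  by rewrite (coef_unit_scale mu')// !cl_slot// -ab.
case: ifP => h; last by rewrite scaler0.
rewrite (coef_unit_scale mu') ?cl_slot -?ab//.
case: eqP => //= cs; move: jj; have := cl_slot h; rewrite -cs cj /= => ->.
by rewrite eqxx.
Qed.

End FieldMorphism.

Lemma eq_idx (r m : nat) (cl : 'I_r -> 'I_m) (rep : 'I_m -> 'I_r) : (forall j, cl (rep j) = j) ->
  forall a t n, (n == @idx _ _ cl a t) = (n %/ @bs _ _ cl (cl a) == t)%N && (@el _ _ cl rep (cl a) n == a).
Proof. by move=> repK a t n; rewrite -(el_eq repK (cl a)) (idx_div repK) (el_idx rep). Qed.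

Section RankTheorySums.
Context {R : realType} {Z : topologicalType} {K : cstarType R} {rk : K -> Z -> nat -> Prop}.
Hypothesis T : rank_theory rk.

Lemma rk_sums (a : nat -> K) (n : nat -> nat) z : (forall k, cpositive (\sum_(i < k) a i)) ->
  (forall k, cpositive (a k)) -> (forall i j, i <> j -> cmul (a i) (a j) = 0) ->
  (forall j, ~ rk 0 z j.+1) -> (forall k j, rk (a k) z j <-> (j <= n k)%N) ->
  forall k j, rk (\sum_(i < k) a i) z j <-> (j <= \sum_(i < k) n i)%N.
Proof.
move=> ps pa oa r0 ra; elim=> [|k IH] j.
  rewrite !big_ord0 leqn0; case: j => [|j]; first by split=> // _; exact: (rt_0 T).
  by split=> // /r0.
rewrite !big_ord_recr (rt_sum T) //; last first.
  by rewrite cmul_suml big1// => i _; apply: oa => /= h; move: (ltn_ord i); rewrite h ltnn.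
split=> [[p [q [<- /IH hp /ra hq]]]|h]; first exact: leq_add.
exists (minn j (\sum_(i < k) n i)), (j - minn j (\sum_(i < k) n i))%N; split.
- by rewrite subnKC// geq_minl.
- by apply/IH; exact: geq_minr.
by apply/ra; move: h => /=; set s := (\sum_(i < k) n i)%N; lia.
Qed.

End RankTheorySums.

Section Amplified.
Context {R : realType} {X W : topologicalType} {cX : compact [set: X]} {cW : compact [set: W]}.
Local Notation Y := (X * W)%type.
Context {A F : cstarType R} {fA : A -> Cfun cW F} {gA : Cfun cW F -> A}.
Hypotheses (sA : star_hom fA) (fK : cancel fA gA) (gK : cancel gA fA).
Context {r m : nat} {cl : 'I_r -> 'I_m} {e : 'I_r -> 'I_r -> F}.
Hypothesis mu : matrix_units cl e.
Context {rep : 'I_m -> 'I_r}.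
Hypothesis repK : forall j, cl (rep j) = j.
Context {B F' : cstarType R} {fB : B -> Cfun cW F'} {gB : Cfun cW F' -> B}.
Hypotheses (sB : star_hom fB) (fK' : cancel fB gB) (gK' : cancel gB fB).
Context {r' m' : nat} {cl' : 'I_r' -> 'I_m'} {e' : 'I_r' -> 'I_r' -> F'}.
Hypothesis mu' : matrix_units cl' e'.
Context {rep' : 'I_m' -> 'I_r'}.
Hypothesis repK' : forall j, cl' (rep' j) = j.
Local Notation Z := (Y * discrete_topology 'I_m)%type.
Local Notation Z' := (Y * discrete_topology 'I_m')%type.
Context {N : nat} {mul : 'I_m -> Z' -> nat} {ev : 'I_m -> nat -> Z' -> W}.
Hypothesis mul_near : forall i z, \forall z' \near z, mul i z' = mul i z.
Hypothesis ev_cont : forall i l, continuous (ev i l).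
Hypothesis mul_size : forall z, (\sum_a mul (cl a) z <= @bs _ _ cl' z.2)%N.
Hypothesis mul_le : forall i z, (mul i z <= N)%N.
Variables (cZ : compact [set: Z]) (cZ' : compact [set: Z']).
Variables (K : stabilization (Cfun cX A)) (K' : stabilization (Cfun cX B)).
Local Notation S := (flat (curry_star cX sA) (curry_fK (cX := cX) sA fK gK) (curry_gK (cX := cX) sA fK gK) mu repK cZ K).
Local Notation S' := (flat (curry_star cX sB) (curry_fK (cX := cX) sB fK' gK') (curry_gK (cX := cX) sB fK' gK') mu' repK' cZ' K').
Local Notation ph := (@phi R X W cX cW A F fA r m cl e B F' gB r' m' cl' e' rep' N mul ev).
Context {Phi : K -> K'}.
Hypothesis aP : amplification ph Phi.

(** The place on the flattened diagonal of the target that receives the [k]-th diagonal entry,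
    evaluated at the point [il.2] of block [il.1]. *)
Definition diag_slot k z (il : 'I_m * 'I_N) : nat :=
  @idx _ _ cl' (@slot X W _ _ cl _ _ cl' rep' mul z (@el _ _ cl rep il.1 k) il.2) (k %/ @bs _ _ cl il.1).

Lemma ent_Phi k h p q y (j : 'I_m') : let z := (y, j : discrete_topology 'I_m') in
  cev z (@ent R _ cZ' S' (Phi (mxu S k k h)) p q) =
  \sum_(il : 'I_m * 'I_N) if [&& (il.2 < mul il.1 z)%N, p == diag_slot k z il & q == diag_slot k z il]
    then cev ((y.1, ev il.1 il.2 z), il.1 : discrete_topology 'I_m) h : R[i] else 0.
Proof.
move=> z; have [sP hP] := aP.
have -> : Phi (mxu S k k h) = \sum_i mxu K' (k %/ @bs _ _ cl i) (k %/ @bs _ _ cl i)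
    (ph (cu (curry_g gA) e (@el _ _ cl rep i k) (@el _ _ cl rep i k) (sl (compact_setTX cX cW) i h))).
  by rewrite (star_hom_sum sP); apply: eq_bigr => i _; rewrite hP.
rewrite ent_sum cev_sum -(pair_bigA _ (fun (i : 'I_m) (l : 'I_N) =>
  if [&& (l < mul i z)%N, p == diag_slot k z (i, l) & q == diag_slot k z (i, l)]
  then cev ((y.1, ev i l z), i : discrete_topology 'I_m) h : R[i] else 0)).
apply: eq_bigr => i _; rewrite ent_flat.
rewrite (coef_phi sA fK gK mu sB fK' gK' mu' rep' mul_near ev_cont mul_size _ y (j := j)) ?(cl_el repK')//=.
have hs l : (l < mul i z)%N -> cl' (@slot X W _ _ cl _ _ cl' rep' mul z (@el _ _ cl rep i k) l) = j.
  by move=> h1; rewrite (cl_slot rep' mul_size)//= (cl_el repK).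
have pE l n : (l < mul i z)%N -> (n == @idx _ _ cl' (@slot X W _ _ cl _ _ cl' rep' mul z (@el _ _ cl rep i k) l) (k %/ @bs _ _ cl i)) =
   (n %/ @bs _ _ cl' j == k %/ @bs _ _ cl i)%N && (@el _ _ cl' rep' j n == @slot X W _ _ cl _ _ cl' rep' mul z (@el _ _ cl rep i k) l).
  by move=> h1; rewrite (eq_idx repK') hs.
case: ifP => [/andP[h1 h2]|h1].
  apply: eq_bigr => l _; rewrite (cl_el repK) /diag_slot/= slE.
  by case: (ltnP l (mul i z)) => //= lm; rewrite !pE// h1 h2.
rewrite big1// => l _; case: (ltnP l (mul i z)) => //= lm; rewrite /diag_slot/= !pE//.
case: ifP => // /andP[/andP[h3 _] /andP[h4 _]].
by move: h1; rewrite h3 h4.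
Qed.

Lemma diag_slot_inj k z (il il' : 'I_m * 'I_N) : (il.2 < mul il.1 z)%N -> (il'.2 < mul il'.1 z)%N ->
  diag_slot k z il = diag_slot k z il' -> il = il'.
Proof.
case: il il' => [i l] [i' l'] /= h h' /eqP; rewrite /diag_slot/= (eq_idx repK').
have hc : (l < mul (cl (@el _ _ cl rep i k)) z)%N by rewrite (cl_el repK).
have hc' : (l' < mul (cl (@el _ _ cl rep i' k)) z)%N by rewrite (cl_el repK).
have c1 := cl_slot rep' mul_size hc; have c2 := cl_slot rep' mul_size hc'.
rewrite c2 -c1 (el_idx rep') => /andP[_ /eqP/(slot_inj mul_size hc hc')[e1 e2]].
have ii : i = i' by rewrite -(cl_el repK i k) e1 (cl_el repK).
by rewrite ii; congr (_, _); exact: val_inj.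
Qed.

Lemma rk_Phi k (s : Z -> R) z n : continuous s -> @rk R _ cZ' S' (Phi (mxu S k k (rcf s))) z n <->
  (n <= \sum_i \sum_(l < mul i z) (s ((z.1.1, ev i l z), i) != 0)%R)%N.
Proof.
move=> cs; case: z => y j; set z := (y, j).
pose P := [pred il : 'I_m * 'I_N | (il.2 < mul il.1 z)%N && (s ((y.1, ev il.1 il.2 z), il.1) != 0)].
pose ks := [seq diag_slot k z il | il <- enum P].
have uk : uniq ks.
  rewrite map_inj_in_uniq ?enum_uniq// => il il'; rewrite !mem_enum => /andP[h _] /andP[h' _].
  exact: diag_slot_inj.
have -> : (\sum_i \sum_(l < mul i z) (s ((z.1.1, ev i l z), i) != 0)%R)%N = size ks.
  rewrite size_map -cardE -sum1_card [RHS]big_mkcond.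
  transitivity (\sum_(i < m) \sum_(l < N)
      if (l < mul i z)%N && (s ((y.1, ev i l z), i) != 0)%R then 1%N else 0%N)%N; last first.
    by rewrite pair_bigA; apply: eq_bigr => -[i l] _; rewrite inE.
  apply: eq_bigr => i _.
  rewrite (big_ord_widen N (fun l => nat_of_bool (s ((z.1.1, ev i l z), i) != 0)) (mul_le i z)) big_mkcond.
  by apply: eq_bigr => l _; case: ifP => //= _; case: (_ != 0).
apply: rk_diagonal => //.
  move=> p q pq; rewrite (ent_Phi k (rcf s) p q y j) big1// => il _.
  by case: ifP => // /and3P[_ /eqP h1 /eqP h2]; case: pq; rewrite h1 h2.
move=> p; rewrite (ent_Phi k (rcf s) p p y j).
have rE (il : 'I_m * 'I_N) : cev ((y.1, ev il.1 il.2 z), il.1 : discrete_topology 'I_m) (rcf s : Cfun cZ (Cplx R)) =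
    (s ((y.1, ev il.1 il.2 z), il.1))%:C :> R[i] by rewrite rcfE.
have C0 (c : R) : c != 0 -> c%:C != 0 :> R[i].
  by apply: contraNneq => /(congr1 (@complex.Re R)) /= ->.
apply/idP/mapP => [|[il]].
  move=> h; apply: contrapT => nh; move: h; rewrite big1 ?eqxx// => il _.
  case: ifP => // /and3P[h1 /eqP h2 _].
  have [s0|s0] := eqVneq (s ((y.1, ev il.1 il.2 z), il.1)) 0.
    by have := rE il; rewrite s0 => h0; exact: h0.
  by case: nh; exists il => //; rewrite mem_enum inE/= h1 s0.
rewrite mem_enum => /andP[h1 h2] pE; rewrite (bigD1 il)//= big1 ?addr0 => [|il' ii]; last first.
  case: ifP => // /and3P[h1' /eqP h2' _]; case/eqP: ii; apply: (diag_slot_inj h1' h1).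
  exact: (eq_trans (esym h2') pE).
rewrite -/z h1 pE eqxx/=; have := C0 _ h2; rewrite -rE; exact.
Qed.

Hypotheses (nt : near_top_fields R Z) (co : cozeros R Z).
Hypotheses (nt' : near_top_fields R Z') (co' : cozeros R Z').
Variable alpha : Cu K -> Cu K'.
Let TA : rank_theory (@rk R _ cZ S : K -> Z -> nat -> Prop) := stab_rank_theory S nt co.
Let TB : rank_theory (@rk R _ cZ' S' : K' -> Z' -> nat -> Prop) := stab_rank_theory S' nt' co'.
Hypothesis alphaE : forall x z j, crk (rk := (@rk R _ cZ' S' : K' -> Z' -> nat -> Prop)) (alpha x) z j <->
  exists n, (j <= \sum_(k < n) \sum_i \sum_(l < mul i z)
    `[< crk (rk := (@rk R _ cZ S : K -> Z -> nat -> Prop)) x ((z.1.1, ev i l z), i) k.+1 >])%N.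

(** Every class has a diagonal representative [D]. [Phi] maps its diagonal entries to mutually
    orthogonal diagonal elements, whose ranks count the evaluation points where the entries are
    non-zero, and this is the number in [alphaE]. *)
Lemma phi_is_Cu : forall x a, Cu_set x a -> Cu_set (alpha x) (Phi a).
Proof.
move=> x a xa; have [sP _] := aP.
pose O k := [set z | crk (rk := (@rk R _ cZ S : K -> Z -> nat -> Prop)) x z k.+1].
have oO k : open (O k) by exact: (crk_open TA).
have dO k : O k.+1 `<=` O k by move=> z; exact: (crk_leq TA).
have [D [h [pD ch h0 eD rD]]] := diag_model S co oO dO.
have xD : Cu_set x D.
  apply: (Cu_set_crk TA) => // z [|k]; first by split=> _; [exact: (crk0 TA)|exact: rk0].
  exact: rD.
have pa := Cu_set_pos xa.
have aD z k : @rk R _ cZ' S' (Phi a) z k <-> @rk R _ cZ' S' (Phi D) z k.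
  have h1 : cuntz_le a D by apply/(rt_le TA pa pD); exact: (Cu_set_rk TA xa xD).
  have h2 : cuntz_le D a by apply/(rt_le TA pD pa); exact: (Cu_set_rk TA xD xa).
  split; apply: (rt_le TB _ _).1; try exact: star_hom_pos; exact: star_hom_cuntz.
apply: (Cu_set_crk TB); first exact: star_hom_pos.
move=> z j; rewrite aD alphaE.
have cutE n : @cutn R _ cZ S n D = \sum_(i < n) mxu S i i (rcf (h i)).
  rewrite cutnE; apply: eq_bigr => i _; rewrite (bigD1 i)//= big1 ?addr0 => [|l li].
    by rewrite eD eqxx.
  rewrite eD eq_sym -[(_ == _ :> nat)]/(l == i) (negPf li); exact: (mxu0 S).
have cut_pos n : cpositive (@cutn R _ cZ S n D).
  by have [c ->] := pD; exists (cmul c (Pn S n)); rewrite /cutn cadjM Pn_adj !cmulA.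
have ePhi n : Phi (@cutn R _ cZ S n D) = \sum_(i < n) Phi (mxu S i i (rcf (h i))).
  by rewrite cutE (star_hom_sum sP).
have hc i : continuous (h i) by exact: (@fcontP _ _ _ _ ch).
have r0 i : ~ @rk R _ cZ' S' 0 z i.+1.
  rewrite rk_rank => -[n]; rewrite (_ : mt n n _ _ = 0) ?mxrank0//.
  by apply/matrixP => p q; rewrite !mxE ent0 cev0.
have rcut n : @rk R _ cZ' S' (Phi (@cutn R _ cZ S n D)) z j <->
    (j <= \sum_(k < n) \sum_i \sum_(l < mul i z) `[< O k ((z.1.1, ev i l z), i) >])%N.
  rewrite ePhi; pose cnt k := (\sum_i \sum_(l < mul i z) `[< O k ((z.1.1, ev i l z), i) >])%N.
  apply: (rk_sums (a := fun k => Phi (mxu S k k (rcf (h k)))) (n := cnt) TB) => //.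
  - by move=> k; rewrite -ePhi; apply: star_hom_pos.
  - move=> k; apply: star_hom_pos => //; apply: mxu_pos; [exact: hc|].
    by move=> z'; have [] := h0 k z'.
  - have [_ PM _] := sP => p q pq /=; rewrite -PM (_ : cmul _ _ = 0); first exact: (star_hom0 sP).
    by apply: (eq_trans (@mxu_mul _ _ S _ _ _ _ _ _)); case: eqP.
  - move=> k i; rewrite rk_Phi; last exact: hc.
    suff -> : cnt k = (\sum_i0 \sum_(l < mul i0 z) (h k ((z.1.1, ev i0 l z), i0) != 0)%R)%N by [].
    apply: eq_bigr => i' _; apply: eq_bigr => l _; congr nat_of_bool.
    have [p0 p1] := h0 k ((z.1.1, ev i' l z), i'); apply/asboolP/idP => [/p1|h1].
      by rewrite lt_neqAle eq_sym => /andP[].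
    by apply/p1; rewrite lt_neqAle eq_sym h1.
(* A rank of the limit [Phi D] is already reached by a truncation; conversely, every truncation is
   Cuntz below [D]. *)
split=> [|[n /rcut]].
  have cP : ccvg (fun n => Phi (@cutn R _ cZ S n D)) (Phi D).
    move=> ep ep0; have [M hM] := @cutn_cvg R _ cZ S D ep ep0; exists M => n Mn.
    by rewrite -(star_homB sP); apply: (le_lt_trans (star_hom_le sP _)); exact: hM.
  move=> /(@rk_cvg R _ cZ' S' _ _ z j cP)[M hM]; exists M.
  exact: (rcut M).1 (hM M (leqnn M)).
apply: (rt_le TB _ _).1; try exact: star_hom_pos.
apply: star_hom_cuntz => //; apply/cuntz_leP => ep ep0; exists (Pn S n).
by rewrite Pn_adj subrr nrm0.
Qed.

End Amplified.

Lemma compact_discrete m : compact [set: discrete_topology 'I_m].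
Proof. by apply: finite_compact; exact: (@finite_finset 'I_m). Qed.

(* [depth] is applied on [X * R], where the product pseudometric is available. *)
Lemma cozeros_interval (R : realType) (X : pseudoMetricType R) :
  cozeros R (X * (`[0, 1 : R]%classic : Type))%type.
Proof.
move=> O oO; pose O' := [set p : X * R | O (p.1, mkI p.2)].
have c1 : continuous (fun p : X * R => (p.1, mkI p.2)).
  apply: pair_continuous; first exact: fst_continuous.
  by apply: (@comp_continuous _ _ _ snd (@mkI R)); [exact: snd_continuous|exact: mkI_continuous].
have oO' : open O' by exact: ((continuousP _).1 c1 _ oO).
have c2 : continuous (fun p : X * (`[0, 1 : R]%classic : Type) => (p.1, set_val p.2 : R)).
  apply: pair_continuous; first exact: fst_continuous.
  by apply: (@comp_continuous _ _ _ snd (set_val : (`[0, 1 : R]%classic : Type) -> R));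
    [exact: snd_continuous|exact: set_val_continuous].
exists (fun p => depth O' (p.1, set_val p.2)); split.
- by apply: (comp_continuous c2); exact: depth_continuous.
- move=> p; rewrite depth_ge0/=; apply: ge_sup; first by exists 0; left.
  by move=> t [->|[]].
move=> [x t]; have -> : O (x, t) = O' (x, set_val t) by rewrite /O'/= mkIK.
split=> [h|]; last exact: depth_gt0.
by apply: contrapT => /depth_out h'; rewrite /= h' ltxx in h.
Qed.

Lemma cozeros_glue (R : realType) (Y : topologicalType) m :
  cozeros R Y -> cozeros R (Y * discrete_topology 'I_m)%type.
Proof.
move=> co O oO.
have /choice[s hs] (j : 'I_m) : exists s : Y -> R, [/\ continuous s, forall z, 0 <= s z <= 1 &
    forall z, 0 < s z <-> O (z, j : discrete_topology 'I_m)].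
  apply: (co [set y | O (y, j : discrete_topology 'I_m)]).
  exact: ((continuousP _).1 (@pair_cst_continuous Y (discrete_topology 'I_m) j) _ oO).
exists (fun z => s z.2 z.1); split.
- by apply: glue_continuous => j; have [cs _ _] := hs j; exact: cs.
- by move=> [y j] /=; have [_ h _] := hs j.
- by move=> [y j] /=; have [_ _ h] := hs j.
Qed.

Lemma interval_model (R : realType) (A : ucstarType R) : interval_algebra A ->
  exists (F : cstarType R) (f : A -> Cfun (@unit_interval_compact R) F) g r m
    (cl : 'I_r -> 'I_m) (e : 'I_r -> 'I_r -> F) (rep : 'I_m -> 'I_r),
  [/\ star_hom f, cancel f g, cancel g f, matrix_units cl e & forall j, cl (rep j) = j].
Proof.
move=> [F fd [f sf [g fK gK]]]; pose t0 : `[0, 1 : R]%classic := mkI 0.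
have [_ fM _] := sf; have cc (a : F) : continuous (fun _ : `[0, 1 : R]%classic => a) by exact: cst_continuous.
(* The unit of [F] is obtained as the value at a point of the image of the unit of [A]. *)
have one_l (a : F) : cmul (cev t0 (f cone)) a = a.
  have h : f (g (mkf (fun _ => a))) = mkf (fun _ => a) by [].
  have := congr1 (cev t0) (fM cone (g (mkf (fun _ => a)))).
  by rewrite cmul1l h cevM mkfE.
have one_r (a : F) : cmul a (cev t0 (f cone)) = a.
  have h : f (g (mkf (fun _ => a))) = mkf (fun _ => a) by [].
  have := congr1 (cev t0) (fM (g (mkf (fun _ => a))) cone).
  by rewrite cmul1r h cevM mkfE.
have [r [m [cl [e mu]]]] := matrix_units_exist fd one_l one_r.
have /choice[rep repK] := mu_surj mu.
by exists F, f, g, r, m, cl, e, rep.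
Qed.

(** * Points and multiplicities of the given Cu-morphism *)

Section Main.
Context {R : realType} {X : metricType R} {cX : compact [set: X]}.
Hypothesis dimX : covering_dim_le X 1.
Local Notation I := (`[0, 1 : R]%classic : Type).
Local Notation cI := (@unit_interval_compact R).
Context {A B : ucstarType R}.
Context {F : cstarType R} {fA : A -> Cfun cI F} {gA : Cfun cI F -> A}.
Hypotheses (sA : star_hom fA) (fK : cancel fA gA) (gK : cancel gA fA).
Context {r m : nat} {cl : 'I_r -> 'I_m} {e : 'I_r -> 'I_r -> F}.
Hypothesis mu : matrix_units cl e.
Context {rep : 'I_m -> 'I_r}.
Hypothesis repK : forall j, cl (rep j) = j.
Context {F' : cstarType R} {fB : B -> Cfun cI F'} {gB : Cfun cI F' -> B}.
Hypotheses (sB : star_hom fB) (fK' : cancel fB gB) (gK' : cancel gB fB).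
Context {r' m' : nat} {cl' : 'I_r' -> 'I_m'} {e' : 'I_r' -> 'I_r' -> F'}.
Hypothesis mu' : matrix_units cl' e'.
Context {rep' : 'I_m' -> 'I_r'}.
Hypothesis repK' : forall j, cl' (rep' j) = j.
Context {KA : stabilization A} {KB : stabilization B}.
Context {K : stabilization (Cfun cX A)} {K' : stabilization (Cfun cX B)}.
Variables (alpha : Cu K -> Cu K') (alpha_ : X -> Cu KA -> Cu KB).
Hypotheses (aC : Cu_morphism alpha) (a1 : Cu_le (alpha (Cu_one K)) (Cu_one K')).
Hypothesis af : descends_to_fibers alpha alpha_.

Local Notation Y := (X * I)%type.
Local Notation Z := (Y * discrete_topology 'I_m)%type.
Local Notation Z' := (Y * discrete_topology 'I_m')%type.
Let cZ : compact [set: Z] := compact_setTX (compact_setTX cX cI) (@compact_discrete m).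
Let cZ' : compact [set: Z'] := compact_setTX (compact_setTX cX cI) (@compact_discrete m').
Let cZ1 : compact [set: (I * discrete_topology 'I_m)%type] := compact_setTX cI (@compact_discrete m).
Let cZ1' : compact [set: (I * discrete_topology 'I_m')%type] := compact_setTX cI (@compact_discrete m').
Local Notation S := (flat (curry_star cX sA) (curry_fK (cX := cX) sA fK gK) (curry_gK (cX := cX) sA fK gK) mu repK cZ K).
Local Notation S' := (flat (curry_star cX sB) (curry_fK (cX := cX) sB fK' gK') (curry_gK (cX := cX) sB fK' gK') mu' repK' cZ' K').
Local Notation rkA := (@rk R _ cZ S : K -> Z -> nat -> Prop).
Local Notation rkB := (@rk R _ cZ' S' : K' -> Z' -> nat -> Prop).

Let nt : near_top_fields R Z.
Proof. by apply: near_top_glue; exact: near_top_interval. Qed.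
Let nt' : near_top_fields R Z'.
Proof. by apply: near_top_glue; exact: near_top_interval. Qed.
Let co : cozeros R Z.
Proof. by apply: cozeros_glue; exact: cozeros_interval. Qed.
Let co' : cozeros R Z'.
Proof. by apply: cozeros_glue; exact: cozeros_interval. Qed.
Let TA : rank_theory rkA := stab_rank_theory S nt co.
Let TB : rank_theory rkB := stab_rank_theory S' nt' co'.

Let crk_oneA z k : crk (rk := rkA) (Cu_one K) z k <-> (k <= @bs _ _ cl z.2)%N.
Proof. by rewrite (crk_of TA); case: z => y j; exact: rk_one. Qed.

Let crk_oneB z k : crk (rk := rkB) (Cu_one K') z k <-> (k <= @bs _ _ cl' z.2)%N.
Proof. by rewrite (crk_of TB); case: z => y j; exact: rk_one. Qed.

Let scaled x : (forall z k, crk (rk := rkA) x z k -> (k <= @bs _ _ cl z.2)%N) ->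
  forall y k, crk (rk := rkB) (alpha x) y k -> (k <= @bs _ _ cl' y.2)%N.
Proof.
move=> h y k hk; apply/crk_oneB; apply: (crk_le TB a1).
have [_ _ am _ _] := aC; apply: (crk_le TB _ hk); apply: am.
by apply/(Cu_leP TA) => z l /h hl; apply/crk_oneA.
Qed.

Let bs_card (n l : nat) (c : 'I_n -> 'I_l) j : @bs _ _ c j = (\sum_a (c a == j))%N.
Proof.
by rewrite /bs /blk -cardE -sum1_card big_mkcond; apply: eq_bigr => a _; rewrite inE; case: eqP.
Qed.

Let bound (O : set Z) x (y : Z') k : is_ind (rk := rkA) x O -> crk (rk := rkB) (alpha x) y k -> (k <= r')%N.
Proof.
move=> hx hk; apply: (@leq_trans (@bs _ _ cl' y.2)); last by rewrite bs_card; exact: sum_bool_le.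
apply: scaled hk => z [//|l /hx[-> _]]; exact: bs_gt0 repK _.
Qed.

Local Notation NU := (nu (rkA := rkA) (rkB := rkB) alpha r').

Let class_open l (i : 'I_l) : open [set z : Y * discrete_topology 'I_l | z.2 = i].
Proof.
rewrite openE => -[y j] /= ->; exists (setT, [set i]); first by split=> /=; [exact: filterT|].
by move=> [y' j'] [_ /=].
Qed.

(** The classes of the blocks, each taken once for every row of the block, add up to the class of
    the unit of $C(X,A)$, so their images add up to at most the class of the unit of $C(X,B)$. *)
Let class_sum y : (\sum_a NU y [set z | z.2 = cl a] <= @bs _ _ cl' y.2)%N.
Proof.
pose O k : set Z := if insub k is Some a then [set z | z.2 = cl (a : 'I_r)] else set0.
have oO k : open (O k) by rewrite /O; case: insubP => [a _ _|_]; [exact: class_open|exact: open0].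
have OE (a : 'I_r) : O a = [set z | z.2 = cl a] by rewrite /O valK.
have [w [w1 w2]] := nu_sums TA TB aC bound oO.
have := (w2 r y _).2 (leqnn _).
rewrite (eq_bigr (fun a : 'I_r => NU y [set z | z.2 = cl a])) => [h|a _]; last by rewrite OE.
apply: (scaled _ h) => z k /w1; congr (_ <= _)%N; rewrite bs_card; apply: eq_bigr => a _.
by rewrite OE/=; congr nat_of_bool; apply/asboolP/eqP.
Qed.

Let cuntz0 (E : cstarType R) (b : E) : cuntz_le b 0 -> b = 0.
Proof.
move=> /cuntz_leP h; apply: nrm_small => ep /h[c].
by rewrite cmul0r cmul0l sub0r nrmN.
Qed.

Let zero_set (E : cstarType R) (L : stabilization E) (b : L) : Cu_set (Cu_zero : Cu L) b <-> b = 0.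
Proof.
split=> [[_ _ /cuntz0//]|->]; have h : cuntz_le (0 : L) 0.
  by apply/cuntz_leP => ep ep0; exists 0; rewrite !cmul0l subrr nrm0.
by split=> //; exact: cpositive0.
Qed.

(** If [O] misses the fibre over [y.1.1], its class vanishes there. As [alpha] descends to a fibre
    map that preserves zero, the image vanishes in that fibre too, and an element restricting to 0
    has rank 0 over it. *)
Let out y (O : set Z) : open O -> (forall t i, ~ O ((y.1.1, t), i)) -> NU y O = 0%N.
Proof.
move=> oO hO; have [s [cs s01 sO]] := co oO.
have s0 z : 0 <= s z by have /andP[] := s01 z.
have pa : cpositive (mxu S 0 0 (rcf s) : K) by exact: (mxu_pos S 0 cs s0).
have ix : is_ind (rk := rkA) (Cu_of pa : Cu K) O.
  by move=> z k; rewrite (crk_of TA) (rk_mxu S _ _ _ cs s0) sO.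
have [[ax0 _ _ _ _] [piA [piB [[PA aPA hA] [PB aPB hB] hpi]]]] := af y.1.1.
have r0 : restr cZ1 y.1.1 (rcf s : Cfun cZ (Cplx R)) = 0.
  apply: CfunP => -[t i]; rewrite restrE rcfE//= cev0.
  have := hO t i; rewrite -sO => /negP; rewrite -leNgt => sn.
  by have -> : s ((y.1.1, t), i) = 0 by apply/eqP; rewrite eq_le sn s0.
have pA0 : piA (Cu_of pa : Cu K) = Cu_zero.
  apply: (@Cu_eq _ _ _ _ _ (PA (mxu S 0 0 (rcf s)))); last first.
    by apply/zero_set; rewrite (fibre_mxu sA fK gK mu repK cZ1 aPA) r0; exact: (mxu0 (flat sA fK gK mu repK cZ1 KA)).
  by apply: hA; split=> //; apply/(rt_le TA pa pa).
have pB0 : piB (alpha (Cu_of pa : Cu K)) = Cu_zero.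
  by rewrite -[LHS]/((piB \o alpha) _) hpi /= pA0.
have [b pb bx] := Cu_rep TB (alpha (Cu_of pa : Cu K)).
have b0 : PB b = 0 by apply/zero_set; rewrite -pB0; exact: hB.
apply/eqP; rewrite -leqn0 leqNgt; apply/negP => /(nuP TA TB bound y _ ix)/(crkE TB _ _ bx).
case: (y) b0 aPB => -[x t] j b0 aPB; exact: (fibre_rank cZ1' aPB b0).
Qed.

Let vf : valuation_field (px := fun z : Z' => z.1.1) (nu := NU).
Proof.
split.
- exact: (nu_mono TA TB aC bound).
- exact: (nu_mod TA TB aC bound).
- exact: (nu_sup TA TB aC bound).
- exact: out.
- exact: (nu_open TA TB bound).
move=> y i; apply: (nu_class TA TB cZ co' aC bound); first exact: class_open.
move=> [p j] /= ji; have := @class_open _ (j : 'I_m); rewrite openE => /(_ (p, j : discrete_topology 'I_m) erefl).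
by apply: filterS => z /= ->.
Qed.

Let X_open (x : X) : open [set x' | x' <> x].
Proof.
have := @hausdorff_accessible X (@metric_hausdorff R X) => /accessible_closed_set1/(_ x).
by move=> /closed_openC; congr open; apply/seteqP; split.
Qed.

Let mul i (z : Z') := mult (nu := NU) i z.
Let ev i l (z : Z') : I := mkI (atom (nu := NU) i l z).
Let mul_near i z : \forall z' \near z, mul i z' = mul i z.
Proof. exact: (mult_near vf). Qed.
Let ev_cont i l : continuous (ev i l).
Proof.
apply: (@comp_continuous _ _ _ (atom (nu := NU) i l) (@mkI R)); last exact: mkI_continuous.
exact: (atom_continuous vf).
Qed.
Let mul_size z : (\sum_a mul (cl a) z <= @bs _ _ cl' z.2)%N.
Proof. exact: class_sum. Qed.
Let mul_le i z : (mul i z <= r')%N.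
Proof. exact: sum_bool_le. Qed.
Local Notation ph := (@phi R X I cX cI A F fA r m cl e B F' gB r' m' cl' e' rep' r' mul ev).
Let sph : star_hom ph.
Proof. exact: (phi_star cX sA mu sB fK' gK' mu' rep' mul_near ev_cont mul_size). Qed.

(** The layers of [x] are open sets, and [nu_atom] counts each of them by the points at which the
    morphism evaluates. *)
Let alphaE x z j : crk (rk := rkB) (alpha x) z j <-> exists n, (j <= \sum_(k < n) \sum_i
  \sum_(l < mul i z) `[< crk (rk := rkA) x ((z.1.1, ev i l z), i) k.+1 >])%N.
Proof.
rewrite (nu_total TA TB aC bound).
have h k : NU z [set z' | crk (rk := rkA) x z' k.+1] =
    (\sum_i \sum_(l < mul i z) `[< crk (rk := rkA) x ((z.1.1, ev i l z), i) k.+1 >])%N.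
  by rewrite (nu_atom X_open vf)//; exact: (crk_open TA).
by split=> -[n hn]; exists n; move: hn; [under eq_bigr => k _ do rewrite h|under eq_bigr => k _ do rewrite -h].
Qed.

Lemma lifting : exists (phi : Cfun cX A -> Cfun cX B) (phi_ : X -> A -> B),
  [/\ field_morphism phi phi_, is_Cu_of phi alpha & forall x, is_Cu_of (phi_ x) (alpha_ x)].
Proof.
have [Phi aP] := amplification_exists (curry_star cX sA) (curry_fK (cX := cX) sA fK gK)
  (curry_gK (cX := cX) sA fK gK) mu repK K cZ K' sph.
have hPhi := phi_is_Cu (sA := sA) (fK := fK) (gK := gK) (mu := mu) (repK := repK)
  (sB := sB) (fK' := fK') (gK' := gK') (mu' := mu') (repK' := repK') mul_near ev_cont mul_size mul_le aP
  nt co nt' co' alphaE.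
have fm := phi_field cX sA mu sB fK' gK' mu' rep' mul_near ev_cont mul_size.
exists ph, (fun x a => cev x (ph (Cmk (cst_subproof (a := a))))); split=> //; first by exists Phi.
move=> x; have [sP hP] := aP.
(* Constant functions split the evaluation at [x], so each class of [A] is the restriction of a
   class of $C(X,A)$, on which [alpha] is already realised. *)
pose cst (a : A) : Cfun cX A := Cmk (cst_subproof (a := a)).
have sc : star_hom cst by split=> [k a b|a b|a]; exact: CfunP.
have [J aJ] := amplification_exists sA fK gK mu repK KA cZ1 K sc.
have [sJ hJ] := aJ.
have [_ [piA [piB [[PA [sPA hPA] hA] [PB [sPB hPB] hB] hpi]]]] := af x.
have PJ : PA \o J = id.
  apply: (amplification_uniq (phi := id)); last by split; [split|].
  have [Jl JM Ja] := sJ; have [Pl PM Pa] := sPA.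
  split; last by move=> i j a /=; rewrite hJ hPA.
  by split=> [k a b|a b|a] /=; rewrite ?(Jl, JM, Ja) ?(Pl, PM, Pa).
exists (PB \o Phi \o J).
  have [Jl JM Ja] := sJ; have [Pl PM Pa] := sPB; have [Ql QM Qa] := sP.
  split; last by move=> i j a /=; rewrite hJ hP hPB.
  by split=> [k a b|a b|a] /=; rewrite ?(Jl, JM, Ja) ?(Ql, QM, Qa) ?(Pl, PM, Pa).
move=> y a ya; have pa : cpositive a.
  by case: y ya => U [c pc UE] /=; rewrite UE => -[].
have pJ : cpositive (J a) by exact: star_hom_pos.
have Jx : Cu_set (Cu_of pJ : Cu K) (J a) by split=> //; apply/(rt_le TA pJ pJ).
have -> : y = piA (Cu_of pJ : Cu K).
  by apply: (Cu_eq ya); have := hA _ _ Jx; rewrite -[PA (J a)]/((PA \o J) a) PJ.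
rewrite -[alpha_ x (piA _)]/((alpha_ x \o piA) _) -hpi /=.
by apply: hB; exact: hPhi.
Qed.

End Main.

Theorem corollary3p15 (R : realType) (X : metricType R)
    (cX : compact [set: X]) (dimX : covering_dim_le X 1)
    (A B : ucstarType R) (intA : interval_algebra A) (intB : interval_algebra B)
    (KA : stabilization A) (KB : stabilization B)
    (KXA : stabilization (Cfun cX A)) (KXB : stabilization (Cfun cX B))
    (alpha : Cu KXA -> Cu KXB) (alpha_ : X -> Cu KA -> Cu KB)
    (alpha_Cu : Cu_morphism alpha)
    (alpha_scaled : Cu_le (alpha (Cu_one KXA)) (Cu_one KXB))
    (alpha_fib : descends_to_fibers alpha alpha_) :
  exists (phi : Cfun cX A -> Cfun cX B) (phi_ : X -> A -> B),
    [/\ field_morphism phi phi_,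
        is_Cu_of phi alpha &
        forall x, is_Cu_of (phi_ x) (alpha_ x)].
Proof.
have [F [f [g [r [m [cl [e [rep [sf fK gK mu repK]]]]]]]]] := interval_model intA.
have [F' [f' [g' [r' [m' [cl' [e' [rep' [sf' fK' gK' mu' repK']]]]]]]]] := interval_model intB.
exact: (lifting dimX sf fK gK mu repK sf' fK' gK' mu' repK' alpha_Cu alpha_scaled alpha_fib).
Qed.
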